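(* Let $(K,v)$ be a mixed characteristic henselian nontrivially valued field. Then $\mathrm{Th}(K;\mathcal{L}_{val})$ is finitely undecidable. Moreover, if the valuation ring $\mathcal{O}_v$ is $\mathcal{L}_r$-definable in $K$, then $K$ is finitely undecidable as a field, i.e. $\mathrm{Th}(K;\mathcal{L}_r)$ is finitely undecidable.
   Context: $\mathcal{L}_r$ is the language of rings and $\mathcal{L}_{val}$ is $\mathcal{L}_r$ together with a unary predicate interpreted as the valuation ring. Mixed characteristic means $\mathrm{char}(K)=0$ and the residue field $Kv$ has characteristic $p>0$. A theory $T$ in a language $\mathcal{L}$ is finitely undecidable if for every nonempty finite set $S\subseteq T$ of $\mathcal{L}$-sentences, the set $\mathrm{Cons}(S)$ of $\mathcal{L}$-sentences $\varphi$ with $S\models\varphi$ is undecidable. *)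

(* Defs.v *)
From HB Require Import structures.
From mathcomp Require Import all_boot all_order all_algebra.
From mathcomp Require Import classical_sets cardinality.

Set Implicit Arguments.
Unset Strict Implicit.
Unset Printing Implicit Defensive.

Import Order.TTheory GRing.Theory.

Local Open Scope classical_set_scope.

(* The general recursive total functions: the least class that contains zero,
   successor and the projections and is closed under composition, primitive
   recursion and minimisation of regular functions.  The functions defined by
   recursion or minimisation are characterised by their equations, so the class
   is closed under extensional equality. *)
Inductive recursive : forall n, (n.-tuple nat -> nat) -> Prop :=
| recursive_zero n : @recursive n (fun=> 0)
| recursive_succ : @recursive 1 (fun v => (thead v).+1)
| recursive_proj n (i : 'I_n) : @recursive n (fun v => tnth v i)
| recursive_comp m n (f : m.-tuple nat -> nat)
    (g : 'I_m -> n.-tuple nat -> nat) :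
    recursive f -> (forall i, recursive (g i)) ->
    @recursive n (fun v => f [tuple g i v | i < m])
| recursive_prec n (f : n.-tuple nat -> nat) (g : n.+2.-tuple nat -> nat)
    (h : n.+1.-tuple nat -> nat) :
    recursive f -> recursive g ->
    (forall v : n.-tuple nat, h [tuple of 0 :: v] = f v) ->
    (forall x (v : n.-tuple nat), h [tuple of x.+1 :: v] =
                 g [tuple of [:: x, h [tuple of x :: v] & v]]) ->
    recursive h
| recursive_min n (g : n.+1.-tuple nat -> nat) (h : n.-tuple nat -> nat) :
    recursive g ->
    (forall v : n.-tuple nat, g [tuple of h v :: v] = 0) ->
    (forall (v : n.-tuple nat) y, y < h v -> g [tuple of y :: v] <> 0) ->
    recursive h.

Definition recursive_set (X : set nat) : Prop :=
  exists2 chi : 1.-tuple nat -> nat, recursive chi &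
    forall n, (X n -> chi [tuple n] = 1) /\ (~ X n -> chi [tuple n] = 0).

(* A language here is the language of rings {0, 1, -, +, *} expanded by finitely
   many unary predicate symbols, and is given by the type of the latter. *)
Definition Lring : finType := void.
Definition Lval : finType := unit.

(* Variables are de Bruijn indices. *)
Inductive term : Type :=
| Var of nat
| Zero
| One
| Opp of term
| Add of term & term
| Mul of term & term.

(* {falsum, ->, forall} is a complete set of connectives, since satisfaction
   below is two-valued (classical logic). *)
Inductive formula (L : finType) : Type :=
| Falsum
| Equal of term & term
| Pred of L & term
| Imp of formula L & formula L
| All of formula L.
Arguments Falsum {L}.
Arguments Equal {L}.

Fixpoint term_bound (n : nat) (t : term) : bool :=
  match t with
  | Var i => i < n
  | Zero | One => true
  | Opp s => term_bound n s
  | Add s1 s2 | Mul s1 s2 => term_bound n s1 && term_bound n s2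
  end.

Fixpoint formula_bound (L : finType) (n : nat) (phi : formula L) : bool :=
  match phi with
  | Falsum => true
  | Equal t1 t2 => term_bound n t1 && term_bound n t2
  | Pred _ t => term_bound n t
  | Imp p q => formula_bound n p && formula_bound n q
  | All p => formula_bound n.+1 p
  end.

Definition sentence (L : finType) (phi : formula L) : bool :=
  formula_bound 0 phi.

Record structure (L : finType) : Type := Structure {
  carrier :> Type;
  szero : carrier;
  sone : carrier;
  sopp : carrier -> carrier;
  sadd : carrier -> carrier -> carrier;
  smul : carrier -> carrier -> carrier;
  spred : L -> set carrier
}.

Definition env_cons (T : Type) (x : T) (e : nat -> T) (n : nat) : T :=
  if n is m.+1 then e m else x.

Fixpoint eval (L : finType) (M : structure L) (e : nat -> M) (t : term) : M :=
  match t with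
  | Var i => e i
  | Zero => szero M
  | One => sone M
  | Opp s => sopp (eval e s)
  | Add s1 s2 => sadd (eval e s1) (eval e s2)
  | Mul s1 s2 => smul (eval e s1) (eval e s2)
  end.

Fixpoint sat (L : finType) (M : structure L) (e : nat -> M) (phi : formula L) :
    Prop :=
  match phi with
  | Falsum => False
  | Equal t1 t2 => eval e t1 = eval e t2
  | Pred P t => spred P (eval e t)
  | Imp p q => sat e p -> sat e q
  | All p => forall x : M, sat (env_cons x e) p
  end.

(* Only used for sentences, where the choice of [e] is irrelevant. *)
Definition models (L : finType) (M : structure L) (phi : formula L) : Prop :=
  forall e : nat -> M, sat e phi.

Definition Th (L : finType) (M : structure L) : set (formula L) :=
  [set phi | sentence phi /\ models M phi].

Definition Cons (L : finType) (S : set (formula L)) : set (formula L) :=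
  [set phi | sentence phi /\
     forall M : structure L, (forall psi, S psi -> models M psi) ->
       models M phi].

(* Definability with parameters: the variable 0 stands for the element, and [e]
   assigns the parameters to the other free variables. *)
Definition definable (L : finType) (M : structure L) (X : set M) : Prop :=
  exists (phi : formula L) (e : nat -> M),
    forall x, X x <-> sat (env_cons x e) phi.

Definition code_pair (x y : nat) : nat := ((x + y) ^ 2 + x).+1.

Fixpoint term_code (t : term) : nat :=
  match t with
  | Var i => code_pair 0 i
  | Zero => code_pair 1 0
  | One => code_pair 2 0
  | Opp s => code_pair 3 (term_code s)
  | Add s1 s2 => code_pair 4 (code_pair (term_code s1) (term_code s2))
  | Mul s1 s2 => code_pair 5 (code_pair (term_code s1) (term_code s2))
  end.

Fixpoint formula_code (L : finType) (phi : formula L) : nat :=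
  match phi with
  | Falsum => code_pair 0 0
  | Equal t1 t2 => code_pair 1 (code_pair (term_code t1) (term_code t2))
  | Pred P t => code_pair 2 (code_pair (enum_rank P) (term_code t))
  | Imp p q => code_pair 3 (code_pair (formula_code p) (formula_code q))
  | All p => code_pair 4 (formula_code p)
  end.

Lemma code_pair_inj x y x' y' :
  code_pair x y = code_pair x' y' -> x = x' /\ y = y'.
Proof.
case=> e.
have lt_sq a b : (a + b) ^ 2 + a < (a + b).+1 ^ 2.
  rewrite -[(a + b).+1]addn1 (sqrnD (a + b)) -addnA ltn_add2l muln1 exp1n add1n ltnS.
  by rewrite mul2n -addnn -!addnA leq_addr.
have les a b c d : (a + b) ^ 2 + a = (c + d) ^ 2 + c -> a + b <= c + d.
  move=> eq_abcd; have := lt_sq c d.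
  rewrite -eq_abcd -[a + b <= _]ltnS => /(leq_ltn_trans (leq_addr _ _)).
  by rewrite ltn_exp2r.
have es : x + y = x' + y' by apply/eqP; rewrite eqn_leq !les.
by move: e; rewrite es => /addnI ex; split=> //; move: es; rewrite ex => /addnI.
Qed.

Lemma term_code_inj : injective term_code.
Proof.
elim=> [i|||s IH|s1 IH1 s2 IH2|s1 IH1 s2 IH2] [j|||t|t1 t2|t1 t2] /=
  /code_pair_inj[] //.
- by move=> _ ->.
- by move=> _ /IH ->.
- by move=> _ /code_pair_inj[/IH1 -> /IH2 ->].
- by move=> _ /code_pair_inj[/IH1 -> /IH2 ->].
Qed.

Lemma formula_code_inj L : injective (@formula_code L).
Proof.
elim=> [|s1 s2|P s|p IHp q IHq|p IHp] [|t1 t2|Q t|p' q'|p'] /=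
  /code_pair_inj[] //.
- by move=> _ /code_pair_inj[/term_code_inj -> /term_code_inj ->].
- by move=> _ /code_pair_inj[/val_inj /enum_rank_inj -> /term_code_inj ->].
- by move=> _ /code_pair_inj[/IHp -> /IHq ->].
- by move=> _ /IHp ->.
Qed.

Definition undecidable (L : finType) (A : set (formula L)) : Prop :=
  ~ recursive_set (@formula_code L @` A).

Definition finitely_undecidable (L : finType) (T : set (formula L)) : Prop :=
  forall S : set (formula L),
    S `<=` T -> finite_set S -> S !=set0 -> undecidable (Cons S).

Local Open Scope ring_scope.

Record ordered_group : Type := OrderedGroup {
  group_sort :> porderZmodType;
  leD_total : total (<=%R : rel group_sort);
  leD2l : forall x y z : group_sort, y <= z -> x + y <= x + z
}.

(* The value at 0 is conventionally +oo; it is not an element of [G], so the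
   value [v 0 : G] is never used.  [G] may be larger than the value group. *)
Record valuation (K : fieldType) (G : ordered_group) : Type := Valuation {
  valuation_fun :> K -> G;
  valuationM : forall x y, x != 0 -> y != 0 ->
    valuation_fun (x * y) = valuation_fun x + valuation_fun y;
  valuationD : forall x y, x != 0 -> y != 0 -> x + y != 0 ->
    Order.min (valuation_fun x) (valuation_fun y) <= valuation_fun (x + y)
}.

Section ValuationRing.
Variables (K : fieldType) (G : ordered_group) (v : valuation K G).

Definition valuation_ring : {pred K} := [pred x | (x == 0) || (0 <= v x)].

Lemma group_comparable (a b : G) : (a >=< b)%O.
Proof. exact: leD_total. Qed.

Lemma valuation1 : v 1 = 0.
Proof.
have := valuationM v (oner_neq0 K) (oner_neq0 K).
by rewrite mulr1 -{1}[v 1]addr0 => /addrI.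
Qed.

Lemma group_addr_ge0 (a b : G) : 0 <= a -> 0 <= b -> 0 <= a + b.
Proof. by move=> a0 /(leD2l a); rewrite addr0; apply: le_trans. Qed.

Lemma valuationN1 : v (- 1) = 0.
Proof.
have n1 : (-1 : K) != 0 by rewrite oppr_eq0 oner_eq0.
have e : v (-1) + v (-1) = 0 by rewrite -valuationM // mulrNN mulr1 valuation1.
apply/eqP; rewrite eq_le; have /orP[] := leD_total (v (-1)) 0 => h.
  by have := leD2l (v (-1)) h; rewrite e addr0 h.
by have := leD2l (v (-1)) h; rewrite e addr0 h andbT.
Qed.

Lemma valuationN x : x != 0 -> v (- x) = v x.
Proof.
move=> x0; rewrite -mulN1r valuationM ?oppr_eq0 ?oner_eq0 //.
by rewrite valuationN1 add0r.
Qed.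

Lemma valuation_ring_subring_closed : subring_closed valuation_ring.
Proof.
split=> [|x y|x y]; rewrite !inE.
- by rewrite valuation1 lexx orbT.
- have [->|x0] := eqVneq x 0.
    by rewrite sub0r oppr_eq0; have [//|y0] := eqVneq y 0; rewrite valuationN.
  have [->|y0] := eqVneq y 0; first by rewrite subr0 (negPf x0).
  rewrite /= => vx vy; have [//|xy0] /= := eqVneq (x - y) 0.
  apply: le_trans (valuationD v x0 _ xy0); last by rewrite oppr_eq0.
  by rewrite comparable_le_min ?group_comparable // vx valuationN.
- have [->|x0] := eqVneq x 0; first by rewrite mul0r eqxx.
  have [->|y0] := eqVneq y 0; first by rewrite mulr0 eqxx.
  by rewrite /= => vx vy; rewrite valuationM // group_addr_ge0 ?orbT.
Qed.

HB.instance Definition _ :=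
  GRing.isSubringClosed.Build K valuation_ring valuation_ring_subring_closed.

Record valuation_ring_of := ValuationRing {
  vring_val :> K;
  _ : vring_val \in valuation_ring
}.

HB.instance Definition _ := [isSub for vring_val].
HB.instance Definition _ := [Choice of valuation_ring_of by <:].
HB.instance Definition _ :=
  [SubChoice_isSubComNzRing of valuation_ring_of by <:].

Definition maximal_ideal : {pred valuation_ring_of} :=
  [pred x | (val x == 0) || (0 < v (val x))].

Lemma maximal_ideal_idealr_closed : idealr_closed maximal_ideal.
Proof.
split=> [||a x y]; rewrite !inE.
- by rewrite rmorph0 eqxx.
- by rewrite rmorph1 valuation1 ltxx oner_eq0.
move: (valP a); rewrite inE.
have gt0 (b c : G) : 0 <= b -> 0 < c -> 0 < b + c.
  move=> b0 c0; apply: lt_le_trans c0 _.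
  by have := leD2l c b0; rewrite addr0 addrC.
set a' := val a; set x' := val x; set y' := val y => ha hx hy.
have -> : val (a * x + y) = a' * x' + y' by rewrite rmorphD rmorphM.
have {ha hx} : (a' * x' == 0) || (0 < v (a' * x')).
  have [->|a0] := eqVneq a' 0; first by rewrite mul0r eqxx.
  have [->|x0] := eqVneq x' 0; first by rewrite mulr0 eqxx.
  by move: ha hx; rewrite (negPf a0) (negPf x0) /= valuationM // => *;
     rewrite gt0 ?orbT.
have [->|z0] := eqVneq (a' * x') 0; first by rewrite add0r.
have [->|y0] := eqVneq y' 0; first by rewrite addr0 (negPf z0).
have [//|s0] := eqVneq (a' * x' + y') 0.
rewrite (negPf y0) in hy; rewrite /= => hz.
apply: lt_le_trans (valuationD v z0 y0 s0).
by rewrite comparable_lt_min ?group_comparable // hz.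
Qed.

HB.instance Definition _ :=
  isIdealr.Build valuation_ring_of maximal_ideal maximal_ideal_idealr_closed.

Definition residue_field : Type := {ideal_quot maximal_ideal}.

HB.instance Definition _ := GRing.ComNzRing.on residue_field.

Definition residue : valuation_ring_of -> residue_field :=
  \pi_({ideal_quot maximal_ideal})%qT.

HB.instance Definition _ := GRing.RMorphism.on residue.

Lemma residue_eq0 x : (residue x == 0) = (x \in maximal_ideal).
Proof.
rewrite -(rmorph0 residue) /residue -[in RHS](subr0 x).
by rewrite Quotient.idealrBE.
Qed.

Lemma residue_inv_ex (x : residue_field) : x != 0 -> exists y, y * x == 1.
Proof.
rewrite -[x]reprK -/(residue _); set z := repr _.
rewrite residue_eq0 inE negb_or => /andP[z0].
rewrite -comparable_leNgt ?group_comparable // => vz.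
have vz0 : v (val z) = 0.
  by apply/eqP; rewrite eq_le vz; move: (valP z); rewrite inE (negPf z0).
have iv : (val z)^-1 \in valuation_ring.
  have: v ((val z)^-1 * val z) = 0 by rewrite mulVf // valuation1.
  by rewrite valuationM ?invr_eq0 // vz0 addr0 inE => ->; rewrite lexx orbT.
exists (residue (ValuationRing iv)); rewrite -rmorphM.
suff -> : ValuationRing iv * z = 1 by rewrite rmorph1.
by apply: val_inj; rewrite rmorphM rmorph1 /= mulVf.
Qed.

Definition residue_inv (x : residue_field) : residue_field :=
  if @idP (x != 0) is ReflectT x0 then xchoose (residue_inv_ex x0) else 0.

Lemma residue_mulVf (x : residue_field) : x != 0 -> residue_inv x * x = 1.
Proof.
rewrite /residue_inv; case: {-}_ / idP => // x0 _.
exact/eqP/(xchooseP (residue_inv_ex x0)).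
Qed.

Lemma residue_inv0 : residue_inv 0 = 0.
Proof. by rewrite /residue_inv; case: {-}_ / idP => // x0; case/eqP: (x0). Qed.

HB.instance Definition _ :=
  GRing.ComNzRing_isField.Build residue_field residue_mulVf residue_inv0.

End ValuationRing.

Section ValuedFields.
Variables (K : fieldType) (G : ordered_group) (v : valuation K G).

Definition nontrivial_valuation : Prop := exists2 x : K, x != 0 & v x != 0.

Definition mixed_characteristic : Prop :=
  [pchar K] =i pred0 /\ exists p : nat, p \in [pchar (residue_field v)].

Definition henselian : Prop :=
  forall (f : {poly valuation_ring_of v}) (a : residue_field v),
    root (map_poly (@residue K G v) f) a ->
    ~~ root (map_poly (@residue K G v) f)^`() a ->
    exists2 b : valuation_ring_of v, root f b & residue b = a.

End ValuedFields.

Definition field_structure (K : fieldType) : structure Lring :=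
  @Structure Lring K 0 1 -%R +%R *%R (fun _ => set0).

Definition valued_field_structure (K : fieldType) (G : ordered_group)
    (v : valuation K G) : structure Lval :=
  @Structure Lval K 0 1 -%R +%R *%R (fun _ => [set x | x \in valuation_ring v]).

(* Main.v *)
(* Every sentence phi true in (K, v) holds in a valued field M that interprets arithmetic, and this
   makes Cons S undecidable for every finite set S of sentences true in K; for the language of rings,
   phi also asserts that the given formula defines the valuation ring for some parameters.

   Let L be a countable elementary subfield of K that is relatively algebraically closed in K, and V an
   ultrapower of K. By a Baire category argument, V contains elements z, y_0, y_1, ... independent over
   L such that L is dense in L(z, y_0, y_1, ...) and in its algebraic closure in V. For primes l < q,
   let M be the closure of L(z, y_0, y_1, ...) in V under roots of polynomials of degree < l and under
   l-th roots of 1 + e u^(lq), for e in a set E0 of monomials in the forms 1 + n z. As l tends to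
   infinity, the fields M become henselian, and since L is dense in them, a back-and-forth of
   Ax-Kochen-Ershov type in an ultraproduct, with respect to the coarsening of residue characteristic
   0, shows that one of them satisfies phi.

   In M, those h for which 1 + h y^(lq) is an l-th power for every small y satisfy e = h^j t^q with e
   in E0: otherwise, for y = a y_k with y_k not involved in h, there is a place of V, trivial on the
   subfield without y_k, at which 1 + h y^(lq) is a uniformiser and no e in E0 is a q-th power in the
   residue field, and both properties survive the construction of M, so that 1 + h y^(lq) is not an
   l-th power. Conversely, all h in E0 qualify. As the forms 1 + n z are independent modulo q-th
   powers, E0 can be chosen so that M interprets numbers with successor, order and coded sequences. *)

From HB Require Import structures.
From mathcomp Require Import all_boot all_order all_algebra.
From mathcomp Require Import boolp classical_sets functions cardinality filter.
From mathcomp Require Import zify ring.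
Require Import Defs.

Set Implicit Arguments.
Unset Strict Implicit.
Unset Printing Implicit Defensive.

Import Order.TTheory GRing.Theory.

Local Open Scope classical_set_scope.
Local Open Scope ring_scope.

(** * Ultrapowers *)

(** K itself may have a decidable theory, as the p-adic numbers do, so arithmetic can only be sought
    in other models of finitely many of its sentences. Two primes are used because every step in the
    construction of M has degree at most l < q: such steps create no new q-th powers, neither in the
    field nor in a residue field, so that classes modulo q-th powers survive and can serve as
    numbers. The exponent lq serves both primes. Its factor l makes 1 + e u^(lq) a unit times an
    l-th power when u has a pole; its factor q makes any zero of 1 + e u^(lq) exhibit e as a q-th
    power in the residue field, which is excluded. So the roots adjoined to build M are roots of
    units up to l-th powers and do not ramify at the place, whereas an l-th root of 1 + h y^(lq)
    would. Infinitely many y_k are needed because h involves finitely many of them, but it is not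
    known which. *)

Record free_ultrafilter := FreeUltrafilter {
  ultra_sets : set_system nat;
  ultra_ultra : UltraFilter ultra_sets;
  ultra_free : forall n : nat, ultra_sets [set i | (n <= i)%N]
}.

Lemma free_ultrafilter_ex : exists U : free_ultrafilter, True.
Proof.
have [U [ultraU ooU]] := ultraFilterLemma (F := eventually) _.
suff h n : U [set i | (n <= i)%N] by exists (FreeUltrafilter ultraU h).
by apply: ooU; exists n.
Qed.

Section AlmostEverywhere.
Variable U : free_ultrafilter.

Definition ae (P : nat -> Prop) : Prop := ultra_sets U [set i | P i].

Let filterU : Filter (ultra_sets U).
Proof. by have [[]] := ultra_ultra U. Qed.

Lemma ae_all P : (forall i, P i) -> ae P.
Proof. exact: (filterE filterU). Qed.

Lemma ae_imp P Q : (forall i, P i -> Q i) -> ae P -> ae Q.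
Proof. exact: (@filterS _ _ filterU). Qed.

Lemma ae_and P Q : ae P -> ae Q -> ae (fun i => P i /\ Q i).
Proof. exact: (@filterI _ _ filterU). Qed.

Lemma ae_imp2 P Q R : (forall i, P i -> Q i -> R i) -> ae P -> ae Q -> ae R.
Proof. by move=> PQR aP aQ; apply: ae_imp (ae_and aP aQ) => i []; apply: PQR. Qed.

Lemma ae_ex P : ae P -> exists i, P i.
Proof.
move=> aP; apply: contrapT => /forallNP nP.
have [[U0 _] _] := ultra_ultra U.
by apply: U0; apply: (@filterS _ _ filterU) aP => i /nP.
Qed.

Lemma ae_not P : ae (fun i => ~ P i) <-> ~ ae P.
Proof.
split=> [aN aP|].
  by have [i []] := ae_ex (ae_and aN aP).
by case: (in_ultra_setVsetC [set i | P i] (ultra_ultra U)).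
Qed.

Lemma ae_ge n : ae (fun i => n <= i)%N.
Proof. exact: ultra_free. Qed.

Lemma ae_seq (T : eqType) (s : seq T) (P : nat -> T -> Prop) :
  ae (fun i => forall x, x \in s -> P i x) <-> (forall x, x \in s -> ae (P^~ x)).
Proof.
elim: s => [|y s IH]; first by split=> // _; apply: ae_all.
split=> [h x xs|h]; first by apply: ae_imp h => i; apply.
have hy := h y (mem_head _ _).
have /IH hs x : x \in s -> ae (P^~ x) by move=> xs; apply: h; rewrite inE xs orbT.
apply: ae_imp2 hy hs => i Py Ps x; rewrite inE => /orP[/eqP->//|]; exact: Ps.
Qed.

Lemma ae_ord n (P : nat -> 'I_n -> Prop) :
  (forall j, ae (P^~ j)) -> ae (fun i => forall j, P i j).
Proof.
move=> h; have [_] := ae_seq (enum 'I_n) P.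
move=> /(_ (fun x _ => h x)); apply: ae_imp => i Pi j; apply: Pi.
by rewrite mem_enum.
Qed.

(** Of finitely many parts covering a large set of indices, one is large. This is what keeps
    algebraic elements of the ultrapower inside the diagonal copy. *)
Lemma ae_pigeonhole (T : eqType) (s : seq T) (f : nat -> T) :
  ae (fun i => f i \in s) -> exists2 x, x \in s & ae (fun i => f i = x).
Proof.
move=> aes; apply: contrapT => nex.
have: ae (fun i => forall x, x \in s -> f i <> x).
  apply/(ae_seq s (fun i x => f i <> x)) => x xs; apply/ae_not => ax.
  by apply: nex; exists x.
move=> /(ae_and aes) /ae_ex[i [fis /(_ _ fis)]].
by [].
Qed.

Section Ultrapower.
Variable F : fieldType.

Definition null_seq : {pred (nat -> F)} := fun f => `[< ae (fun i => f i = 0) >].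

Lemma null_seq_ideal : idealr_closed null_seq.
Proof.
split=> [||a x y].
- by apply/asboolP; apply: ae_all.
- apply/asboolP => /ae_ex[i] /= /eqP; exact/negP/oner_neq0.
move=> /asboolP ax /asboolP ay; apply/asboolP.
apply: ae_imp2 ax ay => i xi yi.
by rewrite !fctE /= xi yi mulr0 addr0.
Qed.

HB.instance Definition _ := isIdealr.Build (nat -> F) null_seq null_seq_ideal.

Definition ultrapower : Type := {ideal_quot null_seq}.

HB.instance Definition _ := GRing.ComNzRing.on ultrapower.

Definition ucls : (nat -> F) -> ultrapower := \pi_({ideal_quot null_seq})%qT.

HB.instance Definition _ := GRing.RMorphism.on ucls.

Definition urep (x : ultrapower) : nat -> F := repr (x : {ideal_quot null_seq}).

Lemma urepK : cancel urep ucls.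
Proof. exact: (@reprK _ {ideal_quot null_seq}). Qed.

Lemma ucls_eq f g : ucls f = ucls g <-> ae (fun i => f i = g i).
Proof.
rewrite /ucls; split.
  move/eqP; rewrite -Quotient.idealrBE => /asboolP; apply: ae_imp => i /eqP.
  by rewrite subr_eq0 => /eqP.
move=> h; apply/eqP; rewrite -Quotient.idealrBE; apply/asboolP.
by apply: ae_imp h => i e; rewrite !fctE /= e subrr.
Qed.

Lemma ucls_eq0 f : ucls f = 0 <-> ae (fun i => f i = 0).
Proof. by rewrite -(rmorph0 ucls) ucls_eq. Qed.

Lemma urep_ucls f : ae (fun i => urep (ucls f) i = f i).
Proof. by apply/ucls_eq; rewrite urepK. Qed.

Definition uinv (x : ultrapower) : ultrapower := ucls (fun i => (urep x i)^-1).

Lemma uinv_ucls f : uinv (ucls f) = ucls (fun i => (f i)^-1).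
Proof. by apply/ucls_eq; apply: ae_imp (urep_ucls f) => i ->. Qed.

Lemma umulVf x : x != 0 -> uinv x * x = 1.
Proof.
rewrite -[x]urepK => /eqP x0; rewrite uinv_ucls -rmorphM -(rmorph1 ucls).
have /ae_not : ~ ae (fun i => urep x i = 0) by move/ucls_eq0.
by move=> h; apply/ucls_eq; apply: ae_imp h => i /eqP xi; rewrite !fctE /= mulVf.
Qed.

Lemma uinv0 : uinv 0 = 0.
Proof.
by rewrite -(rmorph0 ucls) uinv_ucls; apply/ucls_eq/ae_all => i; rewrite invr0.
Qed.

HB.instance Definition _ := GRing.ComNzRing_isField.Build ultrapower umulVf uinv0.

Lemma uclsV f : (ucls f)^-1 = ucls (fun i => (f i)^-1).
Proof. exact: uinv_ucls. Qed.

Definition diag (x : F) : ultrapower := ucls (fun=> x).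

Lemma diag_is_zmod_morphism : zmod_morphism diag.
Proof. by move=> x y; rewrite /diag -(rmorphB ucls). Qed.
Lemma diag_is_monoid_morphism : monoid_morphism diag.
Proof. by split=> [|x y]; [exact: (rmorph1 ucls)|rewrite /diag -(rmorphM ucls)]. Qed.

HB.instance Definition _ :=
  GRing.isZmodMorphism.Build F ultrapower diag diag_is_zmod_morphism.
HB.instance Definition _ :=
  GRing.isMonoidMorphism.Build F ultrapower diag diag_is_monoid_morphism.

(** Membership is tested on the chosen representative [urep x]; by [internalE] the choice does not
    matter. *)
Definition internal (A : nat -> set F) : set ultrapower :=
  [set x | ae (fun i => A i (urep x i))].

Lemma internalE A f : internal A (ucls f) <-> ae (fun i => A i (f i)).
Proof.
split; first by apply: ae_imp2 (urep_ucls f) => i ->.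
by apply: ae_imp2 (urep_ucls f) => i ->.
Qed.

Lemma ucls_horner n (c : nat -> 'I_n -> F) (x : nat -> F) :
  \sum_(j < n) ucls (c^~ j) * ucls x ^+ j =
  ucls (fun i => \sum_(j < n) c i j * x i ^+ j).
Proof.
transitivity (ucls (\sum_(j < n) (c^~ j : nat -> F) * x ^+ j)).
  by rewrite rmorph_sum; apply: eq_bigr => j _; rewrite rmorphM rmorphXn.
congr ucls; apply/funext => i; rewrite fct_sumE; apply: eq_bigr => j _.
by rewrite !fctE.
Qed.

(* Choose b i to satisfy the first N i conditions, N i <= i being as large as possible. *)
Lemma saturation (S : nat -> nat -> set F) :
  (forall k, exists x, forall j, (j <= k)%N -> internal (S j) x) ->
  exists x, forall j, internal (S j) x.
Proof.
move=> fin.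
pose good i k := `[< exists y, forall j, (j <= k)%N -> S j i y >].
pose N i := \max_(k < i.+1 | good i k) k.
pose b i := if pselect (exists y, forall j, (j <= N i)%N -> S j i y) is left h
            then projT1 (cid h) else 0.
have bP k i : (k <= i)%N -> good i k -> S k i (b i).
  move=> ki gk.
  have kN : (k <= N i)%N.
    rewrite /N.
    by apply: (@leq_bigmax_cond _ (fun k0 : 'I_i.+1 => good i k0) (fun k0 => k0 : nat)
       (Ordinal (ki : (k < i.+1)%N))).
  have gN : good i (N i).
    have [j gj ->] : {j : 'I_i.+1 | good i j & N i = j}.
      by apply: eq_bigmax_cond; apply/card_gt0P; exists (Ordinal (ki : (k < i.+1)%N)).
    by [].
  rewrite /b; case: pselect => [h|]; last by move/asboolP: gN.
  by case: cid => y /= /(_ _ kN).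
exists (ucls b) => k; apply/internalE.
have [x xk] := fin k.
have: ae (fun i => good i k).
  have: ae (fun i => forall j : 'I_k.+1, S j i (urep x i)).
    by apply: ae_ord => j; apply: xk; rewrite -ltnS.
  apply: ae_imp => i h; apply/asboolP; exists (urep x i) => j jk.
  exact: (h (Ordinal (jk : (j < k.+1)%N))).
by apply: ae_imp2 (ae_ge k) => i; apply: bP.
Qed.

End Ultrapower.
End AlmostEverywhere.

(** * Valuation rings *)

(** A valuation is given by its ring alone, without a value group: rings restrict to subfields and
    pass to ultrapowers directly. *)
Record valring (F : fieldType) := Valring {
  vring :> F -> Prop;
  vring1 : vring 1;
  vringB : forall x y, vring x -> vring y -> vring (x - y);
  vringM : forall x y, vring x -> vring y -> vring (x * y);
  vring_total : forall x, vring x \/ vring x^-1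
}.

Section ValringTheory.
Variables (F : fieldType) (O : valring F).
Implicit Types x y z : F.

(** Multiplicative convention: |x| <= |y|, that is v(x) >= v(y), with 0 as the least element. *)
Definition vle x y : Prop := exists2 q, O q & x = q * y.
Definition vlt x y : Prop := ~ vle y x.

Lemma vring0 : O 0.
Proof. by rewrite -(subrr 1); apply: vringB; apply: vring1. Qed.

Lemma vringN x : O x -> O (- x).
Proof. by rewrite -[- x]sub0r; apply: vringB; apply: vring0. Qed.

Lemma vringD x y : O x -> O y -> O (x + y).
Proof. by move=> Ox /vringN Oy; rewrite -[y]opprK; apply: vringB. Qed.

Lemma vle1 x : vle x 1 <-> O x.
Proof.
split=> [[q Oq ->]|Ox]; first by rewrite mulr1.
by exists x; rewrite ?mulr1.
Qed.

Lemma vle_refl x : vle x x.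
Proof. by exists 1; rewrite ?mul1r //; apply: vring1. Qed.

Lemma vle_trans y x z : vle x y -> vle y z -> vle x z.
Proof.
by move=> [q Oq ->] [r Or ->]; exists (q * r); rewrite ?mulrA //; apply: vringM.
Qed.

Lemma vle0 x : vle 0 x.
Proof. by exists 0; rewrite ?mul0r //; apply: vring0. Qed.

Lemma vlex0 x : vle x 0 -> x = 0.
Proof. by case=> q _; rewrite mulr0. Qed.

Lemma vle_total x y : vle x y \/ vle y x.
Proof.
have [->|y0] := eqVneq y 0; first by right; apply: vle0.
have [->|x0] := eqVneq x 0; first by left; apply: vle0.
have [h|h] := vring_total O (x / y); [left|right].
  by exists (x / y); rewrite ?divfK.
by exists (x / y)^-1; rewrite // invf_div divfK.
Qed.

Lemma vltW x y : vlt x y -> vle x y.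
Proof. by have [//|h /(_ h)] := vle_total x y. Qed.

Lemma vltP x y : vle x y \/ vlt y x.
Proof. by case: (pselect (vle x y)); [left|right]. Qed.

Lemma vlt_le_trans y x z : vlt x y -> vle y z -> vlt x z.
Proof. by move=> xy yz zx; apply: xy; apply: vle_trans zx. Qed.

Lemma vle_lt_trans y x z : vle x y -> vlt y z -> vlt x z.
Proof. by move=> xy yz zx; apply: yz; apply: vle_trans xy. Qed.

Lemma vlt_irr x : ~ vlt x x.
Proof. by apply; apply: vle_refl. Qed.

Lemma vlt_neq0 x y : vlt x y -> y != 0.
Proof. by move=> xy; apply/eqP => y0; apply: xy; rewrite y0; apply: vle0. Qed.

Lemma vlt0 x : vlt 0 x <-> x != 0.
Proof.
split; first exact: vlt_neq0.
by move=> x0 /vlex0 /eqP; apply/negP.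
Qed.

Lemma vleN x y : vle (- x) y <-> vle x y.
Proof.
suff h x' : vle x' y -> vle (- x') y by split=> /h; rewrite ?opprK.
by move=> [q Oq ->]; exists (- q); rewrite ?mulNr //; apply: vringN.
Qed.

Lemma vleNr x y : vle x (- y) <-> vle x y.
Proof.
suff h y' : vle x y' -> vle x (- y') by split=> /h; rewrite ?opprK.
by move=> [q Oq ->]; exists (- q); rewrite ?mulrNN //; apply: vringN.
Qed.

Lemma vltN x y : vlt (- x) y <-> vlt x y.
Proof. by split=> h k; apply: h; [rewrite vleNr|rewrite -vleNr]. Qed.

Lemma vltNr x y : vlt x (- y) <-> vlt x y.
Proof. by split=> h k; apply: h; [rewrite vleN|rewrite -vleN]. Qed.

Lemma vleD x y z : vle x z -> vle y z -> vle (x + y) z.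
Proof.
by move=> [q Oq ->] [r Or ->]; exists (q + r); rewrite ?mulrDl //; apply: vringD.
Qed.

Lemma vleB x y z : vle x z -> vle y z -> vle (x - y) z.
Proof. by move=> xz /vleN; apply: vleD. Qed.

Lemma vltD x y z : vlt x z -> vlt y z -> vlt (x + y) z.
Proof.
have [h xz yz|h xz yz] := vle_total x y.
- by apply: vle_lt_trans yz; apply: vleD => //; apply: vle_refl.
- by apply: vle_lt_trans xz; apply: vleD => //; apply: vle_refl.
Qed.

Lemma vltB x y z : vlt x z -> vlt y z -> vlt (x - y) z.
Proof. by move=> xz /vltN; apply: vltD. Qed.

Lemma vleM x y x' y' : vle x y -> vle x' y' -> vle (x * x') (y * y').
Proof.
move=> [q Oq ->] [r Or ->]; exists (q * r); first exact: vringM.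
by rewrite mulrACA.
Qed.

Lemma vleMr z x y : z != 0 -> vle (x * z) (y * z) <-> vle x y.
Proof.
move=> z0; split=> [[q Oq]|h]; last by apply: vleM => //; apply: vle_refl.
by rewrite mulrA => /(mulIf z0) ->; exists q.
Qed.

Lemma vltMr z x y : z != 0 -> vlt (x * z) (y * z) <-> vlt x y.
Proof. by move=> z0; rewrite /vlt vleMr. Qed.

Lemma vleMl z x y : z != 0 -> vle (z * x) (z * y) <-> vle x y.
Proof. by rewrite ![z * _]mulrC; apply: vleMr. Qed.

Lemma vltMl z x y : z != 0 -> vlt (z * x) (z * y) <-> vlt x y.
Proof. by move=> z0; rewrite /vlt vleMl. Qed.

Lemma vltM x y x' y' : vlt x y -> vle x' y' -> y' != 0 -> vlt (x * x') (y * y').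
Proof.
move=> xy xy' y0; apply: (@vle_lt_trans (x * y')).
  by apply: vleM => //; apply: vle_refl.
by rewrite vltMr.
Qed.

Lemma vleM1 x y z : vle x y -> O z -> vle (x * z) y.
Proof. by move=> xy /vle1 z1; rewrite -[y]mulr1; apply: vleM. Qed.

Lemma vltM1 x y z : vlt x y -> O z -> vlt (x * z) y.
Proof. by move=> xy /vle1 z1; rewrite -[y]mulr1; apply: vltM; rewrite ?oner_neq0. Qed.

Lemma vleM1l x y z : vle x y -> O z -> vle (z * x) y.
Proof. by rewrite mulrC; apply: vleM1. Qed.

Lemma vltM1l x y z : vlt x y -> O z -> vlt (z * x) y.
Proof. by rewrite mulrC; apply: vltM1. Qed.

Lemma vle_div x y z : z != 0 -> vle (x / z) y <-> vle x (y * z).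
Proof. by move=> z0; rewrite -{2}[x](divfK z0) vleMr. Qed.

Lemma vlt_div x y z : z != 0 -> vlt (x / z) y <-> vlt x (y * z).
Proof. by move=> z0; rewrite -{2}[x](divfK z0) vltMr. Qed.

Lemma vle_divr x y z : z != 0 -> vle y (x / z) <-> vle (y * z) x.
Proof. by move=> z0; rewrite -{2}[x](divfK z0) vleMr. Qed.

Lemma vleX n x y : vle x y -> vle (x ^+ n) (y ^+ n).
Proof.
by move=> xy; elim: n => [|n IH]; rewrite ?expr0 ?exprS; [apply: vle_refl|apply: vleM].
Qed.

Lemma vltX n x y : vlt x y -> vlt (x ^+ n.+1) (y ^+ n.+1).
Proof.
move=> xy; rewrite !exprS; apply: vltM => //; first by apply: vleX; apply: vltW.
by rewrite expf_neq0 // (vlt_neq0 xy).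
Qed.

Lemma vle_sum (I : Type) (r : seq I) (P : pred I) (f : I -> F) z :
  (forall i, P i -> vle (f i) z) -> vle (\sum_(i <- r | P i) f i) z.
Proof.
move=> h; elim/big_ind: _ => // [|x y]; [exact: vle0|exact: vleD].
Qed.

Lemma vlt_sum (I : Type) (r : seq I) (P : pred I) (f : I -> F) z :
  z != 0 -> (forall i, P i -> vlt (f i) z) -> vlt (\sum_(i <- r | P i) f i) z.
Proof.
move=> z0 h; elim/big_ind: _ => // [|x y]; [exact/vlt0|exact: vltD].
Qed.

Lemma vring_sum (I : Type) (r : seq I) (P : pred I) (f : I -> F) :
  (forall i, P i -> O (f i)) -> O (\sum_(i <- r | P i) f i).
Proof. by move=> h; apply/vle1/vle_sum => i /h /vle1. Qed.

Lemma vring_prod (I : Type) (r : seq I) (P : pred I) (f : I -> F) :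
  (forall i, P i -> O (f i)) -> O (\prod_(i <- r | P i) f i).
Proof. by move=> h; elim/big_ind: _ => // [|x y]; [exact: vring1|exact: vringM]. Qed.

Lemma vringX x n : O x -> O (x ^+ n).
Proof.
by move=> Ox; elim: n => [|n IH]; rewrite ?expr0 ?exprS; [apply: vring1|apply: vringM].
Qed.

Lemma vring_nat n : O n%:R.
Proof. by elim: n => [|n IH]; [apply: vring0|rewrite mulrS; apply: vringD => //; apply: vring1]. Qed.

Lemma vlt_ring x : vlt x 1 -> O x.
Proof. by move/vltW/vle1. Qed.

Lemma vlt_dom x y : vlt y x -> vle x (x + y) /\ vle (x + y) x.
Proof.
move=> yx; split; last by apply: vleD; [exact: vle_refl|exact: vltW].
have [//|/(vltB)/(_ yx)] := vltP x (x + y).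
by rewrite addrK => /vlt_irr.
Qed.

Lemma vleV x y : x != 0 -> y != 0 -> vle x^-1 y^-1 <-> vle y x.
Proof.
by move=> x0 y0; rewrite -[x^-1]mul1r vle_div // mulrC vle_divr // mul1r.
Qed.

End ValringTheory.

(** * Satisfaction in subfields and Los's theorem *)

Fixpoint teval (R : pzRingType) (e : nat -> R) (t : term) : R :=
  match t with
  | Var i => e i
  | Zero => 0
  | One => 1
  | Opp s => - teval e s
  | Add s1 s2 => teval e s1 + teval e s2
  | Mul s1 s2 => teval e s1 * teval e s2
  end.

Lemma teval_rmorph (R S : pzRingType) (f : {rmorphism R -> S}) e t :
  teval (f \o e) t = f (teval e t).
Proof.
elim: t => //= [||s ->|s -> u ->|s -> u ->].
- by rewrite rmorph0.
- by rewrite rmorph1.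
- by rewrite rmorphN.
- by rewrite rmorphD.
- by rewrite rmorphM.
Qed.

(** Truth in the subfield [E] of [F] with the trace of [O] as predicate, by relativised quantifiers.
    The models to be compared are subfields of one field, and none needs a structure of its own. *)
Fixpoint rsat (F : fieldType) (O E : F -> Prop) (e : nat -> F) (phi : formula Lval) : Prop :=
  match phi with
  | Falsum => False
  | Equal t1 t2 => teval e t1 = teval e t2
  | Pred P t => O (teval e t)
  | Imp p q => rsat O E e p -> rsat O E e q
  | All p => forall x, E x -> rsat O E (env_cons x e) p
  end.

Section Los.
Variables (U : free_ultrafilter) (F : fieldType).
Notation uF := (ultrapower U F).

Lemma teval_ucls (e : nat -> nat -> F) t :
  teval (fun k => ucls U (e k)) t = ucls U (fun i => teval (fun k => e k i) t).
Proof.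
elim: t => //= [||s ->|s -> u ->|s -> u ->].
- by rewrite -(rmorph0 (ucls U (F := F))).
- by rewrite -(rmorph1 (ucls U (F := F))).
- by rewrite -(rmorphN (ucls U (F := F))).
- by rewrite -(rmorphD (ucls U (F := F))).
- by rewrite -(rmorphM (ucls U (F := F))).
Qed.

(** Los's theorem for a varying sequence of subfields of one field: [internal E] is their
    ultraproduct inside the ultrapower of [F]. *)
Lemma los (O : F -> Prop) (E : nat -> set F) phi (e : nat -> nat -> F) :
  rsat (internal (U := U) (fun=> O)) (internal (U := U) E) (fun k => ucls U (e k)) phi <->
  ae U (fun i => rsat O (E i) (fun k => e k i) phi).
Proof.
elim: phi e => [|t1 t2|P t|p IHp q IHq|p IHp] e /=.
- by split=> // /ae_ex[].
- by rewrite !teval_ucls ucls_eq.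
- by rewrite teval_ucls internalE.
- rewrite IHp IHq; split=> [h|h hp]; last by apply: ae_imp2 h hp => i; apply.
  have [/h|/ae_not] := pselect (ae U (fun i => rsat O (E i) (e^~ i) p)).
    by apply: ae_imp.
  by apply: ae_imp => i np /np.
have consE b : env_cons (ucls U b) (fun k => ucls U (e k)) =
    (fun k => ucls U (env_cons b e k)) by apply/funext; case.
have consE' b i : (fun k => env_cons b e k i) = env_cons (b i) (fun k => e k i).
  by apply/funext; case.
split=> [h|h x]; last first.
  rewrite -[x](urepK (U := U)) => /internalE Ex; rewrite consE; apply/IHp.
  by apply: ae_imp2 h Ex => i hi Exi; rewrite consE'; apply: hi.
apply: contrapT => /ae_not nh.
(* A failing universal quantifier is witnessed index by index; 0 fills the indices at which it
   holds. *)
have /choice[b bP] i : exists b, ~ (forall x, E i x -> rsat O (E i) (env_cons x (e^~ i)) p) ->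
    E i b /\ ~ rsat O (E i) (env_cons b (e^~ i)) p.
  have [hi|hi] := pselect (forall x, E i x -> rsat O (E i) (env_cons x (e^~ i)) p).
    by exists 0.
  by move/existsNP: hi => [b /not_implyP hb]; exists b.
have Eb : internal E (ucls U b).
  by apply/internalE; apply: ae_imp nh => i /bP[].
have := h _ Eb; rewrite consE => /IHp.
move=> /(ae_and nh) /ae_ex[i [/bP[_ nb]]].
by rewrite consE'.
Qed.

End Los.

(** * Newton's method *)

Record subfield (F : fieldType) (E : F -> Prop) : Prop := Subfield {
  sf1 : E 1;
  sfB : forall x y, E x -> E y -> E (x - y);
  sfM : forall x y, E x -> E y -> E (x * y);
  sfV : forall x, E x -> E x^-1
}.

Section SubfieldTheory.
Variables (F : fieldType) (E : F -> Prop).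
Hypothesis sfE : subfield E.

Lemma sf0 : E 0.
Proof. by rewrite -(subrr 1); apply: (sfB sfE); apply: (sf1 sfE). Qed.

Lemma sfN x : E x -> E (- x).
Proof. by rewrite -[- x]sub0r; apply: (sfB sfE); apply: sf0. Qed.

Lemma sfD x y : E x -> E y -> E (x + y).
Proof. by move=> Ex /sfN Ey; rewrite -[y]opprK; apply: (sfB sfE). Qed.

Lemma sf_div x y : E x -> E y -> E (x / y).
Proof. by move=> Ex /(sfV sfE); apply: (sfM sfE). Qed.

Lemma sfX x n : E x -> E (x ^+ n).
Proof.
by move=> Ex; elim: n => [|n IH]; rewrite ?expr0 ?exprS; [apply: (sf1 sfE)|apply: (sfM sfE)].
Qed.

Lemma sf_sum (I : Type) (r : seq I) (P : pred I) (f : I -> F) :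
  (forall i, P i -> E (f i)) -> E (\sum_(i <- r | P i) f i).
Proof. by move=> h; elim/big_ind: _ => // [|x y]; [exact: sf0|exact: sfD]. Qed.

Lemma sf_prod (I : Type) (r : seq I) (P : pred I) (f : I -> F) :
  (forall i, P i -> E (f i)) -> E (\prod_(i <- r | P i) f i).
Proof. by move=> h; elim/big_ind: _ => // [|x y]; [exact: (sf1 sfE)|exact: (sfM sfE)]. Qed.

Lemma sfMn x n : E x -> E (x *+ n).
Proof. by move=> Ex; elim: n => [|n IH]; rewrite ?mulr0n ?mulrS; [apply: sf0|apply: sfD]. Qed.

Lemma sf_nat n : E n%:R.
Proof. by apply: sfMn; apply: (sf1 sfE). Qed.

Lemma sf_horner (g : {poly F}) x : (forall i, E g`_i) -> E x -> E g.[x].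
Proof.
move=> Eg Ex; rewrite horner_coef; apply: sf_sum => i _.
by apply: (sfM sfE) => //; apply: sfX.
Qed.

Lemma sf_nderivn (g : {poly F}) n : (forall i, E g`_i) -> forall i, E (g^`N(n))`_i.
Proof. by move=> Eg i; rewrite coef_nderivn; apply: sfMn. Qed.

End SubfieldTheory.

(** These are divided (Hasse) derivatives, so composing them costs a binomial coefficient; on each
    coefficient both sides amount to the same trinomial coefficient. *)
Lemma nderivn_nderivn (R : comNzRingType) (g : {poly R}) i j :
  (g^`N(j))^`N(i) = g^`N(i + j) *+ 'C(i + j, i).
Proof.
apply/polyP => m; rewrite coef_nderivn coefMn !coef_nderivn.
rewrite -!mulrnA; congr (_ *+ _); first by rewrite addnA [(j + i)%N]addnC.
have bf a b : ('C(a + b, a) * (a`! * b`!) = (a + b)`!)%N.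
  by rewrite -(bin_fact (leq_addr b a)) addKn.
apply/eqP; rewrite -(eqn_pmul2r (m := i`! * j`! * m`!)) ?muln_gt0 ?fact_gt0 //; apply/eqP.
transitivity ((i + j + m)`!).
  transitivity ('C(j + (i + m), j) * (j`! * ('C(i + m, i) * (i`! * m`!))))%N; first by ring.
  by rewrite !bf addnCA addnA.
transitivity ('C(i + j + m, i + j) * (('C(i + j, i) * (i`! * j`!)) * m`!))%N; last by ring.
by rewrite !bf.
Qed.

Lemma taylor_to (R : comNzRingType) (g : {poly R}) c x :
  g.[x] = \sum_(i < size g) g^`N(i).[c] * (x - c) ^+ i.
Proof. by rewrite -{1}(subrKC c x) nderiv_taylor //; apply: mulrC. Qed.

Lemma taylor_shift (R : comNzRingType) (g : {poly R}) c x d e j : x - c = d * e ->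
  g^`N(j).[x] * d ^+ j =
  \sum_(i < size g^`N(j)) (g^`N(i + j).[c] * d ^+ (i + j)) * (e ^+ i *+ 'C(i + j, i)).
Proof.
move=> xc; rewrite (taylor_to _ c x) mulr_suml; apply: eq_bigr => i _.
rewrite xc nderivn_nderivn hornerMn exprMn exprD; ring.
Qed.

Section Approximation.
Variables (X : fieldType) (W : valring X).
Hypothesis W_nat : forall n, vle W 1 n.+1%:R.

(** Equality of leading terms: the same class modulo 1 + (maximal ideal), with 0 as a class of its
    own. *)
Definition apx x y : Prop := vlt W (x - y) x \/ x = 0 /\ y = 0.

Lemma apx_refl x : apx x x.
Proof.
have [->|x0] := eqVneq x 0; [by right|left].
by rewrite subrr; apply/vlt0.
Qed.

Lemma apx_eqv x y : apx x y -> vle W x y /\ vle W y x.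
Proof.
case=> [/vltN h|[-> ->]]; last by split; apply: vle_refl.
by have [] := vlt_dom h; rewrite opprB addrC subrK.
Qed.

Lemma apx_sym x y : apx x y -> apx y x.
Proof.
move=> h; have [xy yx] := apx_eqv h; case: h => [h|[-> ->]]; last by right.
by left; rewrite -opprB; apply/vltN; apply: vlt_le_trans xy.
Qed.

Lemma apx_trans y x z : apx x y -> apx y z -> apx x z.
Proof.
move=> xy yz; have [xy1 yx1] := apx_eqv xy.
case: xy => [xy|[-> y0]]; last first.
  by case: yz => [/vlt_neq0|[_ ->]]; [rewrite y0 eqxx|right].
case: yz => [yz|[y0 _]]; last by move: xy; rewrite y0 subr0 => /vlt_irr.
left; have -> : x - z = (x - y) + (y - z) by ring.
by apply: vltD => //; apply: vlt_le_trans yx1.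
Qed.

Lemma apx_neq0 x y : apx x y -> (x == 0) = (y == 0).
Proof.
move=> /apx_eqv[xy yx]; apply/eqP/eqP => e; first by move: yx; rewrite e => /vlex0.
by move: xy; rewrite e => /vlex0.
Qed.

Lemma apx_le x x' y y' : apx x x' -> apx y y' -> vle W x y -> vle W x' y'.
Proof.
move=> /apx_eqv[_ h] /apx_eqv[k _] xy.
by apply: vle_trans k; apply: vle_trans xy.
Qed.

(** Leading terms may be added when nothing cancels, that is, when the sum is as large as its
    largest term. *)
Lemma apx_sum n (f g : 'I_n -> X) : (forall i, apx (f i) (g i)) ->
  (forall i, vle W (f i) (\sum_i f i)) -> apx (\sum_i f i) (\sum_i g i).
Proof.
move=> fg; have [->|s0] := eqVneq (\sum_i f i) 0 => h.
  right; split=> //; apply: big1 => i _; apply/eqP.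
  by rewrite -(apx_neq0 (fg i)); apply/eqP; apply: vlex0 (h i).
left; rewrite -sumrB; apply: vlt_sum => // i _.
case: (fg i) => [k|[-> ->]]; last by rewrite subrr; apply/vlt0.
exact: vlt_le_trans (h i).
Qed.

Lemma apx_add x x' y y' : apx x x' -> apx y y' -> vle W x (x + y) -> apx (x + y) (x' + y').
Proof.
move=> xx yy xxy.
have yxy : vle W y (x + y) by rewrite -{1}(addKr x y) addrC; apply: vleB => //; apply: vle_refl.
have := @apx_sum 2 (fun i => if i == 0 then x else y) (fun i => if i == 0 then x' else y').
rewrite !big_ord_recl !big_ord0 /= !addr0; apply; move=> i; by case: ifP.
Qed.

Lemma apx_mul x x' y y' : apx x x' -> apx y y' -> apx (x * y) (x' * y').
Proof.
move=> xx yy; have [y'y yy'] := apx_eqv yy.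
case: xx yy => [xx|[-> ->]]; last by rewrite !mul0r; right.
case=> [yy|[-> ->]]; last by rewrite !mulr0; right.
left; have -> : x * y - x' * y' = x * (y - y') + (x - x') * y' by ring.
have x0 := vlt_neq0 xx; have y0 := vlt_neq0 yy.
apply: vltD; first by rewrite vltMl.
by apply: vltM.
Qed.

Lemma apx_inv x x' : apx x x' -> apx x^-1 x'^-1.
Proof.
move=> h; have := apx_neq0 h; case: h => [h|[-> ->]]; last by rewrite !invr0; right.
rewrite (negPf (vlt_neq0 h)) => /esym/negbT x'0; left; have x0 := vlt_neq0 h.
have -> : x^-1 - x'^-1 = (x' - x) / (x' * x) by field; rewrite x0 x'0.
rewrite vlt_div ?mulf_neq0 // mulrCA mulVf // mulr1.
have xx : apx x x' by left.
by rewrite -opprB; apply/vltN; apply: vlt_le_trans (apx_eqv xx).1.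
Qed.

Lemma apx_cancel x x' y y' : apx (x * y) (x' * y') -> apx x x' -> x != 0 -> apx y y'.
Proof.
move=> xy xx x0; have x'0 : x' != 0 by rewrite -(apx_neq0 xx).
have := apx_mul xy (apx_inv xx).
by rewrite ![_ * y]mulrC ![_ * y']mulrC !mulfK.
Qed.

Lemma apx_opp x x' : apx x x' -> apx (- x) (- x').
Proof. by move=> h; rewrite -mulN1r -[- x']mulN1r; apply: apx_mul => //; apply: apx_refl. Qed.

Lemma apx_lt_same x x' : vlt W (x' - x) x -> apx x x'.
Proof. by move=> h; left; rewrite -opprB; apply/vltN. Qed.

(** Hensel's lemma at the residue 0, with coefficients and root in [E], although [W] is a ring of
    the ambient field. *)
Definition henselian_in (E : X -> Prop) : Prop := forall g : {poly X},
  (forall i, E g`_i) -> (forall i, W g`_i) -> vlt W g`_0 1 -> vle W 1 g`_1 ->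
  exists y, [/\ E y, vlt W y 1 & root g y].

(* The Taylor expansion of G at c evaluates at a without cancellation. *)
Definition good_centre (G : {poly X}) c a : Prop :=
  forall i, vle W (G^`N(i).[c] * (a - c) ^+ i) G.[a].

Lemma vring_binom n m : W ('C(n, m))%:R.
Proof. exact: vring_nat. Qed.

(** Only terms of order at least j > 0 at the old centre contribute to the j-th term at the new one,
    with integral factors. *)
Lemma taylor_bound (G : {poly X}) c x d e B :
  x - c = d * e -> W e -> (forall i, (0 < i)%N -> vle W (G^`N(i).[c] * d ^+ i) B) ->
  forall j, (0 < j)%N -> vle W (G^`N(j).[x] * d ^+ j) B.
Proof.
move=> xc We h j j0; rewrite (taylor_shift _ _ xc); apply: vle_sum => i _.
apply: vleM1; first by apply: h; rewrite addn_gt0 j0 orbT.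
by rewrite -mulr_natr; apply: vringM; [apply: vringX|apply: vring_binom].
Qed.

(** The i-th Taylor term of G is (a - c) / i times the term of order i - 1 of G'. This division by i
    is where residue characteristic 0 enters. *)
Lemma good_deriv_bound (G : {poly X}) c a : good_centre G^`() c a ->
  forall i, (0 < i)%N -> vle W (G^`N(i).[c] * (a - c) ^+ i) ((a - c) * G^`().[a]).
Proof.
move=> h [//|i] _; have := h i; rewrite -nderivn1 nderivn_nderivn addn1 hornerMn.
rewrite binSn => {}h; rewrite exprS mulrCA; apply: vleM; first exact: vle_refl.
apply: vle_trans h; rewrite -mulr_natr mulrAC -[X in vle W X _]mulr1.
by apply: vleM; [apply: vle_refl|apply: W_nat].
Qed.

Section NewtonStep.
Variables (E : X -> Prop) (sfE : subfield E) (hensE : henselian_in E).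

(** Substituting a + d y and dividing by B = d G'(a) makes the linear coefficient 1 and the constant
    one G(a) / B, which is small, while the others are integral: Hensel's lemma finds y. *)
Lemma newton_root (G : {poly X}) a d B : (forall i, E G`_i) -> E a -> E d ->
  d * G^`().[a] = B -> vlt W G.[a] B ->
  (forall j, (0 < j)%N -> vle W (G^`N(j).[a] * d ^+ j) B) ->
  exists y, [/\ E y, vlt W y 1 & root G (a + d * y)].
Proof.
move=> EG Ea Ed defB GB hB; have B0 := vlt_neq0 GB.
have EN j : E G^`N(j).[a] by apply: sf_horner => //; apply: sf_nderivn.
pose H := \poly_(j < size G) (G^`N(j).[a] * d ^+ j / B).
have cH j : H`_j = G^`N(j).[a] * d ^+ j / B.
  rewrite coef_poly; case: ltnP => // h; rewrite nderivn_poly0 ?horner0 ?mul0r //.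
have EB : E B by rewrite -defB; apply: (sfM sfE) => //; rewrite -nderivn1.
have H0 : vlt W H`_0 1 by rewrite cH nderivn0 expr0 mulr1 vlt_div // mul1r.
have [||||y [Ey y1 /rootP ry]] := hensE (g := H).
- by move=> i; rewrite cH; apply: sf_div => //; apply: (sfM sfE) => //; apply: sfX.
- case=> [|i]; first exact: vlt_ring.
  by rewrite cH; apply/vle1; rewrite vle_div // mul1r; apply: hB.
- exact: H0.
- by rewrite cH nderivn1 expr1 [_ * d]mulrC defB mulfV //; apply: vle_refl.
exists y; split=> //; apply/rootP.
suff -> : G.[a + d * y] = H.[y] * B by rewrite ry mul0r.
rewrite (taylor_to G a) horner_poly mulr_suml; apply: eq_bigr => j _.
by rewrite addrC addKr exprMn; field.
Qed.

(** B = (a - c) G'(a) bounds all nonconstant Taylor terms. If |B| <= |G(a)|, the constant term is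
    bounded too and c is good. Otherwise Newton's method yields a root closer to a than |a - c|, and
    around it the linear term alone dominates. *)
Lemma good_centre_or_root (G : {poly X}) c a : (forall i, E G`_i) -> E a -> E c ->
  good_centre G^`() c a -> good_centre G c a \/
  exists c', [/\ E c', root G c' & good_centre G c' a].
Proof.
move=> EG Ea Ec gG'; set d := a - c; set B := d * G^`().[a].
have H1 := good_deriv_bound gG'; rewrite -/d -/B in H1.
have ac : a - c = d * 1 by rewrite mulr1.
have sumB (r : seq nat) : vle W (\sum_(i <- r | (0 < i)%N) G^`N(i).[c] * d ^+ i) B.
  by apply: vle_sum => i; apply: H1.
have [BG|GB] := vltP W B G.[a].
  left=> i; have [->|i0] := posnP i; last by apply: vle_trans (H1 _ i0) BG.
  rewrite nderivn0 expr0 mulr1.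
  have -> : G.[c] = G.[a] - \sum_(i < size G | (0 < i)%N) G^`N(i).[c] * d ^+ i.
    rewrite (taylor_to G c a) -/d (bigID (fun i : 'I__ => 0 < i)%N) /= [_ + \sum_(_ | _) _]addrC addrK.
    have [s0|s0] := posnP (size G).
      rewrite big1 => [|j _]; last by have := ltn_ord j; rewrite {2}s0.
      by move/eqP: s0; rewrite size_poly_eq0 => /eqP ->; rewrite horner0.
    rewrite (big_pred1 (Ordinal s0)) => [|j]; first by rewrite /= nderivn0 expr0 mulr1.
    by rewrite -leqNgt leqn0.
  apply: vleB; first exact: vle_refl.
  by apply: vle_trans BG; apply: vle_sum => j; apply: H1.
right; have H3 := taylor_bound ac (vring1 W) H1.
have Ed : E d by apply: (sfB sfE).
have [y [Ey y1 ry]] := newton_root EG Ea Ed erefl GB H3.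
exists (a + d * y); split=> //; first by apply: (sfD sfE) => //; apply: (sfM sfE).
have B0 := vlt_neq0 GB; have Wy := vlt_ring y1.
set c' := a + d * y in ry *; have c'a : c' - a = d * y by rewrite addrC addKr.
have H4 := taylor_bound c'a Wy H3.
(* The derivative is as large at c' as at a, because all corrections carry a factor y. *)
have H5 : vle W B (G^`N(1).[c'] * d).
  have e := taylor_shift G 1 c'a; rewrite expr1 in e; rewrite e.
  have s0 : (0 < size G^`N(1))%N.
    rewrite lt0n size_poly_eq0 nderivn1; apply: contraNneq B0 => G'0.
    by rewrite /B G'0 horner0 mulr0.
  rewrite (bigD1 (Ordinal s0)) //= bin0 !expr0 mulr1n mulr1 expr1.
  rewrite {1}nderivn1 [_ * d]mulrC -/B.
  apply: (vlt_dom _).1; apply: vlt_sum => // i i0.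
  have i0' : (0 < i)%N by rewrite lt0n; apply: contraNneq i0 => i0; apply/eqP/val_inj.
  apply: (vle_lt_trans (y := B * y)); last by rewrite -{2}[B]mulr1 vltMl.
  apply: vleM; first by apply: H3; rewrite addnS.
  rewrite -(prednK i0') exprS -mulrnAr; apply: vleM1; first exact: vle_refl.
  by rewrite -mulr_natr; apply: vringM; [apply: vringX|apply: vring_binom].
have ac' : a - c' = - (d * y) by rewrite -opprB c'a.
have [y0|y0] := eqVneq y 0.
  move=> i; rewrite ac' y0 mulr0 oppr0.
  have [->|i0] := posnP i; last by rewrite expr0n eqn0Ngt i0 mulr0; apply: vle0.
  by rewrite nderivn0 (rootP ry) mul0r; apply: vle0.
pose T i := G^`N(i).[c'] * (a - c') ^+ i.
have T1 : vle W (B * y) (T 1%N).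
  rewrite /T ac' expr1 mulrN vleNr mulrA; apply: vleM => //; exact: vle_refl.
have T2 i : (1 < i)%N -> vlt W (T i) (B * y).
  move=> i1; rewrite /T ac' exprNn mulrCA exprMn; apply: vltM1l; last first.
    by apply: vringX; apply: vringN; apply: vring1.
  rewrite mulrA; apply: (vle_lt_trans (y := B * y ^+ i)).
    by apply: vleM; [apply: H4; apply: leq_trans i1|apply: vle_refl].
  rewrite vltMl // -(subnKC i1) exprD.
  apply: vltM1; last by apply: vringX.
  by rewrite expr2 -{3}[y]mulr1 vltMl.
have T0 : T 0%N = 0 by rewrite /T nderivn0 (rootP ry) mul0r.
have GT : vle W (T 1%N) G.[a].
  have s1 : (1 < size G)%N.
    rewrite ltnNge; apply: contraNN B0 => s1; rewrite /B.
    by rewrite (size1_polyC s1) derivC horner0 mulr0.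
  rewrite (taylor_to G c' a) (bigD1 (Ordinal s1)) //= -/(T 1%N).
  have T10 : T 1%N != 0.
    by apply/eqP => e; move: T1; rewrite e => /vlex0/eqP; rewrite mulf_eq0 (negPf B0) (negPf y0).
  apply: (vlt_dom _).1; apply: vlt_sum => // i; rewrite -/(T i) -val_eqE /= => i1.
  have [->|i0] := posnP i; first by rewrite T0; apply/vlt0.
  by apply: vlt_le_trans T1; apply: T2; rewrite ltn_neqAle eq_sym i1.
move=> i; rewrite -/(T i); apply: vle_trans GT.
case: i => [|[|i]]; [by rewrite T0; apply: vle0|exact: vle_refl|].
by apply: vle_trans T1; apply/vltW/T2.
Qed.

End NewtonStep.
End Approximation.

(** * Back and forth *)

Lemma nderivn_map (R S : nzRingType) (f : {rmorphism R -> S}) (g : {poly R}) n :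
  (map_poly f g)^`N(n) = map_poly f g^`N(n).
Proof. by apply/polyP => i; rewrite coef_nderivn !coef_map coef_nderivn raddfMn. Qed.

(** * Extending an embedding that preserves leading terms by one element *)

Section Span.
Variables (X : fieldType) (W : valring X).
Hypothesis W_nat : forall n, vle W 1 n.+1%:R.
Variables (E1 E2 : X -> Prop).
Hypotheses (sfE1 : subfield E1) (sfE2 : subfield E2).
Hypotheses (hens1 : henselian_in W E1) (hens2 : henselian_in W E2).
Hypothesis rv12 : forall x, E1 x -> exists2 y, E2 y & apx W x y.
Variables (k : fieldType) (f1 f2 : {rmorphism k -> X}).
Hypotheses (kE1 : forall x, E1 (f1 x)) (kE2 : forall x, E2 (f2 x)).
Hypothesis kapx : forall x, apx W (f1 x) (f2 x).
Local Notation P1 g := (map_poly f1 g).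
Local Notation P2 g := (map_poly f2 g).
Implicit Types (g : {poly k}) (c u : k) (a b : X).

Lemma size_span g : size (P2 g) = size (P1 g).
Proof. by rewrite !size_map_poly. Qed.

Lemma span_coef1 g i : E1 (P1 g)`_i.
Proof. by rewrite coef_map; apply: kE1. Qed.

Lemma span_coef2 g i : E2 (P2 g)`_i.
Proof. by rewrite coef_map; apply: kE2. Qed.

Lemma apx_taylor g c a b : apx W (a - f1 c) (b - f2 c) -> forall i,
  apx W ((P1 g)^`N(i).[f1 c] * (a - f1 c) ^+ i) ((P2 g)^`N(i).[f2 c] * (b - f2 c) ^+ i).
Proof.
move=> ab i; apply: apx_mul; first by rewrite !nderivn_map !horner_map.
elim: i => [|i IH]; first exact: apx_refl.
by rewrite !exprS; apply: apx_mul.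
Qed.

(** At a good centre the Taylor terms on the two sides have equal leading terms and do not
    cancel. *)
Lemma apx_transfer g c a b : good_centre W (P1 g) (f1 c) a ->
  apx W (a - f1 c) (b - f2 c) -> apx W (P1 g).[a] (P2 g).[b].
Proof.
move=> gc ab; rewrite (taylor_to _ (f1 c) a) (taylor_to _ (f2 c) b) size_span.
apply: apx_sum => i; first by apply: apx_taylor.
by rewrite -taylor_to; apply: gc.
Qed.

(** When c is at least as near to a as u is, a - u = (a - c) + (c - u) is a sum without
    cancellation. *)
Lemma apx_recentre a b c u : apx W (a - f1 c) (b - f2 c) ->
  vle W (a - f1 c) (a - f1 u) -> apx W (a - f1 u) (b - f2 u).
Proof.
move=> ab au.
have -> : a - f1 u = (a - f1 c) + f1 (c - u) by rewrite rmorphB; ring.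
have -> : b - f2 u = (b - f2 c) + f2 (c - u) by rewrite rmorphB; ring.
by apply: apx_add => //; rewrite rmorphB addrA subrK.
Qed.

(** Size at most d is degree below d: inside [E1] nothing outside k is algebraic over k of degree
    below d. *)
Definition closed_below d := forall g, g != 0 -> (size g <= d)%N ->
  forall x, E1 x -> root (P1 g) x -> exists c, x = f1 c.

(** Induction on the degree through g': a good centre for g' is good for g, unless there is a root
    of g in [E1] that is a good centre, and [closed_below] puts that root into k. *)
Lemma good_centre_ex d a g : closed_below d -> E1 a -> (size g <= d)%N ->
  exists c, good_centre W (P1 g) (f1 c) a.
Proof.
move=> cd Ea; move: {2}(size g) (leqnn (size g)) => n; elim: n g => [|n IH] g.
  rewrite leqn0 size_poly_eq0 => /eqP -> _; exists 0 => i.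
  by rewrite rmorph0 nderivn_poly0 ?size_poly0 // horner0 mul0r; apply: vle0.
move=> sg sgd; have [->|g0] := eqVneq g 0.
  exists 0 => i.
  by rewrite rmorph0 nderivn_poly0 ?size_poly0 // horner0 mul0r; apply: vle0.
have sg' := lt_size_deriv g0.
have [||c gc] := IH g^`(); [by rewrite -ltnS; apply: leq_trans sg|exact: ltnW (leq_trans sg' sgd)|].
rewrite -deriv_map in gc.
have [h|[c' [Ec' rc' h]]] := good_centre_or_root W_nat sfE1 hens1 (span_coef1 g) Ea (kE1 c) gc.
  by exists c.
by have [u cu] := cd g g0 sgd _ Ec' rc'; exists u; rewrite -cu.
Qed.

(** Each g has its own good centre, and a centre c at least as near to a as all of these serves
    every g; then it suffices to copy the leading term of a - c into [E2]. Passing from finitely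
    many g to all of them is left to saturation. *)
Lemma finite_extension a (gs : seq {poly k}) : (forall d, closed_below d) -> E1 a ->
  exists2 b, E2 b & forall g, g \in gs -> apx W (P1 g).[a] (P2 g).[b].
Proof.
move=> cl Ea.
have [c gc] : exists c, forall g, g \in gs -> exists2 u, good_centre W (P1 g) (f1 u) a &
    vle W (a - f1 c) (a - f1 u).
  elim: gs => [|g gs [c IH]]; first by exists 0.
  have [u gu] := good_centre_ex (cl _) Ea (leqnn (size g)).
  have [h|h] := vle_total W (a - f1 c) (a - f1 u).
    exists c => g'; rewrite inE => /orP[/eqP->|/IH//]; by exists u.
  exists u => g'; rewrite inE => /orP[/eqP->|/IH[u' gu' cu']].
    by exists u => //; apply: vle_refl.
  by exists u' => //; apply: vle_trans cu'.
have [|d Ed apd] := rv12 (x := a - f1 c); first by apply: (sfB sfE1).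
exists (d + f2 c) => [|g /gc[u gu cu]]; first by apply: (sfD sfE2).
by apply: (apx_transfer gu); apply: (apx_recentre (c := c)); rewrite ?addrK.
Qed.

(** With c a good centre of f', copying the leading term of a - c gives an approximate root of the
    image of f, which Newton's method turns into a root b'. Every g reduces modulo f to a degree
    where good centres exist, so only the differences a - u and b' - u with u in k remain to be
    compared. *)
Lemma algebraic_extension d (f : {poly k}) a : closed_below d -> size f = d.+1 ->
  E1 a -> root (P1 f) a -> (forall c, a <> f1 c) ->
  exists b, [/\ E2 b, root (P2 f) b & forall g, apx W (P1 g).[a] (P2 g).[b]].
Proof.
move=> cd sf Ea ra nka.
have f0 : f != 0 by rewrite -size_poly_eq0 sf.
have nroot g : g != 0 -> (size g <= d)%N -> (P1 g).[a] != 0.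
  by move=> g0 sg; apply/eqP => /rootP ga; have [c /nka] := cd g g0 sg a Ea ga.
have d2 : (1 < size f)%N.
  rewrite ltnNge; apply/negP => s1; move: ra; rewrite (size1_polyC s1) map_polyC rootC.
  by rewrite fmorph_eq0 => /eqP fc; move: f0; rewrite (size1_polyC s1) fc eqxx.
have natk n : n.+1%:R != 0 :> k.
  rewrite -(fmorph_eq0 f1) rmorph_nat; apply/eqP => e.
  by have := W_nat n; rewrite e => /vlex0/eqP; rewrite oner_eq0.
have f'0 : f^`() != 0.
  apply/eqP => /(congr1 (fun g : {poly k} => g`_(size f).-2)).
  rewrite coef_deriv coef0 -mulr_natr => /eqP; rewrite mulf_eq0 (negPf (natk _)) orbF.
  by rewrite prednK -?subn1 ?subn_gt0 // subn1 -lead_coefE lead_coef_eq0 (negPf f0).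
have sf' : (size f^`() <= d)%N by rewrite -ltnS -sf; apply: lt_size_deriv.
have D0 := nroot _ f'0 sf'.
have [c gc] := good_centre_ex cd Ea sf'; rewrite -deriv_map in gc D0.
have H1 := good_deriv_bound W_nat gc.
set e := a - f1 c in H1 *; set B := e * _ in H1.
have e0 : e != 0 by rewrite subr_eq0; apply/eqP/nka.
have B0 : B != 0 by rewrite mulf_neq0.
have [|e' Ee' ee'] := rv12 (x := e); first by apply: (sfB sfE1).
have e'0 : e' != 0 by rewrite -(apx_neq0 ee').
pose b := f2 c + e'; have bc : b - f2 c = e' by rewrite addrC addKr.
have Eb : E2 b by apply: (sfD sfE2).
have ab : apx W (a - f1 c) (b - f2 c) by rewrite bc.
have apD : apx W (P1 f)^`().[a] (P2 f)^`().[b] by rewrite !deriv_map in gc *; apply: apx_transfer ab.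
pose B' := e' * (P2 f)^`().[b].
have BB' : apx W B B' by apply: apx_mul.
(* f(a) = 0, and every Taylor term of the second image at b differs from that of the first at a by
   less than B. *)
have fb : vlt W (P2 f).[b] B'.
  apply: (vlt_le_trans _ (apx_eqv BB').1).
  have -> : (P2 f).[b] = (P2 f).[b] - (P1 f).[a] by rewrite (rootP ra) subr0.
  rewrite (taylor_to _ (f1 c) a) (taylor_to _ (f2 c) b) size_span -sumrB.
  apply: vlt_sum => // i _.
  case: (apx_sym (apx_taylor f ab i)) => [h|[-> ->]]; last by rewrite subrr; apply/vlt0.
  apply: vlt_le_trans h _; apply: vle_trans (apx_eqv (apx_taylor f ab i)).2 _.
  have [i0|i0] := posnP i; last exact: H1.
  rewrite i0 nderivn0 expr0 mulr1.
  have -> : (P1 f).[f1 c] = (P1 f).[f1 c] - (P1 f).[a] by rewrite (rootP ra) subr0.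
  have s0 : (0 < size (P1 f))%N by rewrite size_map_poly ltnW.
  rewrite (taylor_to _ (f1 c) a) (bigD1 (Ordinal s0)) //=.
  rewrite nderivn0 expr0 mulr1 opprD addrA subrr sub0r vleN.
  apply: vle_sum => j; rewrite -val_eqE /= -lt0n => j0; exact: H1.
have H1' j : (0 < j)%N -> vle W ((P2 f)^`N(j).[f2 c] * e' ^+ j) B'.
  move=> j0; rewrite -bc; apply: apx_le (apx_taylor f ab j) BB' (H1 _ j0).
have bc1 : b - f2 c = e' * 1 by rewrite mulr1.
have H2' := taylor_bound bc1 (vring1 W) H1'.
have [y [Ey y1 ry]] := newton_root sfE2 hens2 (span_coef2 f) Eb Ee' erefl fb H2'.
have Wy := vlt_ring y1.
set b' := b + e' * y in ry.
have Eb' : E2 b' by apply: (sfD sfE2) => //; apply: (sfM sfE2).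
have b'b : b' - b = e' * y by rewrite addrC addKr.
have ab' : apx W (a - f1 c) (b' - f2 c).
  apply: apx_trans ab _; rewrite bc; apply: apx_lt_same.
  have -> : b' - f2 c - e' = e' * y by rewrite /b' /b; ring.
  by rewrite -{2}[e']mulr1 vltMl.
have apD' : apx W (P1 f)^`().[a] (P2 f)^`().[b'] by rewrite !deriv_map in gc *; apply: apx_transfer ab'.
have ac1 : a - f1 c = e * 1 by rewrite mulr1.
have H3 := taylor_bound ac1 (vring1 W) H1.
have H3' := taylor_bound b'b Wy H2'.
(* Near a simple root a polynomial has the leading term of its linear part. *)
have linear (G : {poly X}) (x z h : X) : root G x -> h != 0 -> G^`().[x] != 0 ->
    (forall j, (0 < j)%N -> vle W (G^`N(j).[x] * h ^+ j) (h * G^`().[x])) ->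
    vlt W (z - x) h -> apx W G.[z] (G^`().[x] * (z - x)).
  move=> rx h0 G'0 hb ux; apply: apx_sym.
  have [->|ux0] := eqVneq z x; first by rewrite subrr mulr0 (rootP rx); apply: apx_refl.
  have T0 : G^`().[x] * (z - x) != 0 by rewrite mulf_neq0 // subr_eq0.
  left; rewrite (taylor_to G x z) -opprB; apply/vltN.
  have s2 : (1 < size G)%N.
    rewrite ltnNge; apply: contraNN G'0 => s1.
    by rewrite (size1_polyC s1) derivC horner0.
  rewrite (bigD1 (Ordinal s2)) //= nderivn1 expr1 addrAC subrr add0r.
  apply: vlt_sum => // i; rewrite -val_eqE /= => i1.
  have [->|i0] := posnP i; first by rewrite nderivn0 (rootP rx) mul0r; apply/vlt0.
  have {i0}i1 : (1 < i)%N by rewrite ltn_neqAle eq_sym i1.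
  apply/(vltMr W _ _ (expf_neq0 i h0)).
  rewrite mulrAC; apply: (vle_lt_trans (y := h * G^`().[x] * (z - x) ^+ i)).
    by apply: vleM; [apply: hb; apply: ltnW|apply: vle_refl].
  have [m ->] : exists m, i = m.+2 :> nat by exists i.-2; case: (nat_of_ord i) i1 => [|[]].
  have -> : h * G^`().[x] * (z - x) ^+ m.+2 = (z - x) ^+ m.+1 * (h * (G^`().[x] * (z - x))).
    by rewrite exprS; ring.
  have -> : G^`().[x] * (z - x) * h ^+ m.+2 = h ^+ m.+1 * (h * (G^`().[x] * (z - x))).
    by rewrite (exprS _ m.+1); ring.
  by rewrite vltMr ?mulf_neq0 ?subr_eq0 //; apply: vltX.
(* A u nearer to a than c is cannot be compared through c. But f(u) lies in k, so its two images
   have equal leading terms, and these are those of f'(a) (u - a) and f'(b') (u - b'); the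
   derivatives cancel. *)
have star u : apx W (a - f1 u) (b' - f2 u).
  have [h|h] := vltP W e (a - f1 u); first exact: apx_recentre ab' h.
  have hu : vlt W (f1 u - a) e by rewrite -opprB; apply/vltN.
  have hu' : vlt W (f2 u - b') e'.
    have h1 : apx W (- e) (f1 (c - u)).
      apply: apx_lt_same; apply/vltNr; rewrite rmorphB.
      have -> // : f1 c - f1 u - - e = a - f1 u by rewrite /e; ring.
    have h2 : apx W e' (f2 (u - c)).
      apply: apx_trans (apx_sym ee') _; rewrite -[e]opprK -[u - c]opprB rmorphN.
      by apply: apx_opp; apply: apx_trans h1 (kapx _).
    have h3 : apx W e' (b' - f2 c) by apply: apx_trans (apx_sym ee') ab'.
    have -> : f2 u - b' = (f2 (u - c) - e') - (b' - f2 c - e') by rewrite rmorphB; ring.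
    have lt' x : apx W e' x -> vlt W (x - e') e'.
      by case=> [|[e'z]]; [rewrite -opprB => /vltN|rewrite e'z eqxx in e'0].
    by apply: vltB; apply: lt'.
  have l1 := linear _ _ _ _ ra e0 D0 H3 hu.
  have D'0 : (P2 f)^`().[b'] != 0 by rewrite -(apx_neq0 apD').
  have l2 : apx W (P2 f).[f2 u] ((P2 f)^`().[b'] * (f2 u - b')).
    apply: linear hu' => // j j0; apply: vle_trans (H3' j j0) _.
    apply: vleM; [exact: vle_refl|].
    exact: vle_trans (apx_eqv apD).2 (apx_eqv apD').1.
  have l3 : apx W ((P1 f)^`().[a] * (f1 u - a)) ((P2 f)^`().[b'] * (f2 u - b')).
    by apply: apx_trans (apx_sym l1) _; apply: apx_trans l2; rewrite !horner_map.
  by rewrite -opprB -[b' - _]opprB; apply: apx_opp; apply: apx_cancel l3 apD' D0.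
exists b'; split=> // g.
rewrite (divp_eq g f) !rmorphD !rmorphM !hornerE /= (rootP ra) (rootP ry) !mulr0 !add0r.
have [u gu] : exists u, good_centre W (P1 (g %% f)) (f1 u) a.
  by apply: good_centre_ex cd Ea _; rewrite -ltnS -sf ltn_modp.
exact: apx_transfer gu (star u).
Qed.

End Span.

(* A subring of a commutative ring all of whose nonzero elements are invertible; applied to
   fields F and to products X * X, whose subfields are graphs of partial isomorphisms. *)
Record subfld (A : comUnitRingType) := Subfld {
  sbf :> A -> Prop;
  sbf1 : sbf 1;
  sbfB : forall x y, sbf x -> sbf y -> sbf (x - y);
  sbfM : forall x y, sbf x -> sbf y -> sbf (x * y);
  sbfV : forall x, sbf x -> sbf x^-1;
  sbf_unit : forall x, sbf x -> x != 0 -> x \is a GRing.unit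
}.

Section SubfldType.
Variables (A : comUnitRingType) (S : subfld A).

Definition sbf_pred : {pred A} := fun x => `[< S x >].

Lemma sbf_pred_closed : subring_closed sbf_pred.
Proof.
split=> [|x y /asboolP Sx /asboolP Sy|x y /asboolP Sx /asboolP Sy]; apply/asboolP.
- exact: sbf1.
- exact: sbfB.
- exact: sbfM.
Qed.

HB.instance Definition _ := GRing.isSubringClosed.Build A sbf_pred sbf_pred_closed.

Record sbf_type := SbfType { sbf_val :> A; _ : sbf_val \in sbf_pred }.

HB.instance Definition _ := [isSub for sbf_val].
HB.instance Definition _ := [Choice of sbf_type by <:].
HB.instance Definition _ := [SubChoice_isSubComNzRing of sbf_type by <:].
HB.instance Definition _ := GRing.RMorphism.copy sbf_val (val : sbf_type -> A).

Lemma sbf_valP (x : sbf_type) : S (val x).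
Proof. by apply/asboolP; have := valP x. Qed.

Definition sbf_mk (x : A) (Sx : S x) : sbf_type :=
  @SbfType x (introT (asboolP _) Sx).

Definition sbf_inv (x : sbf_type) : sbf_type := sbf_mk (sbfV (sbf_valP x)).

Lemma sbf_mulVf (x : sbf_type) : x != 0 -> sbf_inv x * x = 1.
Proof.
move=> x0; apply: val_inj; rewrite rmorphM rmorph1 /= mulVr //.
apply: (sbf_unit (sbf_valP x)); apply: contra x0 => /eqP e.
exact/eqP/val_inj.
Qed.

Lemma sbf_inv0 : sbf_inv 0 = 0.
Proof. by apply: val_inj; rewrite /= invr0. Qed.

HB.instance Definition _ := GRing.ComNzRing_isField.Build sbf_type sbf_mulVf sbf_inv0.

End SubfldType.

(** Zorn's lemma is applied to the sets A for which R0 united with A has Q, so that the empty chain,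
    whose union is empty, causes no trouble. *)
Lemma zorn_above (T : Type) (Q : set (set T)) (R0 : set T) : Q R0 ->
  (forall F : set (set T), F !=set0 -> F `<=` Q -> total_on F subset ->
     Q (\bigcup_(A in F) A)) ->
  exists M, [/\ R0 `<=` M, Q M & forall B, M `<=` B -> Q B -> B `<=` M].
Proof.
move=> Q0 Qcup; have [F FQ Ftot|A [QA maxA]] := @Zorn_bigcup T (fun A => Q (R0 `|` A)).
  have [->|F0] := eqVneq F set0; first by rewrite /= bigcup_set0 setU0.
  have -> : R0 `|` \bigcup_(X in F) X = \bigcup_(X in [set R0 `|` X | X in F]) X.
    rewrite eqEsubset; split=> x.
      move/set0P: F0 => [X FX] [R0x|[Y FY Yx]].
        by exists (R0 `|` X); [exists X|left].
      by exists (R0 `|` Y); [exists Y|right].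
    by move=> [_ [X FX <-]] [R0x|Xx]; [left|right; exists X].
  apply: Qcup.
  - by move/set0P: F0 => [X FX]; exists (R0 `|` X); exists X.
  - by move=> _ [X FX <-]; apply: FQ.
  - move=> _ _ [X FX <-] [Y FY <-].
    by have [XY|YX] := Ftot X Y FX FY; [left|right]; apply: setUS.
exists (R0 `|` A); split=> // B RAB QB.
have RB : R0 `<=` B by move=> x Rx; apply: RAB; left.
have AB : A `<=` B by move=> x Ax; apply: RAB; right.
have [BA x Bx|nBA] := pselect (B `<=` A); first by right; apply: BA.
by case: (maxA B) => //; rewrite (_ : R0 `|` B = B) //; apply/setUidPr.
Qed.

Section MaximalSpan.
Variables (X : fieldType) (W : valring X).
Hypothesis W_nat : forall n, vle W 1 n.+1%:R.
Variables (E1 E2 : X -> Prop).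
Hypotheses (sfE1 : subfield E1) (sfE2 : subfield E2).
Hypotheses (hens1 : henselian_in W E1) (hens2 : henselian_in W E2).
Hypothesis rv12 : forall x, E1 x -> exists2 y, E2 y & apx W x y.

(** Partial isomorphisms as their graphs: related components vanish together, so such a ring is the
    graph of an isomorphism between subrings of [E1] and [E2]. *)
Record pair_ring (R : set (X * X)) : Prop := PairRing {
  pr1 : R 1;
  prB : forall z t, R z -> R t -> R (z - t);
  prM : forall z t, R z -> R t -> R (z * t);
  pr_fst : forall z, R z -> E1 z.1;
  pr_snd : forall z, R z -> E2 z.2;
  pr_apx : forall z, R z -> apx W z.1 z.2
}.

Lemma pair_ring_max R0 : pair_ring R0 ->
  exists M, [/\ R0 `<=` M, pair_ring M & forall B, M `<=` B -> pair_ring B -> B `<=` M].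
Proof.
move=> prR0; apply: zorn_above => // F [A0 FA0] FP Ftot.
have common z t : (\bigcup_(A in F) A) z -> (\bigcup_(A in F) A) t ->
    exists A, [/\ F A, A z & A t].
  move=> [A FA Az] [B FB Bt]; have [AB|BA] := Ftot A B FA FB.
    by exists B; split=> //; apply: AB.
  by exists A; split=> //; apply: BA.
split=> [|z t Rz Rt|z t Rz Rt|z [A /FP pA]|z [A /FP pA]|z [A /FP pA]].
- by exists A0 => //; apply: pr1 (FP _ FA0).
- by have [A [FA Az At]] := common z t Rz Rt; exists A => //; apply: prB (FP _ FA) _ _ Az At.
- by have [A [FA Az At]] := common z t Rz Rt; exists A => //; apply: prM (FP _ FA) _ _ Az At.
- exact: pr_fst.
- exact: pr_snd.
- exact: pr_apx.
Qed.

Section Maximal.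
Variable R : set (X * X).
Hypotheses (prR : pair_ring R).
Hypothesis maxR : forall B, R `<=` B -> pair_ring B -> B `<=` R.

Lemma pair_ring_neq0 z : R z -> (z.1 == 0) = (z.2 == 0).
Proof. by move=> /(pr_apx prR); apply: apx_neq0. Qed.

(** Leading terms can be divided, so the fractions with nonzero denominators form a pair ring, which
    maximality puts into R. This makes R a field. *)
Lemma pair_ring_fraction z : R z -> R (z.1^-1, z.2^-1).
Proof.
move=> Rz; have [z0|z0] := eqVneq z.1 0.
  have z2 : z.2 = 0 by apply/eqP; rewrite -pair_ring_neq0 // z0.
  by rewrite z0 z2 invr0 -[(0, 0)]/(0 : X * X) -(subrr 1); apply: (prB prR); apply: (pr1 prR).
pose B := [set t : X * X | exists2 u, R u.1 /\ R u.2 & u.2.1 != 0 /\ u.2.2 != 0 /\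
  t = (u.1.1 / u.2.1, u.1.2 / u.2.2)].
suff RB : B `<=` R.
  apply: RB; exists (1, z) => /=; first by split=> //; apply: (pr1 prR).
  by rewrite !div1r -pair_ring_neq0 // z0.
apply: maxR => [t Rt|].
  exists (t, 1); first by split=> //; apply: (pr1 prR).
  by rewrite /= !divr1 oner_neq0; case: t Rt.
split.
- exists (1, 1); first by split; apply: (pr1 prR).
  by rewrite /= !divr1 oner_neq0.
- move=> _ _ [[[a a'] [b b']] /= [Ra Rb] [b0 [b'0 ->]]] [[[c c'] [d d']] /= [Rc Rd] [d0 [d'0 ->]]].
  exists ((a, a') * (d, d') - (c, c') * (b, b'), (b, b') * (d, d')).
    by split; do ?[apply: (prB prR) => //]; apply: (prM prR).
  rewrite /= !mulf_neq0 //; do 2 split=> //.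
  by congr (_, _); rewrite /=; field; rewrite ?b0 ?b'0 ?d0 ?d'0.
- move=> _ _ [[[a a'] [b b']] /= [Ra Rb] [b0 [b'0 ->]]] [[[c c'] [d d']] /= [Rc Rd] [d0 [d'0 ->]]].
  exists ((a, a') * (c, c'), (b, b') * (d, d')).
    by split; apply: (prM prR).
  rewrite /= !mulf_neq0 //; do 2 split=> //.
  by congr (_, _); rewrite /=; field; rewrite ?b0 ?b'0 ?d0 ?d'0.
- move=> _ [u [Ra Rb] [b0 [b'0 ->]]] /=.
  by apply: (sf_div sfE1); apply: (pr_fst prR).
- move=> _ [u [Ra Rb] [b0 [b'0 ->]]] /=.
  by apply: (sf_div sfE2); apply: (pr_snd prR).
- move=> _ [u [Ra Rb] [b0 [b'0 ->]]] /=.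
  by apply: apx_mul; [|apply: apx_inv]; apply: (pr_apx prR).
Qed.

Lemma span_subfld_inv z : R z -> R z^-1.
Proof.
move=> Rz; have [z0|z0] := eqVneq z 0; first by rewrite z0 invr0 -z0.
have zu : z \is a GRing.unit.
  rewrite -topredE /= !unitfE -pair_ring_neq0 // andbb.
  by apply: contra z0 => z1; case: z Rz z1 => x y Rz /= z1; rewrite xpair_eqE z1 -(pair_ring_neq0 Rz).
suff -> : z^-1 = (z.1^-1, z.2^-1) by apply: pair_ring_fraction.
apply: (mulrI zu); rewrite mulrV //; move: zu; rewrite -topredE /= !unitfE => /andP[z1 z2].
by case: z z1 z2 {Rz z0} => x y /= x0 y0; rewrite -[RHS]/(x / x, y / y) !mulfV.
Qed.

End Maximal.
End MaximalSpan.

Section MaximalSpanClosed.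
Variables (X : fieldType) (W : valring X).
Hypothesis W_nat : forall n, vle W 1 n.+1%:R.
Variables (E1 E2 : X -> Prop).
Hypotheses (sfE1 : subfield E1) (sfE2 : subfield E2).
Hypotheses (hens1 : henselian_in W E1) (hens2 : henselian_in W E2).
Hypothesis rv12 : forall x, E1 x -> exists2 y, E2 y & apx W x y.
Variable R : set (X * X).
Hypotheses (prR : pair_ring W E1 E2 R).
Hypothesis maxR : forall B, R `<=` B -> pair_ring W E1 E2 B -> B `<=` R.

Lemma max_span_unit z : R z -> z != 0 -> z \is a GRing.unit.
Proof.
move=> Rz z0; rewrite -topredE /= !unitfE -(pair_ring_neq0 prR Rz) andbb.
by apply: contra z0 => z1; case: z Rz z1 => x y Rz /= z1; rewrite xpair_eqE z1 -(pair_ring_neq0 prR Rz).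
Qed.

Definition max_span : subfld (X * X)%type :=
  Subfld (pr1 prR) (prB prR) (prM prR) (span_subfld_inv sfE1 sfE2 prR maxR) max_span_unit.

Local Notation k := (sbf_type max_span).

Definition span_fst : {rmorphism k -> X} :=
  GRing.RMorphism.clone _ _ (fst \o (val : k -> (X * X)%type)) _.
Definition span_snd : {rmorphism k -> X} :=
  GRing.RMorphism.clone _ _ (snd \o (val : k -> (X * X)%type)) _.

Lemma span_fst_in x : E1 (span_fst x).
Proof. exact: (pr_fst prR (sbf_valP x)). Qed.

Lemma span_snd_in x : E2 (span_snd x).
Proof. exact: (pr_snd prR (sbf_valP x)). Qed.

Lemma span_apx x : apx W (span_fst x) (span_snd x).
Proof. exact: (pr_apx prR (sbf_valP x)). Qed.

(** An element of [E1] of degree d over the maximal span and outside of it would, by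
    [algebraic_extension], enlarge the pair ring. *)
Lemma max_span_closed d : closed_below E1 span_fst d.
Proof.
elim: d => [|d IH] g g0; first by rewrite leqn0 size_poly_eq0 (negPf g0).
rewrite leq_eqVlt => /orP[/eqP sg x Ex gx|]; last exact: IH.
apply: contrapT => nx.
have [b [Eb gb xb]] := algebraic_extension W_nat sfE1 sfE2 hens1 hens2 rv12
  span_fst_in span_snd_in span_apx IH sg Ex gx (fun c e => nx (ex_intro _ c e)).
pose B := [set z : X * X | exists g, z = ((map_poly span_fst g).[x], (map_poly span_snd g).[b])].
have RB : B `<=` R.
  apply: maxR => [z Rz|].
    by exists (sbf_mk (Rz : max_span z))%:P; rewrite !map_polyC !hornerC; case: z Rz.
  split.
  - by exists 1; rewrite !rmorph1 !hornerC.
  - by move=> _ _ [g1 ->] [g2 ->]; exists (g1 - g2); rewrite !rmorphB !hornerE.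
  - by move=> _ _ [g1 ->] [g2 ->]; exists (g1 * g2); rewrite !rmorphM !hornerE.
  - by move=> _ [h ->]; apply: (sf_horner sfE1) => // i; rewrite coef_map; apply: span_fst_in.
  - by move=> _ [h ->]; apply: (sf_horner sfE2) => // i; rewrite coef_map; apply: span_snd_in.
  - by move=> _ [h ->]; apply: xb.
have Rxb : R (x, b) by apply: RB; exists 'X; rewrite !map_polyX !hornerX.
by apply: nx; exists (sbf_mk (Rxb : max_span (x, b))).
Qed.

End MaximalSpanClosed.

Section BackAndForth.
Variables (X : fieldType) (W : valring X).
Hypothesis W_nat : forall n, vle W 1 n.+1%:R.

(** The invariant of the back-and-forth; the pairs of values of terms then form a pair ring. *)
Definition term_apx (e1 e2 : nat -> X) : Prop := forall t, apx W (teval e1 t) (teval e2 t).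

Lemma teval_in (E : X -> Prop) (e : nat -> X) t : subfield E -> (forall i, E (e i)) -> E (teval e t).
Proof.
move=> sfE Ee; elim: t => //= [||s|s1 h1 s2 h2|s1 h1 s2 h2].
- exact: sf0.
- exact: sf1.
- exact: sfN.
- exact: sfD.
- exact: (sfM sfE).
Qed.

Lemma finite_term_extension (E1 E2 : X -> Prop) (e1 e2 : nat -> X) (T : nat -> term) a n :
  subfield E1 -> subfield E2 -> henselian_in W E1 -> henselian_in W E2 ->
  (forall x, E1 x -> exists2 y, E2 y & apx W x y) ->
  (forall i, E1 (e1 i)) -> (forall i, E2 (e2 i)) -> term_apx e1 e2 -> E1 a ->
  exists2 b, E2 b & forall j, (j <= n)%N ->
    apx W (teval (env_cons a e1) (T j)) (teval (env_cons b e2) (T j)).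
Proof.
move=> sfE1 sfE2 hens1 hens2 rv12 Ee1 Ee2 e12 Ea.
have [|R [R0R prR maxR]] := @pair_ring_max X W E1 E2 [set z | exists t, z = (teval e1 t, teval e2 t)].
  split.
  - by exists One.
  - by move=> _ _ [t ->] [s ->]; exists (Add t (Opp s)).
  - by move=> _ _ [t ->] [s ->]; exists (Mul t s).
  - by move=> _ [t ->]; apply: teval_in.
  - by move=> _ [t ->]; apply: teval_in.
  - by move=> _ [t ->]; apply: e12.
have Re i : R (e1 i, e2 i) by apply: R0R; exists (Var i).
pose S := max_span sfE1 sfE2 prR maxR.
pose kap i : sbf_type S := sbf_mk (Re i : S (e1 i, e2 i)).
(* A term is a polynomial in its variable 0 over the field of the partial isomorphism. *)
pose P t := teval (env_cons 'X (fun i => (kap i)%:P)) t.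
pose f1 := span_fst sfE1 sfE2 prR maxR; pose f2 := span_snd sfE1 sfE2 prR maxR.
have PE (f : {rmorphism sbf_type S -> X}) c t (e : nat -> X) : (forall i, f (kap i) = e i) ->
    (map_poly f (P t)).[c] = teval (env_cons c e) t.
  move=> fe.
  have := teval_rmorph (horner_eval c \o map_poly f) (env_cons 'X (fun i => (kap i)%:P)) t.
  rewrite /= /horner_eval -/(P t) => <-; congr teval; apply/funext => -[|i] /=.
    by rewrite map_polyX hornerX.
  by rewrite map_polyC hornerC; apply: fe.
have [b Eb bP] := finite_extension W_nat sfE1 sfE2 hens1 rv12 (@span_fst_in _ _ _ _ sfE1 sfE2 _ prR
  maxR)
  (@span_snd_in _ _ _ _ sfE1 sfE2 _ prR maxR) (@span_apx _ _ _ _ sfE1 sfE2 _ prR maxR)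
  [seq P (T j) | j <- iota 0 n.+1] (@max_span_closed _ _ W_nat _ _ sfE1 sfE2 hens1 hens2 rv12 _ prR
    maxR) Ea.
exists b => // j jn; have := bP (P (T j)); rewrite (PE _ _ _ e1) // (PE _ _ _ e2) //; apply.
by apply/mapP; exists j => //; rewrite mem_iota.
Qed.

(** Countably many conditions suffice, one for each term. *)
Definition saturated_for (E : X -> Prop) : Prop := forall (T : nat -> term) (e1 e2 : nat -> X) a,
  (forall n, exists2 b, E b & forall j, (j <= n)%N ->
    apx W (teval (env_cons a e1) (T j)) (teval (env_cons b e2) (T j))) ->
  exists2 b, E b & forall j, apx W (teval (env_cons a e1) (T j)) (teval (env_cons b e2) (T j)).

Lemma term_enum : exists T : nat -> term, forall t, exists j, T j = t.
Proof.
have /choice[T TP] j : exists t, forall t', term_code t' = j -> t = t'.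
  have [[t tj]|nt] := pselect (exists t, term_code t = j).
    by exists t => t' t'j; apply: term_code_inj; rewrite tj.
  by exists Zero => t' t'j; case: nt; exists t'.
by exists T => t; exists (term_code t); apply: TP.
Qed.

Lemma term_extension (E1 E2 : X -> Prop) (e1 e2 : nat -> X) a :
  subfield E1 -> subfield E2 -> henselian_in W E1 -> henselian_in W E2 ->
  (forall x, E1 x -> exists2 y, E2 y & apx W x y) -> saturated_for E2 ->
  (forall i, E1 (e1 i)) -> (forall i, E2 (e2 i)) -> term_apx e1 e2 -> E1 a ->
  exists2 b, E2 b & term_apx (env_cons a e1) (env_cons b e2).
Proof.
move=> sfE1 sfE2 hens1 hens2 rv12 sat2 Ee1 Ee2 e12 Ea.
have [T TP] := term_enum.
have [n|b Eb bP] := sat2 T e1 e2 a; first exact: (@finite_term_extension E1).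
by exists b => // t; have [j <-] := TP t.
Qed.

(** The predicate is interpreted by [O], not by [W]: [W] is going to be a coarsening of the
    valuation, and its leading terms have to determine membership in [O]. *)
Theorem back_and_forth (O E1 E2 : X -> Prop) (e1 e2 : nat -> X) (phi : formula Lval) :
  subfield E1 -> subfield E2 -> henselian_in W E1 -> henselian_in W E2 ->
  (forall x, E1 x -> exists2 y, E2 y & apx W x y) -> saturated_for E2 ->
  (forall x, E2 x -> exists2 y, E1 y & apx W x y) -> saturated_for E1 ->
  (forall x y, apx W x y -> O x -> O y) ->
  (forall i, E1 (e1 i)) -> (forall i, E2 (e2 i)) -> term_apx e1 e2 ->
  rsat O E1 e1 phi <-> rsat O E2 e2 phi.
Proof.
move=> sfE1 sfE2 hens1 hens2 rv12 sat2 rv21 sat1 Oapx.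
elim: phi e1 e2 => //= [t1 t2|P t|p IHp q IHq|p IHp] e1 e2 Ee1 Ee2 e12.
- have := apx_neq0 (e12 (Add t1 (Opp t2))); rewrite /= !subr_eq0 => h.
  by split=> /eqP; [rewrite h|rewrite -h] => /eqP.
- by split; apply: Oapx; [|apply: apx_sym]; apply: e12.
- by rewrite (IHp e1 e2) // (IHq e1 e2).
have consE E a e : E a -> (forall i, E (e i)) -> forall i, E (env_cons a e i).
  by move=> Ea Ee [|i] /=.
split=> h a Ea.
  have [b Eb ab] := @term_extension E2 E1 e2 e1 a sfE2 sfE1 hens2 hens1 rv21 sat1 Ee2 Ee1
    (fun t => apx_sym (e12 t)) Ea.
  apply/(IHp (env_cons b e1) (env_cons a e2)); try exact: consE.
    by move=> t; apply: apx_sym.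
  exact: h.
have [b Eb ab] := @term_extension E1 E2 e1 e2 a sfE1 sfE2 hens1 hens2 rv12 sat2 Ee1 Ee2 e12 Ea.
apply/(IHp (env_cons a e1) (env_cons b e2)) => //; try exact: consE.
exact: h.
Qed.

End BackAndForth.

(** * Coarsening to residue characteristic 0 *)

Section Coarsening.
Variables (X : fieldType) (O : valring X) (p : X).
Hypotheses (p0 : p != 0) (p1 : vlt O p 1).

(** The ring O[1/p], the least overring in which p is a unit. *)
Definition coarse x : Prop := exists n, O (p ^+ n * x).

Lemma vring_p : O p. Proof. exact: vlt_ring. Qed.

Lemma coarse_ring x : O x -> coarse x.
Proof. by exists 0%N; rewrite mul1r. Qed.

Lemma coarse_le m n x : (m <= n)%N -> O (p ^+ m * x) -> O (p ^+ n * x).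
Proof.
move=> mn Om; rewrite -(subnK mn) exprD -mulrA; apply: vringM => //.
exact/vringX/vring_p.
Qed.

Lemma coarse_sub x y : coarse x -> coarse y -> coarse (x - y).
Proof.
move=> [m Om] [n On]; exists (maxn m n); rewrite mulrBr; apply: vringB.
  by apply: coarse_le Om; apply: leq_maxl.
by apply: coarse_le On; apply: leq_maxr.
Qed.

Lemma coarse_mul x y : coarse x -> coarse y -> coarse (x * y).
Proof.
by move=> [m Om] [n On]; exists (m + n)%N; rewrite exprD mulrACA; apply: vringM.
Qed.

Definition coarsening : valring X := Valring (coarse_ring (vring1 O)) coarse_sub coarse_mul
  (fun x => match vring_total O x with
   | or_introl h => or_introl (coarse_ring h)
   | or_intror h => or_intror (coarse_ring h) end).

Local Notation W := coarsening.

Lemma vle_coarse x y : vle W x y <-> exists n, vle O (p ^+ n * x) y.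
Proof.
split=> [[q [n On] ->]|[n [q Oq e]]]; first by exists n, (p ^+ n * q); rewrite ?mulrA.
have pn : p ^+ n != 0 by rewrite expf_neq0.
exists (q / p ^+ n); first by exists n; rewrite mulrC divfK.
by apply: (mulfI pn); rewrite e mulrA [_ * (q / _)]mulrC divfK.
Qed.

Lemma vlt_coarse x y : vlt W x y <-> forall n, vlt O x (p ^+ n * y).
Proof.
split=> [h n k|h /vle_coarse[n k]]; last exact: h k.
by apply: h; apply/vle_coarse; exists n.
Qed.

Lemma vlt_coarseW x y : vlt W x y -> vlt O x y.
Proof. by move=> /vlt_coarse/(_ 0%N); rewrite mul1r. Qed.

(** If p^N clears the denominators of all g_i / g_1 and M = N + 1, then g(p^M X) / (g_1 p^M) has
    linear coefficient 1 and all others small for [O]: the constant one since it is small even for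
    [W], that of order i >= 2 thanks to the factor p^(M (i - 1)). *)
Lemma coarse_henselian E : subfield E -> E p -> henselian_in O E -> henselian_in W E.
Proof.
move=> sfE Ep hens g Eg Wg g0 g1.
have g1' : vlt O 0 g`_1.
  by apply/vlt0/eqP => e; move: g1; rewrite e => /vlex0/eqP; rewrite oner_eq0.
have g1n0 := vlt_neq0 g1'.
have Wgi i : W (g`_i / g`_1).
  by apply/vle1; rewrite vle_div // mul1r; apply: vle_trans g1; apply/vle1.
have [N hN] : exists N, forall i, (i < size g)%N -> O (p ^+ N * (g`_i / g`_1)).
  elim: (size g) => [|n [N hN]]; first by exists 0%N.
  have [m Om] := Wgi n; exists (maxn N m) => i; rewrite ltnS leq_eqVlt => /orP[/eqP->|ni].
    by apply: coarse_le Om; apply: leq_maxr.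
  by apply: coarse_le (hN i ni); apply: leq_maxl.
have hN' i : O (p ^+ N * (g`_i / g`_1)).
  have [/hN//|si] := ltnP i (size g).
  by rewrite nth_default // mul0r mulr0; apply: vring0.
pose M := N.+1; have pM : p ^+ M != 0 by rewrite expf_neq0.
pose h := \poly_(i < (size g).+2) (g`_i / g`_1 * p ^+ (M * i) / p ^+ M).
have hE i : h`_i = g`_i / g`_1 * p ^+ (M * i) / p ^+ M.
  by rewrite coef_poly; case: ltnP => // si; rewrite nth_default ?mul0r // ltnW // ltnW.
have h0 : vlt O h`_0 1.
  rewrite hE muln0 expr0 mulr1 vlt_div // mul1r.
  have : vlt W (g`_0 / g`_1) 1 by rewrite vlt_div // mul1r; apply: vlt_le_trans g1.
  by move=> /vlt_coarse/(_ M); rewrite mulr1.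
have h1 : h`_1 = 1 by rewrite hE muln1 divff // mul1r divff.
have h2 i : vlt O h`_i.+2 1.
  rewrite hE mulnC mulSn exprD [_ ^+ _ * _]mulrC mulrA mulfK //.
  have -> : (i.+1 * M = i * M + N + 1)%N by rewrite mulSn /M; lia.
  rewrite !exprD expr1 mulrA.
  apply: vltM1l p1 _; rewrite mulrCA; apply: vringM; first exact/vringX/vring_p.
  by rewrite mulrC; apply: hN'.
have Eh i : E h`_i.
  by rewrite hE; apply: (sf_div sfE); [apply: (sfM sfE); [apply: (sf_div sfE)|]|]; rewrite ?Eg //;
    apply: sfX.
have Oh i : O h`_i.
  by case: i => [|[|i]]; [apply: vlt_ring|rewrite h1; apply: vring1|apply: vlt_ring].
have [|y [Ey y1 /rootP hy]] := hens h Eh Oh h0; first by rewrite h1; apply: vle_refl.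
(* That y is small for [O] does not make it small for [W], but as h_1 = 1 dominates, the root is no
   larger than h_0, which is. *)
have yh0 : vle O y h`_0.
  have [//|h0y] := vltP O y h`_0; exfalso.
  have s1 : (1 < size h)%N.
    rewrite ltnNge; apply/negP => s1; move/eqP: h1.
    by rewrite nth_default // eq_sym oner_eq0.
  move: hy; rewrite horner_coef (bigD1 (Ordinal s1)) //= h1 mul1r expr1 => hy.
  have y0 := vlt_neq0 h0y.
  have [] := @vlt_dom _ O y (\sum_(i < size h | i != Ordinal s1) h`_i * y ^+ i); last first.
    by rewrite hy => /vlex0/eqP; rewrite (negPf y0).
  apply: vlt_sum => // -[[|[|i]] si] //=; first by rewrite mulr1.
  by move=> _; rewrite exprSr mulrA -[X in vlt O _ X]mul1r vltMr //; apply: vltM1 => //;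
    apply/vringX/vlt_ring.
have Wle a b : vle O a b -> vle W a b by move=> [q Oq ->]; exists q => //; apply: coarse_ring.
exists (p ^+ M * y); split.
- by apply: (sfM sfE) => //; apply: sfX.
- apply: (vle_lt_trans (y := p ^+ M * h`_0)).
    by apply: Wle; apply: vleM => //; apply: vle_refl.
  rewrite hE muln0 expr0 mulr1 mulrC divfK // vlt_div // mul1r.
  exact: vlt_le_trans g1.
apply/rootP; transitivity (g`_1 * p ^+ M * h.[y]); last by rewrite hy mulr0.
rewrite horner_poly mulr_sumr horner_coef !big_ord_recr /=.
rewrite [g`_(size g)]nth_default // [g`_(size g).+1]nth_default // !mul0r !mulr0 !addr0.
apply: eq_bigr => i _; by rewrite exprMn exprM; field; rewrite pM g1n0.
Qed.

End Coarsening.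

Section UltrapowerValuation.
Variables (U : free_ultrafilter) (V : fieldType) (O : valring V).
Notation X := (ultrapower U V).
Notation ucls := (ucls U).
Notation uO := (internal (U := U) (fun=> (O : V -> Prop))).

Lemma uvring1 : uO 1.
Proof. by rewrite -(rmorph1 (ucls (F := V))); apply/internalE/ae_all => i; apply: vring1. Qed.

Lemma uvringB x y : uO x -> uO y -> uO (x - y).
Proof.
rewrite -[x](urepK (U := U)) -[y](urepK (U := U)) -(rmorphB (ucls (F := V))).
by move=> /internalE Ox /internalE Oy; apply/internalE; apply: ae_imp2 Ox Oy => i; apply: vringB.
Qed.

Lemma uvringM x y : uO x -> uO y -> uO (x * y).
Proof.
rewrite -[x](urepK (U := U)) -[y](urepK (U := U)) -(rmorphM (ucls (F := V))).
by move=> /internalE Ox /internalE Oy; apply/internalE; apply: ae_imp2 Ox Oy => i; apply: vringM.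
Qed.

Lemma uvring_total x : uO x \/ uO x^-1.
Proof.
have [Ox|nOx] := pselect (uO x); [by left|right].
move: nOx; rewrite -[x](urepK (U := U)) uclsV => nO.
apply/internalE; move: nO; rewrite internalE => /ae_not; apply: ae_imp => i.
by case: (vring_total O (urep x i)).
Qed.

Definition uvalring : valring X := Valring uvring1 uvringB uvringM uvring_total.

Lemma uvring_ucls f : uvalring (ucls f) <-> ae U (fun i => O (f i)).
Proof. exact: (@internalE U V (fun=> (O : V -> Prop)) f). Qed.

Lemma vle_ucls f g : vle uvalring (ucls f) (ucls g) <-> ae U (fun i => vle O (f i) (g i)).
Proof.
split=> [[q]|h].
  rewrite -[q](urepK (U := U)) -(rmorphM (ucls (F := V))) => /uvring_ucls Oq /ucls_eq.
  by apply: ae_imp2 Oq => i Oq e; exists (urep q i).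
have /choice[q qP] i : exists q, vle O (f i) (g i) -> O q /\ f i = q * g i.
  by have [[q Oq e]|n] := pselect (vle O (f i) (g i)); [exists q|exists 0].
exists (ucls q); first by apply/uvring_ucls; apply: ae_imp h => i /qP[].
rewrite -(rmorphM (ucls (F := V))); apply/ucls_eq; apply: ae_imp h => i /qP[_ ->].
by rewrite !fctE.
Qed.

Lemma vlt_ucls f g : vlt uvalring (ucls f) (ucls g) <-> ae U (fun i => vlt O (f i) (g i)).
Proof. by rewrite /vlt vle_ucls ae_not. Qed.

Lemma internal_subfield (A : nat -> set V) : (forall i, subfield (A i)) ->
  subfield (internal (U := U) A).
Proof.
move=> sfA; split.
- by rewrite -(rmorph1 (ucls (F := V))); apply/internalE/ae_all => i; apply: sf1 (sfA i).
- move=> x y; rewrite -[x](urepK (U := U)) -[y](urepK (U := U)) -(rmorphB (ucls (F := V))).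
  move=> /internalE Ox /internalE Oy; apply/internalE; apply: ae_imp2 Ox Oy => i; exact: sfB.
- move=> x y; rewrite -[x](urepK (U := U)) -[y](urepK (U := U)) -(rmorphM (ucls (F := V))).
  move=> /internalE Ox /internalE Oy; apply/internalE; apply: ae_imp2 Ox Oy => i; exact: sfM.
- move=> x; rewrite -[x](urepK (U := U)) uclsV => /internalE Ox; apply/internalE.
  by apply: ae_imp Ox => i; apply: sfV.
Qed.

End UltrapowerValuation.

Definition henselian_upto (X : fieldType) (W : valring X) d (E : X -> Prop) : Prop :=
  forall g : {poly X}, (size g <= d)%N ->
  (forall i, E g`_i) -> (forall i, W g`_i) -> vlt W g`_0 1 -> vle W 1 g`_1 ->
  exists y, [/\ E y, vlt W y 1 & root g y].

(** The degree of a polynomial over the ultraproduct is fixed and exceeded by almost all i, so the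
    restricted Hensel property of the factors becomes a full one. *)
Lemma internal_henselian (U : free_ultrafilter) (V : fieldType) (O : valring V)
    (A : nat -> set V) : (forall i, subfield (A i)) -> (forall i, henselian_upto O i (A i)) ->
  henselian_in (uvalring U O) (internal (U := U) A).
Proof.
move=> sfA hA g Ag Og g0 g1.
(* The two extra coefficients make sure that the constant and the linear one are among those
   considered. *)
pose c i j := urep g`_j i; pose n := (size g).+2.
pose gi i := \poly_(j < n) c i j.
have gc j : g`_j = ucls U (c^~ j) by rewrite urepK.
have szc i : (size (gi i) <= n)%N by apply: size_poly.
have good : ae U (fun i => forall j : 'I_n, A i (c i j) /\ O (c i j)).
  apply: ae_ord => j; apply: ae_and; first exact: Ag.
  exact: Og.
have good0 : ae U (fun i => vlt O (c i 0%N) 1).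
  by move: g0; rewrite gc -(rmorph1 (ucls U (F := V))) => /vlt_ucls.
have good1 : ae U (fun i => vle O 1 (c i 1%N)).
  by move: g1; rewrite gc -(rmorph1 (ucls U (F := V))) => /vle_ucls.
have /choice[y yP] i : exists y, (n <= i)%N /\ (forall j : 'I_n, A i (c i j) /\ O (c i j)) /\
    vlt O (c i 0%N) 1 /\ vle O 1 (c i 1%N) -> [/\ A i y, vlt O y 1 & root (gi i) y].
  have [[ni [cA [c0 c1]]]|n0] := pselect ((n <= i)%N /\ (forall j : 'I_n, A i (c i j) /\ O (c i j)) /\
    vlt O (c i 0%N) 1 /\ vle O 1 (c i 1%N)); last by exists 0.
  have [||||| y h] := hA i (gi i); first exact: leq_trans ni.
  - by move=> j; rewrite coef_poly; case: ltnP => [jn|_]; [have [] :=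
    cA (Ordinal jn)|apply: sf0 (sfA i)].
  - by move=> j; rewrite coef_poly; case: ltnP => [jn|_]; [have [] := cA (Ordinal jn)|apply: vring0].
  - by rewrite coef_poly.
  - by rewrite coef_poly.
  by exists y.
have yae : ae U (fun i => [/\ A i (y i), vlt O (y i) 1 & root (gi i) (y i)]).
  by apply: ae_imp (ae_and (ae_ge U n) (ae_and good (ae_and good0 good1))) => i; apply: yP.
exists (ucls U y); split.
- by apply/internalE; apply: ae_imp yae => i [].
- by rewrite -(rmorph1 (ucls U (F := V))) vlt_ucls; apply: ae_imp yae => i [].
apply/rootP; transitivity (\sum_(j < n) ucls U (c^~ (j : nat)) * ucls U y ^+ j).
  rewrite horner_coef !big_ord_recr /= -!gc [g`_(size g)]nth_default // [g`_(size g).+1]nth_default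
    // !mul0r !addr0.
  by apply: eq_bigr => j _; rewrite -gc.
rewrite (ucls_horner U (fun i (j : 'I_n) => c i j)); apply/ucls_eq0.
by apply: ae_imp yae => i [_ _ /rootP]; rewrite horner_poly.
Qed.

(** * Elementary equivalence of a field and an ultraproduct in which it is dense *)

Section UltraEquivalence.
Variables (U : free_ultrafilter) (V : fieldType) (O : valring V) (p : nat).
Hypothesis char0 : forall n, n.+1%:R != 0 :> V.
Hypotheses (p_prime : prime p) (p1 : vlt O p%:R 1).
Notation X := (ultrapower U V).
Notation uO := (uvalring U O).

Let p0 : p%:R != 0 :> V.
Proof. by rewrite -(prednK (prime_gt0 p_prime)). Qed.

Lemma natr_ucls n : n%:R = ucls U (fun=> n%:R : V).
Proof. by rewrite -[LHS](rmorph_nat (diag U (F := V))). Qed.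

Lemma up0 : p%:R != 0 :> X.
Proof. by rewrite -(rmorph_nat (diag U (F := V))) fmorph_eq0. Qed.

Lemma up1 : vlt uO p%:R 1.
Proof. by rewrite natr_ucls -(rmorph1 (ucls U (F := V))) vlt_ucls; apply: ae_all. Qed.

Notation W := (coarsening up1).

Lemma vunit_coprime n : coprime p n -> (0 < n)%N -> vle O 1 n%:R.
Proof.
move=> pn n0; have [u v e _] := egcdnP p n0.
move: e; rewrite gcdnC (eqP pn) => e.
have h : vle O 1 (u%:R * n%:R).
  rewrite -natrM e natrD addrC; apply: (vlt_dom _).1; rewrite natrM.
  by apply: vltM1l p1 _; apply: vring_nat.
by apply: vle_trans h _; apply: vleM1l; [apply: vle_refl|apply: vring_nat].
Qed.

Lemma vle_natr n : exists k, vle O (p%:R ^+ k) n.+1%:R.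
Proof.
exists (logn p n.+1).
have e : n.+1 = (p ^ logn p n.+1 * (n.+1)`_p^')%N by rewrite -p_part partnC.
rewrite {2}e natrM natrX -{1}[_ ^+ _]mulr1; apply: vleM; first exact: vle_refl.
apply: vunit_coprime; last exact: part_gt0.
by rewrite prime_coprime // -p'natE // part_pnat.
Qed.

Lemma coarse_nat n : vle W 1 n.+1%:R.
Proof.
have [k h] := vle_natr n; apply/vle_coarse; first exact: up0.
exists k; rewrite mulr1 natr_ucls -(rmorphXn (ucls U (F := V))) natr_ucls.
by apply/vle_ucls/ae_all => i; rewrite exprfctE.
Qed.

Lemma apx_vring x y : apx W x y -> uO x -> uO y.
Proof.
case=> [/(vlt_coarseW up0) h Ox|[-> ->]//].
by rewrite -[y](subKr x); apply: vringB => //; apply/vle1; apply: vle_trans (vltW h) _; apply/vle1.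
Qed.

Lemma apxP x y : apx W x y <->
  forall n, (x <> 0 -> vlt uO (x - y) (p%:R ^+ n * x)) /\ (x = 0 -> y = 0).
Proof.
split=> [h n|h]; last first.
  have [x0|x0] := pselect (x = 0); first by right; have [_ ->] := h 0%N.
  by left; apply/vlt_coarse; [exact: up0|move=> n; have [/(_ x0)] := h n].
split=> [/eqP x0|x0]; last by have := apx_neq0 h; rewrite x0 eqxx => /esym/eqP.
case: h => [/(vlt_coarse up0)//|[e]]; by rewrite e eqxx in x0.
Qed.

(** For the coarsening, |x - y| < |x| means |x - y| < |p^n x| for all n, a countable list of
    internal conditions; the index k codes the number of the term and the exponent n. *)
Lemma internal_saturated (A : nat -> set V) : saturated_for W (internal (U := U) A).
Proof.
move=> T e1 e2 a fin.
pose dec k : nat * nat := odflt (0, 0)%N (unpickle k).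
have decP j n : exists k, dec k = (j, n) by exists (pickle (j, n)); rewrite /dec pickleK.
pose al j := urep (teval (env_cons a e1) (T j)).
pose be b i j := teval (env_cons b (fun k => urep (e2 k) i)) (T j).
pose S k i b := A i b /\
  (al (dec k).1 i <> 0 ->
     vlt O (al (dec k).1 i - be b i (dec k).1) (p%:R ^+ (dec k).2 * al (dec k).1 i)) /\
  (al (dec k).1 i = 0 -> be b i (dec k).1 = 0).
have beE b j : teval (env_cons (ucls U b) e2) (T j) = ucls U (fun i => be (b i) i j).
  rewrite (_ : env_cons _ _ = (fun k => ucls U (env_cons b (fun k => urep (e2 k)) k))).
    rewrite teval_ucls; congr ucls; apply/funext => i; rewrite /be; congr teval.
    by apply/funext => -[].
  by apply/funext => -[|k] //=; rewrite urepK.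
have SP k b : internal (S k) (ucls U b) <-> internal A (ucls U b) /\
    ((teval (env_cons a e1) (T (dec k).1) <> 0 ->
      vlt uO (teval (env_cons a e1) (T (dec k).1) - teval (env_cons (ucls U b) e2) (T (dec k).1))
        (p%:R ^+ (dec k).2 * teval (env_cons a e1) (T (dec k).1))) /\
     (teval (env_cons a e1) (T (dec k).1) = 0 -> teval (env_cons (ucls U b) e2) (T (dec k).1) = 0)).
  rewrite !internalE beE -[teval (env_cons a e1) _](urepK (U := U)) -/(al _).
  rewrite -(rmorphB (ucls U (F := V))) natr_ucls -(rmorphXn (ucls U (F := V))).
  rewrite -(rmorphM (ucls U (F := V))) vlt_ucls !ucls_eq0.
  have [z|/ae_not z] := pselect (ae U (fun i => al (dec k).1 i = 0)).
    split=> [h|[hA [_ h]]].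
      split; first by apply: ae_imp h => i [].
      by split=> // _; apply: ae_imp2 z h => i zi [_ [_]]; apply.
    by apply: ae_imp (ae_and hA (ae_and z (h z))) => i [Ai [zi bi]]; split=> //; split=> // _.
  split=> [h|[hA [h _]]].
    split; first by apply: ae_imp h => i [].
    split=> [_|/(ae_and z)/ae_ex[i []]//].
    by apply: ae_imp2 z h => i zi [_ [+ _]]; rewrite exprfctE; apply.
  have {}h : ae U _ := h (fun z' => let: ex_intro i (conj n y) := ae_ex (ae_and z z') in n y).
  apply: ae_imp (ae_and hA (ae_and z h)) => i [Ai [zi bi]]; split=> //; split=> [_|/zi//].
  by move: bi; rewrite !fctE.
have [k|b bS] := @saturation U V S.
  have [b Ab bP] := fin (\max_(j < k.+1) (dec j).1).
  exists b => j jk; rewrite -[b](urepK (U := U)) SP urepK; split=> //.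
  have /apxP h := bP (dec j).1 (leq_bigmax (Ordinal (jk : (j < k.+1)%N))).
  exact: h.
have Ab : internal A b by have := bS 0%N; rewrite -[b](urepK (U := U)) SP => -[].
exists b => // j; apply/apxP => n; have [k dk] := decP j n.
by have := bS k; rewrite -[b](urepK (U := U)) SP dk urepK => -[].
Qed.

(* Ax-Kochen-Ershov in the form needed here: L is dense in every M i, and the M i approximate
   henselian fields better and better. *)
Theorem dense_equivalence (L : set V) (M : nat -> set V) (phi : formula Lval) :
  subfield L -> (forall i, subfield (M i)) ->
  henselian_in O L -> (forall i, henselian_upto O i (M i)) ->
  (forall i x, L x -> M i x) ->
  (forall i x, M i x -> exists2 c, L c & vle O (x - c) (p%:R ^+ i * x)) ->
  rsat O L (fun=> 0) phi -> exists i, rsat O (M i) (fun=> 0) phi.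
Proof.
move=> sfL sfM hL hM LM ML Lphi.
suff: ae U (fun i => rsat O (M i) (fun=> 0) phi) by move/ae_ex.
have e0 : (fun k : nat => ucls U (fun=> 0 : V)) = (fun=> 0).
  by apply/funext => k; rewrite -[RHS](rmorph0 (diag U (F := V))).
apply/(@los U V O M phi (fun _ _ => 0)); rewrite e0.
have: rsat (internal (U := U) (fun=> (O : V -> Prop))) (internal (U := U) (fun=> L)) (fun=> 0) phi.
  by rewrite -e0; apply/(@los U V O (fun=> L) phi (fun _ _ => 0))/ae_all.
have sfL' := internal_subfield U (fun=> sfL); have sfM' := internal_subfield U sfM.
have hL' : henselian_in (uvalring U O) (internal (U := U) (fun=> L)).
  by apply: internal_henselian => // i g _; apply: hL.
have hM' := @internal_henselian U V O M sfM hM.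
apply: (iffLR (@back_and_forth X W coarse_nat (internal (U := U) (fun=> (O : V -> Prop)))
  (internal (U := U) (fun=> L)) (internal (U := U) M) (fun=> 0) (fun=> 0) phi
  sfL' sfM' _ _ _ _ _ _ _ _ _ _)).
- exact: (coarse_henselian up0 sfL' (sf_nat sfL' p) hL').
- exact: (coarse_henselian up0 sfM' (sf_nat sfM' p) hM').
- move=> x; rewrite -[x](urepK (U := U)) => /internalE Lx; exists (ucls U (urep x)).
    by apply/internalE; apply: ae_imp Lx => i; apply: LM.
  exact: apx_refl.
- exact: internal_saturated.
(* The precision p^i improves with i, so in the ultraproduct x and its approximation from L have the
   same leading term for the coarsening. *)
- move=> x; rewrite -[x](urepK (U := U)) => /internalE Mx.
  have /choice[c cP] i : exists c, M i (urep x i) -> L c /\ vle O (urep x i - c) (p%:R ^+ i * urep x i).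
    have [Mi|] := pselect (M i (urep x i)); last by exists 0.
    by have [c Lc xc] := ML i _ Mi; exists c.
  exists (ucls U c); first by apply/internalE; apply: ae_imp Mx => i /cP[].
  apply/apxP => n; rewrite -(rmorphB (ucls U (F := V))) natr_ucls -(rmorphXn (ucls U (F := V))).
  rewrite -(rmorphM (ucls U (F := V))) vlt_ucls !ucls_eq0; split.
    move=> /ae_not x0; apply: ae_imp2 (ae_and Mx x0) (ae_ge U n.+1) => i [/cP[_ ci] /eqP xi0] ni.
    rewrite !fctE; apply: vle_lt_trans ci _; rewrite vltMr // -(subnKC ni) exprD.
    rewrite exprS; apply: vltM1; last by apply/vringX/vring_nat.
    by rewrite -[X in vlt O _ X]mul1r vltMr // expf_neq0.
  move=> x0; apply: ae_imp2 Mx x0 => i /cP[_ ci] xi0.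
  by move: ci; rewrite xi0 mulr0 sub0r => /vlex0/eqP; rewrite oppr_eq0 => /eqP.
- exact: internal_saturated.
- exact: apx_vring.
- by move=> i; apply: sf0.
- by move=> i; apply: sf0.
- by move=> t; apply: apx_refl.
Qed.

End UltraEquivalence.

(** * Subfields, norms and q-th powers *)

Section Adjunction.
Variables (V : fieldType).
Implicit Types (E : set V) (c x : V).

Lemma sfld_unit E x : E x -> x != 0 -> x \is a GRing.unit.
Proof. by rewrite unitfE. Qed.

Definition sfld E (sfE : subfield E) : subfld V :=
  Subfld (sf1 sfE) (sfB sfE) (sfM sfE) (sfV sfE) (@sfld_unit E).

Lemma sfld_valP E (sfE : subfield E) (x : sbf_type (sfld sfE)) : E (val x).
Proof. exact: (sbf_valP x). Qed.

Definition poly_in E (g : {poly V}) : Prop := forall i, E g`_i.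

Lemma poly_in_lift E (sfE : subfield E) g : poly_in E g ->
  exists g' : {poly sbf_type (sfld sfE)}, map_poly val g' = g.
Proof.
move=> Eg; exists (\poly_(i < size g) sbf_mk (Eg i : sfld sfE g`_i)).
apply/polyP => i; rewrite coef_map coef_poly; case: ltnP => si /=; first by [].
by rewrite nth_default.
Qed.

Lemma poly_in_map E (sfE : subfield E) (g : {poly sbf_type (sfld sfE)}) : poly_in E (map_poly val g).
Proof. by move=> i; rewrite coef_map; apply: sfld_valP. Qed.

Lemma poly_inB E : subfield E -> forall g h, poly_in E g -> poly_in E h -> poly_in E (g - h).
Proof. by move=> sfE g h Eg Eh i; rewrite coefB; apply: (sfB sfE). Qed.

Lemma poly_inM E : subfield E -> forall g h, poly_in E g -> poly_in E h -> poly_in E (g * h).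
Proof. by move=> sfE g h Eg Eh i; rewrite coefM; apply: sf_sum => // j _; apply: (sfM sfE). Qed.

Lemma poly_inC E : subfield E -> forall x, E x -> poly_in E x%:P.
Proof. by move=> sfE x Ex i; rewrite coefC; case: ifP => // _; apply: sf0. Qed.

Lemma poly_inXn E : subfield E -> forall n, poly_in E 'X^n.
Proof. by move=> sfE n i; rewrite coefXn; apply: sf_nat. Qed.

Lemma poly_inX E : subfield E -> poly_in E 'X.
Proof. by move=> sfE; apply: (poly_inXn sfE 1). Qed.

Definition adjoin E c : set V := [set x | exists2 g, poly_in E g & x = g.[c]].

Definition degree_le E n c : Prop :=
  exists g, [/\ poly_in E g, g != 0, (size g <= n.+1)%N & root g c].

Definition algebraic_over E c : Prop := exists n, degree_le E n c.

Lemma binomial_degree E n r x : subfield E -> (0 < n)%N -> E x -> r ^+ n = x -> degree_le E n r.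
Proof.
move=> sfE n0 Ex rE; exists ('X^n - x%:P); split.
- by apply: poly_inB => //; [exact: poly_inXn|exact: poly_inC].
- by rewrite -size_poly_gt0 size_XnsubC.
- by rewrite size_XnsubC.
- by rewrite rootE !hornerE rE subrr.
Qed.

Lemma adjoin_sub E c x : subfield E -> E x -> adjoin E c x.
Proof. by move=> sfE Ex; exists x%:P; rewrite ?hornerC //; apply: poly_inC. Qed.

Lemma adjoin_gen E c : subfield E -> adjoin E c c.
Proof. by move=> sfE; exists 'X; rewrite ?hornerX //; apply: poly_inX. Qed.

(** Remainders modulo a polynomial of degree at most n have n coefficients, so n + 1 of them form a
    matrix with a nonzero left kernel. *)
Lemma adjoin_dependent E n c (x : 'I_n.+1 -> V) : subfield E -> degree_le E n c ->
  (forall i, adjoin E c (x i)) ->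
  exists a : 'I_n.+1 -> V, [/\ forall i, E (a i), exists i, a i != 0 & \sum_i a i * x i = 0].
Proof.
move=> sfE [g [Eg g0 sg gc]] Ax.
have /choice[h hx] i : exists g, poly_in E g /\ x i = g.[c].
  by have [g1 Eg1 e] := Ax i; exists g1.
have [g' defg] := poly_in_lift sfE Eg.
have /choice[h' defh] i : exists h', map_poly (val : sbf_type (sfld sfE) -> V) h' = h i.
  by apply: poly_in_lift; have [] := hx i.
have g'0 : g' != 0 by apply: contraNneq g0 => e; rewrite -defg e rmorph0.
have sg' : (size g').-1 = (size g).-1 by rewrite -defg size_map_poly.
pose A := \matrix_(i < n.+1) (poly_rV (h' i %% g') : 'rV_n).
have : kermx A != 0.
  rewrite kermx_eq0 /row_free neq_ltn; apply/orP; left.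
  by apply: leq_ltn_trans (rank_leq_col A) _.
case/rowV0Pn => u /sub_kermxP uA u0.
exists (fun i => val (u 0 i)); split.
- by move=> i; apply: sfld_valP.
- have [i ui] : exists i, u 0 i != 0.
    apply: contrapT => /forallNP nu; case/negP: u0; apply/eqP/rowP => i.
    by rewrite mxE; have /negP := nu i; rewrite negbK => /eqP.
  exists i; apply: contra ui => /eqP e; exact/eqP/val_inj.
have small i : (size (h' i %% g')%R <= n)%N.
  rewrite -ltnS; apply: leq_trans sg; rewrite -defg size_map_poly.
  by rewrite ltn_modp.
have sum0 : \sum_i (u 0 i) *: (h' i %% g') = 0.
  have : poly_rV (\sum_i (u 0 i) *: (h' i %% g')) = 0 :> 'rV_n.
    rewrite -uA; apply/rowP => j; rewrite !mxE coef_sum; apply: eq_bigr => i _.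
    by rewrite coefZ !mxE.
  move/(congr1 rVpoly); rewrite linear0 poly_rV_K // (leq_trans (size_sum _ _ _)) //.
  by apply/bigmax_leqP => i _; apply: leq_trans (size_scale_leq _ _) _.
have gc' : (map_poly val g').[c] = 0 by rewrite defg; apply/rootP.
transitivity (map_poly val (\sum_i (u 0 i) *: (h' i %% g'))).[c]; last first.
  by rewrite sum0 rmorph0 horner0.
rewrite rmorph_sum horner_sum; apply: eq_bigr => i _.
have [_ ->] := hx i; rewrite -defh -mul_polyC rmorphM /= map_polyC hornerM hornerC.
congr (_ * _); rewrite {1}(divp_eq (h' i) g').
by rewrite rmorphD rmorphM hornerD hornerM /= gc' mulr0 add0r.
Qed.

Lemma adjoin_subring E c : subfield E -> forall x y, adjoin E c x -> adjoin E c y ->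
  adjoin E c (x - y) /\ adjoin E c (x * y).
Proof.
move=> sfE x y [g Eg ->] [h Eh ->]; split.
  by exists (g - h); rewrite ?hornerE //; apply: poly_inB.
by exists (g * h); rewrite ?hornerE //; apply: poly_inM.
Qed.

(** The powers of x are dependent; once the relation is freed of factors X its constant coefficient
    is nonzero, and it yields the inverse of x. *)
Lemma adjoin_subfield E c : subfield E -> algebraic_over E c -> subfield (adjoin E c).
Proof.
move=> sfE [n dc]; have sr := @adjoin_subring E c sfE.
have A1 : adjoin E c 1 by apply: adjoin_sub => //; apply: sf1 sfE.
have AX x i : adjoin E c x -> adjoin E c (x ^+ i).
  by move=> Ax; elim: i => [|i IH]; rewrite ?expr0 // exprS; apply: (sr _ _ Ax IH).2.
split=> // [x y /sr h /h []//|x y /sr h /h []//|x Ax].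
have [->|x0] := eqVneq x 0; first by rewrite invr0 -(subrr 1); apply: (sr _ _ A1 A1).1.
have [a [Ea [i0 ai0] sum0]] := adjoin_dependent sfE dc (fun i : 'I_n.+1 => AX x i Ax).
pose P := \poly_(i < n.+1) (if insub i is Some j then a j else 0).
have P_in : poly_in E P.
  move=> i; rewrite coef_poly; case: ifP => _; last exact: sf0.
  by case: insub => [j|]; [apply: Ea|apply: sf0].
have Px : P.[x] = 0.
  by rewrite horner_poly; apply: etrans sum0; apply: eq_bigr => i _; rewrite valK.
have P0 : P != 0.
  by apply: contra ai0 => /eqP/polyP/(_ i0); rewrite coef_poly ltn_ord valK coef0 => ->.
have [m [Q [Q0 defP]]] : exists m Q, ~~ root Q 0 /\ P = Q * 'X^m.
  have [m [Q Qr defP]] := multiplicity_XsubC P 0; exists m, Q.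
  by rewrite P0 in Qr; rewrite subr0 in defP.
have QE : poly_in E Q.
  by move=> i; have := P_in (i + m)%N; rewrite defP coefMXn ltnNge leq_addl /= addnK.
have Qx : Q.[x] = 0.
  by move/eqP: Px; rewrite defP hornerM hornerXn mulf_eq0 expf_eq0 (negPf x0) andbF orbF => /eqP.
pose q := \poly_(i < size Q) Q`_i.+1.
have defQ : Q = q * 'X + (Q`_0)%:P.
  apply/polyP => i; rewrite coefD coefMX coefC; case: i => [|i] /=; first by rewrite add0r.
  by rewrite addr0 coef_poly; case: ltnP => // h; rewrite nth_default // ltnW.
have Q00 : Q`_0 != 0 by rewrite -horner_coef0.
have xq : x * (- q.[x] / Q`_0) = 1.
  move/eqP: Qx; rewrite {1}defQ hornerD hornerMX hornerC addr_eq0 => /eqP e.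
  by rewrite mulrA mulrN mulrC [x * _]mulrC e opprK mulVf.
have -> : x^-1 = - q.[x] / Q`_0 by apply: (mulfI x0); rewrite xq mulfV.
have AE y : E y -> adjoin E c y by apply: adjoin_sub.
have Aq : adjoin E c q.[x].
  rewrite horner_poly; elim/big_ind: _ => // [|y z Ay Az|i _].
  - by apply: AE; apply: sf0.
  - rewrite -[z]opprK; apply: (sr _ _ Ay _).1.
    by rewrite -sub0r; apply: (sr _ _ _ Az).1; apply: AE; apply: sf0.
  - by apply: (sr _ _ _ _).2; [apply: AE|apply: AX].
apply: (sr _ _ _ _).2; last by apply: AE; apply: (sfV sfE).
by rewrite -sub0r; apply: (sr _ _ _ Aq).1; apply: AE; apply: sf0.
Qed.

(** Stands in for transfinite towers: to close off under algebraic steps while keeping Q, it is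
    enough to check one simple extension of a field that has Q. *)
Lemma maximal_subfield (Q : V -> Prop) E0 : subfield E0 -> (forall x, E0 x -> Q x) ->
  exists E, [/\ subfield E, forall x, E0 x -> E x, forall x, E x -> Q x &
    forall c, algebraic_over E c -> (forall x, adjoin E c x -> Q x) -> E c].
Proof.
move=> sf0 Q0; have [|F [A0 FA0] FP Ftot|E [E0E [sfE QE] maxE]] :=
  @zorn_above V (fun E => subfield E /\ forall x, E x -> Q x) E0; first by [].
  split; last by move=> x [A /FP[_]]; apply.
  have common z t : (\bigcup_(A in F) A) z -> (\bigcup_(A in F) A) t ->
      exists A, [/\ F A, A z & A t].
    move=> [A FA Az] [B FB Bt]; have [AB|BA] := Ftot A B FA FB.
      by exists B; split=> //; apply: AB.
    by exists A; split=> //; apply: BA.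
  split=> [|x y Ax Ay|x y Ax Ay|x [A FA Ax]].
  - by exists A0 => //; apply: sf1 (FP _ FA0).1.
  - by have [A [FA Az At]] := common x y Ax Ay; exists A => //; apply: sfB (FP _ FA).1 _ _ Az At.
  - by have [A [FA Az At]] := common x y Ax Ay; exists A => //; apply: sfM (FP _ FA).1 _ _ Az At.
  - by exists A => //; apply: sfV (FP _ FA).1 _ Ax.
exists E; split=> // c algc Qc.
apply: (maxE (adjoin E c)); last exact: adjoin_gen.
  by move=> x; apply: adjoin_sub.
by split=> //; apply: adjoin_subfield.
Qed.

End Adjunction.

Section PowerFactors.
Variables (k : fieldType) (q : nat).
Hypothesis q_prime : prime q.

Lemma coprime_pow (x D : k) d : coprime d q -> (0 < d)%N -> D ^+ q = x ^+ d ->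
  exists t, t ^+ q = x.
Proof.
move=> dq d0 Dx; have [->|x0] := eqVneq x 0.
  by exists 0; rewrite expr0n eqn0Ngt prime_gt0.
have [u v e _] := egcdnP q d0; move: e; rewrite (eqP dq) => e.
exists (D ^+ u / x ^+ v).
rewrite expr_div_n -exprM mulnC exprM Dx -!exprM mulnC e exprD expr1.
by rewrite mulrC mulKf // expf_neq0.
Qed.

Lemma char_poly_ex n (A : {poly k}) : A \is monic -> size A = n.+1 ->
  exists C : 'M[k]_n, char_poly C = A.
Proof.
move=> monA sA; suff h m : m = (size A).-1 -> exists C : 'M[k]_m, char_poly C = A.
  by apply: h; rewrite sA.
by move=> ->; exists (companionmx A); apply: companionmxK.
Qed.

Lemma det_exp n (C : 'M[k]_n.+1) m : \det (C ^+ m) = \det C ^+ m.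
Proof. by elim: m => [|m IH]; rewrite ?expr0 ?det1 // !exprS det_mulmx IH. Qed.

Lemma horner_mx_binomial n (C : 'M[k]_n.+1) (x : k) m :
  horner_mx C ('X^m - x%:P) = C ^+ m - x%:M.
Proof. by rewrite rmorphB rmorphXn /= horner_mx_X horner_mx_C. Qed.

(** The companion matrix C of a factor of degree d satisfies C^q = x, so (det C)^q = x^d; and 0 < d
    < q makes d prime to q. *)
Lemma power_of_factor (A : {poly k}) x :
  A %| 'X^q - x%:P -> (1 < size A)%N -> (size A <= q)%N -> exists t, t ^+ q = x.
Proof.
move=> Adv sA1 sAq.
have A0 : A != 0 by rewrite -size_poly_gt0 ltnW.
have lA : lead_coef A != 0 by rewrite lead_coef_eq0.
pose B := (lead_coef A)^-1 *: A.
have monB : B \is monic by rewrite monicE lead_coefZ mulVf.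
have sB : size B = size A by rewrite size_scale ?invr_eq0.
have [d sd] : exists d, size A = d.+2 by exists (size A).-2; case: (size A) sA1 => [|[]].
have [C charC] := @char_poly_ex d.+1 B monB (etrans sB sd).
have CB : horner_mx C B = 0 by rewrite -charC; apply: Cayley_Hamilton.
have CqE : C ^+ q = x%:M.
  apply/eqP; rewrite -subr_eq0 -horner_mx_binomial.
  have : B %| 'X^q - x%:P by rewrite dvdpZl ?invr_eq0.
  by move=> /dvdpP[Q ->]; rewrite rmorphM /= CB mulr0.
apply: (@coprime_pow x (\det C) d.+1) => //; last by rewrite -det_exp CqE det_scalar.
by rewrite coprime_sym prime_coprime // gtnNdvd // -ltnS -sd.
Qed.

(** Since x is no q-th power, X^q - x has no proper factor, so it is the characteristic polynomial
    of C; its coefficient of degree q - 1 vanishes. *)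
Lemma trace_of_root n (C : 'M[k]_n.+1) (x : k) : q = n.+1 -> C ^+ q = x%:M ->
  (forall t, t ^+ q <> x) -> \tr C = 0.
Proof.
move=> qn Cq nx.
have mdv : mxminpoly C %| 'X^q - x%:P.
  by apply: mxminpoly_min; rewrite horner_mx_binomial Cq subrr.
have q0 := prime_gt0 q_prime.
have p0 : 'X^q - x%:P != 0 by rewrite -size_poly_gt0 size_XnsubC.
have sq : size (mxminpoly C) = q.+1.
  apply/eqP; rewrite eqn_leq; have := dvdp_leq p0 mdv; rewrite size_XnsubC // => -> /=.
  rewrite ltnNge; apply/negP => small.
  have [|t /nx//] := power_of_factor mdv _ small.
  by rewrite size_mxminpoly ltnS mxminpoly_nonconstant.
have eqm : mxminpoly C = 'X^q - x%:P.
  apply/eqP; rewrite -eqp_monic ?mxminpoly_monic ?monicXnsubC ?prime_gt0 //.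
  by rewrite -dvdp_size_eqp // sq size_XnsubC ?prime_gt0.
have eqc : char_poly C = 'X^q - x%:P.
  rewrite -eqm; apply/eqP; rewrite eq_sym -eqp_monic ?mxminpoly_monic ?char_poly_monic //.
  by rewrite -dvdp_size_eqp ?mxminpoly_dvd_char // sq size_char_poly qn.
apply: oppr_inj; rewrite -char_poly_trace // eqc oppr0 coefB coefXn coefC.
have q2 := prime_gt1 q_prime; rewrite qn in q2 *.
by rewrite /= ltn_eqF // eqn0Ngt -ltnS q2 subr0.
Qed.

Hypothesis q_char : q%:R != 0 :> k.

(** Kummer theory without roots of unity, by traces: a q-th root of e in k[X] / (X^q - g),
    multiplied by a suitable power of X, has nonzero trace, and by [trace_of_root] its q-th power is
    then a q-th power in k. *)
Lemma kummer (g e : k) (S : {poly k}) : (forall t, t ^+ q <> g) ->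
  'X^q - g%:P %| S ^+ q - e%:P -> exists j z, e = g ^+ j * z ^+ q.
Proof.
move=> ng dv; have q0 := prime_gt0 q_prime.
have g0 : g != 0 by apply/eqP => g0; apply: (ng 0); rewrite g0 expr0n eqn0Ngt q0.
set p := 'X^q - g%:P in dv.
have monp : p \is monic by rewrite monicXnsubC.
have sp : size p = q.+1 by rewrite size_XnsubC.
wlog sS : S dv / (size S <= q)%N.
  move=> /(_ (S %% p)); apply; last by rewrite -ltnS -sp ltn_modp monic_neq0.
  move: dv; rewrite {1}(divp_eq S p); set Q := S %/ p; set R := S %% p => dv.
  rewrite -(dvdp_addr _ (_ : p %| (Q * p + R) ^+ q - R ^+ q)).
    by rewrite addrA subrK.
  by rewrite subrXX dvdp_mulr // addrK dvdp_mull.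
have [n qn] : exists n, q = n.+1 by exists q.-1; rewrite prednK.
have [C charC] := @char_poly_ex n.+1 p monp (etrans sp (congr1 succn qn)).
have Cq : C ^+ q = g%:M.
  apply/eqP; rewrite -subr_eq0 -horner_mx_binomial -/p -charC.
  by rewrite Cayley_Hamilton.
have trC m : ~~ (q %| m)%N -> \tr (C ^+ m) = 0.
  move=> qm; apply: (@trace_of_root n _ (g ^+ m) qn).
    by rewrite -exprM mulnC exprM Cq -rmorphXn.
  move=> t tg; have [||t' /ng//] := @coprime_pow g t m _ _ tg.
    by rewrite coprime_sym prime_coprime.
  by rewrite lt0n; apply: contraNneq qm => ->; rewrite dvdn0.
have [S0|S0] := eqVneq S 0.
  exists 0%N, 0; move: dv; rewrite S0 !expr0n eqn0Ngt q0 /= mulr0 sub0r dvdpNr => dv.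
  apply/eqP/negPn/negP => e0; have := dvdp_leq _ dv; rewrite polyC_eq0 => /(_ e0).
  by rewrite sp size_polyC e0 ltnS leqn0 eqn0Ngt q0.
have sS0 : (0 < size S)%N by rewrite size_poly_gt0.
pose i := (size S).-1; have iq : (i < q)%N by rewrite (leq_trans _ sS) // ltn_predL.
have Si : S`_i != 0 by rewrite -lead_coefE lead_coef_eq0.
(* The shift by q - i, where i is the degree of S, moves the leading term to C^q = g and the others
   to exponents strictly between 0 and q, whose traces vanish. *)
pose N := horner_mx C S * C ^+ (q - i).
have CS : horner_mx C S ^+ q = e%:M.
  apply/eqP; rewrite -subr_eq0 -[e%:M](horner_mx_C C) -rmorphXn -rmorphB /=.
  by case/dvdpP: dv => Q ->; rewrite rmorphM /= -charC Cayley_Hamilton mulr0.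
have Nq : N ^+ q = (e * g ^+ (q - i))%:M.
  rewrite exprMn_comm; last by apply: commrX; rewrite -[in X in GRing.comm _ X](horner_mx_X C);
    apply: comm_horner_mx2.
  by rewrite CS -exprM mulnC exprM Cq -rmorphXn -rmorphM.
have trN : \tr N = S`_i * g * q%:R.
  have -> : N = \sum_(j < size S) S`_j *: C ^+ (j + (q - i)).
    rewrite /N -{1}(coefK S) poly_def rmorph_sum mulr_suml; apply: eq_bigr => j _.
    by rewrite /= -mul_polyC rmorphM /= horner_mx_C rmorphXn /= horner_mx_X -mulrA -exprD -mulmxE
      mul_scalar_mx.
  have isz : (i < size S)%N by rewrite ltn_predL.
  rewrite raddf_sum (bigD1 (Ordinal isz)) //= big1 => [|j ji].
    by rewrite addr0 mxtraceZ subnKC ?(ltnW iq) // Cq mxtrace_scalar -(mulr_natr g) mulrA qn.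
  rewrite mxtraceZ trC ?mulr0 //.
  have {}ji : (j < i)%N by rewrite ltn_neqAle -ltnS prednK // ltn_ord andbT;
    apply: contraNneq ji => ji; apply/eqP/val_inj.
  rewrite gtnNdvd ?addn_gt0 ?subn_gt0 ?iq ?orbT //.
  by move: ji iq; lia.
have [z zE] : exists z, z ^+ q = e * g ^+ (q - i).
  apply: contrapT => nz; have := trace_of_root qn Nq (fun t e => nz (ex_intro _ t e)).
  by rewrite trN => /eqP; rewrite !mulf_eq0 (negPf Si) (negPf g0) (negPf q_char).
exists i, (z / g).
rewrite expr_div_n zE -[in g ^+ q](subnK (ltnW iq)) exprD; field.
by rewrite !expf_neq0.
Qed.

End PowerFactors.

Section FieldPowers.
Variables (V : fieldType) (q : nat).
Hypothesis q_prime : prime q.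

(** The root r has a relation of degree at most n < q over E, whose greatest common divisor with X^q
    - x is a proper factor. *)
Lemma power_descent (E : set V) n c r x : subfield E -> (n < q)%N -> degree_le E n c ->
  adjoin E c r -> E x -> r ^+ q = x -> exists2 t, E t & t ^+ q = x.
Proof.
move=> sfE nq dc Ar Ex rx; have q0 := prime_gt0 q_prime.
have sfA : subfield (adjoin E c) by apply: adjoin_subfield => //; exists n.
have [a [Ea [i0 ai0] sum0]] := adjoin_dependent sfE dc (fun i : 'I_n.+1 => sfX sfA i Ar).
pose P := \poly_(i < n.+1) (if insub i is Some j then a j else 0).
have P_in : poly_in E P.
  move=> i; rewrite coef_poly; case: ifP => _; last exact: sf0.
  by case: insub => [j|]; [apply: Ea|apply: sf0].
have Pr : P.[r] = 0.
  by rewrite horner_poly; apply: etrans sum0; apply: eq_bigr => i _; rewrite valK.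
have [P' defP] := poly_in_lift sfE P_in.
pose x' := sbf_mk (Ex : sfld sfE x).
have P'0 : P' != 0.
  apply: contra ai0 => /eqP e; move/polyP/(_ i0): defP.
  by rewrite e rmorph0 coef0 coef_poly ltn_ord valK => <-.
have m0 : 'X^q - x'%:P != 0 by rewrite -size_poly_gt0 size_XnsubC.
pose A := gcdp P' ('X^q - x'%:P).
have rA : root (map_poly val A) r.
  rewrite gcdp_map root_gcd defP; apply/andP; split; first exact/rootP.
  by rewrite rmorphB /= map_polyXn map_polyC rootE !hornerE /= rx subrr.
have A0 : A != 0 by rewrite gcdp_eq0 negb_and P'0.
have sA1 : (1 < size A)%N.
  rewrite ltnNge; apply/negP => s1; move: rA A0; rewrite (size1_polyC s1) map_polyC rootC.
  by rewrite polyC_eq0 => /eqP e /eqP; apply; apply: val_inj.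
have sAq : (size A <= q)%N.
  apply: leq_trans (dvdp_leq P'0 (dvdp_gcdl _ _)) _.
  have <- : size (map_poly val P') = size P' by apply: size_map_poly.
  by apply: leq_trans nq; rewrite defP size_poly.
have [t' tx] := power_of_factor q_prime (dvdp_gcdr _ _ : A %| _) sA1 sAq.
by exists (val t'); [apply: sfld_valP|rewrite -rmorphXn tx].
Qed.

End FieldPowers.

(** * Places that obstruct l-th roots *)

Record subring (V : comNzRingType) (S : V -> Prop) : Prop := Subring {
  sr1 : S 1;
  srB : forall x y, S x -> S y -> S (x - y);
  srM : forall x y, S x -> S y -> S (x * y)
}.

Section SubringTheory.
Variables (V : comNzRingType) (S : V -> Prop).
Hypothesis srS : subring S.

Lemma sr0 : S 0.
Proof. by rewrite -(subrr 1); apply: (srB srS); apply: sr1 srS. Qed.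

Lemma srN x : S x -> S (- x).
Proof. by rewrite -sub0r; apply: (srB srS); apply: sr0. Qed.

Lemma srD x y : S x -> S y -> S (x + y).
Proof. by move=> Sx /srN Sy; rewrite -[y]opprK; apply: (srB srS). Qed.

Lemma srX x n : S x -> S (x ^+ n).
Proof.
by move=> Sx; elim: n => [|n IH]; rewrite ?expr0 ?exprS; [apply: sr1|apply: (srM srS)].
Qed.

Lemma sr_sum (I : Type) (r : seq I) (P : pred I) (F : I -> V) :
  (forall i, P i -> S (F i)) -> S (\sum_(i <- r | P i) F i).
Proof. by move=> h; elim/big_ind: _ => // [|x y]; [apply: sr0|apply: srD]. Qed.

Lemma sr_prod (I : Type) (r : seq I) (P : pred I) (F : I -> V) :
  (forall i, P i -> S (F i)) -> S (\prod_(i <- r | P i) F i).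
Proof. by move=> h; elim/big_ind: _ => // [|x y]; [apply: sr1|apply: (srM srS)]. Qed.

Lemma sr_polyM (g h : {poly V}) : (forall i, S g`_i) -> (forall i, S h`_i) ->
  forall i, S (g * h)`_i.
Proof. by move=> Sg Sh i; rewrite coefM; apply: sr_sum => j _; apply: (srM srS). Qed.

Lemma sr_polyC x : S x -> forall i, S (x%:P)`_i.
Proof. by move=> Sx i; rewrite coefC; case: ifP => // _; apply: sr0. Qed.

Lemma sr_polyXn n i : S ('X^n)`_i.
Proof. by rewrite coefXn; case: eqP => _; [apply: sr1|apply: sr0]. Qed.

End SubringTheory.

Lemma sr_adjoin (V : fieldType) (S : set V) x : subring S -> subring (adjoin S x).
Proof.
move=> srS; split.
- by exists 1; rewrite ?hornerC //; apply: sr_polyC => //; apply: sr1.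
- move=> _ _ [g Sg ->] [h Sh ->]; exists (g - h); last by rewrite hornerD hornerN.
  by move=> i; rewrite coefB; apply: (srB srS).
- move=> _ _ [g Sg ->] [h Sh ->]; exists (g * h); last by rewrite hornerM.
  exact: sr_polyM.
Qed.

(** * Chevalley's extension theorem for places *)

Section Chevalley.
Variables (V : fieldType) (S : set V) (a : V).
Hypotheses (srS : subring S) (Sa : S a) (Sa' : ~ S a^-1).
Hypothesis maxS : forall T, S `<=` T -> subring T -> ~ T a^-1 -> T `<=` S.

Let a0 : a != 0.
Proof. by apply/eqP => e; apply: Sa'; rewrite e invr0; apply: sr0. Qed.

Lemma chevalley_adjoin u : ~ S u -> adjoin S u a^-1.
Proof.
move=> nSu; apply: contrapT => na; apply: nSu; apply: (maxS (T := adjoin S u)) => //.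
- by move=> x Sx; exists x%:P; rewrite ?hornerC //; apply: sr_polyC.
- exact: sr_adjoin.
- by exists 'X; rewrite ?hornerX //; apply: (@sr_polyXn _ _ srS 1).
Qed.

(** The element a lies in the radical of S. Otherwise 1/a is a polynomial in 1/w for w = 1 - a c;
    multiplied by a power of w it falls into S, and that power is itself 1 - a d with d in S, so 1/a
    is in S. *)
Lemma chevalley_unit c : S c -> S (1 - a * c)^-1.
Proof.
move=> Sc; set w := 1 - a * c; have [->|w0] := eqVneq w 0; first by rewrite invr0; apply: sr0.
apply: contrapT => /chevalley_adjoin[P SP aP]; apply: Sa'.
have Sw : S w by apply: (srB srS); [apply: sr1|apply: (srM srS)].
have h1 : S (a^-1 * w ^+ size P).
  rewrite aP horner_coef mulr_suml; apply: (sr_sum srS) => i _.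
  rewrite -mulrA; apply: (srM srS); first exact: SP.
  rewrite -[in w ^+ size P](subnK (ltnW (ltn_ord i))) exprD mulrCA exprVn mulVf ?expf_neq0 // mulr1.
  exact: srX.
have [d Sd wd] : exists2 d, S d & w ^+ size P = 1 - a * d.
  elim: (size P) => [|n [d Sd IH]]; first by exists 0; [apply: sr0|rewrite mulr0 subr0].
  exists (c + d - a * (c * d)); last by rewrite exprS IH /w; ring.
  by apply: (srB srS); [apply: srD|apply: (srM srS) => //; apply: (srM srS)].
have -> : a^-1 = a^-1 * w ^+ size P + d by rewrite wd; field.
exact: srD.
Qed.

Let K (y : V) n := `[< exists P : {poly V}, [/\ (forall i, S P`_i),
  (size P <= n.+1)%N & 1 = a * P.[y]] >].

(** The relation for 1/x, whose constant part 1 - a Q_0 is a unit of S, serves to eliminate the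
    leading term of the relation for x. Two relations of least degree thus contradict each other. *)
Lemma chevalley_descent x n m : x != 0 -> (0 < m <= n.+1)%N -> K x n.+1 -> K x^-1 m -> K x n.
Proof.
move=> x0 /andP[m0 mn] /asboolP[P [SP sP Px]] /asboolP[Q [SQ sQ Qx]]; apply/asboolP.
pose w := 1 - a * Q`_0; have Sw := chevalley_unit (SQ 0%N); rewrite -/w in Sw.
have defw : w = a * \sum_(j < m) Q`_j.+1 * x ^- j.+1.
  rewrite /w {1}Qx (horner_coef_wide _ sQ) big_ord_recl expr0 mulr1 mulrDr addrAC subrr add0r.
  by congr (a * _); apply: eq_bigr => j _; rewrite exprVn.
have w0 : w != 0.
  apply/eqP => e; apply: Sa'; have -> : a^-1 = Q`_0; last exact: SQ.
  by apply: (mulfI a0); rewrite mulfV //; apply/eqP; rewrite -subr_eq0 -/w e.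
pose r j := P`_n.+1 * a * (w^-1 * Q`_j.+1).
exists (take_poly n.+1 P + \sum_(j < m) (r j)%:P * 'X^(n - j)); split.
- move=> i; rewrite coefD coef_take_poly; apply: (srD srS).
    by case: ifP => // _; apply: sr0.
  rewrite coef_sum; apply: (sr_sum srS) => j _; rewrite coefCM; apply: (srM srS).
    by do ?[apply: (srM srS)].
  exact: sr_polyXn.
- apply: leq_trans (size_polyD _ _) _; rewrite geq_max size_take_poly /=.
  apply: leq_trans (size_sum _ _ _) _; apply/bigmax_leqP => j _.
  rewrite mul_polyC; apply: leq_trans (size_scale_leq _ _) _.
  by rewrite size_polyXn ltnS leq_subr.
rewrite {1}Px; congr (a * _).
rewrite (horner_coef_wide _ sP) big_ord_recr /= hornerD; congr (_ + _).
  rewrite (horner_coef_wide _ (size_take_poly _ _)); apply: eq_bigr => i _.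
  by rewrite coef_take_poly ltn_ord.
rewrite horner_sum; transitivity (P`_n.+1 * w^-1 * (w * x ^+ n.+1)).
  by field.
rewrite [in X in _ * X]defw -[X in _ * X]mulrA mulr_suml !mulr_sumr; apply: eq_bigr => j _.
rewrite !hornerE /r.
have -> : x ^+ n.+1 = x ^+ (n - j) * x ^+ j.+1 by rewrite -exprD; congr (_ ^+ _);
  move: (ltn_ord j); lia.
move: (x ^+ j.+1) (expf_neq0 j.+1 x0) (x ^+ (n - j)) => X X0 Y /=.
by field; rewrite w0 X0.
Qed.

Lemma chevalley_total x : S x \/ S x^-1.
Proof.
apply: contrapT => /not_orP[nSx nSx'].
have x0 : x != 0 by apply/eqP => e; apply: nSx; rewrite e; apply: sr0.
have exK y : ~ S y -> exists n, K y n.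
  move=> /chevalley_adjoin[P SP aP]; exists (size P); apply/asboolP; exists P.
  by split=> //; rewrite -aP mulfV.
have K0 y : ~~ K y 0.
  apply/asboolP => -[P [SP sP Py]]; apply: Sa'; have -> : a^-1 = P`_0; last exact: SP.
  move: Py; rewrite (size1_polyC sP) hornerC => Py.
  by apply: (mulfI a0); rewrite mulfV // Py coefC.
have [n Kn minn] := ex_minnP (exK _ nSx); have [m Km minm] := ex_minnP (exK _ nSx').
have n0 : (0 < n)%N by rewrite lt0n; apply: contraTneq Kn => ->.
have m0 : (0 < m)%N by rewrite lt0n; apply: contraTneq Km => ->.
have [mn|nm] := leqP m n.
  have := @chevalley_descent x n.-1 m x0; rewrite prednK // m0 mn => /(_ isT Kn Km)/minn.
  by rewrite -ltnS prednK // ltnn.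
have := @chevalley_descent x^-1 m.-1 n; rewrite invr_eq0 invrK prednK // n0 (ltnW nm) =>
  /(_ x0 isT Km Kn)/minm.
by rewrite -ltnS prednK // ltnn.
Qed.

End Chevalley.

Theorem chevalley (V : fieldType) (R : set V) (a : V) : subring R -> R a -> ~ R a^-1 ->
  exists2 O : valring V, (forall x, R x -> O x) & vlt O a 1.
Proof.
move=> srR Ra Ra'.
have [|F [A0 FA0] FP Ftot|S [RS [srS Sa'] maxS]] :=
  @zorn_above V (fun S => subring S /\ ~ S a^-1) R; first by [].
  split; last by move=> [A /FP[_]].
  have common z t : (\bigcup_(A in F) A) z -> (\bigcup_(A in F) A) t ->
      exists A, [/\ F A, A z & A t].
    move=> [A FA Az] [B FB Bt]; have [AB|BA] := Ftot A B FA FB.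
      by exists B; split=> //; apply: AB.
    by exists A; split=> //; apply: BA.
  split=> [|x y Ax Ay|x y Ax Ay].
  - by exists A0 => //; apply: sr1 (FP _ FA0).1.
  - by have [A [FA Az At]] := common x y Ax Ay; exists A => //; apply: srB (FP _ FA).1 _ _ Az At.
  - by have [A [FA Az At]] := common x y Ax Ay; exists A => //; apply: srM (FP _ FA).1 _ _ Az At.
have tot := chevalley_total srS (RS _ Ra) Sa' (fun T ST srT nT => maxS T ST (conj srT nT)).
exists (Valring (sr1 srS) (srB srS) (srM srS) tot); first exact: RS.
move=> [b Sb e]; apply: Sa'.
have a0 : a != 0 by apply: contraTneq (oner_neq0 V) => a0; rewrite e a0 mulr0 eqxx.
have -> // : a^-1 = b by apply: (mulIf a0); rewrite mulVf.
Qed.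

(** * Values of sums, and extensions without ramification *)

Section Dominance.
Variables (V : fieldType) (O : valring V).
Hypothesis O_nat : forall n, vle O 1 n.+1%:R.

Definition veq x y : Prop := vle O x y /\ vle O y x.

Lemma veq_sym x y : veq x y -> veq y x. Proof. by case. Qed.

Lemma veq_refl x : veq x x. Proof. by split; apply: vle_refl. Qed.

Lemma veq_trans y x z : veq x y -> veq y z -> veq x z.
Proof. by move=> [a b] [c d]; split; [apply: vle_trans c|apply: vle_trans b]. Qed.

Lemma veqM x y x' y' : veq x y -> veq x' y' -> veq (x * x') (y * y').
Proof. by move=> [a b] [c d]; split; apply: vleM. Qed.

Lemma veqX n x y : veq x y -> veq (x ^+ n) (y ^+ n).
Proof. by move=> [a b]; split; apply: vleX. Qed.

Lemma veq_neq0 x y : veq x y -> (x == 0) = (y == 0).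
Proof.
move=> [xy yx]; apply/eqP/eqP => e; first by move: yx; rewrite e => /vlex0.
by move: xy; rewrite e => /vlex0.
Qed.

Lemma veqMr z x y : z != 0 -> veq (x * z) (y * z) -> veq x y.
Proof. by move=> z0 [] /(vleMr O _ _ z0) a /(vleMr O _ _ z0). Qed.

Lemma veq_add x y : vlt O y x -> veq x (x + y).
Proof. by move/vlt_dom. Qed.

Lemma vle_max n (t : 'I_n.+1 -> V) : exists i, forall j, vle O (t j) (t i).
Proof.
suff [i hi] : exists i, forall j, j \in enum 'I_n.+1 -> vle O (t j) (t i).
  by exists i => j; apply: hi; rewrite mem_enum.
elim: (enum _) => [|k s [i hi]]; first by exists ord0.
have [ki|ik] := vle_total O (t k) (t i).
  by exists i => j; rewrite inE => /orP[/eqP->|/hi].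
exists k => j; rewrite inE => /orP[/eqP->|/hi ji]; first exact: vle_refl.
exact: vle_trans ik.
Qed.

(** When all nonzero terms have different values, the largest one determines the value of the
    sum. *)
Lemma dominant_term n (t : 'I_n -> V) (i0 : 'I_n) : t i0 != 0 ->
  (forall i j, i != j -> t i != 0 -> t j != 0 -> ~ veq (t i) (t j)) ->
  exists i, [/\ t i != 0, forall j, j != i -> vlt O (t j) (t i) & veq (t i) (\sum_j t j)].
Proof.
move=> t0 sep.
case: n t i0 t0 sep => [t []//|n] t i0 t0 sep.
have [i tmax] := vle_max t.
have ti : t i != 0 by apply: contraNneq t0 => e; have := tmax i0; rewrite e => /vlex0 ->.
have ltj j : j != i -> vlt O (t j) (t i).
  move=> ji; have [->|tj] := eqVneq (t j) 0; first exact/vlt0.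
  by move=> ij; apply: (sep j i ji tj ti).
exists i; split=> //; rewrite (bigD1 i) //=; apply: veq_add.
by apply: vlt_sum.
Qed.

Section Ramified.
Variables (l : nat) (E : set V) (f : V).
Hypotheses (l_prime : prime l) (sfE : subfield E) (Ef : E f) (f0 : f != 0).
Hypothesis ram : forall x, E x -> ~ veq (x ^+ l) f.

(** As d is invertible modulo l, an x^d with value in that of E would give E an element of value
    v(f) / l. So 1, x, ..., x^(l - 1) have values in different cosets of the value group of E. *)
Lemma ramified_sep x a b d : veq (x ^+ l) f -> E a -> E b -> a != 0 -> b != 0 ->
  (0 < d < l)%N -> ~ veq a (b * x ^+ d).
Proof.
move=> xf Ea Eb a0 b0 /andP[d0 dl] ab.
have x0 : x != 0.
  by apply: contraNneq f0 => x0; rewrite -(veq_neq0 xf) x0 expr0n eqn0Ngt prime_gt0.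
have [u v e _] := egcdnP l d0.
have cdl : gcdn d l = 1%N by apply/eqP;
  rewrite -[_ == _]/(coprime d l) coprime_sym prime_coprime // gtnNdvd.
rewrite cdl in e.
have xd : veq ((a / b) ^+ u) (f ^+ v * x).
  have h : veq (a / b) (x ^+ d).
    by apply: (veqMr b0); rewrite divfK // mulrC.
  apply: veq_trans (veqX u h) _; rewrite -exprM mulnC e exprD expr1 mulnC exprM.
  by apply: veqM (veqX v xf) (veq_refl _).
have fv0 : f ^+ v != 0 by rewrite expf_neq0.
apply: (ram (x := (a / b) ^+ u / f ^+ v)).
  by apply: (sf_div sfE); apply: (sfX sfE) => //; apply: (sf_div sfE).
apply: veq_trans xf; apply: veqX; apply: (veqMr fv0).
by rewrite divfK // [x * _]mulrC.
Qed.

Lemma ramified_terms x n (a : 'I_n -> V) : veq (x ^+ l) f -> (n <= l)%N -> (forall i, E (a i)) ->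
  forall i j, i != j -> a i * x ^+ i != 0 -> a j * x ^+ j != 0 -> ~ veq (a i * x ^+ i) (a j * x ^+ j).
Proof.
move=> xf nl Ea.
suff h (i j : 'I_n) : (i < j)%N -> a i * x ^+ i != 0 -> a j * x ^+ j != 0 ->
    ~ veq (a i * x ^+ i) (a j * x ^+ j).
  move=> i j; rewrite -val_eqE neq_ltn => /orP[] ij ti tj; first exact: h.
  by move=> /veq_sym; apply: h.
move=> ij; rewrite !mulf_eq0 !negb_or => /andP[ai xi] /andP[aj _].
rewrite -(subnK (ltnW ij)) exprD mulrA => /(veqMr xi); apply: ramified_sep => //.
by rewrite subn_gt0 ij /=; apply: leq_ltn_trans (leq_subr _ _) (leq_trans (ltn_ord j) nl).
Qed.

(** In degree n < l the powers 1, ..., x^n are dependent over E, yet their values lie in different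
    cosets. *)
Lemma ramified_small_step n c x : degree_le E n c -> (n < l)%N -> adjoin E c x -> ~ veq (x ^+ l) f.
Proof.
move=> dc nl Ax xf.
have sfA : subfield (adjoin E c) by apply: adjoin_subfield => //; exists n.
have [a [Ea [i0 ai0] sum0]] := adjoin_dependent sfE dc (fun i : 'I_n.+1 => sfX sfA i Ax).
have x0 : x != 0.
  by apply: contraNneq f0 => x0; rewrite -(veq_neq0 xf) x0 expr0n eqn0Ngt prime_gt0.
have [|i [ti _]] := @dominant_term _ (fun i : 'I_n.+1 => a i * x ^+ i) i0 _ (ramified_terms xf nl Ea).
  by rewrite mulf_neq0 // expf_neq0.
by rewrite sum0 => -[/vlex0/eqP]; rewrite (negPf ti).
Qed.

(* The l-th root of a unit does not ramify: if x had value v(f)/l, then the root would be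
   a_0 (1 + theta) with v(theta) not in v(E), although (1 + theta) ^+ l lies in E. *)
Lemma ramified_unit_step r w a x : E w -> E a -> a != 0 -> veq w 1 -> r ^+ l = w * a ^+ l ->
  adjoin E r x -> ~ veq (x ^+ l) f.
Proof.
move=> Ew Ea a0 w1 rw Ax xf; have l0 := prime_gt0 l_prime.
have x0 : x != 0.
  by apply: contraNneq f0 => x0; rewrite -(veq_neq0 xf) x0 expr0n eqn0Ngt prime_gt0.
have dr : degree_le E l r.
  by apply: binomial_degree rw => //; apply: (sfM sfE) => //; apply: (sfX sfE).
have sfA : subfield (adjoin E r) by apply: adjoin_subfield => //; exists l.
pose s := r / a; have sw : s ^+ l = w by rewrite expr_div_n rw mulfK // expf_neq0.
have As : adjoin E r s by apply: (sf_div sfA); [apply: adjoin_gen|apply: adjoin_sub].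
have Ax' n : adjoin E r (x ^+ n) by apply: (sfX sfA).
(* Among the l + 1 elements 1, x, ..., x^(l - 1), s there is a relation; it involves s, as the
   powers of x are independent. *)
have [|b [Eb [i0 bi0] sum0]] := adjoin_dependent sfE dr
  (x := fun i : 'I_l.+1 => if (i < l)%N then x ^+ i else s); first by move=> i; case: ifP.
have {}sum0 : \sum_(i < l) b (widen_ord (leqnSn l) i) * x ^+ i + b ord_max * s = 0.
  rewrite -[RHS]sum0 big_ord_recr /= ltnn; congr (_ + _).
  by apply: eq_bigr => i _; rewrite ltn_ord.
have s0 : s != 0.
  apply/negP => /eqP s0; have := veq_neq0 w1.
  by rewrite -sw s0 expr0n eqn0Ngt l0 eqxx oner_eq0.
have bl : b ord_max != 0.
  apply/negP => /eqP bl; rewrite bl mul0r addr0 in sum0.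
  have [i1 bi1] : exists i : 'I_l, b (widen_ord (leqnSn l) i) != 0.
    have [e|ne] := eqVneq i0 ord_max; first by move: bi0; rewrite e bl eqxx.
    have il : (i0 < l)%N by rewrite ltn_neqAle -ltnS ltn_ord andbT -val_eqE in ne *.
    by exists (Ordinal il); congr (b _ != 0): bi0; apply: val_inj.
  have [|i [ti _]] := @dominant_term _ (fun i : 'I_l => b (widen_ord (leqnSn l) i) * x ^+ i) i1 _
      (ramified_terms xf (leqnn l) (fun i => Eb _)).
    by rewrite mulf_neq0 // expf_neq0.
  by rewrite sum0 => -[/vlex0/eqP]; rewrite (negPf ti).
pose d (i : 'I_l) := - (b (widen_ord (leqnSn l) i) / b ord_max).
have Ed i : E (d i) by apply: (sfN sfE); apply: (sf_div sfE).
have sE : s = \sum_i d i * x ^+ i.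
  apply: (mulfI bl); move/eqP: sum0; rewrite addrC addr_eq0 => /eqP ->.
  rewrite mulr_sumr -sumrN; apply: eq_bigr => i _.
  by rewrite /d mulNr mulrN mulrA [b ord_max * _]mulrC divfK.
have s1 : veq s 1.
  have [h1 h2] : veq (s ^+ l) 1 by rewrite sw.
  split; [have [//|h] := vltP O s 1|have [//|h] := vltP O 1 s].
  - by move: (@vltX _ O l.-1 _ _ h); rewrite prednK // expr1n.
  - by move: (@vltX _ O l.-1 _ _ h); rewrite prednK // expr1n.
have [i1 ti1] : exists i, d i * x ^+ i != 0.
  apply: contrapT => /forallNP hd; case/eqP: s0; rewrite sE big1 // => i _.
  by apply/eqP; apply: contrapT => /negP/hd.
have dsep := ramified_terms xf (leqnn l) Ed.
have [i [ti ltt ts]] := dominant_term ti1 dsep.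
rewrite -sE in ts; have t1 := veq_trans ts s1.
have iE : i = Ordinal l0.
  apply: val_inj => /=; apply/eqP; rewrite -leqn0 leqNgt; apply/negP => i_gt0.
  have di0 : d i != 0 by apply: contraNneq ti => ->; rewrite mul0r.
  apply: (ramified_sep xf (sf1 sfE) (Ed i) (oner_neq0 V) di0 (d := i)); last exact: veq_sym.
  by rewrite i_gt0 ltn_ord.
rewrite {}iE {i} in ti ltt ts t1; rewrite expr0 mulr1 in ti ltt ts t1.
set d0 := d (Ordinal l0) in ti ltt ts t1.
pose u (j : 'I_l) := (if j == Ordinal l0 then 0 else d j / d0) * x ^+ j.
have [th thD] : exists th, th = s / d0 - 1 by exists (s / d0 - 1).
have thE : th = \sum_j u j.
  rewrite thD sE (bigD1 (Ordinal l0)) //= expr0 mulr1 mulrDl divff // addrC addKr.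
  rewrite [RHS](bigD1 (Ordinal l0)) //= /u eqxx mul0r add0r mulr_suml.
  by apply: eq_bigr => j /negPf ->; rewrite mulrAC.
have Eu j : E (if j == Ordinal l0 then 0 else d j / d0).
  by case: ifP => _; [apply: (sf0 sfE)|apply: (sf_div sfE); apply: Ed].
have [[j0 uj0]|/forallNP u0] := pselect (exists j, u j != 0); last first.
  have sd : s = d0.
    apply: (divIf ti); rewrite divff //; apply/eqP; rewrite -subr_eq0 -thD thE big1 // => j _.
    by apply/eqP; apply: contrapT => /negP/u0.
  have Er : E r by rewrite -(divfK a0 r) -/s sd; apply: (sfM sfE) => //; apply: Ed.
  case: Ax => g gE xg; apply: (ram (x := x)) => //; rewrite xg; exact: (sf_horner sfE).
have [j [uj _ ut]] := dominant_term uj0 (ramified_terms xf (leqnn l) Eu).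
rewrite -thE in ut.
have jn0 : j != Ordinal l0 by apply: contraNneq uj => ->; rewrite /u eqxx mul0r.
have uE : u j = d j / d0 * x ^+ j by rewrite /u (negPf jn0).
have u1 : vlt O (u j) 1 by rewrite uE mulrAC vlt_div // mul1r; apply: ltt.
have th1 : vlt O th 1 by apply: vle_lt_trans u1; case: ut.
have O1 : O (1 + th) by apply: vringD; [apply: vring1|apply: vlt_ring].
have sumu : veq l%:R (\sum_(k < l) (1 + th) ^+ k).
  have -> : \sum_(k < l) (1 + th) ^+ k = l%:R + \sum_(k < l) ((1 + th) ^+ k - 1).
    by rewrite sumrB sumr_const card_ord addrCA subrr addr0.
  apply: veq_add; apply: (@vlt_le_trans _ _ 1); last by rewrite -(prednK l0).
  apply: vlt_sum; first exact: oner_neq0.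
  move=> k _; rewrite subrX1 [1 + th]addrC addrK; apply: vltM1 => //.
  by apply: vring_sum => ? _; apply: vringX; rewrite addrC.
have l1 : veq l%:R 1 by split; [apply/vle1/vring_nat|rewrite -(prednK l0)].
(* (1 + theta)^l - 1 is theta times a sum that differs from the unit l by something small; so theta
   has the value of an element of E. *)
have wth : w / d0 ^+ l - 1 = th * \sum_(k < l) (1 + th) ^+ k.
  have -> : w / d0 ^+ l = (1 + th) ^+ l by rewrite thD addrC subrK expr_div_n sw.
  by rewrite subrX1 [1 + th - 1]addrC addKr.
have wu : veq (w / d0 ^+ l - 1) (u j).
  rewrite wth -[u j]mulr1; apply: veqM; first exact: veq_sym.
  by apply: veq_trans l1; apply: veq_sym.
have dj0 : d j / d0 != 0 by apply: contraNneq uj => e; rewrite uE e mul0r.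
rewrite uE in wu; apply: (ramified_sep xf _ _ _ dj0 _ wu).
- by apply: (sfB sfE); [apply: (sf_div sfE) => //; apply: (sfX sfE); apply: Ed|apply: sf1].
- by apply: (sf_div sfE); apply: Ed.
- by rewrite (veq_neq0 wu) -uE.
- by rewrite ltn_ord andbT lt0n; apply: contra jn0 => /eqP e; apply/eqP/val_inj.
Qed.

End Ramified.
End Dominance.

(** * q-th powers in the residue field *)

Section Residual.
Variables (V : fieldType) (O : valring V).

Lemma vlt_subM x y x' y' : O x -> O y' -> vlt O (x - y) 1 -> vlt O (x' - y') 1 ->
  vlt O (x * x' - y * y') 1.
Proof.
move=> Ox Oy' xy xy'; rewrite (_ : _ - _ = x * (x' - y') + (x - y) * y'); last by ring.
by apply: vltD; [apply: vltM1l|apply: vltM1].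
Qed.

Lemma vlt_subX n x y : O x -> O y -> vlt O (x - y) 1 -> vlt O (x ^+ n - y ^+ n) 1.
Proof.
move=> Ox Oy xy; elim: n => [|n IH]; first by rewrite !expr0 subrr; apply/vlt0/oner_neq0.
by rewrite !exprS; apply: vlt_subM => //; apply: vringX.
Qed.

Lemma vlt_prod (I : Type) (r : seq I) (f g : I -> V) : (forall i, O (f i)) -> (forall i, O (g i)) ->
  (forall i, vlt O (f i - g i) 1) -> vlt O (\prod_(i <- r) f i - \prod_(i <- r) g i) 1.
Proof.
move=> Of Og fg; elim: r => [|i r IH]; first by rewrite !big_nil subrr; apply/vlt0/oner_neq0.
by rewrite !big_cons; apply: vlt_subM => //; apply: vring_prod.
Qed.

Lemma vlt_det n (A B : 'M[V]_n) : (forall i j, O (A i j)) -> (forall i j, O (B i j)) ->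
  (forall i j, vlt O (A i j - B i j) 1) -> vlt O (\det A - \det B) 1.
Proof.
move=> OA OB AB; rewrite /determinant -sumrB; apply: vlt_sum; first exact: oner_neq0.
move=> s _; rewrite -mulrBr; apply: vltM1l; first exact: vlt_prod.
by apply: vringX; apply: vringN; apply: vring1.
Qed.

Variables (q : nat) (E : set V) (e : V).
Hypotheses (q_prime : prime q) (sfE : subfield E) (Ee : E e) (e1 : veq O e 1).
Hypothesis res : forall x, E x -> O x -> ~ vlt O (x ^+ q - e) 1.

Definition residually_monic x m : Prop := exists a : nat -> V,
  (forall i, E (a i) /\ O (a i)) /\ vlt O (x ^+ m + \sum_(i < m) a i * x ^+ i) 1.

Lemma residually_monic_ex x N (g : nat -> V) : O x -> (forall i, E (g i) /\ O (g i)) ->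
  vlt O (\sum_(i < N) g i * x ^+ i) 1 -> (exists2 i, (i < N)%N & vle O 1 (g i)) ->
  exists2 m, (m < N)%N & residually_monic x m.
Proof.
move=> Ox Eg; elim: N => [_ []//|N IH]; rewrite big_ord_recr /= => small [i iN gi].
have [gN|gN] := vltP O 1 (g N); last first.
  have [||m mN Pm] := IH; last by exists m => //; apply: ltnW.
  - rewrite -[X in vlt O X](addrK (g N * x ^+ N)); apply: vltB => //.
    by apply: vltM1 => //; apply: vringX.
  - exists i => //; rewrite ltn_neqAle -ltnS iN andbT; apply/eqP => iE.
    by apply: gN; rewrite -iE.
exists N => //; exists (fun i => g i / g N); split=> [j|].
  have [/vle1 Oj OgN] : vle O (g j) 1 /\ vle O 1 (g N) by split=> //; apply/vle1; case: (Eg j).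
  split; first by apply: (sf_div sfE); case: (Eg j); case: (Eg N).
  apply/vle1; have gN0 : g N != 0.
    by apply: contraPneq gN => -> /vlex0/eqP; rewrite oner_eq0.
  by rewrite vle_div // mul1r; apply: vle_trans OgN; apply/vle1.
have gN0 : g N != 0 by apply: contraPneq gN => -> /vlex0/eqP; rewrite oner_eq0.
suff -> : x ^+ N + \sum_(i < N) g i / g N * x ^+ i =
    (\sum_(i < N) g i * x ^+ i + g N * x ^+ N) / g N.
  by rewrite vlt_div // mul1r; apply: vlt_le_trans gN.
rewrite mulrDl mulrAC divff // mul1r addrC mulr_suml; congr (_ + _).
by apply: eq_bigr => j _; rewrite mulrAC.
Qed.

(* Norms descend a q-th root of the residue of e from E(c) to E: with C the companion matrix of a
   polynomial A of least degree d < q that kills the residue of x, C ^+ q is congruent to e, so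
   that (det C) ^+ q is congruent to e ^+ d. *)
Lemma residual_step n c x : degree_le E n c -> (n < q)%N -> adjoin E c x -> O x ->
  ~ vlt O (x ^+ q - e) 1.
Proof.
move=> dc nq Ax Ox xe.
have sfA : subfield (adjoin E c) by apply: adjoin_subfield => //; exists n.
have Oe : O e by apply/vle1; case: e1.
have e0 : e != 0 by rewrite (veq_neq0 e1) oner_neq0.
have [a [Ea [i0 ai0] sum0]] := adjoin_dependent sfE dc (fun i : 'I_n.+1 => sfX sfA i Ax).
have [i amax] := vle_max O a.
have ai : a i != 0 by apply: contraNneq ai0 => ai; have := amax i0; rewrite ai => /vlex0 ->.
have [j /ltnSE jn Pj] : exists2 m, (m < n.+1)%N & residually_monic x m.
  apply: (@residually_monic_ex x n.+1 (fun k => if insub k is Some k' then a k' / a i else 0)) => //.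
  - move=> k; case: insubP => [k' _ _|_]; last by split; [apply: (sf0 sfE)|apply: vring0].
    split; first exact: (sf_div sfE).
    by apply/vle1; rewrite vle_div // mul1r.
  - rewrite (eq_bigr (fun k : 'I_n.+1 => (a k * x ^+ k) / a i)); last first.
      by move=> k _; rewrite valK mulrAC.
    by rewrite -mulr_suml sum0 mul0r; apply/vlt0/oner_neq0.
  - by exists i => //; rewrite valK divff //; apply: vle_refl.
have exd : exists m, `[< residually_monic x m >] by exists j; apply/asboolP.
case: (ex_minnP exd) => d /asboolP[A [EA Asmall]] dmin {i amax ai}.
have dn : (d <= n)%N by apply: leq_trans jn; apply/dmin/asboolP.
(* Minimality of d: the residues of 1, ..., x^(d - 1) are linearly independent over the residue
   field of E. *)
have coef_small (g : nat -> V) : (forall i, E (g i) /\ O (g i)) ->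
    vlt O (\sum_(i < d) g i * x ^+ i) 1 -> forall i, (i < d)%N -> vlt O (g i) 1.
  move=> Eg gs i id gi; have [|m md /asboolP/dmin] := residually_monic_ex Ox Eg gs; first by exists i.
  by rewrite leqNgt md.
case: d => [|d] in A EA Asmall dmin dn coef_small *.
  by move: Asmall; rewrite big_ord0 addr0 expr0; apply; apply: vle_refl.
(* The rows describe multiplication by x on the powers of x, up to the maximal ideal. *)
pose C := \matrix_(i < d.+1, j < d.+1) (if i == ord_max then - A j else (j == i.+1 :> nat)%:R).
pose S := [set y | E y /\ O y].
have srS : subring S.
  split=> [|y z [Ey Oy] [Ez Oz]|y z [Ey Oy] [Ez Oz]].
  - by split; [apply: (sf1 sfE)|apply: vring1].
  - by split; [apply: (sfB sfE)|apply: vringB].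
  - by split; [apply: (sfM sfE)|apply: vringM].
have SC i k : S (C i k).
  rewrite mxE; case: ifP => _; first by apply: (srN srS); apply: EA.
  by case: eqP => _; [apply: (sr1 srS)|apply: (sr0 srS)].
have SCX m i k : S ((C ^+ m) i k).
  elim: m i k => [|m IH] i k.
    by rewrite expr0 mxE; case: eqP => _; [apply: (sr1 srS)|apply: (sr0 srS)].
  by rewrite exprS mxE; apply: (sr_sum srS) => h _; apply: (srM srS).
have Cx i : vlt O (\sum_k C i k * x ^+ k - x * x ^+ i) 1.
  rewrite -exprS; have [->|im] := eqVneq i ord_max.
    rewrite -vltN opprB; congr (vlt O _ 1): Asmall; congr (_ + _).
    by rewrite -sumrN; apply: eq_bigr => k _; rewrite mxE eqxx mulNr opprK.
  have id : (i.+1 < d.+1)%N by rewrite ltnS ltn_neqAle -ltnS ltn_ord andbT -val_eqE in im *.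
  rewrite (bigD1 (Ordinal id)) //= big1 => [|k ki]; last first.
    rewrite mxE (negPf im) (_ : _ == _ = false) ?mul0r //.
    by apply: contraNF ki => /eqP ki; apply/eqP/val_inj.
  by rewrite mxE (negPf im) eqxx mul1r addr0 subrr; apply/vlt0/oner_neq0.
have CXx m i : vlt O (\sum_k (C ^+ m) i k * x ^+ k - x ^+ m * x ^+ i) 1.
  elim: m i => [|m IH] i.
    rewrite expr0 (bigD1 i) //= big1 => [|k ki]; last by rewrite mxE eq_sym (negPf ki) mul0r.
    by rewrite mxE eqxx addr0 subrr; apply/vlt0/oner_neq0.
  have -> : \sum_k (C ^+ m.+1) i k * x ^+ k - x ^+ m.+1 * x ^+ i =
     \sum_k (C ^+ m) i k * (\sum_h C k h * x ^+ h - x * x ^+ k) +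
      x * (\sum_k (C ^+ m) i k * x ^+ k - x ^+ m * x ^+ i).
    rewrite mulrBr mulrA -exprS addrA; congr (_ - _).
    rewrite mulr_sumr -big_split /=.
    rewrite [RHS](eq_bigr (fun k => \sum_h (C ^+ m) i k * C k h * x ^+ h)); last first.
      move=> k _; rewrite mulrBr [X in _ + X]mulrCA subrK mulr_sumr.
      by apply: eq_bigr => h _; rewrite mulrA.
    rewrite exchange_big; apply: eq_bigr => h _ /=.
    by rewrite exprSr mxE mulr_suml.
  apply: vltD; last exact: vltM1l.
  by apply: vlt_sum => [|k _]; [apply: oner_neq0|apply: vltM1l => //; case: (SCX m i k)].
(* Applied to the powers of x, row i of C^q - e gives (x^q - e) x^i up to something small, hence
   something small; by independence its entries are small. *)
have Ce i k : vlt O ((C ^+ q) i k - (e%:M : 'M_d.+1) i k) 1.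
  pose g m := if insub m is Some m' then (C ^+ q) i m' - (e%:M : 'M_d.+1) i m' else 0.
  have gE (h : 'I_d.+1) : g h = (C ^+ q) i h - (e%:M : 'M_d.+1) i h by rewrite /g valK.
  rewrite -gE; apply: coef_small => //.
    move=> m; rewrite /g; case: insubP => [m' _ _|_]; last exact: (sr0 srS).
    apply: (srB srS) => //; rewrite mxE.
    by case: eqP => _; [split|apply: (sr0 srS)].
  rewrite (eq_bigr (fun h : 'I_d.+1 => (C ^+ q) i h * x ^+ h - (e%:M : 'M_d.+1) i h * x ^+ h));
    last first.
    by move=> h _; rewrite gE mulrBl.
  have eI : \sum_(h < d.+1) (e%:M : 'M_d.+1) i h * x ^+ h = e * x ^+ i.
    rewrite (bigD1 i) //= big1 => [|h hi]; last by rewrite mxE eq_sym (negPf hi) mul0r.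
    by rewrite mxE eqxx addr0.
  rewrite sumrB eI -(subrK (x ^+ q * x ^+ i) (\sum_k _)) -addrA -mulrBl.
  by apply: vltD => //; apply: vltM1 => //; apply: vringX.
have [ED OD] : S (\det C).
  rewrite /determinant; apply: (sr_sum srS) => s _; apply: (srM srS).
    by apply: (srX srS); apply: (srN srS); apply: (sr1 srS).
  exact: (sr_prod srS).
have De : vlt O ((\det C) ^+ q - e ^+ d.+1) 1.
  rewrite -det_exp -det_scalar; apply: vlt_det => // i k; first by case: (SCX q i k).
  by rewrite mxE; case: eqP => _; [|apply: vring0].
(* The degree d + 1 <= n < q is prime to q, and u (d + 1) = v q + 1 turns a residual root of e^(d +
   1) into one of e. *)
have [u v uv _] := egcdnP q (ltn0Sn d).
have gdq : gcdn d.+1 q = 1%N.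
  apply/eqP; rewrite -[_ == _]/(coprime d.+1 q) coprime_sym prime_coprime // gtnNdvd //.
  exact: leq_ltn_trans nq.
rewrite gdq in uv; have ev0 : e ^+ v != 0 by rewrite expf_neq0.
have [ev1 ev2] := veqX v e1; rewrite expr1n in ev1 ev2.
apply: (res (x := (\det C) ^+ u / e ^+ v)).
- by apply: (sf_div sfE); apply: (sfX sfE).
- apply/vle1; rewrite vle_div // mul1r; apply: vle_trans ev2; apply/vle1; exact: vringX.
have evq0 : e ^+ (v * q) != 0 by rewrite expf_neq0.
have -> : (\det C ^+ u / e ^+ v) ^+ q - e = ((\det C ^+ q) ^+ u - (e ^+ d.+1) ^+ u) / e ^+ (v * q).
  rewrite expr_div_n -!exprM [(q * u)%N]mulnC mulrBl; congr (_ - _).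
  by rewrite [(d.+1 * u)%N]mulnC uv addn1 exprS mulfK.
have [_ ev3] := veqX (v * q) e1; rewrite expr1n in ev3.
rewrite vlt_div // mul1r; apply: vlt_le_trans ev3; apply: vlt_subX => //; exact: vringX.
Qed.

End Residual.

(** * The place of k(eta) at an irreducible polynomial *)

Section ResiduePlace.
Variables (k V : fieldType) (iota : {rmorphism k -> V}) (eta : V) (p : {poly k}).
Notation ev g := ((map_poly iota g).[eta]).

Lemma irreducible_coprime (g : {poly k}) : irreducible_poly p -> ~~ (p %| g) ->
  exists u v, u * p + v * g = 1.
Proof.
move=> [sp irr] pg; have : coprimep p g.
  apply/contraT => ng; have /irr := ng; move/(_ (dvdp_gcdl p g)) => e.
  by rewrite -(eqp_dvdl _ e) dvdp_gcdr in pg.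
case/Bezout_eq1_coprimepP => -[u v] e.
by exists u, v.
Qed.

Lemma multiplicity_ex (g : {poly k}) : (1 < size p)%N -> g != 0 ->
  exists m g', g = p ^+ m * g' /\ ~~ (p %| g').
Proof.
move=> sp; have [n] := ubnP (size g); elim: n g => // n IH g /ltnSE sgn g0.
have [/dvdpP[h gE]|ng] := boolP (p %| g); last by exists 0%N, g; rewrite expr0 mul1r.
have h0 : h != 0 by apply: contraNneq g0 => h0; rewrite gE h0 mul0r.
have p0 : p != 0 by rewrite -size_poly_gt0 ltnW.
have [|m [g' [hE ng']]] := IH h _ h0.
  apply: leq_trans sgn; rewrite gE size_mul //; have := size_poly_gt0 h; rewrite h0.
  by case: (size h) (size p) sp => // a [|[|b]] // _ _; rewrite addSn /= !addnS !ltnS leq_addr.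
by exists m.+1, g'; split=> //; rewrite gE hE exprS mulrAC [_ * p]mulrC.
Qed.

Lemma irreducible_binomial q (g0 : k) : prime q -> (forall t, t ^+ q <> g0) ->
  irreducible_poly ('X^q - g0%:P).
Proof.
move=> q_prime ng; have q0 := prime_gt0 q_prime.
have s : size ('X^q - g0%:P : {poly k}) = q.+1 by rewrite size_XnsubC.
split=> [|A sA Ap]; first by rewrite s ltnS.
have nz : 'X^q - g0%:P != 0 :> {poly k} by rewrite -size_poly_gt0 s.
rewrite -dvdp_size_eqp // s eqn_leq -s dvdp_leq //= s ltnNge; apply/negP => sq.
have [] // := power_of_factor q_prime Ap _ sq.
rewrite ltn_neqAle eq_sym sA /= size_poly_gt0.
by apply: contraNneq nz => A0; rewrite A0 dvd0p in Ap.
Qed.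

Variable O : valring V.
Hypotheses (Ok : forall x, O (iota x)) (Oeta : O eta) (p_irr : irreducible_poly p)
  (p_small : vlt O (ev p) 1) (eta_transc : forall g : {poly k}, ev g = 0 -> g = 0).

Lemma evB g h : ev (g - h) = ev g - ev h. Proof. by rewrite rmorphB hornerD hornerN. Qed.
Lemma evM g h : ev (g * h) = ev g * ev h. Proof. by rewrite rmorphM hornerM. Qed.
Lemma evX g n : ev (g ^+ n) = ev g ^+ n. Proof. by rewrite rmorphXn horner_exp. Qed.
Lemma evC c : ev c%:P = iota c. Proof. by rewrite map_polyC hornerC. Qed.
Lemma ev1 : ev 1 = 1. Proof. by rewrite rmorph1 hornerC. Qed.

Lemma ev_ring g : O (ev g).
Proof.
rewrite horner_coef; apply: vring_sum => i _; apply: vringM; last exact: vringX.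
by rewrite coef_map; apply: Ok.
Qed.

Lemma ev_neq0 g : g != 0 -> ev g != 0.
Proof. by apply: contra => /eqP/eta_transc ->. Qed.

(** In u p + v g = 1 the first summand is small at eta, so the second cannot be. *)
Lemma ev_unit g : ~~ (p %| g) -> veq O (ev g) 1.
Proof.
move=> /(irreducible_coprime p_irr)[u [v e]]; split; first exact/vle1/ev_ring.
have := ev1; rewrite -e rmorphD hornerD !rmorphM !hornerM => e1.
have [//|g1] := vltP O 1 (ev g); case: (@vlt_irr _ O 1).
by rewrite -[X in vlt O X]e1; apply: vltD; apply: vltM1l => //; apply: ev_ring.
Qed.

Lemma ev_small g : vlt O (ev g) 1 -> p %| g.
Proof. by move=> g1; apply: contraT => /ev_unit[_]. Qed.

Lemma ev_order g : g != 0 -> exists m, veq O (ev g) (ev p ^+ m).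
Proof.
case: (p_irr) => sp _ g0; have [m [g' [-> ng']]] := multiplicity_ex sp g0.
exists m; rewrite evM evX -[X in veq O _ X]mulr1; apply: veqM; first exact: veq_refl.
exact: ev_unit.
Qed.

Definition fractions : set V := [set x | exists g h, h != 0 /\ x = ev g / ev h].

Lemma fractions_const c : fractions (iota c).
Proof. by exists c%:P, 1; rewrite oner_neq0 evC ev1 divr1. Qed.

Lemma fractions_gen : fractions eta.
Proof. by exists 'X, 1; rewrite oner_neq0 ev1 divr1 map_polyX hornerX. Qed.

Lemma fractions_subfield : subfield fractions.
Proof.
split.
- by exists 1, 1; rewrite oner_neq0 ev1 divr1.
- move=> _ _ [g [h [h0 ->]]] [g' [h' [h0' ->]]]; exists (g * h' - g' * h), (h * h').
  by rewrite mulf_neq0 // evB !evM -mulNr addf_div ?ev_neq0 // mulNr.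
- move=> _ _ [g [h [h0 ->]]] [g' [h' [h0' ->]]]; exists (g * g'), (h * h').
  by rewrite mulf_neq0 // !evM mulf_div.
- move=> _ [g [h [h0 ->]]]; rewrite invf_div; have [->|g0] := eqVneq g 0.
    by exists 0, 1; rewrite oner_neq0 rmorph0 horner0 invr0 mul0r mulr0.
  by exists h, g.
Qed.

Lemma power_lt n : (0 < n)%N -> vlt O (ev p ^+ n) 1.
Proof. by case: n => // n _; rewrite -(expr1n _ n.+1); apply: vltX. Qed.

Lemma power_order n m : veq O (ev p ^+ n) (ev p ^+ m) -> n = m.
Proof.
have p0 : ev p != 0 by apply/ev_neq0/irredp_neq0.
have h i j : (i < j)%N -> ~ veq O (ev p ^+ i) (ev p ^+ j).
  move=> ij; rewrite -(subnK (ltnW ij)) exprD -{1}[ev p ^+ i]mul1r => /(veqMr (expf_neq0 i p0))[+ _].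
  by apply: power_lt; rewrite subn_gt0.
have [/h//|/h ne e|//] := ltngtP n m; case: ne; exact: veq_sym.
Qed.

(** The values on k(eta) are the multiples of that of p(eta), and l does not divide 1. *)
Lemma fractions_unramified l x : (1 < l)%N -> fractions x -> ~ veq O (x ^+ l) (ev p).
Proof.
have p0 : ev p != 0 by apply/ev_neq0/irredp_neq0.
move=> l1 [g [h [h0 ->]]] e; have [g0|g0] := eqVneq g 0.
  have := veq_neq0 e; rewrite g0 rmorph0 horner0 mul0r expr0n (negPf p0).
  by case: (l) l1 => //= ? _; rewrite eqxx.
have [n gn] := ev_order g0; have [m hm] := ev_order h0.
have : veq O (ev p ^+ (n * l)) (ev p ^+ (m * l).+1).
  rewrite exprS !exprM; apply: veq_trans (veqX l (veq_sym gn)) _.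
  have hl : ev h ^+ l != 0 by rewrite expf_neq0 ?ev_neq0.
  rewrite -(divfK hl (ev g ^+ l)) -expr_div_n; apply: veqM => //; exact: veqX.
move/power_order => nm; have := dvdn_mull n (dvdnn l).
by rewrite nm -addn1 dvdn_addr ?dvdn_mull // dvdn1 => /eqP l1'; rewrite l1' in l1.
Qed.

(** An integral fraction can be written with a denominator prime to p, which is invertible modulo p.
    So x has the residue of a polynomial S, and the question becomes one in k[X] / (p). *)
Lemma fractions_residue q e x : (forall S, p %| S ^+ q - e%:P -> False) ->
  fractions x -> O x -> ~ vlt O (x ^+ q - iota e) 1.
Proof.
move=> noroot [g0 [h0 [h00 xE]]] Ox xe; have p0 : ev p != 0 by apply/ev_neq0/irredp_neq0.
have [g [h [hp {}xE]]] : exists g h, ~~ (p %| h) /\ x = ev g / ev h.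
  case: (p_irr) => sp _; have [m [h [hE hp]]] := multiplicity_ex sp h00.
  have [g00|g00] := eqVneq g0 0.
    by exists 0, h; rewrite xE g00 rmorph0 !horner0 !mul0r.
  have [n [g [gE gp]]] := multiplicity_ex sp g00.
  have eh0 : ev h != 0 by apply: ev_neq0; apply: contraNneq hp => ->; apply: dvdp0.
  have [mn|nm] := leqP m n.
    exists (p ^+ (n - m) * g), h; split=> //; rewrite xE gE hE -{1}(subnK mn) exprD !evM !evX.
    have : ev p ^+ m != 0 by rewrite expf_neq0.
    by move: (ev p ^+ m) (ev p ^+ (n - m)) => a b a0; field; rewrite a0 eh0.
  have [g1 g2] := ev_unit gp; have [h1 h2] := ev_unit hp.
  have xE' : x * (ev p ^+ (m - n) * ev h) = ev g.
    have pn : ev p ^+ n != 0 by rewrite expf_neq0.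
    apply: (mulIf pn); transitivity (x * ev h0).
      by rewrite hE evM evX -{2}(subnK (ltnW nm)) exprD; ring.
    by rewrite xE divfK ?ev_neq0 // gE evM evX mulrC.
  suff /(_ g2) : vlt O (ev g) 1 by []; rewrite -xE'; apply: vltM1l => //; apply: vltM1;
    last exact: ev_ring.
  by apply: power_lt; rewrite subn_gt0.
have [u [v uv]] := irreducible_coprime p_irr hp.
have eh0 : ev h != 0 by apply: ev_neq0; apply: contraNneq hp => ->; apply: dvdp0.
apply: (noroot (v * g)); apply: ev_small; rewrite evB evX evC -[X in X - _](subrK (x ^+ q)) -addrA.
apply: vltD => //; apply: vlt_subX; [exact: ev_ring|by []|].
have -> : ev (v * g) - x = - (ev (u * p) * x).
  have <- : 1 - ev (v * h) = ev (u * p) by rewrite -ev1 -uv -evB addrK.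
  by rewrite !evM xE; field.
by apply/vltN; apply: vltM1 => //; rewrite evM; apply: vltM1l => //; apply: ev_ring.
Qed.

End ResiduePlace.

(** p is a simple irreducible factor of 1 + h X^q: X - t when t^q = -1/h, with k itself as residue
    field, and X^q + 1/h otherwise, when [kummer] tells which constants become q-th powers. *)
Lemma place_polynomial (k : fieldType) q (h : k) : prime q -> odd q -> q%:R != 0 :> k -> h != 0 ->
  exists p c : {poly k}, [/\ irreducible_poly p, ~~ (p %| 'X), 1 + h%:P * 'X^q = p * c,
    ~~ (p %| c) & forall e S, p %| S ^+ q - e%:P -> exists j z, e = h ^+ j * z ^+ q].
Proof.
move=> q_prime q_odd qk h0; have q0 := prime_gt0 q_prime.
have [[t tq]|/forallNP nt] := pselect (exists t, t ^+ q = - h^-1).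
  have t0 : t != 0.
    by apply: contraTneq h0 => t0; rewrite negbK -invr_eq0 -oppr_eq0 -tq t0 expr0n eqn0Ngt q0.
  exists ('X - t%:P), (h%:P * \sum_(i < q) 'X^(q.-1 - i) * t%:P ^+ i); split.
  - exact: irredp_XsubC.
  - by rewrite dvdp_XsubCl rootE hornerX.
  - rewrite mulrCA -subrXX -rmorphXn /= tq mulrBr -rmorphM mulrN divff // rmorphN opprK addrC.
    by rewrite rmorph1.
  - rewrite dvdp_XsubCl rootE hornerM hornerC mulf_eq0 negb_or h0 horner_sum /=.
    rewrite (eq_bigr (fun=> t ^+ q.-1)) => [|i _]; last first.
      by rewrite hornerM hornerXn -rmorphXn hornerC -exprD subnK // -ltnS prednK.
    by rewrite sumr_const card_ord -mulr_natr mulf_neq0 ?expf_neq0.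
  - move=> e S; rewrite dvdp_XsubCl rootE hornerD hornerN hornerC horner_exp subr_eq0 => /eqP <-.
    by exists 0%N, S.[t]; rewrite expr0 mul1r.
exists ('X^q - (- h^-1)%:P), h%:P; split.
- exact: irreducible_binomial.
- apply/negP => /dvdp_leq; rewrite polyX_eq0 size_polyX size_XnsubC // => /(_ isT).
  by rewrite ltnS leqNgt prime_gt1.
- by rewrite [RHS]mulrC mulrBr -rmorphM mulrN divff // rmorphN opprK rmorph1 addrC.
- apply/negP => /dvdp_leq; rewrite polyC_eq0 h0 size_XnsubC // size_polyC h0 => /(_ isT).
  by rewrite ltnS leqNgt q0.
(* Up to q-th powers (-1/h)^j is h^(j (q - 1)): h^(-j q) is a q-th power, and so is (-1)^j because q
   is odd. *)
move=> e S /(kummer q_prime qk nt)[j [z ->]]; exists (j * q.-1)%N, ((-1) ^+ j * z / h ^+ j).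
have sgn : ((-1) ^+ j) ^+ q = (-1) ^+ j :> k by rewrite exprAC -[(-1) ^+ q]signr_odd q_odd expr1.
rewrite !exprMn sgn exprVn -exprM (_ : (j * q = j + j * q.-1)%N) 1?exprD; last by rewrite -mulnS prednK.
rewrite [(- h^-1) ^+ j]exprNn exprVn.
have hj : h ^+ j != 0 by rewrite expf_neq0.
have hq : h ^+ (j * q.-1) != 0 by rewrite expf_neq0.
by field; rewrite hj hq.
Qed.

Section Witness.
Variables (V : fieldType) (l q : nat) (B E0 : set V) (h y : V).
Hypotheses (l_prime : prime l) (q_prime : prime q) (q_odd : odd q) (lq : (l < q)%N)
  (char0 : forall n, n.+1%:R != 0 :> V) (sfB : subfield B) (E0B : forall e, E0 e -> B e)
  (E0nz : forall e, E0 e -> e != 0) (Bh : B h) (h0 : h != 0)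
  (y_transc : ~ algebraic_over B y)
  (h_exact : forall e j z, E0 e -> B z -> e <> h ^+ j * z ^+ q).

(* Adjoin y to B and close off under the steps below, keeping a place of B(y ^+ l) at which
   1 + h y ^+ (l q) is a uniformiser and no e in E0 becomes a q-th power in the residue field. *)
Theorem unsolvable_above : exists E : set V,
  [/\ subfield E, forall x, B x -> E x, E y &
      forall n c, (n < l)%N -> degree_le E n c -> E c] /\
  (forall r e u, E0 e -> E u -> r ^+ l = 1 + e * u ^+ (l * q) -> E r) /\
  forall x, E x -> x ^+ l <> 1 + h * y ^+ (l * q).
Proof.
have l0 := prime_gt0 l_prime; have q0 := prime_gt0 q_prime.
pose k := sbf_type (sfld sfB); pose iota : {rmorphism k -> V} := val.
have [h' hE] : exists h' : k, iota h' = h by exists (sbf_mk (Bh : sfld sfB h)).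
have h'0 : h' != 0 by rewrite -(fmorph_eq0 iota) hE.
have qk : q%:R != 0 :> k by rewrite -(fmorph_eq0 iota) rmorph_nat -(prednK q0).
have [p [c [p_irr pX pc ncp pS]]] := place_polynomial q_prime q_odd qk h'0.
(* The place starts on B(y^l) rather than B(y): in eta the relevant polynomial 1 + h X^q is binomial
   of prime degree, as Kummer theory needs. Since eta is a unit at the place, y returns later as an
   l-th root of a unit. *)
pose eta := y ^+ l; pose ev (g : {poly k}) := (map_poly iota g).[eta].
have transc (g : {poly k}) : ev g = 0 -> g = 0.
  move=> eg; apply: contrapT => /eqP g0; apply: y_transc.
  exists (size (map_poly iota g \Po 'X^l)), (map_poly iota g \Po 'X^l); split=> //.
  - move=> i; rewrite coef_comp_poly; apply: (sf_sum sfB) => j _; apply: (sfM sfB).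
      exact: poly_in_map.
    by rewrite -exprM; apply: (poly_inXn sfB).
  - rewrite comp_poly_eq0 ?map_poly_eq0 // size_polyXn ltnS //.
  - by rewrite rootE horner_comp hornerXn -/eta; apply/eqP.
have srB : subring B by case: (sfB).
have ev_adjoin g : adjoin B eta (ev g) by exists (map_poly iota g) => //; apply: poly_in_map.
(* p(eta) is not invertible in B[eta]. The ring obtained contains the field B, so the place is
   trivial on it. *)
have [|O BO p_small] := chevalley (sr_adjoin eta srB) (ev_adjoin p).
  move=> [g Bg]; have [g' <-] := poly_in_lift sfB Bg; rewrite -/iota -/(ev g') => pg.
  have p0 : ev p != 0 by apply/eqP => /transc/eqP; apply/negP/irredp_neq0.
  case/negP: pX; apply: (dvdp_trans _ (dvd1p _)); apply/dvdpP; exists g'.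
  apply/eqP; rewrite -subr_eq0; apply/eqP/transc.
  by rewrite /ev evB evM ev1 -!/(ev _) -pg mulVf // subrr.
have Ok x : O (iota x) by apply: BO; apply: (adjoin_sub _ sfB); apply: sfld_valP.
have Oeta : O eta by apply: BO; apply: adjoin_gen.
have unit_ev := ev_unit Ok Oeta p_irr p_small.
have Bunit b : B b -> b != 0 -> veq O b 1.
  move=> Bb b0; split; first by apply/vle1; apply: BO; apply: adjoin_sub.
  exists b^-1; last by rewrite mulVf.
  by apply: BO; apply: adjoin_sub => //; apply: (sfV sfB).
have O_nat n : vle O 1 n.+1%:R by case: (Bunit n.+1%:R) => //; apply: sf_nat.
have f0 : ev p != 0 by apply/eqP => /transc/eqP; apply/negP/irredp_neq0.
(* The first clause is what the conclusion needs; the second is what keeps the l-th roots of 1 + e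
   u^(lq) unramified. *)
pose Q x := ~ veq O (x ^+ l) (ev p) /\ (O x -> forall e, E0 e -> ~ vlt O (x ^+ q - e) 1).
have [|E [sfE frE QE maxE]] := maximal_subfield (fractions_subfield transc) (Q := Q).
  move=> x frx; split; first exact: (fractions_unramified Ok Oeta p_irr p_small transc (prime_gt1
    l_prime)).
  move=> Ox e E0e; rewrite (_ : e = iota (sbf_mk (E0B E0e : sfld sfB e))) //.
  apply: (fractions_residue Ok Oeta p_irr p_small transc) => // S /pS[j [z eE]].
  apply: (h_exact (j := j) E0e (sfld_valP z)).
  by rewrite -hE -[LHS]/(iota (sbf_mk (E0B E0e : sfld sfB e))) eE rmorphM !rmorphXn.
have BE x : B x -> E x.
  by move=> Bx; apply: frE; apply: (fractions_const _ _ (sbf_mk (Bx : sfld sfB x))).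
have Eeta : E eta by apply: frE; apply: fractions_gen.
have evE g : E (ev g) by apply: frE; exists g, 1; rewrite oner_neq0 ev1 divr1.
have ramE x (Ex : E x) := (QE x Ex).1.
(* In degree below q the residual clause persists by [residual_step], so only ramification is left
   to check. *)
have step n d : degree_le E n d -> (n < q)%N ->
    (forall x, adjoin E d x -> ~ veq O (x ^+ l) (ev p)) -> E d.
  move=> dd nq ram; apply: maxE => [|x Ax]; first by exists n.
  split; first exact: ram.
  move=> Ox e E0e; have e1 := Bunit e (E0B E0e) (E0nz E0e).
  apply: (residual_step q_prime sfE (BE _ (E0B E0e)) e1 _ dd nq Ax Ox).
  by move=> z Ez Oz; apply: (QE z Ez).2.
have root_step r w a : E w -> E a -> a != 0 -> veq O w 1 -> r ^+ l = w * a ^+ l -> E r.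
  move=> Ew Ea a0 w1 rE; apply: (step l) => // [|x Ax].
    by apply: binomial_degree rE => //; apply: (sfM sfE) => //; apply: (sfX sfE).
  exact: (ramified_unit_step O_nat l_prime sfE (evE p) f0 ramE Ew Ea a0 w1 rE Ax).
exists E; split; [split=> // [|n d nl dd]|split].
- apply: (root_step y eta 1) => //; [exact: (sf1 sfE)|exact: oner_neq0| |by rewrite expr1n mulr1].
  by have := unit_ev _ pX; rewrite map_polyX hornerX.
- apply: (step n) => //; first exact: ltn_trans lq.
  by move=> x; apply: (ramified_small_step l_prime sfE (evE p) f0 ramE dd nl).
- move=> r e u E0e Eu rE; have Ee := BE _ (E0B E0e).
  have e1 := Bunit e (E0B E0e) (E0nz E0e).
  have Ew : E (1 + e * u ^+ (l * q)).
    by apply: (sfD sfE); [apply: sf1|apply: (sfM sfE) => //; apply: sfX].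
  (* For integral u the element 1 + e u^(lq) is a unit: otherwise e would be the q-th power of
     -u^(-l) in the residue field, q being odd. If u has a pole, it is the unit e + u^(-lq) times
     the l-th power of u^q. *)
  have [Ou|nOu] := pselect (O u).
    apply: (root_step r (1 + e * u ^+ (l * q)) 1) => //;
      [exact: (sf1 sfE)|exact: oner_neq0| |by rewrite expr1n mulr1].
    split; first by apply/vle1/vringD; [apply: vring1|apply: vringM; [apply/vle1;
      case: e1|apply: vringX]].
    have [//|w1] := vltP O 1 (1 + e * u ^+ (l * q)).
    have eu : veq O (e * u ^+ (l * q)) 1.
      have -> : e * u ^+ (l * q) = - (1 - (1 + e * u ^+ (l * q))) by ring.
      have [h1 h2] := vlt_dom ((vltN O _ _).2 w1).
      by split; [apply/vleN|apply/vleNr].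
    have u0 : u != 0.
      apply: contraTneq (oner_neq0 V) => u0; rewrite negbK -(veq_neq0 eu) u0 expr0n muln_eq0.
      by rewrite !eqn0Ngt l0 q0 mulr0.
    have ulq : veq O (u ^+ (l * q)) 1.
      rewrite -[u ^+ _]mul1r; apply: veq_trans eu; apply: veqM; last exact: veq_refl.
      exact: veq_sym.
    have ul : O (u ^- l).
      apply/vle1; rewrite -[1]invr1 vleV ?expf_neq0 ?oner_neq0 //.
      have [//|h1] := vltP O 1 (u ^+ l); have h2 : vlt O (u ^+ (l * q)) 1.
        by rewrite exprM -(expr1n _ q) -(prednK q0); apply: vltX.
      by case: ulq => _ /h2.
    case: (QE (- u ^- l)) => [|_ /(_ (vringN ul) e E0e) []].
      by apply: (sfN sfE); apply: (sfV sfE); apply: sfX.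
    have uq0 : u ^+ (l * q) != 0 by rewrite expf_neq0.
    have -> : (- u ^- l) ^+ q - e = - ((1 + e * u ^+ (l * q)) / u ^+ (l * q)).
      rewrite exprNn -signr_odd q_odd expr1 exprVn -exprM mulN1r mulrDl mulfK // mul1r opprD //.
    apply/vltN; rewrite vlt_div // mul1r; apply: vlt_le_trans w1 _; by case: ulq.
  have u0 : u != 0 by apply: contra_notN nOu => /eqP ->; apply: vring0.
  have ui : vlt O u^-1 1.
    by rewrite -[X in vlt O _ X]invr1 /vlt vleV ?oner_neq0 // => /vle1.
  apply: (root_step r (e + u^-1 ^+ (l * q)) (u ^+ q)) => //.
  - by apply: (sfD sfE) => //; apply: (sfX sfE); apply: sfV.
  - by apply: sfX.
  - by rewrite expf_neq0.
  - apply: veq_trans (e1); apply/veq_sym/veq_add; case: e1 => _; apply: vlt_le_trans.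
    by rewrite -(expr1n _ (l * q)) -[(l * q)%N]prednK ?muln_gt0 ?l0 //; apply: vltX.
  - by rewrite rE mulrDl -exprM [(q * l)%N]mulnC exprVn mulVf ?expf_neq0 // addrC.
move=> x Ex xE; apply: (ramE x Ex); rewrite xE.
have -> : 1 + h * y ^+ (l * q) = ev p * ev c.
  rewrite /ev -evM -pc exprM -hE rmorphD rmorphM rmorph1 /= map_polyC map_polyXn /=.
  by rewrite hornerD hornerM !hornerC hornerXn.
by rewrite -[X in veq O _ X]mulr1; apply: veqM; [apply: veq_refl|apply: unit_ev].
Qed.

End Witness.

(** * Generated subfields *)

Section AlgebraicClosure.
Variables (V : fieldType) (B : set V).
Hypothesis sfB : subfield B.
Notation iota := (val : sbf_type (sfld sfB) -> V).

Lemma algebraic_overE x : algebraic_over B x <-> integralOver iota x.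
Proof.
rewrite -integral_algebraic; split=> [[n [g [Bg g0 _ rg]]]|[g g0 rg]].
  have [g' gE] := poly_in_lift sfB Bg; exists g'; last by rewrite gE.
  by rewrite -(map_poly_eq0 iota) gE.
exists (size (map_poly iota g)), (map_poly iota g); split=> //.
- exact: poly_in_map.
- by rewrite map_poly_eq0.
Qed.

Lemma algebraic_subfield : subfield (algebraic_over B).
Proof.
split=> [|x y|x y|x]; rewrite ?algebraic_overE => *.
- exact: integral1.
- exact: integral_sub.
- exact: integral_mul.
- exact: integral_inv.
Qed.

Lemma algebraic_root (g : {poly V}) x : g != 0 -> (forall i, algebraic_over B g`_i) -> root g x ->
  algebraic_over B x.
Proof.
move=> g0 Bg rg; apply/algebraic_overE; apply: integral_root g0 rg _ => y.
by move=> /(nthP 0)[i _ <-]; apply/algebraic_overE.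
Qed.

Lemma algebraic_of x : B x -> algebraic_over B x.
Proof. by move=> Bx; exact/algebraic_overE/(integral_id iota (sbf_mk (Bx : sfld sfB x))). Qed.

Lemma algebraic_closed n c : degree_le (algebraic_over B) n c -> algebraic_over B c.
Proof. by case=> g [Ag g0 _ rg]; apply: algebraic_root rg. Qed.

End AlgebraicClosure.

Lemma algebraic_sub (V : fieldType) (A B : set V) x : A `<=` B -> algebraic_over A x ->
  algebraic_over B x.
Proof. by move=> AB [n [g [Ag g0 sg rg]]]; exists n, g; split=> // i; apply: AB. Qed.

Lemma degree_le_sub (V : fieldType) (A B : set V) n x : A `<=` B -> degree_le A n x -> degree_le B n x.
Proof. by move=> AB [g [Ag g0 sg rg]]; exists g; split=> // i; apply: AB. Qed.

(** * Closure operators and unions of chains *)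

Section Hull.
Variables (T : Type) (P : set T -> Prop).

Definition hull (X : set T) : set T := [set x | forall E, P E -> X `<=` E -> E x].

Lemma hull_sub X : X `<=` hull X. Proof. by move=> x Xx E _; apply. Qed.

Lemma hull_min X E : P E -> X `<=` E -> hull X `<=` E.
Proof. by move=> PE XE x; apply. Qed.

Lemma hullS X Y : X `<=` Y -> hull X `<=` hull Y.
Proof. by move=> XY x hx E PE YE; apply: hx => // y /XY/YE. Qed.

Definition ascending (A : nat -> set T) : Prop := forall m n, (m <= n)%N -> A m `<=` A n.

(** P is finitary, so the union of the hulls has it: a generated element involves only a finite
    stage of the generators. *)
Lemma hull_union (X : nat -> set T) :
  (forall A, ascending A -> (forall n, P (A n)) -> P (\bigcup_n A n)) ->
  (forall Y, P (hull Y)) -> ascending X -> hull (\bigcup_n X n) `<=` \bigcup_n hull (X n).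
Proof.
move=> PU Ph Xa; apply: hull_min.
  by apply: PU => // m n mn; apply: hullS; apply: Xa.
by move=> x [n _ Xx]; exists n => //; apply: hull_sub.
Qed.

End Hull.

Section Ascending.
Variable V : fieldType.

Lemma ascending_subfield (A : nat -> set V) : ascending A -> (forall n, subfield (A n)) ->
  subfield (\bigcup_n A n).
Proof.
move=> Aa sfA.
have common x y : (\bigcup_n A n) x -> (\bigcup_n A n) y -> exists n, A n x /\ A n y.
  move=> [m _ Ax] [n _ Ay]; exists (maxn m n).
  by split; [apply: Aa Ax; apply: leq_maxl|apply: Aa Ay; apply: leq_maxr].
split=> [|x y Ax Ay|x y Ax Ay|x [n _ Ax]].
- by exists 0%N => //; apply: sf1.
- by have [n [? ?]] := common x y Ax Ay; exists n => //; apply: (sfB (sfA n)).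
- by have [n [? ?]] := common x y Ax Ay; exists n => //; apply: (sfM (sfA n)).
- by exists n => //; apply: (sfV (sfA n)).
Qed.

Lemma ascending_degree (A : nat -> set V) n c : ascending A -> (forall n, subfield (A n)) ->
  degree_le (\bigcup_n A n) n c -> exists m, degree_le (A m) n c.
Proof.
move=> Aa sfA [g [Ag g0 sg rg]].
have /choice[N hN] : forall i, exists m, A m g`_i by move=> i; have [m _ h] := Ag i; exists m.
exists (\max_(i < size g) N i)%N, g; split=> // i.
have [si|si] := ltnP i (size g); last by rewrite nth_default //; apply: sf0.
by apply: Aa (hN i); apply: (leq_bigmax (Ordinal si)).
Qed.

Definition gen : set V -> set V := hull (@subfield V).

Lemma gen_subfield X : subfield (gen X).
Proof.
split=> [E sfE _|x y hx hy E sfE XE|x y hx hy E sfE XE|x hx E sfE XE].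
- exact: sf1.
- by apply: (sfB sfE); [apply: hx|apply: hy].
- by apply: (sfM sfE); [apply: hx|apply: hy].
- by apply: (sfV sfE); apply: hx.
Qed.

Lemma gen_union X : ascending X -> gen (\bigcup_n X n) `<=` \bigcup_n gen (X n).
Proof. by apply: hull_union; [move=> A; apply: ascending_subfield|apply: gen_subfield]. Qed.

(* Clearing denominators: w transcendental over F, so F(w) consists of the fractions in w. *)
Lemma exchange (F : set V) w x : subfield F -> algebraic_over (gen (F `|` [set w])) x ->
  ~ algebraic_over F x -> algebraic_over (gen (F `|` [set x])) w.
Proof.
move=> sfF xw nx.
have [Fw|nw] := pselect (algebraic_over F w).
  case: nx; have [n [g [Ag g0 _ rg]]] := xw.
  apply: (algebraic_root sfF g0 _ rg) => i.
  apply: (hull_min (algebraic_subfield sfF)) (Ag i) => y [Fy|->//].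
  exact: (algebraic_of sfF).
pose k := sbf_type (sfld sfF); pose iota : {rmorphism k -> V} := val.
have transc (g : {poly k}) : (map_poly iota g).[w] = 0 -> g = 0.
  move=> eg; apply: contrapT => /eqP g0; apply: nw; exists (size (map_poly iota g)), (map_poly iota g).
  by split; [apply: poly_in_map|rewrite map_poly_eq0| |apply/eqP].
have frF : F `|` [set w] `<=` fractions iota w.
  move=> y [Fy|->]; last exact: fractions_gen.
  exact: (fractions_const _ _ (sbf_mk (Fy : sfld sfF y))).
have [n [g [Ag g0 _ rg]]] := xw.
have /choice[a /choice[b ab]] : forall i, exists a b, b != 0 /\
  g`_i = (map_poly iota a).[w] / (map_poly iota b).[w].
  by move=> i; apply: (hull_min (fractions_subfield transc) frF) (Ag i).
pose c (i : 'I_(size g)) := a i * \prod_(j < size g | j != i) b j.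
have D0 : \prod_(j < size g) b j != 0 by apply/prodf_neq0 => j _; case: (ab j).
have cE i : (map_poly iota (c i)).[w] = (map_poly iota (\prod_(j < size g) b j)).[w] * g`_i.
  have [bi ->] := ab i; rewrite (bigD1 i) //= !rmorphM !hornerM.
  have bw : (map_poly iota (b i)).[w] != 0 by apply: contra bi => /eqP/transc ->.
  by field.
(* The relation for x over F(w), cleared of denominators and read as a polynomial in w with
   coefficients in F[x]. *)
pose G := \sum_(i < size g) x ^+ i *: map_poly iota (c i).
have Gw : root G w.
  rewrite rootE horner_sum (eq_bigr (fun i : 'I_(size g) =>
    (map_poly iota (\prod_(j < size g) b j)).[w] * (g`_i * x ^+ i))).
    by rewrite -mulr_sumr -horner_coef (eqP rg) mulr0.
  by move=> i _; rewrite hornerZ cE; ring.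
have sfFx := gen_subfield (F `|` [set x]).
have FFx y : F y -> gen (F `|` [set x]) y by move=> Fy; apply: hull_sub; left.
have Gj j : G`_j = \sum_(i < size g) x ^+ i * iota (c i)`_j.
  by rewrite coef_sum; apply: eq_bigr => i _; rewrite coefZ coef_map.
exists (size G), G; split=> //.
  move=> j; rewrite Gj; apply: (sf_sum sfFx) => i _; apply: (sfM sfFx).
    by apply: (sfX sfFx); apply: hull_sub; right.
  by apply: FFx; apply: sfld_valP.
apply/eqP => G0; apply: nx.
have [i ci] : exists i, c i != 0.
  have sg : ((size g).-1 < size g)%N by rewrite prednK ?size_poly_gt0.
  exists (Ordinal sg); apply: contraNneq g0 => c0; have := cE (Ordinal sg).
  rewrite c0 rmorph0 horner0 => /esym/eqP; rewrite mulf_eq0 => /orP[/eqP/transc/eqP|].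
    by rewrite (negPf D0).
  by rewrite -/(lead_coef g) lead_coef_eq0.
have [j cj] : exists j, (c i)`_j != 0.
  by exists (size (c i)).-1; rewrite -/(lead_coef _) lead_coef_eq0.
pose h := \poly_(i' < size g) (if insub i' is Some i'' then iota (c i'')`_j else 0).
exists (size h), h; split=> //.
- move=> m; rewrite coef_poly; case: ifP => _; last exact: sf0.
  by case: insubP => [u _ _|_]; [apply: sfld_valP|apply: sf0].
- apply: contraNneq cj => h0; have := coef_poly (size g) (fun i' =>
  if insub i' is Some i'' then iota (c i'')`_j else 0) i.
  by rewrite -/h h0 coef0 ltn_ord valK -(fmorph_eq0 iota) => <-.
- rewrite rootE horner_poly; apply/eqP; rewrite -[RHS](coef0 V j) -G0 Gj.
  by apply: eq_bigr => m _; rewrite valK mulrC.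
Qed.

(** A relation for x n involves finitely many others. If the last one needed, x N, has N > n, then
    [exchange] makes x N algebraic over its predecessors, x n among them. *)
Lemma independent (L : set V) (x : nat -> V) :
  (forall n, ~ algebraic_over (gen (L `|` [set x m | m in [set m | (m < n)%N]])) (x n)) ->
  forall n, ~ algebraic_over (gen (L `|` [set x m | m in [set m | m != n]])) (x n).
Proof.
move=> ind n [d dn].
pose X N := L `|` [set x m | m in [set m | m != n /\ (m < N)%N]].
have Xa : ascending X.
  move=> i j ij y [Ly|[m [mn mi] <-]]; [by left|right; exists m => //].
  by split=> //; apply: leq_trans ij.
have [N alg] : exists N, degree_le (gen (X N)) d (x n).
  apply: (@ascending_degree (fun N => gen (X N))); last first.
    apply: degree_le_sub dn; apply: subset_trans (gen_union Xa); apply: hullS => y [Ly|[m mn <-]].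
      by exists 0%N => //; left.
    by exists m.+1 => //; right; exists m.
  - by move=> i; apply: gen_subfield.
  - by move=> i j ij; apply: hullS; apply: Xa.
have {alg} : algebraic_over (gen (X N)) (x n) by exists d.
elim: N => [|N IH].
  apply: contra_not (ind n) => alg; apply: algebraic_sub alg; apply: hullS => y [Ly|[m [//]]].
  by left.
have [Nn|nN] := leqP N n.
  apply: contra_not (ind n) => alg; apply: algebraic_sub alg; apply: hullS => y [Ly|[m [mn mN] <-]].
    by left.
  by right; exists m => //=; rewrite ltn_neqAle mn /=; apply: leq_trans Nn.
have sub : gen (X N.+1) `<=` gen (gen (X N) `|` [set x N]).
  apply: hullS => y [Ly|[m [mn mN] <-]]; first by left; apply: hull_sub; left.
  have [->|mN'] := eqVneq m N; first by right.
  by left; apply: hull_sub; right; exists m => //; split=> //; rewrite ltn_neqAle mN' -ltnS.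
move=> alg; have := exchange (gen_subfield (X N)) (algebraic_sub sub alg) IH.
apply: contra_not (ind N) => {}alg; apply: algebraic_sub alg; apply: hull_min;
  first exact: gen_subfield.
move=> y [|->]; last by apply: hull_sub; right; exists n.
by apply: hullS => {}y [Ly|[m [_ mN] <-]]; [left|right; exists m].
Qed.

End Ascending.

Section Closure.
Variables (V : fieldType) (l q : nat) (E0 : set V).

Definition power_closed (E : set V) : Prop := [/\ subfield E,
  forall n c, (n < l)%N -> degree_le E n c -> E c &
  forall r e u, E0 e -> E u -> r ^+ l = 1 + e * u ^+ (l * q) -> E r].

Definition power_closure : set V -> set V := hull power_closed.

Lemma power_closureP X : power_closed (power_closure X).
Proof.
have gX : gen (power_closure X) `<=` power_closure X.
  by move=> x gx E PE XE; apply: gx => [|y]; [case: PE|apply].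
split=> [|n c nl dc E PE XE|r e u E0e hu rE E PE XE].
- split=> [|x y Xx Xy|x y Xx Xy|x Xx]; apply: gX.
  + exact: (sf1 (gen_subfield _)).
  + by apply: (sfB (gen_subfield _)); apply: hull_sub.
  + by apply: (sfM (gen_subfield _)); apply: hull_sub.
  + by apply: (sfV (gen_subfield _)); apply: hull_sub.
- by case: (PE) => _ h _; apply: h nl _; apply: degree_le_sub dc => x; apply.
- by case: (PE) => _ _ h; apply: (h r e u) => //; apply: hu.
Qed.

Lemma power_closure_union X : ascending X ->
  power_closure (\bigcup_n X n) `<=` \bigcup_n power_closure (X n).
Proof.
apply: hull_union => [A Aa PA|]; last exact: power_closureP.
have sfA n : subfield (A n) by case: (PA n).
split=> [|n c nl /(ascending_degree Aa sfA)[m dm]|r e u E0e [n _ Au] rE].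
- exact: ascending_subfield.
- by exists m => //; case: (PA m) => _ h _; apply: h dm.
- by exists n => //; case: (PA n) => _ _ h; apply: (h r e u).
Qed.

Lemma algebraic_power_closed B : subfield B -> (0 < l)%N -> E0 `<=` B ->
  power_closed (algebraic_over B).
Proof.
move=> sfB l0 E0B; have sfA := algebraic_subfield sfB.
split=> // [n c _|r e u E0e Au rE]; first exact: algebraic_closed.
apply: (@algebraic_closed _ B sfB l); apply: binomial_degree rE => //.
apply: (sfD sfA); first exact: sf1.
by apply: (sfM sfA); [apply/algebraic_of/E0B|apply: sfX].
Qed.

(* Since all the steps have degree at most l < q, they create no new q-th powers. *)
Lemma power_closure_powers B X w : prime q -> (0 < l < q)%N -> subfield B -> E0 `<=` B -> X `<=` B ->
  power_closure X w -> B (w ^+ q) -> exists2 t, B t & t ^+ q = w ^+ q.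
Proof.
move=> q_prime /andP[l0 lq] sfB E0B XB.
pose Q x := B (x ^+ q) -> exists2 t, B t & t ^+ q = x ^+ q.
have [|E [sfE BE QE maxE]] := maximal_subfield sfB (Q := Q); first by move=> x Bx _; exists x.
have step n c : (n < q)%N -> degree_le E n c -> E c.
  move=> nq dc; apply: maxE; first by exists n.
  move=> x Ax Bx; have [t Et tE] := power_descent q_prime sfE nq dc Ax (BE _ Bx) erefl.
  by rewrite -tE in Bx *; apply: QE.
suff PE : power_closed E by move=> hw; apply: QE; apply: (hull_min PE) hw => x /XB/BE.
split=> // [n c nl|r e u E0e Eu rE]; first by apply: step; apply: ltn_trans lq.
apply: (step l r) => //; apply: binomial_degree rE => //.
apply: (sfD sfE); first exact: sf1.
by apply: (sfM sfE); [apply/BE/E0B|apply: sfX].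
Qed.

End Closure.

(** * Elements approximable by L *)

Section Density.
Variables (V : fieldType) (O : valring V) (L : set V) (pi : V).
Hypotheses (sfL : subfield L) (Lpi : L pi) (pi0 : pi != 0) (pi1 : vlt O pi 1).

Definition scale : set V := [set a | L a /\ a != 0].
Definition negligible x : Prop := forall a, scale a -> vlt O x a.
Definition bounded x : Prop := exists2 b, scale b & vle O x b.
Definition approximable x : Prop := forall a, scale a -> exists2 c, L c & vlt O (x - c) a.
(** The second clause bounds a nonzero x from below by an element of L; it is what allows inverses
    to be approximated, and x to be approximated relative to its own size. *)
Definition dense x : Prop := approximable x /\ (negligible x -> x = 0).

Lemma scale1 : scale 1. Proof. by split; [apply: sf1|apply: oner_neq0]. Qed.
Lemma scaleM a b : scale a -> scale b -> scale (a * b).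
Proof. by move=> [La a0] [Lb b0]; split; [apply: (sfM sfL)|rewrite mulf_neq0]. Qed.
Lemma scaleV a : scale a -> scale a^-1.
Proof. by move=> [La a0]; split; [apply: (sfV sfL)|rewrite invr_eq0]. Qed.
Lemma scale_div a b : scale a -> scale b -> scale (a / b).
Proof. by move=> sa /scaleV; apply: scaleM. Qed.
Lemma scale_pi : scale pi. Proof. by []. Qed.

Lemma scale_min a b : scale a -> scale b -> exists d, [/\ scale d, vle O d a & vle O d b].
Proof.
move=> sa sb; have [ab|ba] := vle_total O a b.
  by exists a; split=> //; apply: vle_refl.
by exists b; split=> //; apply: vle_refl.
Qed.

Lemma scale_max a b : scale a -> scale b -> exists d, [/\ scale d, vle O a d & vle O b d].
Proof.
move=> sa sb; have [ab|ba] := vle_total O a b.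
  by exists b; split=> //; apply: vle_refl.
by exists a; split=> //; apply: vle_refl.
Qed.

Lemma vlt_pi a : a != 0 -> vlt O (pi * a) a.
Proof. by move=> a0; rewrite -[X in vlt O _ X]mul1r vltMr. Qed.

Lemma bounded_scale x : L x -> bounded x.
Proof.
move=> Lx; have [->|x0] := eqVneq x 0; first by exists 1; [apply: scale1|apply: vle0].
by exists x => //; apply: vle_refl.
Qed.

Lemma boundedD x y : bounded x -> bounded y -> bounded (x + y).
Proof.
move=> [a sa xa] [b sb yb]; have [d [sd ad bd]] := scale_max sa sb.
by exists d => //; apply: vleD; [apply: vle_trans ad|apply: vle_trans bd].
Qed.

Lemma boundedM x y : bounded x -> bounded y -> bounded (x * y).
Proof. by move=> [a sa xa] [b sb yb]; exists (a * b); [apply: scaleM|apply: vleM]. Qed.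

Lemma boundedX n x : bounded x -> bounded (x ^+ n).
Proof.
move=> bx; elim: n => [|n IH]; rewrite ?expr0 ?exprS; last exact: boundedM.
by apply: bounded_scale; apply: sf1.
Qed.

Lemma negligible_bounded x : negligible x -> bounded x.
Proof. by move=> nx; exists 1; [apply: scale1|apply/vltW/nx/scale1]. Qed.

Lemma approximable_bounded x : approximable x -> bounded x.
Proof.
move=> /(_ 1 scale1)[c Lc xc]; rewrite -(subrK c x); apply: boundedD; last exact: bounded_scale.
by exists 1; [apply: scale1|apply: vltW].
Qed.

Lemma negligible0 : negligible 0. Proof. by move=> a [_ a0]; apply/vlt0. Qed.

Lemma negligibleD x y : negligible x -> negligible y -> negligible (x + y).
Proof. by move=> nx ny a sa; apply: vltD; [apply: nx|apply: ny]. Qed.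

Lemma negligibleM x y : negligible x -> bounded y -> negligible (x * y).
Proof.
move=> nx [b sb yb] a sa; have [_ b0] := sb; rewrite -(divfK b0 a).
by apply: vltM => //; apply/nx/scale_div.
Qed.

Lemma negligibleN x : negligible x -> negligible (- x).
Proof. by move=> nx a sa; apply/vltN/nx. Qed.

Lemma not_negligible x : ~ negligible x -> exists2 b, scale b & vle O b x.
Proof. by move=> /existsNP[b /not_implyP[sb /contrapT bx]]; exists b. Qed.

Lemma approximable_scale x : L x -> approximable x.
Proof. by move=> Lx a [_ a0]; exists x => //; rewrite subrr; apply/vlt0. Qed.

Lemma approximableB x y : approximable x -> approximable y -> approximable (x - y).
Proof.
move=> ax ay a sa; have [c Lc xc] := ax a sa; have [d Ld yd] := ay a sa.
exists (c - d); first exact: (sfB sfL).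
by rewrite (_ : _ - _ = (x - c) - (y - d)); [apply: vltB|ring].
Qed.

Lemma approximableM x y : approximable x -> approximable y -> approximable (x * y).
Proof.
move=> ax ay a sa; have [b sb xb] := approximable_bounded ax.
have [d Ld yd] := ay _ (scale_div sa sb); have [b' sb' db'] := bounded_scale Ld.
have [c Lc xc] := ax _ (scale_div sa sb'); exists (c * d); first exact: (sfM sfL).
have [[_ b0] [_ b0']] := (sb, sb').
rewrite (_ : _ - _ = (y - d) * x + (x - c) * d); last by ring.
by apply: vltD; [rewrite -(divfK b0 a)|rewrite -(divfK b0' a)]; apply: vltM.
Qed.

Lemma approximableV x : approximable x -> ~ negligible x -> approximable x^-1.
Proof.
move=> ax /not_negligible[b sb bx] a sa; have [_ b0] := sb.
have [d [sd db dab]] := scale_min sb (scaleM sa (scaleM sb sb)).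
have [c Lc xc] := ax d sd; exists c^-1; first exact: (sfV sfL).
have xb : vlt O (c - x) b by rewrite -opprB; apply/vltN; apply: vlt_le_trans db.
have x0 : x != 0 by apply: contraTneq b0 => x0; move: bx; rewrite x0 => /vlex0 ->; rewrite eqxx.
have bc : vle O b c.
  have [h _] := vlt_dom (vlt_le_trans xb bx); rewrite addrC subrK in h; exact: vle_trans h.
have c0 : c != 0 by apply: contraTneq b0 => c0; move: bc; rewrite c0 => /vlex0 ->; rewrite eqxx.
rewrite (_ : _ - _ = - ((x - c) / (x * c))); last by field; rewrite x0 c0.
apply/vltN; rewrite vlt_div ?mulf_neq0 //; apply: vlt_le_trans xc _; apply: vle_trans dab _.
by apply: vleM; [apply: vle_refl|apply: vleM].
Qed.

Lemma approximable_subring : subring approximable.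
Proof.
split; [|exact: approximableB|exact: approximableM].
by apply: approximable_scale; apply: sf1.
Qed.

Lemma bounded_horner (g : {poly V}) x : (forall i, bounded g`_i) -> bounded x -> bounded g.[x].
Proof.
move=> bg bx; elim/poly_ind: g bg => [|g c IH] bg; first by rewrite horner0; apply: bounded_scale;
  apply: sf0.
rewrite hornerMXaddC; apply: boundedD; last by have := bg 0%N; rewrite coefD coefMX coefC add0r.
apply: boundedM => //; apply: IH => i; have := bg i.+1.
by rewrite coefD coefMX coefC addr0.
Qed.

Section AlgebraicStep.
Hypotheses (char0 : forall n, n.+1%:R != 0 :> V).
Hypothesis hensV : henselian_in O (fun=> True).
Hypothesis L_closed : forall x, algebraic_over L x -> L x.
Variable E : set V.
Hypotheses (sfE : subfield E) (E_dense : forall x, E x -> dense x).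

Lemma minimal_relation x : algebraic_over E x -> exists g, [/\ poly_in E g, g != 0, root g x &
  forall h, poly_in E h -> root h x -> (size h < size g)%N -> h = 0].
Proof.
move=> [n [g [Eg g0 _ rg]]].
have ex : exists m, `[< exists h, [/\ poly_in E h, h != 0, root h x & size h = m] >].
  by exists (size g); apply/asboolP; exists g.
case: (ex_minnP ex) => m /asboolP[h [Eh h0 rh <-]] hmin; exists h; split=> // f Ef rf.
rewrite ltnNge; apply: contraNeq => f0; apply: hmin; apply/asboolP; by exists f.
Qed.

Lemma E_bounded x : E x -> bounded x.
Proof. by move=> /E_dense[/approximable_bounded]. Qed.

(** In a relation of least degree the constant coefficient is x times something bounded, hence
    negligible, hence 0 as E is dense; then X divides the relation, against minimality. *)
Lemma algebraic_negligible x : algebraic_over E x -> negligible x -> x = 0.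
Proof.
move=> ax nx; apply: contrapT => /eqP x0; have [g [Eg g0 rg gmin]] := minimal_relation ax.
have [h [c gE]] : exists h c, g = h * 'X + c%:P.
  by elim/poly_ind: (g) => [|h c _]; [exists 0, 0; rewrite mul0r add0r|exists h, c].
have Eh i : E h`_i by have := Eg i.+1; rewrite gE coefD coefMX coefC addr0.
have Ec : E c by have := Eg 0%N; rewrite gE coefD coefMX coefC add0r.
have /eqP := rg; rewrite gE hornerMXaddC => hx.
have c0 : c = 0.
  apply: (E_dense Ec).2; rewrite -[c]add0r -{1}(subrr (h.[x] * x)) addrAC hx add0r mulrC.
  apply/negligibleN/negligibleM => //.
  by apply: bounded_horner => [i|]; [apply: E_bounded|apply: negligible_bounded].
case/eqP: (g0); rewrite gE c0 addr0 [h]gmin ?mul0r //.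
  by move: hx; rewrite c0 addr0 => /eqP; rewrite mulf_eq0 (negPf x0) orbF.
have h0 : h != 0 by apply: contraNneq (g0) => h0; rewrite gE c0 h0 mul0r addr0.
by rewrite gE c0 addr0 size_mulX.
Qed.

Lemma separable_relation x g : root g x -> g != 0 -> poly_in E g ->
  (forall h, poly_in E h -> root h x -> (size h < size g)%N -> h = 0) -> g^`().[x] != 0.
Proof.
move=> rg g0 Eg gmin; apply/negP => dx; case/eqP: (g0).
have d0 : g^`() = 0.
  apply: gmin => //; last exact: lt_size_deriv.
  by move=> i; rewrite coef_deriv; apply: (sfMn sfE).
have gS i : g`_i.+1 = 0.
  have := coef_deriv g i; rewrite d0 coef0 -mulr_natr => /esym/eqP.
  by rewrite mulf_eq0 (negPf (char0 i)) orbF => /eqP.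
have gC : g = (g`_0)%:P by apply/polyP => -[|i]; rewrite coefC.
by move: rg; rewrite gC rootE hornerC => /eqP ->; rewrite polyC0.
Qed.

Lemma nderivn_bound (D : {poly V}) n x d X j : (size D <= n)%N -> (forall i, vle O D`_i d) ->
  (forall i, (i < n)%N -> vle O (x ^+ i) X) -> vle O (D^`N(j)).[x] (d * X).
Proof.
move=> sD Dd xX; rewrite horner_coef; apply: vle_sum => i _; apply: vleM.
  rewrite coef_nderivn -mulr_natl; apply: vleM1l => //; exact: vring_nat.
apply/xX/(leq_trans (ltn_ord i))/(leq_trans (size_poly _ _)).
exact: leq_trans (leq_subr _ _) sD.
Qed.

Lemma powers_bound n x : bounded x -> exists2 X, scale X & forall i, (i < n)%N -> vle O (x ^+ i) X.
Proof.
move=> bx; elim: n => [|n [X sX xX]]; first by exists 1 => //; apply: scale1.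
have [Y sY xY] := boundedX n bx.
have [Z [sZ XZ YZ]] := scale_max sX sY; exists Z => // i; rewrite ltnS leq_eqVlt => /orP[/eqP->|/xX h].
  exact: vle_trans YZ.
exact: vle_trans XZ.
Qed.

(* Approximate the minimal polynomial of x over E by one over L; by Newton's method the latter has
   a root near x, which lies in L. *)
Lemma algebraic_approximable x : algebraic_over E x -> approximable x.
Proof.
move=> ax a sa; have sfA := algebraic_subfield sfE.
have bx : bounded x.
  apply: contrapT => nbx; have x0 : x != 0.
    by apply: contra_notN nbx => /eqP ->; apply: bounded_scale; apply: sf0.
  have /eqP : x^-1 = 0; last by rewrite invr_eq0 (negPf x0).
  apply: algebraic_negligible; first exact: (sfV sfA).
  move=> b sb bi; apply: nbx; exists b^-1; first exact: scaleV.
  by have [_ b0] := sb; rewrite -[x]invrK vleV ?invr_eq0.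
have [g [Eg g0 rg gmin]] := minimal_relation ax.
have d0 := separable_relation rg g0 Eg gmin.
have [b sb bd] : exists2 b, scale b & vle O b g^`().[x].
  apply: not_negligible => nd; case/eqP: d0; apply: algebraic_negligible => //.
  apply: (sf_horner sfA) => // i; apply: algebraic_of => //.
  by rewrite coef_deriv; apply: (sfMn sfE).
pose n := size g; have [X sX xX] := powers_bound n bx.
have [Y sY gY] : exists2 Y, scale Y & forall i, vle O g`_i Y.
  suff [Y sY h] : exists2 Y, scale Y & forall i, (i < n)%N -> vle O g`_i Y.
    by exists Y => // i; have [/h//|ni] := ltnP i n; rewrite nth_default //; apply: vle0.
  elim: (n) => [|m [Y sY h]]; first by exists 1 => //; apply: scale1.
  have [Z sZ gZ] := E_bounded (Eg m); have [W [sW YW ZW]] := scale_max sY sZ.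
  exists W => // i; rewrite ltnS leq_eqVlt => /orP[/eqP->|/h k]; first exact: vle_trans ZW.
  exact: vle_trans YW.
(* The precision: b bounds |g'(x)| from below and b2 the Taylor coefficients of g at x from above.
   The root is sought within d, where d <= a, d <= 1 and d b2 <= b make Newton's method applicable;
   the coefficients of g are approximated up to e, with e X < d b. *)
have [b2 [sb2 YXb _]] := scale_max (scaleM sY sX) scale1.
have [d1 [sd1 d11 d1b]] := scale_min scale1 (scale_div sb sb2).
have [d [sd dd1 da]] := scale_min sd1 sa.
have [[[[Ld dn0] [_ b20]] [_ X0]] [_ b0]] := (sd, sb2, sX, sb).
have [d1' db] : vle O d 1 /\ vle O (d * b2) b.
  by split; [apply: vle_trans d11|rewrite -vle_divr //; apply: vle_trans d1b].
pose e0 := pi * (d * b) / X.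
have [e [se ee0 eY]] := scale_min (scale_div (scaleM scale_pi (scaleM sd sb)) sX) sY.
have /choice[c cP] : forall i, exists c, L c /\ vlt O (g`_i - c) e.
  by move=> i; have [c Lc h] := (E_dense (Eg i)).1 e se; exists c.
pose G := \poly_(i < n) c i; pose D := G - g.
have LG i : L G`_i by rewrite coef_poly; case: ifP => _; [case: (cP i)|apply: sf0].
have sD : (size D <= n)%N.
  by apply: leq_trans (size_polyD _ _) _; rewrite size_polyN geq_max size_poly leqnn.
have De i : vle O D`_i e.
  rewrite coefB coef_poly; case: ltnP => ni; last by rewrite nth_default // subrr; apply: vle0.
  by rewrite -opprB; apply/vleN; apply: vltW; case: (cP i).
have GE : G = g + D by rewrite addrC subrK.
have eX : vle O (e * X) (pi * (d * b)).
  by rewrite -vle_divr //.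
have small : vlt O (e * X) (d * b).
  by apply: vle_lt_trans eX _; apply: vlt_pi; rewrite mulf_neq0.
have dbb : vle O (d * b) b by rewrite mulrC; apply: vleM1; [apply: vle_refl|apply/vle1].
have D'b : vlt O D^`().[x] g^`().[x].
  rewrite -nderivn1; apply: vle_lt_trans (nderivn_bound 1 sD De xX) _.
  by apply: vlt_le_trans small _; apply: vle_trans dbb _.
have [dG _] : vle O g^`().[x] G^`().[x] /\ vle O G^`().[x] g^`().[x].
  by rewrite GE derivD hornerD; apply: vlt_dom.
have dbG : vle O (d * b) (d * G^`().[x]).
  by apply: vleM; [apply: vle_refl|apply: vle_trans dG].
have [y [_ y1 ry]] : exists y, [/\ (fun _ : V => True) y, vlt O y 1 & root G (x + d * y)].
  have sfV' : subfield (fun _ : V => True) by [].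
  apply: (newton_root sfV' hensV (B := d * G^`().[x])) => //.
    apply: vlt_le_trans (dbG); rewrite GE hornerD (eqP rg) add0r.
    by have := nderivn_bound 0 sD De xX; rewrite nderivn0 => h; apply: vle_lt_trans small.
  case=> // -[_|j _]; first by rewrite nderivn1 mulrC; apply: vle_refl.
  apply: vle_trans (dbG); rewrite exprS mulrCA; apply: vleM; first exact: vle_refl.
  rewrite exprS mulrCA mulrA; apply: vleM1; last by apply/vringX/vle1.
  apply: vle_trans db; apply: vleM; first exact: vle_refl.
  apply: vle_trans YXb; rewrite GE; have ->
    : (g + D)^`N(j.+2) = g^`N(j.+2) + D^`N(j.+2) by rewrite linearD.
  rewrite hornerD; apply: vleD; first exact: nderivn_bound xX.
  apply: vle_trans (nderivn_bound _ sD De xX) _.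
  by apply: vleM => //; apply: vle_refl.
exists (x + d * y).
  apply: L_closed; exists (size G), G; split=> //.
  by apply: contraTneq d0 => G0; rewrite negbK; move: dG; rewrite G0 linear0 horner0 => /vlex0 ->.
rewrite opprD addrA subrr add0r; apply/vltN; apply: vlt_le_trans da.
by rewrite -[X in vlt O _ X]mulr1 mulrC [d * 1]mulrC; apply: vltM => //; apply: vle_refl.
Qed.

Lemma algebraic_dense x : algebraic_over E x -> dense x.
Proof. by move=> ax; split; [apply: algebraic_approximable|apply: algebraic_negligible]. Qed.

End AlgebraicStep.
End Density.

(** * Generic elements by Baire category *)

Section Generic.
Variables (V : fieldType) (O : valring V) (L : set V) (pi : V).
Hypotheses (sfL : subfield L) (Lpi : L pi) (pi0 : pi != 0) (pi1 : vlt O pi 1).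
Hypothesis char0 : forall n, n.+1%:R != 0 :> V.
Notation scale := (scale L).
Notation negligible := (negligible O L).
Notation bounded := (bounded O L).
Notation approximable := (approximable O L).
Notation dense := (dense O L).

Definition enumerable (A : set V) : Prop := exists s : nat -> V, forall x, A x -> exists n, s n = x.

Lemma natr_inj : injective (fun n => n%:R : V).
Proof.
suff h m n : (m < n)%N -> m%:R <> n%:R :> V.
  by move=> m n e; have [/h|/h/(_ (esym e))|] := ltngtP m n.
move=> mn e; have /negP := char0 (n - m).-1; apply.
by rewrite prednK ?subn_gt0 // natrB 1?ltnW // e subrr.
Qed.

(** Divided differences: the points lie in L and are distinct, so dividing by their differences
    keeps negligible elements negligible. *)
Lemma poly_negligible n (f : {poly V}) (t : nat -> V) : (size f <= n)%N -> injective t ->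
  (forall i, L (t i)) -> (forall i, negligible f.[t i]) -> forall i, negligible f`_i.
Proof.
elim: n f t => [|n IH] f t sf tinj Lt nf.
  have -> : f = 0 by apply/eqP; rewrite -size_poly_eq0 -leqn0.
  by move=> i; rewrite coef0; apply: negligible0.
have [g gE] : exists g, f - f.[t 0%N]%:P = g * ('X - (t 0%N)%:P).
  by apply/factor_theorem; rewrite rootE hornerD hornerN hornerC subrr.
have ng0 := nf 0%N; set f0 := f.[t 0%N] in gE ng0.
have tn0 i : t i.+1 - t 0%N != 0 by rewrite subr_eq0; apply/eqP => /tinj.
have gt i : g.[t i.+1] * (t i.+1 - t 0%N) = f.[t i.+1] - f0.
  by have := congr1 (fun h : {poly V} => h.[t i.+1]) gE; rewrite !hornerE.
have ng i : negligible g.[t i.+1].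
  rewrite -[g.[_]](mulfK (tn0 i)) gt; apply: (negligibleM sfL).
    by apply: negligibleD; [apply: nf|apply: negligibleN].
  by apply: (bounded_scale _ sfL); apply: (sfV sfL); apply: (sfB sfL).
have sg : (size g <= n)%N.
  have [->|g0] := eqVneq g 0; first by rewrite size_poly0.
  have : (size (g * ('X - (t 0%N)%:P))%R <= n.+1)%N.
    rewrite -gE; apply: leq_trans (size_polyD _ _) _; rewrite geq_max sf size_polyN.
    by apply: leq_trans (size_polyC_leq1 _) _.
  by rewrite size_Mmonic ?monicXsubC // size_XsubC addn2.
have ngi := IH g (fun i => t i.+1) sg (fun i j e => succn_inj (tinj _ _ e)) (fun i => Lt _) ng.
move=> i; have -> : f = g * 'X - (t 0%N) *: g + f0%:P.
  by rewrite -(subrK f0%:P f) gE mulrBr [g * (t 0%N)%:P]mulrC mul_polyC.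
rewrite coefD coefB coefMX coefZ coefC; apply: negligibleD; last first.
  by case: ifP => _ //; apply: negligible0.
apply: negligibleD; first by case: ifP => _; [apply: negligible0|apply: ngi].
apply: negligibleN; rewrite mulrC; apply: (negligibleM sfL) => //; exact: bounded_scale.
Qed.

Lemma lipschitz (f : {poly V}) X : scale X -> (forall i, bounded f`_i) -> exists K, [/\ scale K,
   forall x, vle O x X -> vle O f.[x] K & 
   forall x y, vle O x X -> vle O y X -> vle O (f.[x] - f.[y]) (K * (x - y))].
Proof.
move=> sX; elim/poly_ind: f => [|f c IH] bf.
  exists 1; split=> [|x|x y]; rewrite ?horner0 ?subrr; [exact: scale1|by move=> _;
    exact: vle0|by move=> *; exact: vle0].
have bc : bounded c by have := bf 0%N; rewrite coefD coefMX coefC add0r.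
have [i|K [sK fK fL]] := IH; first by have := bf i.+1; rewrite coefD coefMX coefC addr0.
have [D sD cD] := bc; have [D' [sD' KX DD']] := scale_max O (scaleM sfL sK sX) sD.
have [D2 [sD2 D'D KD]] := scale_max O sD' sK.
exists D2; split=> // [x xX|x y xX yX]; rewrite !hornerMXaddC.
  apply: vleD; last by apply: vle_trans D'D; apply: vle_trans DD'.
  by apply: vle_trans D'D; apply: vle_trans KX; apply: vleM => //; apply: fK.
rewrite (_ : _ - _ = f.[x] * (x - y) + (f.[x] - f.[y]) * y); last by ring.
apply: vleD.
  by apply: vleM; [apply: vle_trans KD; apply: fK|apply: vle_refl].
apply: (@vle_trans _ _ (K * (x - y) * X)); first by apply: vleM => //; apply: fL.
rewrite mulrAC; apply: vleM; last exact: vle_refl.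
by apply: vle_trans D'D.
Qed.

(* When V is an ultrapower, this is saturation. *)
Hypothesis balls : forall c r : nat -> V, (forall n, L (c n)) -> (forall n, scale (r n)) ->
  (forall m n, (m <= n)%N -> vle O (c n - c m) (r m)) -> exists x, forall n, vle O (x - c n) (r n).

(** One Baire step. A nonzero polynomial over B has a coefficient that is not negligible, so it is
    not negligible at some point c + r m; by continuity the same holds on a whole ball around it,
    whose radius is also taken below a. *)
Lemma avoid (B : set V) (f : {poly V}) c r a : (forall x, B x -> dense x) -> poly_in B f -> f != 0 ->
  L c -> scale r -> scale a -> exists c' r', [/\ L c', scale r', vle O (c' - c) r &
   [/\ vle O r' r, vlt O r' a & forall x, vle O (x - c') r' -> ~ negligible f.[x]]].
Proof.
move=> Bd Bf f0 Lc sr sa; have [Lr r0] := sr; have [La a0] := sa.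
have bf i : bounded f`_i by have [h _] := Bd _ (Bf i); apply: approximable_bounded h.
have [m nm] : exists m, ~ negligible f.[c + r * m%:R].
  apply: contrapT => /forallNP h; case/eqP: f0; apply/polyP => i; rewrite coef0.
  apply: (Bd _ (Bf i)).2; apply: (poly_negligible (t := fun m => c + r * m%:R) (leqnn _)).
  - by move=> j k /addrI/(mulfI r0)/natr_inj.
  - by move=> j; apply: (sfD sfL) => //; apply: (sfM sfL) => //; apply: sf_nat.
  - by move=> j; apply: contrapT; apply: h.
set c' := c + r * m%:R in nm; have Lc' : L c'.
  by apply: (sfD sfL) => //; apply: (sfM sfL) => //; apply: sf_nat.
have [b sb bfc] := not_negligible nm.
have [X0 sX0 cX] := bounded_scale O sfL Lc'; have [X [sX X0X rX]] := scale_max O sX0 sr.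
have [K [sK _ fK]] := lipschitz sX bf.
have spi : scale pi by [].
have [r1 [sr1 r1r r1a]] := scale_min O sr (scaleM sfL spi sa).
have [r' [sr' r'r r'b]] := scale_min O sr1 (scaleM sfL spi (scale_div sfL sb sK)).
exists c', r'; split=> //; first by rewrite /c' addrAC subrr add0r; apply: vleM1;
  [apply: vle_refl|apply: vring_nat].
have r'r' : vle O r' r by apply: vle_trans r1r.
split=> // [|x xc].
  by apply: vle_lt_trans r'r _; apply: vle_lt_trans r1a _; apply: (vlt_pi pi1).
have xX : vle O x X.
  rewrite -(subrK c' x); apply: vleD; last exact: vle_trans X0X.
  by apply: vle_trans rX; apply: vle_trans r'r'.
have cX' : vle O c' X by apply: vle_trans X0X.
have [[_ K0] [_ b0]] := (sK, sb).
have fb : vlt O (f.[x] - f.[c']) b.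
  apply: vle_lt_trans (fK _ _ xX cX') _; rewrite mulrC -(divfK K0 b) vltMr //.
  apply: vle_lt_trans xc _; apply: vle_lt_trans r'b _; apply: (vlt_pi pi1).
  by rewrite mulf_neq0 ?invr_eq0.
move=> /(_ b sb); apply.
have [h _] := vlt_dom (vlt_le_trans fb bfc).
by apply: vle_trans bfc _; rewrite addrC subrK in h.
Qed.

Lemma enumerable_poly (B : set V) : subfield B -> enumerable B ->
  exists f : nat -> {poly V}, (forall n, poly_in B (f n) /\ f n != 0) /\
    forall g, poly_in B g -> g != 0 -> exists n, f n = g.
Proof.
move=> sfB [s hs].
pose F n := \poly_(i < size (CodeSeq.decode n)) s (nth 0%N (CodeSeq.decode n) i).
exists (fun n => if `[< poly_in B (F n) /\ F n != 0 >] then F n else 1); split=> [n|g Bg g0].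
  case: asboolP => [//|_]; split; last exact: oner_neq0.
  by apply: poly_inC => //; apply: sf1.
have /choice[k hk] : forall i, exists n, s n = g`_i by move=> i; apply: hs.
exists (CodeSeq.code (mkseq k (size g))); set n := CodeSeq.code _.
suff -> : F n = g by case: asboolP => // -[].
apply/polyP => i; rewrite /F CodeSeq.codeK size_mkseq coef_poly.
by case: ltnP => gi; [rewrite nth_mkseq|rewrite nth_default].
Qed.

(** The n-th ball avoids the n-th polynomial over B and is smaller than the n-th radius; a point
    common to all balls is both approximable and generic. *)
Lemma generic_ex (B : set V) : subfield B -> enumerable B -> L `<=` B -> (forall x, B x -> dense x) ->
  exists x, approximable x /\ forall g, poly_in B g -> g != 0 -> ~ negligible g.[x].
Proof.
move=> sfB enB LB Bd; have [f [Bf fB]] := enumerable_poly sfB enB; case: (enB) => s sB.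
pose a n := if `[< scale (s n) >] then s n else 1.
have sa n : scale (a n) by rewrite /a; case: asboolP => // _; apply: scale1.
pose St := {cr : V * V | L cr.1 /\ scale cr.2}.
have /choice[F hF] : forall nst : nat * St, exists st : St,
    [/\ vle O ((sval st).1 - (sval nst.2).1) (sval nst.2).2, vle O (sval st).2 (sval nst.2).2,
        vlt O (sval st).2 (a nst.1) &
        forall x, vle O (x - (sval st).1) (sval st).2 -> ~ negligible (f nst.1).[x]].
  move=> [n [[c r] /= [Lc sr]]]; have [fn fn0] := Bf n.
  have [c' [r' [Lc' sr' cc [rr ra h]]]] := avoid Bd fn fn0 Lc sr (sa n).
  by exists (exist _ (c', r') (conj Lc' sr')).
pose st0 : St := exist _ (0, 1) (conj (sf0 sfL) (scale1 sfL)).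
pose fix st n : St := if n is n'.+1 then F (n', st n') else st0.
pose c n := (sval (st n)).1; pose r n := (sval (st n)).2.
have stP n := hF (n, st n).
have rr m k : vle O (r (k + m)%N) (r m).
  elim: k => [|k IH]; first exact: vle_refl.
  by apply: vle_trans IH; case: (stP (k + m)%N).
have [m|m|m n mn|x hx] := balls (c := c) (r := r).
- exact: (svalP (st m)).1.
- exact: (svalP (st m)).2.
- rewrite -(subnK mn); elim: (n - m)%N => [|k IH]; first by rewrite subrr; apply: vle0.
  rewrite -(subrK (c (k + m)%N) (c (k.+1 + m)%N)) -addrA; apply: vleD => //.
  by apply: vle_trans (rr m k); case: (stP (k + m)%N).
exists x; split=> [b sb|g Bg g0].
  have [n sn] := sB b (LB _ sb.1).
  exists (c n.+1); first exact: (svalP (st n.+1)).1.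
  apply: vle_lt_trans (hx n.+1) _; have [_ _ + _] := stP n.
  by rewrite /a sn; case: asboolP.
have [n <-] := fB g Bg g0; have [_ _ _ h] := stP n; exact: (h _ (hx n.+1)).
Qed.

(** Denominators in B(x) are not negligible at x and can be inverted; so B(x) is dense again, and
    still enumerable, and the construction can be iterated. *)
Lemma generic_step (B : set V) : subfield B -> enumerable B -> L `<=` B -> (forall x, B x -> dense x) ->
  exists x, ~ algebraic_over B x /\ enumerable (gen (B `|` [set x])) /\
    forall y, gen (B `|` [set x]) y -> dense y.
Proof.
move=> sfB enB LB Bd; have [x [ax gx]] := generic_ex sfB enB LB Bd; exists x.
pose k := sbf_type (sfld sfB); pose iota : {rmorphism k -> V} := val.
have g0 (g : {poly k}) : g != 0 -> ~ negligible (map_poly iota g).[x].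
  by move=> g0; apply: gx; [apply: poly_in_map|rewrite map_poly_eq0].
have transc (g : {poly k}) : (map_poly iota g).[x] = 0 -> g = 0.
  move=> e; apply: contrapT => /eqP/g0; rewrite e; apply; exact: negligible0.
have frB : gen (B `|` [set x]) `<=` fractions iota x.
  apply: hull_min; first exact: fractions_subfield transc.
  move=> y [By|->]; last exact: fractions_gen.
  exact: (fractions_const _ _ (sbf_mk (By : sfld sfB y))).
split; first by move=> [n [g [Bg gn0 _ rg]]]; apply: (gx g) => //; rewrite (eqP rg); apply: negligible0.
have apx (g : {poly k}) : approximable (map_poly iota g).[x].
  have srA := approximable_subring O sfL.
  rewrite horner_coef; apply: (sr_sum srA) => i _; apply: (srM srA); last exact: (srX srA).
  by rewrite coef_map; case: (Bd _ (sfld_valP (g`_i))).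
split=> [|y /frB[g [h [h0 ->]]]].
  have [f [_ fB]] := enumerable_poly sfB enB.
  exists (fun n => if unpickle n is Some (i,
    j) then if i is i'.+1 then (f i').[x] / (f j).[x] else 0 else 0).
  move=> _ /frB[g [h [h0 ->]]].
  have [j hj] := fB _ (poly_in_map h) (etrans (congr1 negb (map_poly_eq0 iota h)) h0).
  have [->|gn0] := eqVneq g 0; first by exists (pickle (0%N, j)); rewrite pickleK rmorph0 horner0 mul0r.
  have [i hi] := fB _ (poly_in_map g) (etrans (congr1 negb (map_poly_eq0 iota g)) gn0).
  by exists (pickle (i.+1, j)); rewrite pickleK hi hj.
have nh := g0 _ h0; split.
  by apply: (approximableM sfL) => //; apply: approximableV.
have hn0 : (map_poly iota h).[x] != 0 by apply/eqP => e; apply: nh; rewrite e; apply: negligible0.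
move=> ng; suff -> : g = 0 by rewrite rmorph0 horner0 mul0r.
apply: contrapT => /eqP/g0; apply; rewrite -[_.[x]](divfK hn0); apply: (negligibleM sfL) => //.
exact: approximable_bounded.
Qed.

Theorem independent_dense : enumerable L -> exists x : nat -> V,
  (forall n, ~ algebraic_over (gen (L `|` [set x m | m in [set m | (m < n)%N]])) (x n)) /\
  (forall y, gen (L `|` range x) y -> dense y).
Proof.
move=> enL; pose good (B : set V) := [/\ subfield B, enumerable B, L `<=` B & forall x, B x -> dense x].
have goodL : good L.
  split=> // x Lx; split; first exact: approximable_scale.
  by move=> nx; apply: contrapT => /eqP x0; apply: (@vlt_irr _ O x); apply: nx.
pose St := {B : set V | good B}.
have /choice[F hF] : forall st : St, exists x, ~ algebraic_over (sval st) x /\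
  good (gen (sval st `|` [set x])).
  move=> [B [sfB enB LB Bd]] /=; have [x [nx [en d]]] := generic_step sfB enB LB Bd.
  exists x; split=> //; split=> //; first exact: gen_subfield.
  by move=> y Ly; apply: hull_sub; left; apply: LB.
pose st0 : St := exist _ L goodL.
pose fix st n : St := if n is n'.+1 then exist _ _ (hF (st n')).2 else st0.
pose x n := F (st n); exists x.
have asc : ascending (fun n => sval (st n)).
  move=> m n mn; rewrite -(subnK mn); elim: (n - m)%N => // k IH y /IH h.
  by apply: hull_sub; left.
have stx n : sval (st n.+1) (x n) by apply: hull_sub; right.
have sfst n : subfield (sval (st n)) by case: (svalP (st n)).
have Lst n : L `<=` sval (st n) by case: (svalP (st n)).
split=> [n|y].
  apply: contra_not (hF (st n)).1; apply: algebraic_sub; apply: hull_min => // y [/Lst//|[m mn <-]].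
  exact: asc (stx m).
move=> gy; suff [n _] : (\bigcup_n sval (st n)) y by case: (svalP (st n)) => _ _ _; apply.
apply: (hull_min (ascending_subfield asc sfst)) gy => z [Lz|[n _ <-]]; first by exists 0%N.
by exists n.+1.
Qed.

End Generic.

(** * Monomial models *)

Section MonomialModels.
Variables (V : fieldType) (O : valring V) (L : set V) (pi : V) (x : nat -> V) (S0 : set (seq nat)).
Hypotheses (sfL : subfield L) (Lpi : L pi) (pi0 : pi != 0) (pi1 : vlt O pi 1)
  (char0 : forall n, n.+1%:R != 0 :> V) (hensV : henselian_in O (fun=> True))
  (L_closed : forall y, algebraic_over L y -> L y)
  (ind : forall n, ~ algebraic_over (gen (L `|` [set x m | m in [set m | m != n]])) (x n))
  (dns : forall y, gen (L `|` range x) y -> dense O L y).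

(** [x 0] plays the role of z. As polynomials in z these forms have the distinct roots -1 / (n + 1),
    which is the source of independence modulo q-th powers. *)
Definition unit_form n : V := 1 + n.+1%:R * x 0%N.
Definition monomial (s : seq nat) : V := \prod_(n <- s) unit_form n.
Definition monomials : set V := [set monomial s | s in S0].

Lemma L_nat n : L n%:R. Proof. exact: sf_nat. Qed.

Lemma unit_form_neq0 n : unit_form n != 0.
Proof.
apply/eqP => e; apply: (ind (n := 0%N)); apply: algebraic_of; first exact: gen_subfield.
apply: hull_sub; left; have -> : x 0%N = - (n.+1%:R)^-1.
  apply: (mulfI (char0 n)); rewrite mulrN divff //; apply/eqP; rewrite -subr_eq0 opprK addrC.
  exact/eqP.
by apply: (sfN sfL); apply: (sfV sfL); apply: L_nat.
Qed.

Lemma monomial_neq0 s : monomial s != 0.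
Proof. by rewrite /monomial; elim/big_ind: _ => [|y z|n _]; rewrite ?oner_neq0 ?unit_form_neq0 //;
  apply: mulf_neq0. Qed.

Lemma monomial_sub (B : set V) s : subfield B -> L `<=` B -> B (x 0%N) -> B (monomial s).
Proof.
move=> sfB LB Bx; apply: (sf_prod sfB) => n _; apply: (sfD sfB); first exact: sf1.
by apply: (sfM sfB) => //; apply/LB/L_nat.
Qed.

Section OneModel.
Variables (l q : nat).
Hypotheses (l_prime : prime l) (q_prime : prime q) (q_odd : odd q) (lq : (l < q)%N).
Notation M := (power_closure l q monomials (L `|` range x)).

Lemma model_subfield : subfield M. Proof. by case: (power_closureP l q monomials (L `|` range x)). Qed.
Lemma model_sub y : L y -> M y. Proof. by move=> Ly; apply: hull_sub; left. Qed.
Lemma model_gen n : M (x n). Proof. by apply: hull_sub; right; exists n. Qed.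

Lemma monomials_gen : monomials `<=` gen (L `|` range x).
Proof.
move=> _ [s _ <-]; apply: (monomial_sub _ (gen_subfield _)).
  by move=> y Ly; apply: hull_sub; left.
by apply: hull_sub; right; exists 0%N.
Qed.

Lemma model_dense y : M y -> dense O L y.
Proof.
move=> My; have sfB := gen_subfield (L `|` range x).
apply: (algebraic_dense sfL Lpi pi0 pi1 char0 hensV L_closed sfB dns).
suff sub : M `<=` algebraic_over (gen (L `|` range x)) by apply: sub.
apply: hull_min; first exact: (algebraic_power_closed q sfB (prime_gt0 l_prime) monomials_gen).
by move=> z hz; apply: algebraic_of => //; apply: hull_sub.
Qed.

Lemma model_approximation n y : M y -> exists2 c, L c & vle O (y - c) (pi ^+ n * y).
Proof.
move=> My; have [ay ny] := model_dense My; have [->|y0] := eqVneq y 0.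
  by exists 0; [apply: sf0|rewrite subrr mulr0; apply: vle0].
have [b sb by_] : exists2 b, scale L b & vle O b y.
  by apply: not_negligible => /ny/eqP; apply/negP.
have [c Lc yc] : exists2 c, L c & vlt O (y - c) (pi ^+ n * b).
  apply: ay; apply: (scaleM sfL) => //; split; first exact: (sfX sfL).
  by rewrite expf_neq0.
exists c => //; apply: vltW; apply: vlt_le_trans yc _; apply: vleM => //; exact: vle_refl.
Qed.

(** Since l is a unit, Hensel's lemma in V gives an l-th root of 1 + w for small w; M is closed
    under exactly these roots. *)
Lemma model_positive e y : vle O 1 l%:R -> monomials e -> M y -> vlt O (e * y ^+ (l * q)) 1 ->
  exists2 r, M r & r ^+ l = 1 + e * y ^+ (l * q).
Proof.
move=> l1 E0e My small; set w := e * y ^+ (l * q).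
have l0 := prime_gt0 l_prime.
pose g := \poly_(i < l.+1) (if i == 0%N then - w else 'C(l, i)%:R).
have gE s : g.[s] = (1 + s) ^+ l - (1 + w).
  rewrite horner_poly exprDn !big_ord_recl /= bin0 expr0 mulr1n !mulr1 expr1n opprD.
  rewrite [RHS]addrACA subrr add0r [LHS]addrC; congr (_ + _); apply: eq_bigr => i _ /=.
  by rewrite expr1n mul1r mulr_natl.
have [|||s [_ s1 rs]] := hensV (g := g) (fun=> I).
- move=> i; rewrite coef_poly; case: ifP => _; last exact: vring0.
  by case: ifP => _; [apply/vringN/vlt_ring|apply: vring_nat].
- by rewrite coef_poly /=; apply/vltN.
- by rewrite coef_poly /= bin1 ltnS l0.
have sE : (1 + s) ^+ l = 1 + w by apply/eqP; rewrite -subr_eq0 -gE.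
exists (1 + s) => //.
by have [_ _ h] := power_closureP l q monomials (L `|` range x); apply: (h _ e y).
Qed.

Lemma small_multiple h y : bounded O L h -> bounded O L y ->
  exists2 a, scale L a & vlt O (h * (a * y) ^+ (l * q)) 1.
Proof.
move=> [b sb hb] [d sd yd]; have s1 := scale1 sfL.
have [b' [sb' bb' b1]] := scale_max O sb s1.
have [d' [sd' dd' d1]] := scale_max O sd s1.
have [[Lb b0] [Ld d0]] := (sb', sd').
have sa : scale L (pi / (b' * d')) by apply: (scale_div sfL) => //; apply: (scaleM sfL).
(* One factor of the power absorbs h and y and leaves pi to spare; the remaining factors are
   integral, because b' also dominates 1. *)
exists (pi / (b' * d')) => //.
have n0 : (0 < l * q)%N by rewrite muln_gt0 !prime_gt0.
rewrite -(prednK n0) exprS mulrA; apply: vltM1; last first.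
  apply/vringX/vle1; rewrite mulrAC vle_div ?mulf_neq0 // mul1r.
  apply: vleM; last exact: vle_trans dd'.
  by apply: vle_trans b1; apply: vltW.
have -> : h * (pi / (b' * d') * y) = pi * ((h / b') * (y / d')) by field; rewrite b0 d0.
apply: vltM1 => //; apply: vringM; apply/vle1; rewrite vle_div // mul1r.
  exact: vle_trans bb'.
exact: vle_trans dd'.
Qed.

Definition solvable_at (h : V) : Prop := forall y, M y -> vlt O (h * y ^+ (l * q)) 1 ->
  exists2 r, M r & r ^+ l = 1 + h * y ^+ (l * q).

(** The index k lies beyond those occurring in h, and k > 0 keeps z = [x 0], and with it all
    monomials, in the smaller field. *)
Lemma model_finite h : M h ->
  exists k, (0 < k)%N /\ power_closure l q monomials (L `|` [set x m | m in [set m | m != k]]) h.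
Proof.
move=> Mh; pose X N := L `|` [set x m | m in [set m | (m < N)%N]].
have Xa : ascending X.
  by move=> i j ij y [Ly|[m mi <-]]; [left|right; exists m => //; apply: leq_trans ij].
have [N _ hN] : (\bigcup_n power_closure l q monomials (X n)) h.
  apply: (power_closure_union Xa); apply: hullS Mh => y [Ly|[m _ <-]].
    by exists 0%N => //; left.
  by exists m.+1 => //; right; exists m => /=.
exists N.+1; split=> //; apply: hullS hN => y [Ly|[m mN <-]]; first by left.
by right; exists m => //=; rewrite neq_ltn ltnS ltnW.
Qed.

(** [unsolvable_above] is applied over the closure of all generators but [x k], with y = a [x k],
    the scalar a making h y^(lq) small. The field E it provides is power closed and contains all
    generators, hence contains M. *)
Lemma model_negative h : M h -> h != 0 -> solvable_at h ->
  exists e j t, [/\ monomials e, M t & e = h ^+ j * t ^+ q].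
Proof.
move=> Mh h0 sol; have [k [k0 Bh]] := model_finite Mh.
set X := L `|` _ in Bh; set B := power_closure l q monomials X in Bh.
have [sfB _ _] := power_closureP l q monomials X; rewrite -/B in sfB.
have XM : X `<=` L `|` range x by move=> y [Ly|[m _ <-]]; [left|right; exists m].
have LB y : L y -> B y by move=> Ly; apply: hull_sub; left.
have Bx m : m != k -> B (x m) by move=> mk; apply: hull_sub; right; exists m.
have E0B e : monomials e -> B e.
  by move=> [s _ <-]; apply: (monomial_sub _ sfB) => //; apply: Bx; rewrite eq_sym -lt0n.
have E0X e : monomials e -> gen X e.
  move=> [s _ <-]; apply: (monomial_sub _ (gen_subfield _)).
    by move=> y Ly; apply: hull_sub; left.
  by apply: hull_sub; right; exists 0%N => //=; rewrite eq_sym -lt0n.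
have bh : bounded O L h by have [/(approximable_bounded sfL)] := model_dense Mh.
have bx : bounded O L (x k) by have [/(approximable_bounded sfL)] := model_dense (model_gen k).
have [a [La a0] small] := small_multiple bh bx.
have transc : ~ algebraic_over B (a * x k).
  move=> ay; have sfX := gen_subfield X; have sfA := algebraic_subfield sfX.
  have BA : B `<=` algebraic_over (gen X).
    apply: hull_min; first by apply: algebraic_power_closed => //; rewrite prime_gt0.
    by move=> y Xy; apply: algebraic_of => //; apply: hull_sub.
  have {ay} [n [g [Bg g0 _ rg]]] := ay.
  apply: (ind (n := k)); rewrite -/X -[x k](mulKf a0); apply: (sfM sfA).
    by apply: (sfV sfA); apply: BA; apply: LB.
  by apply: (algebraic_root sfX g0 _ rg) => i; apply: BA.
apply: contrapT => nex.
have exact_h e j z : monomials e -> B z -> e <> h ^+ j * z ^+ q.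
  by move=> me Bz eE; apply: nex; exists e, j, z; split=> //; apply: hullS Bz.
have E0nz e : monomials e -> e != 0 by move=> [s _ <-]; apply: monomial_neq0.
have [E [[sfE BE Ey dE] [rE nE]]] :=
  unsolvable_above l_prime q_prime q_odd lq char0 sfB E0B E0nz Bh h0 transc exact_h.
have ME : M `<=` E.
  apply: hull_min; first by split.
  move=> y [Ly|[m _ <-]]; first by apply: BE; apply: LB.
  have [->|mk] := eqVneq m k; last by apply: BE; apply: Bx.
  by rewrite -[x k](mulKf a0); apply: (sfM sfE) => //; apply: (sfV sfE); apply: BE; apply: LB.
have [|r Mr rE'] := sol (a * x k) _ small.
  by apply: (sfM model_subfield); [apply: model_sub|apply: model_gen].
exact: nE (ME _ Mr) rE'.
Qed.

(** A q-th root in M exists already in the field generated by L and all [x m], which is rational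
    over z. There the multiplicity of the root -1 / (n + 1) is compared on both sides. *)
Lemma model_independent s t n : M t -> monomial s = t ^+ q -> (q %| count_mem n s)%N.
Proof.
move=> Mt st; pose X := L `|` [set x m | m in [set m | m != 0%N]].
have sfB := gen_subfield (L `|` range x).
have [||t' Bt' t'E] := power_closure_powers q_prime _ sfB monomials_gen (@hull_sub _ _ _) Mt.
- by rewrite prime_gt0.
- rewrite -st; apply: (monomial_sub _ (gen_subfield _)) => [y Ly|]; first by apply: hull_sub; left.
  by apply: hull_sub; right; exists 0%N.
have sfF := gen_subfield X; pose k := sbf_type (sfld sfF); pose iota : {rmorphism k -> V} := val.
have transc (g : {poly k}) : (map_poly iota g).[x 0%N] = 0 -> g = 0.
  move=> e; apply: contrapT => /eqP g0; apply: (ind (n := 0%N)).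
  exists (size (map_poly iota g)), (map_poly iota g); split=> //; last exact/eqP.
  - exact: poly_in_map.
  - by rewrite map_poly_eq0.
have frG : gen (L `|` range x) `<=` fractions iota (x 0%N).
  apply: hull_min; first exact: fractions_subfield transc.
  have frX y : X y -> fractions iota (x 0%N) y.
    move=> Xy; have gy : gen X y by apply: hull_sub.
    exact: (fractions_const _ _ (sbf_mk (gy : sfld sfF y))).
  move=> y [Ly|[[|m] _ <-]]; [by apply: frX; left|exact: fractions_gen|].
  by apply: frX; right; exists m.+1.
have [g [h [h0 t'gh]]] := frG _ Bt'.
pose a m : {poly k} := m.+1%:R%:P * ('X - (- (m.+1%:R)^-1)%:P).
have k0 m : m.+1%:R != 0 :> k by rewrite -(fmorph_eq0 iota) rmorph_nat.
have aE m : (map_poly iota (a m)).[x 0%N] = unit_form m.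
  have i1 : iota m.+1%:R = m.+1%:R by apply: rmorph_nat.
  have i2 : iota (- (m.+1%:R)^-1) = - (m.+1%:R)^-1 by rewrite -[in RHS]i1 -fmorphV -rmorphN.
  have -> : (map_poly iota (a m)).[x 0%N] = iota m.+1%:R * (x 0%N - iota (- (m.+1%:R)^-1)).
    by rewrite rmorphM rmorphB /= !map_polyC map_polyX hornerM hornerD hornerN !hornerC hornerX.
  rewrite i1 i2 opprK.
  by rewrite mulrDr divff // addrC.
have ghE : g ^+ q = (\prod_(m <- s) a m) * h ^+ q.
  apply/eqP; rewrite -subr_eq0; apply/eqP/transc.
  rewrite rmorphB hornerD hornerN rmorphM !rmorphXn hornerM !horner_exp.
  have -> : (map_poly iota (\prod_(m <- s) a m)).[x 0%N] = monomial s.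
    by rewrite rmorph_prod horner_prod; apply: eq_bigr => m _; rewrite aE.
  rewrite st -t'E t'gh expr_div_n divfK ?subrr // expf_neq0 //.
  by apply: contra h0 => /eqP/transc ->.
have a0 m : a m != 0 by rewrite mulf_neq0 ?polyC_eq0 ?polyXsubC_eq0.
have pa0 : \prod_(m <- s) a m != 0.
  by elim/big_ind: _ => [|y z|m _]; [exact: oner_neq0|exact: mulf_neq0|].
have g0 : g != 0.
  apply: contraNneq (mulf_neq0 pa0 (expf_neq0 q h0)) => g0.
  by rewrite -ghE g0 expr0n eqn0Ngt prime_gt0.
pose r : k := - (n.+1%:R)^-1.
have mupX (f : {poly k}) j : f != 0 -> mup r (f ^+ j) = (j * mup r f)%N.
  move=> f0; elim: j => [|j IH]; last by rewrite exprS mupM ?expf_neq0 // IH mulSn.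
  by rewrite expr0 mupNroot // root1.
have mupa m : mup r (a m) = (m == n).
  have -> : (m == n) = (- (m.+1%:R)^-1 == r).
    apply/eqP/eqP => [->//|/oppr_inj/invr_inj/(congr1 iota)].
    by rewrite !(rmorph_nat iota) => /(natr_inj char0)[].
  rewrite mupMr; first by rewrite -['X - _]expr1 mup_XsubCX; case: eqP.
  by rewrite rootE hornerC.
have : mup r (g ^+ q) = mup r ((\prod_(m <- s) a m) * h ^+ q) by rewrite ghE.
rewrite mupM ?expf_neq0 // !mupX //.
have -> : mup r (\prod_(m <- s) a m) = count_mem n s.
  elim: s {pa0 ghE st} => [|m s IH]; first by rewrite big_nil mupNroot // root1.
  rewrite big_cons mupM // ?mupa ?IH //.
  by elim/big_ind: _ => [|y z|m' _]; [exact: oner_neq0|exact: mulf_neq0|].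
by move=> e; rewrite -(dvdn_addl _ (dvdn_mulr (mup r h) (dvdnn q))) -e dvdn_mulr.
Qed.

End OneModel.
End MonomialModels.

(** * Definability and recursive functions *)

Section Renaming.
Variable Lg : finType.

Fixpoint ren_term (s : nat -> nat) (t : term) : term :=
  match t with
  | Var i => Var (s i)
  | Zero => Zero
  | One => One
  | Opp t => Opp (ren_term s t)
  | Add t u => Add (ren_term s t) (ren_term s u)
  | Mul t u => Mul (ren_term s t) (ren_term s u)
  end.

Definition lift_ren (s : nat -> nat) : nat -> nat := env_cons 0%N (fun i => (s i).+1).

Fixpoint ren (s : nat -> nat) (phi : formula Lg) : formula Lg :=
  match phi with
  | Falsum => Falsum
  | Equal t u => Equal (ren_term s t) (ren_term s u)
  | Pred P t => Pred P (ren_term s t)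
  | Imp p q => Imp (ren s p) (ren s q)
  | All p => All (ren (lift_ren s) p)
  end.

Lemma eval_ren (M : structure Lg) (e : nat -> M) s t : eval e (ren_term s t) = eval (e \o s) t.
Proof. by elim: t => //= [t ->|t -> u ->|t -> u ->]. Qed.

Lemma sat_ren (M : structure Lg) (e : nat -> M) s phi : sat e (ren s phi) <-> sat (e \o s) phi.
Proof.
elim: phi e s => //= [t u|P t|p IHp q IHq|p IHp] e s; rewrite ?eval_ren //.
  by rewrite IHp IHq.
have eqe x : env_cons x e \o lift_ren s = env_cons x (e \o s) by apply/funext; case.
by split=> h x; have := h x; rewrite IHp eqe.
Qed.

Lemma ren_term_bound s t n : (forall i, s i < n)%N -> term_bound n (ren_term s t).
Proof. by move=> sn; elim: t => //= t -> u ->. Qed.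

Lemma ren_bound s phi n : (forall i, s i < n)%N -> formula_bound n (ren s phi).
Proof.
elim: phi s n => //= [t u|P t|p IHp q IHq|p IHp] s n sn; rewrite ?ren_term_bound //.
  by rewrite IHp ?IHq.
by apply: IHp => -[|i] //=; rewrite ltnS.
Qed.

Definition srel : Type := forall M : structure Lg, (nat -> M) -> Prop.

(* The environment carries arguments and parameters alike. *)
Definition udef (R : srel) : Prop := exists phi, forall M e, @sat Lg M e phi <-> R M e.

Lemma eq_udef (R R' : srel) : (forall M e, R M e <-> R' M e) -> udef R -> udef R'.
Proof. by move=> h [phi hphi]; exists phi => M e; rewrite hphi. Qed.

Lemma udef_ren (s : nat -> nat) (R : srel) : udef R -> udef (fun M e => R M (fun i => e (s i))).
Proof. by move=> [phi h]; exists (ren s phi) => M e; rewrite sat_ren h. Qed.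

Lemma udef_false : udef (fun M e => False).
Proof. by exists Falsum. Qed.

Lemma udef_imp (R R' : srel) : udef R -> udef R' -> udef (fun M e => R M e -> R' M e).
Proof. by move=> [p hp] [q hq]; exists (Imp p q) => M e /=; rewrite hp hq. Qed.

Lemma udef_all (R : forall M : structure Lg, M -> (nat -> M) -> Prop) :
  udef (fun M e => R M (e 0%N) (fun i => e i.+1)) -> udef (fun M e => forall x, R M x e).
Proof. by move=> [p hp]; exists (All p) => M e /=; split=> h x; have := h x; rewrite hp. Qed.

Lemma udef_not (R : srel) : udef R -> udef (fun M e => ~ R M e).
Proof. by move=> hR; apply: udef_imp => //; apply: udef_false. Qed.

Lemma udef_ex (R : forall M : structure Lg, M -> (nat -> M) -> Prop) :
  udef (fun M e => R M (e 0%N) (fun i => e i.+1)) -> udef (fun M e => exists x, R M x e).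
Proof.
move=> /udef_not/(@udef_all (fun M x e => ~ R M x e))/udef_not; apply: eq_udef => M e.
split=> [/existsNP[x /contrapT h]|[x h] k]; [by exists x|exact: k h].
Qed.

Lemma udef_and (R R' : srel) : udef R -> udef R' -> udef (fun M e => R M e /\ R' M e).
Proof.
move=> hR /udef_not hR'; apply: eq_udef (udef_not (udef_imp hR hR')) => M e.
by split=> [/not_implyP[? /contrapT]|[? ?] h]; [|apply: h].
Qed.

Lemma udef_and3 (R1 R2 R3 : srel) : udef R1 -> udef R2 -> udef R3 ->
  udef (fun M e => [/\ R1 M e, R2 M e & R3 M e]).
Proof.
move=> h1 h2 h3; apply: eq_udef (udef_and h1 (udef_and h2 h3)) => M e.
by split=> [[? []]|[]].
Qed.

Lemma udef_or (R R' : srel) : udef R -> udef R' -> udef (fun M e => R M e \/ R' M e).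
Proof.
move=> /udef_not hR hR'; apply: eq_udef (udef_imp hR hR') => M e.
by split=> [h|[h /(_ h)|]//]; have [k|/h k] := pselect (R M e); [left|right].
Qed.

Lemma udef_equal t u : udef (fun M e => eval e t = eval e u).
Proof. by exists (Equal t u). Qed.

Lemma sat_closure (M : structure Lg) n phi : (forall e : nat -> M, sat e (iter n (@All Lg) phi)) <->
  forall e : nat -> M, sat e phi.
Proof.
elim: n phi => //= n IH phi; split=> [h|/IH h e x]; last exact: h.
apply/IH => e; have := h (fun i => e i.+1) (e 0%N).
by congr (sat _ _); apply/funext; case.
Qed.

Lemma bound_closure n m phi : formula_bound (n + m) phi -> formula_bound m (iter n (@All Lg) phi).
Proof. by elim: n m => //= n IH m h; apply: IH; rewrite addnS. Qed.

End Renaming.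

(** * Recursiveness of syntactic operations *)

Section RecursiveFunctions.

Definition rec1 (f : nat -> nat) : Prop := recursive (fun v : 1.-tuple nat => f (thead v)).
Definition rec2 (f : nat -> nat -> nat) : Prop :=
  recursive (fun v : 2.-tuple nat => f (tnth v ord0) (tnth v ord_max)).

Lemma eq_recursive n (f g : n.-tuple nat -> nat) : f =1 g -> recursive f -> recursive g.
Proof. by move=> fg; rewrite (funext fg). Qed.

Lemma rec_comp1 n (f : nat -> nat) (g : n.-tuple nat -> nat) : rec1 f -> recursive g ->
  recursive (fun v => f (g v)).
Proof.
move=> hf hg; apply: eq_recursive (recursive_comp hf (g := fun=> g) (fun=> hg)) => v.
by rewrite /thead tnth_mktuple.
Qed.

Lemma rec_comp2 n (f : nat -> nat -> nat) (g h : n.-tuple nat -> nat) : rec2 f -> recursive g ->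
  recursive h -> recursive (fun v => f (g v) (h v)).
Proof.
move=> hf hg hh; pose gh (i : 'I_2) := if i == ord0 then g else h.
have hgh i : recursive (gh i) by rewrite /gh; case: ifP.
by apply: eq_recursive (recursive_comp hf hgh) => v; rewrite !tnth_mktuple.
Qed.

Lemma rec_const n c : recursive (fun _ : n.-tuple nat => c).
Proof.
elim: c => [|c IH]; first exact: recursive_zero.
exact: (rec_comp1 recursive_succ IH).
Qed.

Lemma rec1_id : rec1 id. Proof. exact: (recursive_proj (ord0 : 'I_1)). Qed.

Lemma rec2_prec (f : nat -> nat -> nat) (a : nat -> nat) (b : nat -> nat -> nat -> nat) : rec1 a ->
  recursive (fun v : 3.-tuple nat => b (tnth v (inord 0)) (tnth v (inord 1)) (tnth v (inord 2))) ->
  (forall y, f 0%N y = a y) -> (forall x y, f x.+1 y = b x (f x y) y) -> rec2 f.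
Proof.
move=> ha hb f0 fS; apply: (recursive_prec ha hb) => [v|x v].
  by rewrite -f0; congr (f _ _); rewrite /thead !(tnth_nth 0%N).
by rewrite !(tnth_nth 0%N) !inordK //= fS.
Qed.

Lemma rec2_add : rec2 addn.
Proof.
apply: (@rec2_prec _ id (fun _ r _ => r.+1)) => //; first exact: rec1_id.
exact: (rec_comp1 recursive_succ (recursive_proj (inord 1 : 'I_3))).
Qed.

Lemma rec2_mul : rec2 muln.
Proof.
apply: (@rec2_prec _ (fun=> 0%N) (fun _ r y => y + r)%N) => //; first exact: rec_const.
exact: (rec_comp2 rec2_add (recursive_proj (inord 2 : 'I_3)) (recursive_proj (inord 1 : 'I_3))).
Qed.

Lemma rec2_code_pair : rec2 code_pair.
Proof.
have px : recursive (fun v : 2.-tuple nat => tnth v ord0) by apply: recursive_proj.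
have py : recursive (fun v : 2.-tuple nat => tnth v ord_max) by apply: recursive_proj.
have s := rec_comp2 rec2_add px py.
exact: (rec_comp1 recursive_succ (rec_comp2 rec2_add (rec_comp2 rec2_mul s s) px)).
Qed.

Lemma rec1_code_pair (f g : nat -> nat) : rec1 f -> rec1 g -> rec1 (fun n => code_pair (f n) (g n)).
Proof. exact: rec_comp2 rec2_code_pair. Qed.

Lemma rec1_ren_term t (s : nat -> nat -> nat) : (forall i, rec1 (s^~ i)) ->
  rec1 (fun n => term_code (ren_term (s n) t)).
Proof.
move=> hs; have c k : rec1 (fun=> k) by apply: rec_const.
by elim: t => /= *; do ?[exact: c|exact: hs|apply: rec1_code_pair => //].
Qed.

Lemma rec1_ren (Lg : finType) (phi : formula Lg) (s : nat -> nat -> nat) : (forall i, rec1 (s^~ i)) ->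
  rec1 (fun n => formula_code (ren (s n) phi)).
Proof.
have c k : rec1 (fun=> k) by apply: rec_const.
elim: phi s => [|t u|P t|p IHp q IHq|p IHp] s hs /=;
  do ?[exact: c|exact: rec1_ren_term|exact: IHp|exact: IHq|apply: rec1_code_pair].
apply: IHp => -[|i]; first exact: c.
exact: (rec_comp1 recursive_succ (hs i)).
Qed.

End RecursiveFunctions.

(** Numbers, zero, equality, successor, order, sequence entries. Addition and multiplication are
    absent: with coded sequences all recursive functions come from successor. *)
Record arith (T : Type) : Type := Arith {
  aV : T -> Prop; aZ : T -> Prop; aE : T -> T -> Prop; aS : T -> T -> Prop;
  aL : T -> T -> Prop; aN : T -> T -> T -> Prop
}.

(* aN c i y says that the i-th entry of the sequence with code c is y. *)
Record arith_ax (T : Type) (a : arith T) : Prop := ArithAx {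
  aE_refl : forall x, aE a x x;
  aE_sym : forall x y, aE a x y -> aE a y x;
  aE_trans : forall x y z, aE a x y -> aE a y z -> aE a x z;
  aZ_eq : forall x y, aZ a x -> aE a x y -> aZ a y;
  aZ_uniq : forall x y, aZ a x -> aZ a y -> aE a x y;
  aZ_ex : exists x, aZ a x;
  aZ_V : forall x, aZ a x -> aV a x;
  aS_eq : forall x y x' y', aS a x y -> aE a x x' -> aE a y y' -> aS a x' y';
  aS_uniq : forall x y y', aS a x y -> aS a x y' -> aE a y y';
  aS_ex : forall x, aV a x -> exists y, aS a x y;
  aS_V : forall x y, aS a x y -> aV a y;
  aS_Z : forall x y, aZ a y -> ~ aS a x y;
  aL_Z : forall i x, aZ a x -> ~ aL a i x;
  aL_S : forall i x y, aS a x y -> aL a i y -> aL a i x \/ aE a i x;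
  aL_S' : forall i x y, aS a x y -> aL a i x \/ aE a i x -> aL a i y;
  aL_total : forall x y, aV a x -> aV a y -> aL a x y \/ aE a x y \/ aL a y x;
  aN_eq : forall c i y i' y', aN a c i y -> aE a i i' -> aE a y y' -> aN a c i' y';
  aN_uniq : forall c i y y', aN a c i y -> aN a c i y' -> aE a y y';
  aN_base : forall y, aV a y -> exists c i, aZ a i /\ aN a c i y;
  aN_step : forall c i j y, aS a i j -> aV a y -> exists c',
    (forall k z, aL a k j -> aN a c k z -> aN a c' k z) /\ aN a c' j y
}.

Section Numerals.
Variables (T : Type) (a : arith T).
Hypothesis ax : arith_ax a.

Fixpoint num (n : nat) (x : T) : Prop :=
  if n is n'.+1 then exists2 y, num n' y & aS a y x else aZ a x.

Lemma num_V n x : num n x -> aV a x.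
Proof. by case: n => [/(aZ_V ax)|n [y _ /(aS_V ax)]]. Qed.

Lemma num_ex n : exists x, num n x.
Proof.
elim: n => [|n [x nx]]; first exact: (aZ_ex ax).
by have [y xy] := aS_ex ax (num_V nx); exists y, x.
Qed.

Lemma num_eq n x y : num n x -> aE a x y -> num n y.
Proof.
case: n => [|n] /=; first exact: (aZ_eq ax).
by move=> [z nz zx] xy; exists z => //; apply: (aS_eq ax zx (aE_refl ax _) xy).
Qed.

Lemma num_uniq n x y : num n x -> num n y -> aE a x y.
Proof.
elim: n x y => [|n IH] x y /=; first exact: (aZ_uniq ax).
move=> [z nz zx] [t nt ty]; apply: (aS_uniq ax zx).
by apply: (aS_eq ax ty (IH _ _ nt nz) (aE_refl ax _)).
Qed.

Lemma num_lt m n x y : num m x -> num n y -> (m < n)%N -> aL a x y.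
Proof.
elim: n y => // n IH y mx [z nz zy]; rewrite ltnS leq_eqVlt => /orP[/eqP mn|mn].
  by apply: (aL_S' ax zy); right; rewrite -mn in nz; apply: (num_uniq mx nz).
by apply: (aL_S' ax zy); left; apply: IH.
Qed.

Lemma num_lt_inv n x y : num n y -> aL a x y -> exists2 m, (m < n)%N & num m x.
Proof.
elim: n y => [y /(aL_Z ax) h /h//|n IH y [z nz zy] /(aL_S ax zy)[/(IH _ nz)[m mn mx]|xz]].
  by exists m => //; apply: ltnW.
by exists n => //; apply: (num_eq nz (aE_sym ax xz)).
Qed.

Lemma num_zero n x : num n x -> aZ a x -> n = 0%N.
Proof. by case: n => // n [y _ yx] /(aS_Z ax)/(_ yx). Qed.

(** [T] may contain nonstandard numbers; nothing is required at nonstandard arguments. *)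
Definition represents n (f : n.-tuple nat -> nat) (R : (nat -> T) -> T -> Prop) : Prop :=
  forall (v : n.-tuple nat) x, (forall i, (i < n)%N -> num (nth 0%N v i) (x i)) ->
    forall y, R x y <-> num (f v) y.

(** Values are prepended to z from the index k - 1 down to 0, so that z ends up listing them in
    order. *)
Fixpoint rcomp (R : nat -> (nat -> T) -> T -> Prop) (Rf : (nat -> T) -> T -> Prop) (x : nat -> T)
    (k : nat) (z : nat -> T) (y : T) : Prop :=
  if k is k'.+1 then exists t, R k' x t /\ rcomp R Rf x k' (env_cons t z) y else Rf z y.

Lemma represents_comp m n (f : m.-tuple nat -> nat) (g : 'I_m -> n.-tuple nat -> nat)
    (R : nat -> (nat -> T) -> T -> Prop) Rf :
  represents f Rf -> (forall i : 'I_m, represents (g i) (R i)) ->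
  represents (fun v => f [tuple g i v | i < m]) (fun x => rcomp R Rf x m x).
Proof.
move=> hf hg v x xv y.
pose w := [tuple g i v | i < m].
suff h k z : (k <= m)%N -> (forall i, (k + i < m)%N -> num (nth 0%N w (k + i)) (z i)) ->
    rcomp R Rf x k z y <-> num (f w) y by apply: h => // i; rewrite ltnNge leq_addr.
elim: k z => [|k IH] z km hz; first exact: hf.
have gk t : R k x t <-> num (nth 0%N w k) t.
  by rewrite (hg (Ordinal km) v x xv) -(nth_mktuple (g^~ v) 0%N (Ordinal km)).
have hz' t : R k x t -> forall i, (k + i < m)%N -> num (nth 0%N w (k + i)) (env_cons t z i).
  move=> /gk kt [|i]; first by rewrite addn0.
  by rewrite addnS -addSn; apply: hz.
split=> /= [[t [kt /(IH _ (ltnW km) (hz' t kt))//]]|ny].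
have [t kt] := num_ex (nth 0%N w k); exists t; have {}kt := (gk t).2 kt.
by split=> //; apply/(IH _ (ltnW km) (hz' t kt)).
Qed.

(** Goedel's device: c codes the sequence of values up to [x 0]. *)
Definition rprec (Rf Rg : (nat -> T) -> T -> Prop) (x : nat -> T) (y : T) : Prop :=
  exists c, (exists i z, [/\ aZ a i, aN a c i z & Rf (fun k => x k.+1) z]) /\
    (forall i j, aL a i (x 0%N) -> aS a i j -> exists z w,
       [/\ aN a c i z, Rg (env_cons i (env_cons z (fun k => x k.+1))) w & aN a c j w]) /\
    aN a c (x 0%N) y.

Lemma represents_prec n (f : n.-tuple nat -> nat) (g : n.+2.-tuple nat -> nat)
    (h : n.+1.-tuple nat -> nat) Rf Rg :
  represents f Rf -> represents g Rg ->
  (forall v : n.-tuple nat, h [tuple of 0%N :: v] = f v) ->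
  (forall x (v : n.-tuple nat), h [tuple of x.+1 :: v] =
                 g [tuple of [:: x, h [tuple of x :: v] & v]]) ->
  represents h (rprec Rf Rg).
Proof.
move=> hf hg h0 hS v0 x; case/tupleP: v0 => m v xv y.
have nx0 : num m (x 0%N) by apply: (xv 0%N).
have xv' i : (i < n)%N -> num (nth 0%N v i) (x i.+1) by move=> ni; apply: (xv i.+1).
have gk k i z w : num k i -> num (h [tuple of k :: v]) z ->
    Rg (env_cons i (env_cons z (fun k => x k.+1))) w <-> num (h [tuple of k.+1 :: v]) w.
  by move=> ki hz; rewrite hS; apply: hg => -[|[|j]] //; rewrite !ltnS; apply: xv'.
split=> [[c [[i0 [z0 [i00 ciz fz]]] [step cxy]]]|ny].
  (* The code c may be nonstandard, but the induction runs only over the standard k up to m. *)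
  have hc k : (k <= m)%N -> forall i z, num k i -> aN a c i z -> num (h [tuple of k :: v]) z.
    elim: k => [|k IH] km i z /=.
      move=> i0z ciz'; rewrite h0; apply: (num_eq (x := z0)); first exact/(hf _ _ xv').
      apply: (aN_uniq ax ciz); apply: (aN_eq ax ciz' _ (aE_refl ax _)); exact: (aZ_uniq ax).
    move=> [j kj ji] ciz'; have jx : aL a j (x 0%N) by apply: (num_lt kj nx0 km).
    have [t [w [cjt gw ciw]]] := step j i jx ji.
    have ht := IH (ltnW km) _ _ kj cjt.
    by apply: num_eq (aN_uniq ax ciw ciz'); apply/(gk _ _ _ _ kj ht).
  exact: (hc _ (leqnn m) _ _ nx0 cxy).
(* The code is extended by one entry at a time; [aN_step] preserves the entries before the new one,
   which is enough. *)
have [c hc] : exists c, forall k, (k <= m)%N -> forall i z, num k i ->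
    num (h [tuple of k :: v]) z -> aN a c i z.
  elim: (m) => [|m' [c hc]].
    have [t ht] := num_ex (h [tuple of 0%N :: v]).
    have [c [i [iz cit]]] := aN_base ax (num_V ht); exists c => k;
      rewrite leqn0 => /eqP -> i' z' /= i'z hz.
    by apply: (aN_eq ax cit); [apply: (aZ_uniq ax)|apply: (num_uniq ht hz)].
  have [t ht] := num_ex (h [tuple of m'.+1 :: v]); have [i mi] := num_ex m'.
  have [j ij] := aS_ex ax (num_V mi); have [c' [c'L c'j]] := aN_step ax c ij (num_V ht).
  have mj : num m'.+1 j by exists i.
  exists c' => k; rewrite leq_eqVlt => /orP[/eqP->|km] i' z' ki' hz.
    by apply: (aN_eq ax c'j); [apply: (num_uniq mj ki')|apply: (num_uniq ht hz)].
  by apply: c'L; [apply: (num_lt ki' mj km)|apply: (hc _ _ _ _ ki' hz)].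
exists c; split; last split; last exact: (hc _ (leqnn m) _ _ nx0 ny).
  have [i iz] := num_ex 0; have [z hz] := num_ex (f v); exists i, z; split=> //.
    by apply: (hc 0%N) => //; rewrite h0.
  exact/(hf _ _ xv').
move=> i j /(num_lt_inv nx0)[k km ki] ij; have kj : num k.+1 j by exists i.
have [z hz] := num_ex (h [tuple of k :: v]); have [w hw] := num_ex (h [tuple of k.+1 :: v]).
exists z, w; split; [exact: (hc _ (ltnW km) _ _ ki hz)|exact/(gk _ _ _ _ ki hz)|exact: (hc _ km _ _
  kj hw)].
Qed.

Definition rmin (Rg : (nat -> T) -> T -> Prop) (x : nat -> T) (y : T) : Prop :=
  [/\ aV a y, exists w, Rg (env_cons y x) w /\ aZ a w &
    forall i, aL a i y -> exists w, Rg (env_cons i x) w /\ ~ aZ a w].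

(** A candidate y is compared with the numeral of h(v) by [aL_total]. If it is smaller, it is
    standard and g does not vanish there; if it is larger, the numeral violates its minimality. *)
Lemma represents_min n (g : n.+1.-tuple nat -> nat) (h : n.-tuple nat -> nat) Rg :
  represents g Rg -> (forall v : n.-tuple nat, g [tuple of h v :: v] = 0%N) ->
  (forall (v : n.-tuple nat) y, (y < h v)%N -> g [tuple of y :: v] <> 0%N) ->
  represents h (rmin Rg).
Proof.
move=> hg g0 gS v x xv y.
have gk k i w : num k i -> Rg (env_cons i x) w <-> num (g [tuple of k :: v]) w.
  by move=> ki; apply: hg => -[|j] //; rewrite ltnS; apply: xv.
split=> [[Vy [w [gw w0]] low]|hy]; last first.
  split; first exact: num_V hy.
    have [w hw] := num_ex (g [tuple of h v :: v]); exists w; split; first exact/(gk _ _ _ hy).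
    by move: hw; rewrite g0.
  move=> i /(num_lt_inv hy)[k kh ki]; have [w hw] := num_ex (g [tuple of k :: v]).
  exists w; split; first exact/(gk _ _ _ ki).
  by move/(num_zero hw); apply: gS.
have [t ht] := num_ex (h v); have [yt|[yt|ty]] := aL_total ax Vy (num_V ht).
- have [k kh ky] := num_lt_inv ht yt; case: (gS v k kh).
  by apply: (num_zero _ w0); apply/(gk _ _ _ ky).
- exact: (num_eq ht (aE_sym ax yt)).
- have [w' [gw' nw']] := low t ty; case: nw'.
  by have := (gk _ _ _ ht).1 gw'; rewrite g0.
Qed.

End Numerals.

Section Representability.
Variables (Lg : finType) (A : forall M : structure Lg, (nat -> M) -> arith M).
Hypotheses (uV : forall s i, udef (fun M e => aV (A (fun k => e (s k))) (e i)))
  (uZ : forall s i, udef (fun M e => aZ (A (fun k => e (s k))) (e i)))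
  (uE : forall s i j, udef (fun M e => aE (A (fun k => e (s k))) (e i) (e j)))
  (uS : forall s i j, udef (fun M e => aS (A (fun k => e (s k))) (e i) (e j)))
  (uL : forall s i j, udef (fun M e => aL (A (fun k => e (s k))) (e i) (e j)))
  (uN : forall s i j h, udef (fun M e => aN (A (fun k => e (s k))) (e i) (e j) (e h))).

Ltac udef_step := first [apply: uV | apply: uZ | apply: uE | apply: uS | apply: uL | apply: uN
  | apply: udef_and | apply: udef_or | apply: udef_not | apply: udef_imp | apply: udef_ex |
    apply: udef_all].

Lemma udef_arith_ax : udef (fun M e => arith_ax (@A M e)).
Proof.
refine (@eq_udef _ (fun M e => _ /\ _ /\ _ /\ _ /\ _ /\ _ /\ _ /\ _ /\ _ /\ _ /\ _ /\ _ /\ _ /\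
  _ /\ _ /\ _ /\ _ /\ _ /\ _ /\ _) _ _ _).
  move=> M e; split=> h; first by do 19!destruct h as [? h]; constructor; eassumption.
  by case: h => *; do 19?split.
do !udef_step.
Qed.

Definition prel : Type := forall M : structure Lg, (nat -> M) -> (nat -> M) -> M -> Prop.

Definition udef_prel (R : prel) : Prop :=
  forall s t c, udef (fun M e => R M (fun k => e (s k)) (fun k => e (t k)) (e c)).

Lemma env_cons_map (M : Type) (e : nat -> M) i t :
  env_cons (e i) (fun k => e (t k)) = (fun k => e (env_cons i t k)).
Proof. by apply/funext; case. Qed.

Theorem representable n (f : n.-tuple nat -> nat) : recursive f -> exists R : prel,
  udef_prel R /\ forall M p, arith_ax (@A M p) -> represents (A p) f (R M p).
Proof.
elim=> {n f} [n||n i|m n f g _ [Rf [uf hf]] _ IHg|n f g h _ [Rf [uf hf]] _ [Rg [ug hg]] h0 hS|n g h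
  _ [Rg [ug hg]] g0 gS].
- by exists (fun M p x y => aZ (A p) y); split.
- exists (fun M p x y => aS (A p) (x 0%N) y); split=> [s t c|M p ax v x xv y]; first exact: uS.
  have v0 : num (A p) (thead v) (x 0%N) by rewrite /thead (tnth_nth 0%N); apply: xv.
  split=> [xy|[z vz zy]]; first by exists (x 0%N).
  by apply: (aS_eq ax zy _ (aE_refl ax _)); apply: num_uniq vz v0.
- exists (fun M p x y => aE (A p) (x i) y); split=> [s t c|M p ax v x xv y]; first exact: uE.
  have vi : num (A p) (tnth v i) (x i) by rewrite (tnth_nth 0%N); apply: xv.
  by split=> [xy|/(num_uniq ax vi)//]; apply: num_eq vi xy.
- have /choice[Rg hRg] := IHg.
  pose G k : prel := if insub k is Some i then Rg i else fun M p x y => aE (A p) y y.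
  have uG k : udef_prel (G k).
    rewrite /G; case: insubP => [i _ _|_]; first exact: (hRg i).1.
    by move=> s t c; apply: uE.
  exists (fun M p x y => rcomp (fun k => G k M p) (Rf M p) x m x y); split=> [s t c|M p ax].
    suff h k s' t' z' c' : udef (fun M e => rcomp (fun k => G k M (fun i =>
      e (s' i))) (Rf M (fun i => e (s' i)))
       (fun i => e (t' i)) k (fun i => e (z' i)) (e c')) by apply: h.
    elim: k s' t' z' c' => [|k IH] s' t' z' c' /=; first exact: uf.
    apply: udef_ex; apply: udef_and; first exact: uG.
    have := IH (fun i => (s' i).+1) (fun i => (t' i).+1) (env_cons 0%N (fun i => (z' i).+1)) c'.+1.
    by apply: eq_udef => M e; rewrite -env_cons_map.
  apply: represents_comp; [by []|exact: hf|].
  by move=> i; rewrite /G valK; apply: (hRg i).2.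
- exists (fun M p x y => rprec (A p) (Rf M p) (Rg M p) x y); split=> [s t c|M p ax]; last first.
    by apply: represents_prec; [by []|exact: hf|exact: hg|exact: h0|exact: hS].
  have ug' s' t' i j c' : udef (fun M e => Rg M (fun k => e (s' k))
      (env_cons (e i) (env_cons (e j) (fun k => e (t' k)))) (e c')).
    have := ug s' (env_cons i (env_cons j t')) c'.
    by apply: eq_udef => M e; rewrite -!env_cons_map.
  apply: udef_ex; apply: udef_and; first by do 2!apply: udef_ex; apply: udef_and3;
    [apply: uZ|apply: uN|apply: uf].
  apply: udef_and; last exact: uN.
  do 2!apply: udef_all; apply: udef_imp; first exact: uL.
  apply: udef_imp; first exact: uS.
  by do 2!apply: udef_ex; apply: udef_and3; [apply: uN|apply: ug'|apply: uN].
- exists (fun M p x y => rmin (A p) (Rg M p) x y); split=> [s t c|M p ax]; last first.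
    by apply: represents_min; [by []|exact: hg|exact: g0|exact: gS].
  have ug' s' t' i c' : udef (fun M e => Rg M (fun k => e (s' k)) (env_cons (e i) (fun k =>
    e (t' k))) (e c')).
    by have := ug s' (env_cons i t') c'; apply: eq_udef => M e; rewrite -env_cons_map.
  apply: udef_and3; first exact: uV.
    by apply: udef_ex; apply: udef_and; [apply: ug'|apply: uZ].
  apply: udef_all; apply: udef_imp; first exact: uL.
  by apply: udef_ex; apply: udef_and; [apply: ug'|apply: udef_not; apply: uZ].
Qed.

(** Reads only the first P entries of an environment as parameters, the others being replaced by
    entry 0; this bounds the free variables that a sentence has to quantify. *)
Definition clip (P k : nat) : nat := if (k < P)%N then k else 0%N.

(* If Cons S were recursive, so would be the set of those n for which Cons S contains the sentence
   "phi_n holds of the number n", phi_n being the formula with code n; but this set is represented,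
   and so is its complement, by some phi_n. The variables are the parameters (the indices below P),
   n (the index P), and n - 1, ..., 0. *)
Theorem undecidable_interpretation (P : nat) (S : set (formula Lg)) (M : structure Lg) (p : nat -> M) :
  (0 < P)%N -> (forall k, p k = p (clip P k)) -> (forall psi, S psi -> models M psi) ->
  arith_ax (A p) -> undecidable (Cons S).
Proof.
move=> P0 pP MS axp [chi recchi chiP].
have [Fax hax] := udef_arith_ax; have [FZ hZ] := uZ succn 0; have [FS hS] := uS (fun k => k.+2) 0 1.
pose cl := clip P; have clP k : (cl k < P)%N by rewrite /cl /clip; case: ifP.
have clK k : cl (cl k) = cl k by rewrite {1}/cl /clip clP.
(* Placement of the arguments: the variable P + n is zero and each P + j is the successor of P + (j
   + 1), so that the variable P holds n. *)
pose sZ n : nat -> nat := env_cons (P + n)%N cl.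
pose sS j : nat -> nat := env_cons (P + j.+1)%N (env_cons (P + j)%N cl).
pose fix chain j phi {struct j} : formula Lg :=
  if j is j'.+1 then Imp (ren (sS j') FS) (chain j' phi) else phi.
pose delta n phi := iter (P + n).+1 (@All Lg) (Imp (ren cl Fax) (Imp (ren (sZ n) FZ) (chain n phi))).
(* The code of the sentence as a function of n alone, which is possible because n is itself the code
   of [phi]. *)
pose fix dchain j n {struct j} :=
  if j is j'.+1 then code_pair 3 (code_pair (formula_code (ren (sS j') FS)) (dchain j' n)) else n.
pose d n := iter (P + n).+1 (code_pair 4) (code_pair 3 (code_pair (formula_code (ren cl Fax))
   (code_pair 3 (code_pair (formula_code (ren (sZ n) FZ)) (dchain n n))))).
have dE n phi : formula_code phi = n -> formula_code (delta n phi) = d n.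
  move=> phin; rewrite /delta /d.
  have -> k psi : formula_code (iter k (@All Lg) psi) = iter k (code_pair 4) (formula_code psi).
    by elim: k => //= k ->.
  congr (iter _ _ _); rewrite /=; do 4!congr (code_pair _ _).
  suff h j : formula_code (chain j phi) = dchain j n by apply: h.
  by elim: j => //= j ->.
have recd : rec1 d.
  have c k : rec1 (fun=> k) by apply: rec_const.
  have addP k : rec1 (fun n => k + n)%N.
    by apply: (rec_comp2 rec2_add); [apply: rec_const|apply: rec1_id].
  have recS : rec1 (fun j => formula_code (ren (sS j) FS)).
    apply: rec1_ren => -[|[|i]] //=; rewrite /sS /=.
    by apply: (rec_comp1 (addP P)); apply: recursive_succ.
  have recdc : rec2 dchain.
    apply: (@rec2_prec _ id (fun j r _ =>
      code_pair 3 (code_pair (formula_code (ren (sS j) FS)) r))) => //.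
      exact: rec1_id.
    apply: (rec_comp2 rec2_code_pair); first exact: rec_const.
    apply: (rec_comp2 rec2_code_pair); last exact: recursive_proj.
    exact: (rec_comp1 recS (recursive_proj _)).
  have reci : rec2 (fun k c => iter k (code_pair 4) c).
    apply: (@rec2_prec _ id (fun _ r _ => code_pair 4 r)) => //; first exact: rec1_id.
    by apply: (rec_comp2 rec2_code_pair); [apply: rec_const|apply: recursive_proj].
  apply: (rec_comp2 reci).
    exact: (rec_comp1 recursive_succ (addP P)).
  do 3![apply: (rec_comp2 rec2_code_pair); first exact: rec_const].
  apply: (rec_comp2 rec2_code_pair); last exact: (rec_comp2 recdc rec1_id rec1_id).
  by apply: (rec1_ren FZ) => -[|i] //=.
have recf : rec1 (fun n => chi [tuple d n]).
  apply: eq_recursive (recursive_comp recchi (g := fun=> fun v => d (thead v)) (fun=> recd)) => v.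
  by congr chi; apply: eq_from_tnth => i; rewrite tnth_mktuple (tnth_nth 0%N) (ord1 i).
have [R [uR hR]] := representable recf.
(* [chi] vanishes at [d x]: the diagonal sentence with index x does not follow from S. *)
pose Q (M : structure Lg) (p : nat -> M) x := exists y, R M p (fun=> x) y /\ aZ (A p) y.
have [phi0 hphi0] : udef (fun M e => Q M (fun k => e (cl k)) (e P)).
  by apply: udef_ex; apply: udef_and; [apply: uR|apply: uZ].
pose s k := if (k <= P)%N then k else 0%N.
pose phi := ren s phi0; pose n := formula_code phi.
have scl k : s (cl k) = cl k by rewrite /s ltnW.
have hphi (M' : structure Lg) (e : nat -> M') : sat e phi <-> Q M' (fun k => e (cl k)) (e P).
  rewrite sat_ren hphi0 /s /= leqnn.
  by rewrite (_ : (fun k => e _) = (fun k => e (cl k))) //; apply/funext => k; rewrite -/(s _) scl.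
have chainP (M' : structure Lg) (e : nat -> M') : sat e (chain n phi) <->
    ((forall j, (j < n)%N -> aS (A (fun k => e (cl k))) (e (P + j.+1)%N) (e (P + j)%N)) -> sat e phi).
  elim: (n) => [|j IH] /=; first by split=> [h _|]; [|apply].
  rewrite IH sat_ren hS /=; split=> [h hj|h h1 h2]; first by apply: h => [|i ij]; apply: hj => //;
    apply: ltnW.
  by apply: h => i; rewrite ltnS leq_eqVlt => /orP[/eqP->//|/h2].
have bodyP (M' : structure Lg) : models M' (delta n phi) <-> forall e : nat -> M',
    arith_ax (A (fun k => e (cl k))) -> aZ (A (fun k => e (cl k))) (e (P + n)%N) ->
    (forall j, (j < n)%N -> aS (A (fun k => e (cl k))) (e (P + j.+1)%N) (e (P + j)%N)) ->
    Q M' (fun k => e (cl k)) (e P).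
  rewrite /models sat_closure; split=> h e.
    by have := h e; rewrite /= !sat_ren hax hZ chainP hphi.
  by rewrite /= !sat_ren hax hZ chainP hphi; apply: h.
have numP (M' : structure Lg) (e : nat -> M') : aZ (A (fun k => e (cl k))) (e (P + n)%N) ->
    (forall j, (j < n)%N -> aS (A (fun k => e (cl k))) (e (P + j.+1)%N) (e (P + j)%N)) ->
    num (A (fun k => e (cl k))) n (e P).
  move=> h0 h; suff hj j : (j <= n)%N -> num (A (fun k => e (cl k))) j (e (P + (n - j))%N).
    by have := hj n (leqnn n); rewrite subnn addn0.
  elim: j => [|j IH] jn; first by rewrite subn0.
  exists (e (P + (n - j))%N); first by apply: IH; apply: ltnW.
  by rewrite -{1}(subnSK jn); apply: h; rewrite subnSK // leq_subr.
have sent : sentence (delta n phi).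
  apply: bound_closure; rewrite addn0 /=.
  have cb i : (cl i < (P + n).+1)%N by apply: leq_trans (clP i) _; rewrite -addnS leq_addr.
  apply/and3P; split; [exact: ren_bound|apply: ren_bound => -[|i]; [exact: ltnSn|exact: cb]|].
  suff h j : (j <= n)%N -> formula_bound (P + n).+1 (chain j phi) by apply: h.
  elim: j => [_|j IH jn] /=.
    apply: ren_bound => i; apply: (@leq_ltn_trans P); first by rewrite /s; case: ifP.
    by rewrite ltnS leq_addr.
  rewrite IH 1?ltnW // andbT; apply: ren_bound => -[|[|i]]; [| |exact: cb];
    rewrite /sS /= ltnS leq_add2l //; exact: ltnW.
have Xd : (@formula_code Lg @` Cons S) (d n) <-> Cons S (delta n phi).
  split=> [[psi Cpsi]|C]; last by exists (delta n phi) => //; apply: dE.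
  by rewrite -(dE n phi erefl) => /formula_code_inj <-.
have [chi1 chi0] := chiP (d n).
have hR1 (M' : structure Lg) (p' : nat -> M') x y : arith_ax (A p') -> num (A p') n x ->
    R M' p' (fun=> x) y <-> num (A p') (chi [tuple d n]) y.
  by move=> ax nx; apply: (hR M' p' ax [tuple n]) => -[|i] //.
(* If the diagonal sentence does not follow from S, then [chi] is 0 at its code, so the sentence is
   valid and does follow. If it follows, M satisfies it and gives 0 for [chi], which is 1. *)
have [Cd|nC] := pselect (Cons S (delta n phi)); last first.
  apply: (nC); split=> // M' M'S; apply/bodyP => e ax h0 h; have nP := numP M' e h0 h.
  have [y y0] := num_ex ax 0; exists y; split=> //.
  by apply/(hR1 _ _ _ _ ax nP); rewrite chi0 // => /Xd.
have /bodyP hM := Cd.2 M MS.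
have /choice[nx nxP] : forall x, exists y, aV (A p) x -> aS (A p) x y.
  move=> x; have [/(aS_ex axp)[y xy]|nV] := pselect (aV (A p) x); first by exists y.
  by exists x.
have [x0 x00] := aZ_ex axp; pose X j := iter j nx x0.
have XV j : aV (A p) (X j).
  elim: j => [|j IH]; first exact: (aZ_V axp).
  by apply: (aS_V axp (x := X j)); apply: nxP.
(* Variables below P carry the parameters, the others the numerals in descending order. *)
pose e k := if (k < P)%N then p k else X (P + n - k)%N.
have ep : (fun k => e (cl k)) = p.
  by apply/funext => k; rewrite /e clP -pP.
have eX j : e (P + j)%N = X (n - j)%N.
  by rewrite /e ltnNge leq_addr /= subnDl.
have h0 : aZ (A p) (e (P + n)%N) by rewrite eX subnn.
have h j : (j < n)%N -> aS (A p) (e (P + j.+1)%N) (e (P + j)%N).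
  by move=> jn; rewrite !eX -(subnSK jn); apply: nxP; apply: XV.
have := hM e; have := numP M e; rewrite ep => nP hQ.
have [y [Ry y0]] := hQ axp h0 h.
have := (hR1 _ _ _ _ axp (nP h0 h)).1 Ry; rewrite (chi1 (Xd.2 Cd)) => n1.
by have := num_zero axp n1 y0.
Qed.

End Representability.

(** * Arithmetic in a field *)

Section StandardModel.
Variables (T : Type) (a : arith T) (cl : T -> nat -> Prop).

Definition entry (c i y : nat) : Prop :=
  (i < size (CodeSeq.decode c))%N /\ nth 0%N (CodeSeq.decode c) i = y.

(** The labels in [cl] carry the relations to the standard ones on natural numbers, where the axioms
    hold. *)
Lemma arith_ax_classes :
  (forall x, aE a x x) -> (forall x y, aE a x y -> aE a y x) ->
  (forall x y z, aE a x y -> aE a y z -> aE a x z) ->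
  (forall n, exists x, cl x n) -> (forall x m n, cl x m -> cl x n -> m = n) ->
  (forall x y n, cl x n -> aE a x y -> cl y n) -> (forall x y n, cl x n -> cl y n -> aE a x y) ->
  (forall x, aV a x <-> exists n, cl x n) -> (forall x, aZ a x <-> cl x 0%N) ->
  (forall x y, aS a x y <-> exists n, cl x n /\ cl y n.+1) ->
  (forall x y, aL a x y <-> exists m n, [/\ cl x m, cl y n & (m < n)%N]) ->
  (forall x y z, aN a x y z <-> exists c i n, [/\ cl x c, cl y i, cl z n & entry c i n]) ->
  arith_ax a.
Proof.
move=> Er Es Et cex cu cE cS VP ZP SP LP NP; split=> //.
- by move=> x y /ZP x0 xy; apply/ZP/(cE x).
- by move=> x y /ZP x0 /ZP; apply: cS.
- by have [x x0] := cex 0%N; exists x; apply/ZP.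
- by move=> x /ZP x0; apply/VP; exists 0%N.
- move=> x y x' y' /SP[n [xn yn]] xx yy; apply/SP; exists n.
  by split; [apply: (cE x)|apply: (cE y)].
- move=> x y y' /SP[n [xn yn]] /SP[m [xm ym]]; apply: cS yn _.
  by rewrite (cu _ _ _ xn xm).
- by move=> x /VP[n xn]; have [y yn] := cex n.+1; exists y; apply/SP; exists n.
- by move=> x y /SP[n [_ yn]]; apply/VP; exists n.+1.
- by move=> x y /ZP y0 /SP[n [_ yn]]; have := cu _ _ _ y0 yn.
- by move=> i x /ZP x0 /LP[m [n [_ xn]]]; rewrite -(cu _ _ _ x0 xn).
- move=> i x y /SP[n [xn yn]] /LP[m [n' [im yn' mn]]].
  rewrite -(cu _ _ _ yn yn') ltnS leq_eqVlt in mn; case/orP: mn => [/eqP mn|mn].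
    by right; apply: (cS _ _ n) => //; rewrite -mn.
  by left; apply/LP; exists m, n.
- move=> i x y /SP[n [xn yn]] [/LP[m [n' [im xn' mn]]]|ix]; apply/LP.
    by exists m, n.+1; split=> //; rewrite (cu _ _ _ xn xn'); apply: ltnW.
  by exists n, n.+1; split=> //; apply: (cE x) => //; apply: Es.
- move=> x y /VP[m xm] /VP[n yn]; have [mn|nm|mn] := ltngtP m n.
  + by left; apply/LP; exists m, n.
  + by right; right; apply/LP; exists n, m.
  + by right; left; apply: (cS _ _ m) => //; rewrite mn.
- move=> c i y i' y' /NP[d [m [n [cd im yn en]]]] ii yy; apply/NP; exists d, m, n.
  by split=> //; [apply: (cE i)|apply: (cE y)].
- move=> c i y y' /NP[d [m [n [cd im yn [_ en]]]]] /NP[d' [m' [n' [cd' im' yn' [_ en']]]]].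
  by apply: cS yn _; rewrite -en (cu _ _ _ cd cd') (cu _ _ _ im im') en'.
- move=> y /VP[n yn]; have [i i0] := cex 0%N; have [c cc] := cex (CodeSeq.code [:: n]).
  exists c, i; split; first exact/ZP.
  by apply/NP; exists (CodeSeq.code [:: n]), 0%N, n; split=> //; rewrite /entry CodeSeq.codeK.
- move=> c i j y /SP[n [im jn]] /VP[m ym].
  (* The entries up to n are kept and entry n + 1 becomes m. The element c need not be a number,
     whence a default for d below. *)
  pose s d := CodeSeq.code (mkseq (fun k =>
    if k == n.+1 then m else nth 0%N (CodeSeq.decode d) k) n.+2).
  have [d hd] : exists d, forall d', cl c d' -> d' = d.
    have [[d cd]|nc] := pselect (exists d, cl c d); first by exists d => d' cd'; apply: cu cd' cd.
    by exists 0%N => d' cd'; case: nc; exists d'.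
  have [c' cc'] := cex (s d); exists c'; split.
    move=> k z /LP[k' [j' [kk' jj' lt]]] /NP[d' [k2 [z' [cd' kk2 zz' [en1 en2]]]]]; apply/NP.
    exists (s d), k', z'; split=> //; rewrite /entry CodeSeq.codeK size_mkseq.
    rewrite -(cu _ _ _ jn jj') in lt; split; first exact: ltnW.
    by rewrite nth_mkseq 1?ltnW // ltn_eqF // -(hd _ cd') -en2 (cu _ _ _ kk' kk2).
  apply/NP; exists (s d), n.+1, m; split=> //; rewrite /entry CodeSeq.codeK size_mkseq; split=> //.
  by rewrite nth_mkseq // eqxx.
Qed.

End StandardModel.

(* r = 0, 1, 2 only serve to single out the classes of numbers; unary and binary relations repeat an
   argument. *)
Definition basic_relation (r i j k : nat) : Prop :=
  match r with
  | 3 => [/\ i = 0, j = 0 & k = 0]%N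
  | 4 => j = i.+1 /\ k = j
  | 5 => (i < j)%N /\ k = j
  | 6 => entry i j k
  | _ => False
  end.

(** The multiplicities 1, 2 and 4 have distinct partial sums, so the triple can be recovered even
    when entries coincide. The shift by 7 separates numbers from the tags 0 to 6. *)
Definition relation_code (r i j k : nat) : seq nat :=
  r :: (i + 7)%N :: nseq 2 (j + 7)%N ++ nseq 4 (k + 7)%N.

Definition relation_codes : set (seq nat) := [set s |
  (exists r i, (r < 3)%N /\ s = [:: r; (i + 7)%N]) \/
  (exists r i j k, basic_relation r i j k /\ s = relation_code r i j k)].

(** * Numbers as classes modulo q-th powers *)

Section FieldCoding.
Variables (F : fieldType) (q : nat) (b : nat -> F) (Theta : F -> Prop).
Let mono (s : seq nat) : F := \prod_(n <- s) b n.
Hypotheses (q_prime : prime q) (q7 : (7 < q)%N) (b0 : forall n, b n != 0).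
Hypothesis Theta_pos : forall s, relation_codes s -> Theta (mono s).
Hypothesis Theta_neg : forall h, h != 0 -> Theta h ->
  exists s j t, relation_codes s /\ mono s = h ^+ j * t ^+ q.
Hypothesis independence : forall s t n, mono s = t ^+ q -> (q %| count_mem n s)%N.

Definition qequiv (x y : F) : Prop := exists u, u != 0 /\ x = y * u ^+ q.
Definition solvable (h : F) : Prop := exists u, u != 0 /\ Theta (h * u ^+ q).
Definition is_number (g : F) : Prop :=
  g != 0 /\ solvable (g * b 0%N) /\ solvable (g * b 1%N) /\ solvable (g * b 2%N).
Definition related r (x y z : F) : Prop := is_number x /\ is_number y /\ is_number z /\
  solvable (b r * x * y ^+ 2 * z ^+ 4).
Definition field_arith : arith F := Arith is_number (fun x => related 3 x x x) qequiv
  (fun x y => related 4 x y y) (fun x y => related 5 x y y) (related 6).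

Definition number_class (g : F) (n : nat) : Prop := qequiv g (b (n + 7)%N).

Lemma qequiv_refl x : qequiv x x.
Proof. by exists 1; rewrite oner_neq0 expr1n mulr1. Qed.

Lemma qequiv_sym x y : qequiv x y -> qequiv y x.
Proof. by move=> [u [u0 ->]]; exists u^-1; rewrite invr_eq0 u0 exprVn mulfK ?expf_neq0. Qed.

Lemma qequiv_trans x y z : qequiv x y -> qequiv y z -> qequiv x z.
Proof.
move=> [u [u0 ->]] [w [w0 ->]]; exists (w * u).
by rewrite mulf_neq0 // exprMn mulrA.
Qed.

Lemma qequivM x y x' y' : qequiv x y -> qequiv x' y' -> qequiv (x * x') (y * y').
Proof. by move=> [u [u0 ->]] [w [w0 ->]]; exists (u * w); rewrite mulf_neq0 // exprMn mulrACA. Qed.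

Lemma qequivX n x y : qequiv x y -> qequiv (x ^+ n) (y ^+ n).
Proof. by move=> [u [u0 ->]]; exists (u ^+ n); rewrite expf_neq0 // exprMn exprAC. Qed.

Lemma qequiv_neq0 x y : qequiv x y -> y != 0 -> x != 0.
Proof. by move=> [u [u0 ->]] y0; rewrite mulf_neq0 // expf_neq0. Qed.

Lemma mono_neq0 s : mono s != 0.
Proof. by rewrite /mono; elim/big_ind: _ => [|x y|n _]; [exact: oner_neq0|exact: mulf_neq0|]. Qed.

Lemma mono_cat s s' : mono (s ++ s') = mono s * mono s'. Proof. exact: big_cat. Qed.

Lemma mono_cons n s : mono (n :: s) = b n * mono s. Proof. exact: big_cons. Qed.

Lemma mono_nil : mono [::] = 1. Proof. exact: big_nil. Qed.

Definition rep m (s : seq nat) : seq nat := flatten (nseq m s).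

Lemma mono_rep m s : mono (rep m s) = mono s ^+ m.
Proof. by elim: m => [|m IH]; rewrite ?expr0 ?mono_nil // exprS -IH -mono_cat. Qed.

Lemma count_rep n m s : count_mem n (rep m s) = (m * count_mem n s)%N.
Proof. by elim: m => //= m IH; rewrite count_cat IH mulSn. Qed.

(** The list s followed by q - 1 copies of s' gives a q-th power, to which independence applies. *)
Lemma qequiv_count s s' n : qequiv (mono s) (mono s') ->
  (count_mem n s)%:R = (count_mem n s')%:R :> 'F_q.
Proof.
move=> [t [t0 e]]; have q0 := prime_gt0 q_prime.
have : (q %| count_mem n (s ++ rep q.-1 s'))%N.
  apply: (independence (t := mono s' * t)).
  by rewrite mono_cat mono_rep e mulrAC -exprS prednK // exprMn.
rewrite count_cat count_rep (dvdn_pcharf (pchar_Fp q_prime)) natrD natrM.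
have -> : q.-1%:R = -1 :> 'F_q.
  by apply/eqP; rewrite -addr_eq0 -mulrSr prednK // pchar_Fp_0.
by rewrite mulN1r subr_eq0 => /eqP.
Qed.

Lemma natr_Fp_inj m n : (m < q)%N -> (n < q)%N -> m%:R = n%:R :> 'F_q -> m = n.
Proof.
move=> mq nq /(congr1 val); rewrite /= !val_Fp_nat ?pdiv_id // !modn_small //.
Qed.

Lemma code_tag s : relation_codes s -> exists r, [/\ (r < 7)%N,
  forall m, (m < 7)%N -> count_mem m s = (r == m),
  (r < 3)%N -> exists i, s = [:: r; (i + 7)%N] &
  (2 < r)%N -> exists i j k, basic_relation r i j k /\ s = relation_code r i j k].
Proof.
have high m i : (m < 7)%N -> ((i + 7)%N == m) = false.
  by move=> m7; apply/negbTE; rewrite neq_ltn (leq_trans m7 (leq_addl _ _)) orbT.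
case=> [[r [i [r3 ->]]]|[r [i [j [k [rijk ->]]]]]]; exists r; split.
- exact: leq_trans r3 _.
- by move=> m m7; rewrite /= high // !addn0.
- by move=> _; exists i.
- by rewrite ltnNge -ltnS r3.
- by case: (r) rijk => [|[|[|[|[|[|[|]]]]]]].
- by move=> m m7; rewrite /= !high // !addn0.
- by case: (r) rijk => [|[|[|]]].
- by move=> _; exists i, j, k.
Qed.

Lemma solvable_pos s h : relation_codes s -> qequiv h (mono s) -> solvable h.
Proof.
move=> Ss [u [u0 ->]]; exists u^-1; rewrite invr_eq0 u0 exprVn mulfK ?expf_neq0 //.
by split=> //; apply: Theta_pos.
Qed.

(** Only some power h^j is known to be coded. The tag occurs exactly once in every code, and later
    this forces j = 1 modulo q. *)
Lemma solvable_neg h s : qequiv h (mono s) -> solvable h -> exists s' j, relation_codes s' /\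
  forall n, (count_mem n s')%:R = j%:R * (count_mem n s)%:R :> 'F_q.
Proof.
move=> hs [u [u0 /Theta_neg[]]].
  by rewrite mulf_neq0 ?expf_neq0 // (qequiv_neq0 hs) // mono_neq0.
move=> s' [j [t [Ss' e]]]; exists s', j; split=> // n.
have t0 : t != 0.
  apply: contraTneq (mono_neq0 s') => t0.
  by rewrite e t0 expr0n eqn0Ngt prime_gt0 // mulr0 eqxx.
have : qequiv (mono s') (mono (rep j s)).
  rewrite mono_rep; apply: qequiv_trans (qequivX j hs); exists (u ^+ j * t).
  by rewrite mulf_neq0 ?expf_neq0 // e !exprMn exprAC mulrA.
by move/qequiv_count => ->; rewrite count_rep natrM.
Qed.

Lemma number_class_mono g n : number_class g n -> qequiv g (mono [:: (n + 7)%N]).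
Proof. by rewrite /mono big_seq1. Qed.

(** The exponents of g at the tags are pinned down by three tests. Two would not do: g = 1 / (b_0
    b_1 b_(i + 7)) makes the inverses of g b_0 and g b_1 coded monomials, and [Theta_neg] does not
    tell a power from its inverse. *)
Lemma is_numberP g : is_number g <-> exists n, number_class g n.
Proof.
have q0 := prime_gt0 q_prime; have q1 := prime_gt1 q_prime.
split=> [[g0 [s0 [s1 s2]]]|[n gn]]; last first.
  have h r : (r < 3)%N -> solvable (g * b r).
    move=> r3; apply: (@solvable_pos [:: r; (n + 7)%N]); first by left; exists r, n.
    rewrite mono_cons mulrC; apply: qequivM; [exact: qequiv_refl|exact: number_class_mono].
  by split; [apply: qequiv_neq0 gn _|do ![split; first exact: h]; apply: h].
have [u [u0 /Theta_neg[|s [j [t [Ss e]]]]]] := s0; first by rewrite !mulf_neq0 ?expf_neq0.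
have t0 : t != 0.
  by apply: contraTneq (mono_neq0 s) => t0; rewrite e t0 expr0n eqn0Ngt q0 mulr0 eqxx.
have {e} es : qequiv (mono s) ((g * b 0%N) ^+ j).
  by exists (u ^+ j * t); rewrite mulf_neq0 ?expf_neq0 // e !exprMn exprAC mulrA.
have [r [r7 tag rlow _]] := code_tag Ss.
(* Otherwise the monomial of s would be a q-th power, although its tag occurs once. *)
have jq : coprime j q.
  rewrite coprime_sym prime_coprime //; apply/negP => /dvdnP[m jE].
  have : qequiv (mono s) (mono [::]).
    apply: qequiv_trans es _; rewrite mono_nil; exists ((g * b 0%N) ^+ m).
    by rewrite mul1r -exprM -jE !expf_neq0 // mulf_neq0.
  by move/(qequiv_count r); rewrite tag // eqxx => /(natr_Fp_inj q1 q0).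
have j0 : (0 < j)%N by case: (j) jq => //; rewrite /coprime gcd0n => /eqP q1'; rewrite q1' in q1.
have [c d cd _] := egcdnP q j0; rewrite (eqP jq) in cd.
(* An inverse c of j modulo q recovers g b_0 from its j-th power; q - 1 further factors b_0 cancel
   b_0 up to a q-th power. *)
pose S := rep c s ++ nseq q.-1 0%N.
have gS : qequiv g (mono S).
  have nb : mono (nseq q.-1 0%N) = b 0%N ^+ q.-1 by rewrite /mono big_nseq -Monoid.iteropE.
  have : qequiv (g * b 0%N * b 0%N ^+ q.-1) (mono S).
    rewrite mono_cat nb mono_rep; apply: qequivM; last exact: qequiv_refl.
    apply: qequiv_sym; apply: qequiv_trans (qequivX c es) _;
      rewrite -exprM mulnC cd exprD expr1 mulrC exprM.
    by exists ((g * b 0%N) ^+ d); rewrite expf_neq0 // mulf_neq0.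
  apply: qequiv_trans; rewrite -mulrA -exprS prednK //; apply: qequiv_sym.
  by exists (b 0%N).
have hr r' : solvable (g * b r') -> exists s' j', relation_codes s' /\
    forall n, (count_mem n s')%:R = j'%:R * (count_mem n S + (r' == n))%:R :> 'F_q.
  move=> hs; have [|s' [j' [Ss' h]]] := @solvable_neg _ (r' :: S) _ hs.
    by rewrite mono_cons mulrC; apply: qequivM; [exact: qequiv_refl|].
  by exists s', j'; split=> // n; rewrite h /= addnC.
pose G n : 'F_q := (count_mem n S)%:R.
have key r' : solvable (g * b r') -> exists r0 J, [/\ (r0 < 7)%N, J * (G r0 + (r' == r0)%:R) = 1 &
    forall m, (m < 7)%N -> m != r0 -> G m + (r' == m)%:R = 0].
  move=> /hr[s' [j' [Ss' h]]]; have [r0 [r07 tag0 _ _]] := code_tag Ss'.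
  have J1 : j'%:R * (G r0 + (r' == r0)%:R) = 1.
    by rewrite -natrD -h tag0 // eqxx.
  exists r0, j'%:R; split=> // m m7 mr; have := h m; rewrite tag0 // eq_sym (negPf mr) natrD.
  move/esym/eqP; rewrite mulf_eq0 => /orP[/eqP j0'|/eqP//].
  by move/eqP: J1; rewrite j0' mul0r eq_sym oner_eq0.
have one0 : (1 : 'F_q) != 0 by apply: oner_neq0.
have esG m : (count_mem m s)%:R = j%:R * (G m + (0%N == m)%:R).
  have : qequiv (mono s) (mono (rep j (0%N :: S))).
    by rewrite mono_rep mono_cons mulrC; apply: qequiv_trans es _; apply: qequivX;
      apply: qequivM => //; exact: qequiv_refl.
  by move/(qequiv_count m) => ->; rewrite count_rep natrM /= addnC natrD.
have jne : j%:R != 0 :> 'F_q by rewrite -(dvdn_pcharf (pchar_Fp q_prime)) -prime_coprime // coprime_sym.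
have es0 m : (m < 7)%N -> m != r -> G m + (0%N == m)%:R = 0.
  move=> m7 mr; have := esG m; rewrite tag // eq_sym (negPf mr) => /esym/eqP.
  by rewrite mulf_eq0 (negPf jne) => /eqP.
(* If r is not 0, then G 0 = -1, so g b_1 and g b_2 both have tag 0 and G 1 = G 2 = -1; but g b_0
   has a single tag, so G 1 or G 2 vanishes. *)
have G1 : r = 0%N /\ G 0%N = 0.
  have [a [J [a7 Ja ha]]] := key 1%N s1; have [c' [K [c7 Kc hc]]] := key 2%N s2.
  have [r0|r0] := eqVneq r 0%N.
    split=> //; have g1 : G 1%N = 0 by have := es0 1%N isT; rewrite r0 addr0; apply.
    have [a1|a1] := eqVneq a 1%N; first by have := ha 0%N isT; rewrite a1 addr0; apply.
    by have := ha 1%N isT; rewrite eq_sym a1 g1 add0r => /(_ isT)/eqP; rewrite (negPf one0).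
  have g0' : G 0%N = -1.
    by apply/eqP; rewrite -addr_eq0; apply/eqP/es0; rewrite // eq_sym.
  have g0ne : G 0%N != 0 by rewrite g0' oppr_eq0.
  have a0 : a = 0%N.
    apply/eqP; apply: contraNT g0ne => a0.
    by have := ha 0%N isT; rewrite eq_sym a0 addr0 => ->.
  have c0 : c' = 0%N.
    apply/eqP; apply: contraNT g0ne => c0.
    by have := hc 0%N isT; rewrite eq_sym c0 addr0 => ->.
  have [r1|r1] := eqVneq r 1%N.
    have := hc 2%N isT; rewrite c0 => /(_ isT); have := es0 2%N isT; rewrite r1 addr0 => /(_ isT) ->.
    by rewrite add0r => /eqP; rewrite (negPf one0).
  have := ha 1%N isT; rewrite a0 => /(_ isT); have := es0 1%N isT;
    rewrite addr0 eq_sym r1 => /(_ isT) ->.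
  by rewrite add0r => /eqP; rewrite (negPf one0).
have [r0 g00] := G1; have [|i sE] := rlow; first by rewrite r0.
have j1 : j%:R = 1 :> 'F_q.
  by have := esG 0%N; rewrite tag // r0 eqxx g00 add0r mulr1.
have /dvdnP[m jE] : (q %| j.-1)%N.
  by rewrite (dvdn_pcharf (pchar_Fp q_prime)) -(inj_eq (addIr 1)) -mulrSr prednK // j1 add0r.
exists i; have : qequiv (b 0%N * b (i + 7)%N) (b 0%N * g).
  move: es; rewrite sE r0 mono_cons /mono big_seq1 => es; apply: qequiv_trans es _.
  rewrite -(prednK j0) jE exprS exprM [b 0%N * g]mulrC; exists ((g * b 0%N) ^+ m).
  by rewrite expf_neq0 // mulf_neq0.
move=> /qequiv_sym h; rewrite /number_class -[g](mulKf (b0 0%N)) -[b (i + 7)%N](mulKf (b0 0%N)).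
by apply: qequivM h; apply: qequiv_refl.
Qed.

Lemma number_class_uniq x m n : number_class x m -> number_class x n -> m = n.
Proof.
move=> /number_class_mono/qequiv_sym xm /number_class_mono xn.
have := qequiv_count (m + 7)%N (qequiv_trans xm xn); rewrite /= eqxx !addn0 eqn_add2r.
have q1 := prime_gt1 q_prime; have q0 := prime_gt0 q_prime.
by case: eqP => [->//|_] /(natr_Fp_inj q1 q0).
Qed.

Lemma count_relation r i j k n : count_mem (n + 7)%N (relation_code r i j k) =
  ((r == n + 7) + ((i == n) + (2 * (j == n) + 4 * (k == n))))%N.
Proof. by rewrite /= !eqn_add2r; case: (j == n); case: (k == n). Qed.

(** All multiplicities are at most 1 + 2 + 4 = 7 < q, so they can be read off modulo q once the tag
    has shown the exponent to be 1. *)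
Lemma relatedP r x y z : (2 < r < 7)%N -> related r x y z <->
  exists i j k, [/\ number_class x i, number_class y j, number_class z k & basic_relation r i j k].
Proof.
move=> /andP[r2 r7]; have q0 := prime_gt0 q_prime; have q1 := prime_gt1 q_prime.
have hE i j k : number_class x i -> number_class y j -> number_class z k ->
    qequiv (b r * x * y ^+ 2 * z ^+ 4) (mono (relation_code r i j k)).
  move=> xi yj zk; have -> : mono (relation_code r i j k) = b r * b (i + 7)%N * b (j + 7)%N ^+ 2 *
    b (k + 7)%N ^+ 4.
    by rewrite /relation_code !mono_cons mono_nil; ring.
  apply: qequivM; last exact: qequivX.
  apply: qequivM; last exact: qequivX.
  by apply: qequivM => //; apply: qequiv_refl.
split=> [[/is_numberP[i xi] [/is_numberP[j yj] [/is_numberP[k zk] sol]]]|[i [j [k [xi yj zk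
  bas]]]]]; last first.
  do ![split; first by apply/is_numberP; eexists; eassumption].
  by apply: solvable_pos (hE _ _ _ xi yj zk); right; exists r, i, j, k.
exists i, j, k; split=> //; have [s' [J [Ss' hJ]]] := solvable_neg (hE _ _ _ xi yj zk) sol.
have [r' [r7' tag' _ high]] := code_tag Ss'.
have low m : (m < 7)%N -> count_mem m (relation_code r i j k) = (r == m).
  move=> m7; have e i' : ((i' + 7)%N == m) = false.
    by apply/negbTE; rewrite neq_ltn (leq_trans m7 (leq_addl _ _)) orbT.
  by rewrite /= !e !addn0.
have rr : r = r'.
  apply/eqP; have := hJ r'; rewrite tag' // eqxx low //; case: eqP => // _.
  by rewrite mulr0 => /eqP; rewrite oner_eq0.
have J1 : J%:R = 1 :> 'F_q by have := hJ r; rewrite low // tag' // rr eqxx mulr1.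
have [|i' [j' [k' [bas sE]]]] := high; first by rewrite -rr.
have cnt n : ((i' == n) + (2 * (j' == n) + 4 * (k' == n)))%N = ((i == n) + (2 * (j == n) + 4 * (k
  == n)))%N.
  have := hJ (n + 7)%N; rewrite J1 mul1r sE !count_relation.
  have -> : (r' == n + 7)%N = false by apply/negbTE; rewrite neq_ltn (leq_trans r7' (leq_addl _ _)).
  have -> : (r == n + 7)%N = false by apply/negbTE; rewrite neq_ltn (leq_trans r7 (leq_addl _ _)).
  have small (b1 b2 b3 : bool) : (b1 + (2 * b2 + 4 * b3) < q)%N by apply: leq_ltn_trans q7;
    case: b1 b2 b3 => [] [] [].
  by rewrite !add0n; apply: natr_Fp_inj; apply: small.
have ei : i' = i by have := cnt i; rewrite eqxx; case: eqP => //;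
  case: (j' == i) (k' == i) (j == i) (k == i) => [] [] [] [].
have ej : j' = j by have := cnt j; rewrite eqxx; case: (j' =P j) => //;
  case: (i' == j) (k' == j) (i == j) (k == j) => [] [] [] [].
have ek : k' = k by have := cnt k; rewrite eqxx; case: (k' =P k) => //;
  case: (i' == k) (j' == k) (i == k) (j == k) => [] [] [] [].
by rewrite rr -ei -ej -ek.
Qed.

Theorem field_arithmetic : arith_ax field_arith.
Proof.
apply: (arith_ax_classes (cl := number_class)) => /=.
- exact: qequiv_refl.
- exact: qequiv_sym.
- exact: qequiv_trans.
- by move=> n; exists (b (n + 7)%N); apply: qequiv_refl.
- exact: number_class_uniq.
- by move=> x y n xn xy; apply: qequiv_trans xn; apply: qequiv_sym.
- by move=> x y n xn yn; apply: qequiv_trans xn _; apply: qequiv_sym.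
- exact: is_numberP.
- move=> x; rewrite relatedP //; split=> [[i [j [k [xi _ _ [i0 _ _]]]]]|x0]; first by rewrite -i0.
  by exists 0%N, 0%N, 0%N.
- move=> x y; rewrite relatedP //; split=> [[i [j [k [xi yj _ [jE _]]]]]|[n [xn yn]]].
    by exists i; rewrite -jE.
  by exists n, n.+1, n.+1.
- move=> x y; rewrite relatedP //; split=> [[i [j [k [xi yj _ [ij _]]]]]|[m [n [xm yn mn]]]].
    by exists i, j.
  by exists m, n, n.
- by move=> x y z; rewrite relatedP.
Qed.

End FieldCoding.

(** * The same arithmetic, defined uniformly in all structures *)

Section DefinableArithmetic.
Variables (Lg : finType) (Op : forall M : structure Lg, (nat -> M) -> M -> Prop) (l q : nat).
Hypothesis uO : forall s i, udef (fun M e => Op (fun k => e (s k)) (e i)).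

Definition mpow (M : structure Lg) (x : M) n : M := iter n (smul x) (sone M).
Definition mform (M : structure Lg) (z : M) n : M :=
  sadd (sone M) (smul (iter n.+1 (sadd (sone M)) (szero M)) z).

Section OneStructure.
Variables (M : structure Lg) (p : nat -> M).

(** The premise on y says |h y^(lq)| < 1, expressed by the ring: no integral t is inverse to h
    y^(lq). *)
Definition mtheta (h : M) : Prop := forall y,
  ~ (exists t, Op p t /\ sone M = smul t (smul h (mpow y (l * q)))) ->
  exists x, mpow x l = sadd (sone M) (smul h (mpow y (l * q))).
Definition msolvable (h : M) : Prop := exists u, u <> szero M /\ mtheta (smul h (mpow u q)).
Definition mnumber (g : M) : Prop := g <> szero M /\ msolvable (smul g (mform (p 0%N) 0)) /\
  msolvable (smul g (mform (p 0%N) 1)) /\ msolvable (smul g (mform (p 0%N) 2)).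
Definition mrelated r (x y z : M) : Prop := mnumber x /\ mnumber y /\ mnumber z /\
  msolvable (smul (smul (smul (mform (p 0%N) r) x) (mpow y 2)) (mpow z 4)).
Definition mequiv (x y : M) : Prop := exists u, u <> szero M /\ x = smul y (mpow u q).
Definition marith : arith M := Arith mnumber (fun x => mrelated 3 x x x) mequiv
  (fun x y => mrelated 4 x y y) (fun x y => mrelated 5 x y y) (mrelated 6).

End OneStructure.

Definition tpow (t : term) n : term := iter n (Mul t) One.
Definition tform (t : term) n : term := Add One (Mul (iter n.+1 (Add One) Zero) t).

Lemma eval_tpow (M : structure Lg) (e : nat -> M) t n : eval e (tpow t n) = mpow (eval e t) n.
Proof. by rewrite /tpow /mpow; elim: n => //= n ->. Qed.

Lemma eval_tform (M : structure Lg) (e : nat -> M) t n : eval e (tform t n) = mform (eval e t) n.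
Proof. by rewrite /tform /mform /=; do 3!congr (_ _ _); elim: n => //= n ->. Qed.

Lemma eval_mul (M : structure Lg) (e : nat -> M) t u : eval e (Mul t u) = smul (eval e t) (eval e u).
Proof. by []. Qed.

(** Only renaming of variables is available, so the term is given a name by an existential
    quantifier. *)
Lemma udef_term (R : forall M : structure Lg, M -> (nat -> M) -> Prop) t :
  udef (fun M e => R M (e 0%N) (fun i => e i.+1)) -> udef (fun M e => R M (eval e t) e).
Proof.
move=> uR; have : udef (fun M e => exists x, x = eval e t /\ R M x e).
  apply: udef_ex; apply: udef_and => //;
    apply: eq_udef (@udef_equal Lg (Var 0) (ren_term succn t)) => M e.
  by rewrite eval_ren.
by apply: eq_udef => M e; split=> [[x [-> ]]|h] //; exists (eval e t).
Qed.

Lemma udef_neq0 i : udef (Lg := Lg) (fun M e => e i <> szero M).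
Proof. exact: (udef_not (@udef_equal Lg (Var i) Zero)). Qed.

Lemma udef_theta s i : udef (fun M e => mtheta (fun k => e (s k)) (e i)).
Proof.
apply: udef_all; apply: udef_imp.
  apply: udef_not; apply: udef_ex; apply: udef_and; first exact: uO.
  apply: eq_udef (@udef_equal Lg One (Mul (Var 0) (Mul (Var i.+2) (tpow (Var 1) (l * q))))) => M e.
  by rewrite /= eval_tpow.
apply: udef_ex.
apply: eq_udef (@udef_equal Lg (tpow (Var 0) l) (Add One (Mul (Var i.+2) (tpow (Var 1) (l * q)))))
  => M e.
by rewrite /= !eval_tpow.
Qed.

Lemma udef_solvable s i : udef (fun M e => msolvable (fun k => e (s k)) (e i)).
Proof.
apply: udef_ex; apply: udef_and; first exact: udef_neq0.
have := @udef_term (fun M x e => mtheta (fun k =>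
  e (s k).+1) x) (Mul (Var i.+1) (tpow (Var 0) q)) (udef_theta _ _).
by apply: eq_udef => M e; rewrite /= eval_tpow.
Qed.

Lemma udef_solvable_at s t : udef (fun M e => msolvable (fun k => e (s k)) (eval e t)).
Proof.
exact: (@udef_term (fun M x e => msolvable (fun k => e (s k)) x) t (udef_solvable _ _)).
Qed.

Lemma udef_number s i : udef (fun M e => mnumber (fun k => e (s k)) (e i)).
Proof.
have h n : udef (fun M e => msolvable (fun k => e (s k)) (smul (e i) (mform (e (s 0%N)) n))).
  apply: eq_udef (udef_solvable_at s (Mul (Var i) (tform (Var (s 0%N)) n))) => M e.
  by rewrite eval_mul eval_tform.
by apply: udef_and; [apply: udef_neq0|do ?apply: udef_and; apply: h].
Qed.

Lemma udef_related r s i j h : udef (fun M e => mrelated (fun k => e (s k)) r (e i) (e j) (e h)).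
Proof.
do 3![apply: udef_and; first exact: udef_number].
apply: eq_udef (udef_solvable_at s (Mul (Mul (Mul (tform (Var (s 0%N)) r) (Var i)) (tpow (Var j)
  2)) (tpow (Var h) 4))) => M e.
by rewrite 3!eval_mul eval_tform !eval_tpow.
Qed.

Lemma udef_equiv i j : udef (Lg := Lg) (fun M e => mequiv (e i) (e j)).
Proof.
apply: udef_ex; apply: udef_and; first exact: udef_neq0.
apply: eq_udef (@udef_equal Lg (Var i.+1) (Mul (Var j.+1) (tpow (Var 0) q))) => M e.
by rewrite /= eval_tpow.
Qed.

Theorem undecidable_arithmetic (P : nat) (S : set (formula Lg)) (M : structure Lg) (p : nat -> M) :
  (0 < P)%N -> (forall k, p k = p (clip P k)) -> (forall psi, S psi -> models M psi) ->
  arith_ax (marith p) -> undecidable (Cons S).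
Proof.
apply: undecidable_interpretation => *.
- exact: udef_number.
- exact: udef_related.
- exact: udef_equiv.
- exact: udef_related.
- exact: udef_related.
- exact: udef_related.
Qed.

End DefinableArithmetic.

Definition field_theta (F : fieldType) (O : F -> Prop) l q (h : F) : Prop := forall y,
  ~ (exists t, O t /\ 1 = t * (h * y ^+ (l * q))) -> exists x, x ^+ l = 1 + h * y ^+ (l * q).

Definition linear_form (F : fieldType) (z : F) n : F := 1 + n.+1%:R * z.

Definition fstruct (Lg : finType) (F : fieldType) (P : Lg -> set F) : structure Lg :=
  @Structure Lg F 0 1 -%R +%R *%R P.

Lemma marith_field (Lg : finType) (Op : forall M : structure Lg, (nat -> M) -> M -> Prop) l q
    (F : fieldType) (P : Lg -> set F) (p : nat -> fstruct P) :
  arith_ax (field_arith q (linear_form (p 0%N)) (field_theta (@Op (fstruct P) p) l q)) ->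
  arith_ax (marith Op l q p).
Proof.
have powE : @mpow Lg (fstruct P) = fun x n => x ^+ n :> F.
  apply/funext => x; apply/funext => n; rewrite /mpow /=.
  by elim: n => [|n IH]; rewrite ?expr0 //= IH exprS.
have formE : @mform Lg (fstruct P) = @linear_form F.
  apply/funext => z; apply/funext => n; rewrite /mform /linear_form /=; congr (1 + _ * _).
  by rewrite mulrS; congr (1 + _); elim: n => [|n IH] //=; rewrite IH mulrS.
suff -> : marith Op l q p = field_arith q (linear_form (p 0%N)) (field_theta (@Op (fstruct P) p) l
  q) by [].
have thE : @mtheta _ Op l q _ p = field_theta (@Op (fstruct P) p) l q by rewrite /mtheta powE.
have neq (x : F) : (x <> 0) = (x != 0) :> Prop by apply/propext; split=> /eqP.
have solE : @msolvable _ Op l q _ p = solvable q (field_theta (@Op (fstruct P) p) l q).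
  apply/funext => h; rewrite /msolvable thE powE; apply/propext.
  by split=> -[u [u0 hu]]; exists u; split=> //; apply/eqP.
have numE : @mnumber _ Op l q _ p = is_number q (linear_form (p 0%N)) (field_theta (@Op (fstruct P)
  p) l q).
  by apply/funext => h; rewrite /mnumber solE formE neq.
have eqE : @mequiv _ q (fstruct P) = @qequiv F q.
  apply/funext => x; apply/funext => y; rewrite /mequiv powE; apply/propext.
  by split=> -[u [u0 hu]]; exists u; split=> //; apply/eqP.
by rewrite /marith /field_arith /mrelated numE solE eqE formE powE.
Qed.

(** * Conclusion *)

Section ModelArithmetic.
Variables (V : fieldType) (O : valring V) (L : set V) (pi : V) (x : nat -> V) (l q : nat).
Hypotheses (sfL : subfield L) (Lpi : L pi) (pi0 : pi != 0) (pi1 : vlt O pi 1)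
  (char0 : forall n, n.+1%:R != 0 :> V) (hensV : henselian_in O (fun=> True))
  (L_closed : forall y, algebraic_over L y -> L y)
  (ind : forall n, ~ algebraic_over (gen (L `|` [set x m | m in [set m | m != n]])) (x n))
  (dns : forall y, gen (L `|` range x) y -> dense O L y)
  (l_prime : prime l) (q_prime : prime q) (q_odd : odd q) (lq : (l < q)%N) (q7 : (7 < q)%N)
  (l_unit : vle O 1 l%:R).
Notation M := (power_closure l q (monomials x relation_codes) (L `|` range x)).

Lemma model_arithmetic (sfM : subfield M) : exists z : sbf_type (sfld sfM),
  arith_ax (field_arith q (linear_form z) (field_theta (fun y : sbf_type (sfld sfM) => O (val y)) l q)).
Proof.
pose k := sbf_type (sfld sfM); pose iota : {rmorphism k -> V} := val.
have Mx : M (x 0%N) by apply: model_gen.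
exists (sbf_mk (Mx : sfld sfM (x 0%N))); set z := sbf_mk _.
have formE n : iota (linear_form z n) = unit_form x n.
  by rewrite /linear_form rmorphD rmorph1 rmorphM rmorph_nat.
have monoE s : iota (\prod_(n <- s) linear_form z n) = monomial x s.
  by rewrite rmorph_prod; apply: eq_bigr => n _; apply: formE.
have small (w : k) : ~ (exists t : k, O (val t) /\ 1 = t * w) <-> vlt O (iota w) 1.
  split=> [h [t Ot e]|h [t [Ot e]]]; last by apply: h; exists (val t) => //;
    rewrite -(rmorph1 iota) e rmorphM.
  have w0 : w != 0.
    by apply: contraTneq (oner_neq0 V) => w0; rewrite e w0 rmorph0 mulr0 negbK.
  have iw0 : iota w != 0 by rewrite fmorph_eq0.
  apply: h; exists w^-1; split; last by rewrite mulVf.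
  by rewrite -[val _]/(iota _) fmorphV -[(iota w)^-1]mul1r e mulfK.
apply: field_arithmetic => //.
- move=> n; rewrite -(fmorph_eq0 iota) formE; exact: (unit_form_neq0 sfL char0 ind).
- move=> s Ss y /small; rewrite rmorphM rmorphXn monoE => sm.
  have [|r Mr rE] := model_positive (S0 := relation_codes) (x :=
    x) hensV l_prime l_unit _ (sfld_valP y) sm.
    by exists s.
  exists (sbf_mk (Mr : sfld sfM r)); apply: (fmorph_inj iota).
  by rewrite rmorphXn rmorphD rmorph1 rmorphM rmorphXn monoE.
- move=> h h0 th.
  have [||e [j [t [[s Ss <-] Mt eE]]]] := model_negative sfL Lpi pi0 pi1 char0 hensV L_closed ind dns
    l_prime q_prime q_odd lq (sfld_valP h).
  + by rewrite fmorph_eq0.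
  + move=> y My sm; pose y' : k := sbf_mk (My : sfld sfM y).
    have [|r rE] := th y'; first by apply/small; rewrite rmorphM rmorphXn.
    exists (val r); first exact: sfld_valP.
    by have := congr1 iota rE; rewrite rmorphXn rmorphD rmorph1 rmorphM rmorphXn.
  exists s, j, (sbf_mk (Mt : sfld sfM t)); split=> //; apply: (fmorph_inj iota).
  by rewrite monoE eE rmorphM !rmorphXn.
- move=> s t n e; apply: (model_independent sfL char0 ind l_prime q_prime lq n (sfld_valP t)).
  by rewrite -monoE e rmorphXn.
Qed.

End ModelArithmetic.

(** * A countable elementary subfield that is relatively algebraically closed *)

Section CountableHull.
Variables (K : fieldType) (O : K -> Prop).

Lemma roots_ex (g : {poly K}) : exists s : seq K, g != 0 -> forall y, root g y -> y \in s.
Proof.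
have [n] := ubnP (size g); elim: n g => // n IH g /ltnSE sg.
have [[y ry]|nr] := pselect (exists y, root g y); last by exists [::] => _ y ry; case: nr; exists y.
have [h gE] := factor_theorem _ _ ry.
have [->|g0] := eqVneq g 0; first by exists [::].
have h0 : h != 0 by apply: contraNneq g0 => h0; rewrite gE h0 mul0r.
have [|s hs] := IH h.
  by apply: leq_trans sg; rewrite gE size_Mmonic ?monicXsubC // size_XsubC addn2 /=.
exists (y :: s) => _ t; rewrite {1}gE rootM root_XsubC inE => /orP[/(hs h0) -> |->//].
by rewrite orbT.
Qed.

(** The elements are values of trees with nodes labelled by natural numbers, and there are countably
    many such trees. *)
Lemma countable_closure (F : nat -> seq K -> K) : exists L : set K, enumerable L /\
  forall k xs, (forall y, y \in xs -> L y) -> L (F k xs).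
Proof.
pose fix ev (t : GenTree.tree nat) : K :=
  match t with GenTree.Leaf _ => 0 | GenTree.Node k ts => F k (map ev ts) end.
exists (range ev); split.
  exists (fun n => if unpickle n is Some t then ev t else 0) => _ [t _ <-].
  by exists (pickle t); rewrite pickleK.
move=> k xs hxs; suff [ts <-] : exists ts, map ev ts = xs by exists (GenTree.Node k ts).
elim: xs hxs => [|y xs IH] h; first by exists [::].
have [|ts <-] := IH; first by move=> z zx; apply: h; rewrite inE zx orbT.
by have [t _ <-] := h y (mem_head _ _); exists (t :: ts).
Qed.

Notation full := (fun _ : K => True).

Lemma env_cons_nth (y : K) s : env_cons y (nth 0 s) = nth 0 (y :: s).
Proof. by apply/funext; case. Qed.

Lemma elementary_hull : exists L : set K, [/\ enumerable L, subfield L,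
  (forall (g : {poly K}) y, g != 0 -> (forall i, L g`_i) -> root g y -> L y) &
  forall phi, rsat O L (fun=> 0) phi <-> rsat O full (fun=> 0) phi].
Proof.
have /choice[rt rtP] := roots_ex.
have /choice[sk skP] : forall ms : nat * seq K, exists y, forall phi, formula_code phi = ms.1 ->
    (exists t, ~ rsat O full (env_cons t (nth 0 ms.2)) phi) ->
      ~ rsat O full (env_cons y (nth 0 ms.2)) phi.
  move=> [m s] /=.
  have [[phi [cphi [t nt]]]|no] := pselect (exists phi : formula Lval, formula_code phi = m /\
      exists t, ~ rsat O full (env_cons t (nth 0 s)) phi).
    by exists t => psi; rewrite -cphi => /formula_code_inj ->.
  by exists 0 => psi cpsi ex; case: no; exists psi.
(* One operation for everything: the field operations for k < 4, then alternately a root of the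
   polynomial with coefficients s and a counterexample to the formula with a given code in the
   environment s, continued by 0. *)
pose F k (s : seq K) : K := match k with
  | 0%N => nth 0 s 0 - nth 0 s 1 | 1%N => nth 0 s 0 * nth 0 s 1 | 2%N => (nth 0 s 0)^-1 | 3%N => 1
  | k'.+4 => if odd k' then nth 0 (rt (Poly s)) k'./2 else sk (k'./2, s) end.
have [L [enL LF]] := countable_closure F.
have L1 : L 1 by apply: (LF 3%N [::]).
have L2 k y z : L y -> L z -> L (F k [:: y; z]).
  by move=> Ly Lz; apply: LF => t; rewrite !inE => /orP[/eqP->|/eqP->].
have sfL : subfield L.
  split=> // [y z Ly Lz|y z Ly Lz|y Ly]; [exact: (L2 0%N)|exact: (L2 1%N)|exact: (L2 2%N _ _ Ly Ly)].
exists L; split=> // [g y g0 Lg rg|phi].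
  have := rtP g g0 y rg => /(nthP 0)[i _ <-].
  have := LF (i.*2.+1).+4 g; rewrite /F /= odd_double /= uphalf_double polyseqK; apply.
  by move=> _ /(nthP 0)[j _ <-].
suff h s : (forall y, y \in s -> L y) -> rsat O L (nth 0 s) phi <-> rsat O full (nth 0 s) phi.
  have -> : (fun _ : nat => 0 : K) = nth 0 [::] by apply/funext => i; rewrite nth_nil.
  exact: h.
elim: phi s => //= [p IHp q IHq|p IHp] s Ls; first by rewrite IHp ?IHq.
have Lcons y : L y -> forall t, t \in y :: s -> L t.
  by move=> Ly t; rewrite inE => /orP[/eqP->|/Ls].
split=> [h y _|h y Ly]; last first.
  by rewrite env_cons_nth IHp -?env_cons_nth; [apply: h|apply: Lcons].
apply: contrapT => ny; have := skP (formula_code p, s) p erefl; apply; first by exists y.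
have Lsk : L (sk (formula_code p, s)).
  by have := LF (formula_code p).*2.+4 s Ls; rewrite /F /= odd_double half_double.
by rewrite /= env_cons_nth -IHp ?[in rsat _ _ _ _]/= -?env_cons_nth; [apply: h|apply: Lcons].
Qed.

End CountableHull.

Lemma rsat_image (F F' : fieldType) (f : {rmorphism F -> F'}) (O E : F -> Prop) (O' E' : F' ->
  Prop) phi e :
  (forall y, O' (f y) <-> O y) -> (forall y, E' y <-> exists2 t, E t & f t = y) ->
  rsat O' E' (f \o e) phi <-> rsat O E e phi.
Proof.
move=> OO EE; elim: phi e => //= [t1 t2|P t|p IHp q IHq|p IHp] e.
- by rewrite !teval_rmorph; split=> [/fmorph_inj|->].
- by rewrite teval_rmorph.
- by rewrite IHp IHq.
have consE y : env_cons (f y) (f \o e) = f \o env_cons y e by apply/funext; case.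
split=> [h y Ey|h _ /EE[y Ey <-]]; last by rewrite consE IHp; apply: h.
by rewrite -IHp -consE; apply: h; apply/EE; exists y.
Qed.

(** * The model of a given sentence *)

Section Core.
Variables (K : fieldType) (O : valring K) (p : nat).
Hypotheses (char0 : forall n, n.+1%:R != 0 :> K) (p_prime : prime p) (p1 : vlt O p%:R 1)
  (hens : henselian_in O (fun=> True)).

Section Hull.
Variables (U : free_ultrafilter) (L0 : set K).
Hypotheses (sfL0 : subfield L0)
  (rootL0 : forall (g : {poly K}) y, g != 0 -> (forall i, L0 g`_i) -> root g y -> L0 y).
Notation V := (ultrapower U K).
Notation uO := (uvalring U O).
Notation dg := (diag U (F := K)).
Notation L := [set dg y | y in L0].

Lemma hull_char0 n : n.+1%:R != 0 :> V.
Proof. by rewrite -(rmorph_nat dg) fmorph_eq0. Qed.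

Lemma vle_diag x y : vle uO (dg x) (dg y) <-> vle O x y.
Proof. by rewrite vle_ucls; split=> [/ae_ex[]|h] //; apply: ae_all. Qed.

Lemma hull_p1 : vlt uO p%:R 1.
Proof. by rewrite /vlt -(rmorph_nat dg) -(rmorph1 dg) vle_diag. Qed.

Lemma hull_subfield : subfield L.
Proof.
split=> [|_ _ [x Lx <-] [y Ly <-]|_ _ [x Lx <-] [y Ly <-]|_ [x Lx <-]].
- by exists 1; [apply: sf1|rewrite rmorph1].
- by exists (x - y); [apply: (sfB sfL0)|rewrite rmorphB].
- by exists (x * y); [apply: (sfM sfL0)|rewrite rmorphM].
- by exists x^-1; [apply: (sfV sfL0)|rewrite fmorphV].
Qed.

Lemma hull_henselian : henselian_in uO (fun=> True).
Proof.
have := @internal_henselian U K O (fun=> (fun _ : K => True)) (fun=> Subfield I (fun _ _ _ _ =>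
  I) (fun _ _ _ _ => I) (fun _ _ => I)).
move=> h g _ Og g0 g1; have [||y [_ y1 ry]] := h _ g _ Og g0 g1; last by exists y.
  by move=> i g' _ Eg'; apply: hens.
by move=> i; rewrite -[_`_i](urepK (U := U)); apply/internalE/ae_all.
Qed.

(** At almost all indices the element is one of the finitely many roots in K of a fixed polynomial,
    hence it is constant almost everywhere. *)
Lemma hull_closed y : algebraic_over L y -> L y.
Proof.
move=> [n [g [Lg g0 _ rg]]].
have /choice[c cP] : forall i, exists c, L0 c /\ dg c = g`_i by move=> i; have [c] := Lg i; exists c.
pose h := \poly_(i < size g) c i.
have hE : map_poly dg h = g.
  apply/polyP => i; rewrite coef_map coef_poly; case: ltnP => gi; first exact: (cP i).2.
  by rewrite [RHS]nth_default //; apply: (rmorph0 dg).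
have h0 : h != 0 by rewrite -(map_poly_eq0 dg) hE.
have Lh i : L0 h`_i by rewrite coef_poly; case: ifP => _; [case: (cP i)|apply: sf0].
have [s hs] := roots_ex h.
have rh : ae U (fun i => root h (urep y i)).
  have : (map_poly dg h).[ucls U (urep y)] = 0 by rewrite urepK hE; apply/eqP.
  rewrite horner_coef size_map_poly.
  have -> : \sum_(i < size h) (map_poly dg h)`_i * ucls U (urep y) ^+ i = ucls U (fun i =>
    h.[urep y i]).
    transitivity (\sum_(j < size h) ucls U (fun=> h`_j) * ucls U (urep y) ^+ j).
      by apply: eq_bigr => j _; rewrite coef_map.
    rewrite (ucls_horner U (fun _ (j : 'I_(size h)) => h`_j)).
    by congr (ucls U _); apply/funext => i; rewrite horner_coef.
  by move/ucls_eq0; apply: ae_imp => i /eqP.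
have [t ts yt] := ae_pigeonhole (ae_imp (fun i => hs h0 _) rh).
have [i [rt ti]] := ae_ex (ae_and rh yt).
exists t; first by apply: rootL0 h0 Lh _; rewrite -ti.
by rewrite -[RHS](urepK (U := U)); apply/ucls_eq; apply: ae_imp yt => j ->.
Qed.

(** Centres and radii are diagonal, so each ball is internal; finitely many nested balls share the
    last centre, and saturation does the rest. *)
Lemma hull_balls (c r : nat -> V) : (forall n, L (c n)) -> (forall n, scale L (r n)) ->
  (forall m n, (m <= n)%N -> vle uO (c n - c m) (r m)) -> exists x, forall n, vle uO (x - c n) (r n).
Proof.
move=> Lc Lr nest.
have /choice[c' c'E] : forall n, exists c', dg c' = c n by move=> n; have [c'] := Lc n; exists c'.
have /choice[r' r'E] : forall n, exists r', dg r' = r n by move=> n; have [[r']] := Lr n; exists r'.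
have inE j x : internal (U := U) (fun _ : nat => [set y |
  vle O (y - c' j) (r' j)]) x <-> vle uO (x - c j) (r j).
  rewrite -[x](urepK (U := U)) internalE -c'E -r'E -vle_ucls.
  by rewrite -[ucls U (urep x) - _](rmorphB (ucls U (F := K))).
have [k|x hx] := saturation (S := fun j _ => [set y | vle O (y - c' j) (r' j)]) (U := U).
  by exists (c k) => j jk; apply/inE/nest.
by exists x => n; apply/inE/hx.
Qed.

End Hull.

Theorem core (psi : formula Lval) : rsat O (fun=> True) (fun=> 0) psi ->
  exists (k : fieldType) (Ok : k -> Prop) (z : k) (l q : nat), rsat Ok (fun=> True) (fun=> 0) psi /\
    arith_ax (field_arith q (linear_form z) (field_theta Ok l q)).
Proof.
have [L0 [enL0 sfL0 rootL0 elem]] := elementary_hull O.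
have [U _] := free_ultrafilter_ex; pose V := ultrapower U K; pose uO := uvalring U O.
pose L : set V := [set diag U y | y in L0].
move/elem => Lpsi.
have sfL : subfield L by apply: hull_subfield.
have char0V : forall n, n.+1%:R != 0 :> V by move=> n; apply: hull_char0.
have piV : vlt uO p%:R 1 by apply: hull_p1.
have hensV : henselian_in uO (fun=> True) by apply: hull_henselian.
have L_closed : forall y, algebraic_over L y -> L y by apply: hull_closed.
have Lp : L p%:R by apply: sf_nat.
have p0 : p%:R != 0 :> V by rewrite -(prednK (prime_gt0 p_prime)).
have enL : enumerable L.
  have [s hs] := enL0; exists (fun n => diag U (s n)) => _ [y Ly <-].
  by have [n <-] := hs y Ly; exists n.
have [x [ind0 dns]] := independent_dense sfL Lp p0 piV char0V (hull_balls (U := U) (L0 := L0)) enL.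
have ind := independent ind0.
(* l > i makes [M i] henselian up to i, l > p makes l a unit of the valuation ring, and l > 7 gives
   q > 7 and q odd. *)
pose l i := s2val (prime_above (maxn i (maxn p 7))); pose q i := s2val (prime_above (l i)).
have l_prime i : prime (l i) by rewrite /l; case: (prime_above _).
have q_prime i : prime (q i) by rewrite /q; case: (prime_above _).
have lq i : (l i < q i)%N by rewrite /q; case: (prime_above _).
have lbig i : (maxn i (maxn p 7) < l i)%N by rewrite /l; case: (prime_above _).
have li i : (i < l i)%N by apply: leq_ltn_trans (lbig i); apply: leq_maxl.
have lp i : (p < l i)%N by apply: leq_ltn_trans (lbig i); rewrite !leq_max leqnn orbT.
have l7 i : (7 < l i)%N by apply: leq_ltn_trans (lbig i); rewrite !leq_max !leqnn !orbT.
have q7 i : (7 < q i)%N by apply: ltn_trans (lq i).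
have q_odd i : odd (q i) by case: (even_prime (q_prime i)) (q7 i) => [->|].
pose M i := power_closure (l i) (q i) (monomials x relation_codes) (L `|` range x).
have sfM i : subfield (M i) by apply: model_subfield.
have hensL : henselian_in uO L.
  move=> g Lg Og g0 g1; have [y [_ y1 ry]] := hensV g (fun=> I) Og g0 g1; exists y; split=> //.
  apply: L_closed; exists (size g), g; split=> //.
  by apply: contraTneq (oner_neq0 V) => gz; move: g1; rewrite gz coef0 => /vlex0 ->; rewrite eqxx.
have hensM i : henselian_upto uO i (M i).
  move=> g sg Mg Og g0 g1; have [y [_ y1 ry]] := hensV g (fun=> I) Og g0 g1; exists y; split=> //.
  have gn0 : g != 0.
    by apply: contraTneq (oner_neq0 V) => gz; move: g1; rewrite gz coef0 => /vlex0 ->; rewrite eqxx.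
  have [_ h _] := power_closureP (l i) (q i) (monomials x relation_codes) (L `|` range x).
  apply: (h (size g).-1); first by rewrite prednK ?size_poly_gt0 // ltnW //;
    apply: leq_ltn_trans sg (li i).
  by exists g; split=> //; exact: leqSpred.
have LM i y : L y -> M i y by apply: model_sub.
have apx i y : M i y -> exists2 c, L c & vle uO (y - c) (p%:R ^+ i * y).
  exact: (model_approximation sfL Lp p0 piV char0V hensV L_closed dns (l_prime i)).
have Lpsi' : rsat uO L (fun=> 0) psi.
  have e0 : (fun _ : nat => 0 : V) = diag U (F := K) \o (fun=> 0) by apply/funext => i;
    rewrite /= rmorph0.
  rewrite e0; apply/(rsat_image (O := O) (E := L0)) => // y.
  by rewrite -[uO _]/(uvalring U O _) uvring_ucls; split=> [/ae_ex[]|h] //; apply: ae_all.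
have [i Mpsi] := dense_equivalence U char0V p_prime piV sfL sfM hensL hensM LM apx Lpsi'.
pose k := sbf_type (sfld (sfM i)).
have l_unit : vle uO 1 (l i)%:R.
  apply: (vunit_coprime piV); last exact: prime_gt0.
  by rewrite prime_coprime // dvdn_prime2 // ltn_eqF.
have [z hz] := model_arithmetic sfL Lp p0 piV char0V hensV L_closed ind dns (l_prime i) (q_prime i)
  (q_odd i) (lq i) (q7 i) l_unit (sfM i).
exists k, (fun y : k => uO (val y)), z, (l i), (q i); split=> //.
pose iota : {rmorphism k -> V} := val.
have e0 : (fun _ : nat => 0 : V) = iota \o (fun=> 0) by apply/funext => j; rewrite -(rmorph0 iota).
move: Mpsi; rewrite e0 => /(rsat_image (f := iota) (O := fun y : k => uO (val y)) (E := fun=> True)).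
apply=> // y; split=> [My|[t _ <-]]; last exact: sfld_valP.
by exists (sbf_mk (My : sfld (sfM i) y)).
Qed.

End Core.

(** * Free variables and finite conjunctions *)

Section BoundedFormulas.
Variable Lg : finType.

Lemma eval_bound (M : structure Lg) n t (e e' : nat -> M) : term_bound n t ->
  (forall i, (i < n)%N -> e i = e' i) -> eval e t = eval e' t.
Proof.
move=> tb h; elim: t tb => [i|||t IH|t IHt u IHu|t IHt u IHu] //= tb; first exact: h.
- by rewrite IH.
- by case/andP: tb => ht hu; rewrite IHt ?IHu.
- by case/andP: tb => ht hu; rewrite IHt ?IHu.
Qed.

Lemma sat_bound (M : structure Lg) n phi (e e' : nat -> M) : formula_bound n phi ->
  (forall i, (i < n)%N -> e i = e' i) -> sat e phi <-> sat e' phi.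
Proof.
elim: phi n e e' => //= [t u|P t|p IHp q IHq|p IHp] n e e'.
- by move=> /andP[ht hu] h; rewrite (eval_bound ht h) (eval_bound hu h).
- by move=> ht h; rewrite (eval_bound ht h).
- by move=> /andP[hp hq] h; rewrite (IHp _ _ _ hp h) (IHq _ _ _ hq h).
move=> hp h; have h' x i : (i < n.+1)%N -> env_cons x e i = env_cons x e' i by case: i => //= i;
  apply: h.
by split=> hx x; have := hx x; rewrite (IHp _ _ _ hp (h' x)).
Qed.

Lemma term_bound_le m n t : (m <= n)%N -> term_bound m t -> term_bound n t.
Proof.
move=> mn; elim: t => [i|||t IH|t IHt u IHu|t IHt u IHu] //= tb; first exact: leq_trans mn.
- by case/andP: tb => ht hu; rewrite IHt ?IHu.
- by case/andP: tb => ht hu; rewrite IHt ?IHu.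
Qed.

Lemma formula_bound_le (phi : formula Lg) m n : (m <= n)%N -> formula_bound m phi ->
  formula_bound n phi.
Proof.
elim: phi m n => //= [t u|P t|p IHp q IHq|p IHp] m n mn; last exact: IHp.
- by move=> /andP[/(term_bound_le mn)-> /(term_bound_le mn)->].
- exact: term_bound_le.
- by move=> /andP[/(IHp _ _ mn)-> /(IHq _ _ mn)->].
Qed.

Lemma term_bound_ex t : exists n, term_bound n t.
Proof.
elim: t => [i|||t [n hn]|t [m hm] u [n hn]|t [m hm] u [n hn]] /=; try by exists 0%N.
- by exists i.+1; apply: ltnSn.
- by exists n.
- by exists (maxn m n); rewrite (term_bound_le _ hm) ?(term_bound_le _ hn) ?leq_maxl ?leq_maxr.
- by exists (maxn m n); rewrite (term_bound_le _ hm) ?(term_bound_le _ hn) ?leq_maxl ?leq_maxr.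
Qed.

Lemma formula_bound_ex (phi : formula Lg) : exists n, formula_bound n phi.
Proof.
elim: phi => [|t u|P t|p [m hm] q [n hn]|p [n hn]] /=.
- by exists 0%N.
- have [m hm] := term_bound_ex t; have [n hn] := term_bound_ex u.
  by exists (maxn m n); rewrite (term_bound_le _ hm) ?(term_bound_le _ hn) ?leq_maxl ?leq_maxr.
- exact: term_bound_ex.
- by exists (maxn m n); rewrite (formula_bound_le _ hm) ?(formula_bound_le _ hn) ?leq_maxl ?leq_maxr.
- by exists n; apply: formula_bound_le hn.
Qed.

Lemma sentence_models (M : structure Lg) phi (e : nat -> M) : sentence phi -> sat e phi -> models M phi.
Proof. by move=> sp h e'; apply/(sat_bound (e := e) sp). Qed.

Definition And (p q : formula Lg) : formula Lg := Imp (Imp p (Imp q Falsum)) Falsum.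

(** S is only a finite set; it is listed through the codes of its formulas, which are injective. *)
Lemma finite_conjunction (S : set (formula Lg)) : finite_set S ->
  exists psi, forall (M : structure Lg) e, @sat Lg M e psi <-> forall phi, S phi -> sat e phi.
Proof.
move=> /(finite_image (@formula_code Lg))/finite_seqP[s sE].
have /choice[dec decP] : forall c, exists psi : formula Lg, forall (M : structure Lg) (e : nat -> M),
    sat e psi <-> (forall phi, S phi -> formula_code phi = c -> sat e phi).
  move=> c; have [[phi [Sphi <-]]|no] := pselect (exists phi, S phi /\ formula_code phi = c).
    exists phi => M e; split=> [h psi _ /formula_code_inj->//|h]; exact: h.
  by exists (Imp Falsum Falsum) => M e; split=> [_ phi Sphi c'|_ []]; case: no; exists phi.
exists (foldr (fun c => And (dec c)) (Imp Falsum Falsum) s) => M e.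
have -> : (forall phi, S phi -> sat e phi) <-> (forall c, c \in s -> sat e (dec c)).
  split=> [h c _|h phi Sphi]; first by apply/decP => phi /h.
  have cs : formula_code phi \in s by have : [set` s] (formula_code phi) by rewrite -sE; exists phi.
  by apply/(iffLR (decP _ _ _) (h _ cs)).
elim: s {sE} => [|c s IH] /=; first by split.
split=> [h|h k]; last first.
  by apply: k; [apply: h; rewrite mem_head|apply/IH => c' c's; apply: h; rewrite inE c's orbT].
have [h1 h2] : sat e (dec c) /\ sat e (foldr (fun c => And (dec c)) (Imp Falsum Falsum) s).
  by apply: contrapT => nh; apply: h => h1 h2; apply: nh.
by move=> c'; rewrite inE => /orP[/eqP->//|]; move: c'; apply/IH.
Qed.

End BoundedFormulas.

Lemma sat_fstruct (F : fieldType) (P : Lval -> set F) (e : nat -> F) phi :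
  @sat Lval (fstruct P) e phi <-> rsat (P tt) (fun=> True) e phi.
Proof.
have evalE (e' : nat -> F) t : @eval Lval (fstruct P) e' t = teval e' t.
  by elim: t => //= [t ->|t -> u ->|t -> u ->].
elim: phi e => [|t u|[] t|p IHp q IHq|p IHp] e /=; rewrite ?evalE //.
  by rewrite IHp IHq.
by split=> h x; [move=> _; apply/IHp|apply/IHp/h].
Qed.

Fixpoint to_val (phi : formula Lring) : formula Lval :=
  match phi with
  | Falsum => Falsum
  | Equal t u => Equal t u
  | Pred _ _ => Falsum
  | Imp p q => Imp (to_val p) (to_val q)
  | All p => All (to_val p)
  end.

Lemma sat_to_val (F : fieldType) (O : F -> Prop) (P : Lring -> set F) (e : nat -> F) phi :
  rsat O (fun=> True) e (to_val phi) <-> @sat Lring (fstruct P) e phi.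
Proof.
have evalE (e' : nat -> F) t : @eval Lring (fstruct P) e' t = teval e' t.
  by elim: t => //= [t ->|t -> u ->|t -> u ->].
elim: phi e => [|t u|[] t|p IHp q IHq|p IHp] e /=; rewrite ?evalE //.
  by rewrite IHp IHq.
by split=> h x; [apply/IHp/h|move=> _; apply/IHp].
Qed.

Lemma rsat_closure (F : fieldType) (O : F -> Prop) n phi (e : nat -> F) :
  rsat O (fun=> True) e (iter n (@All Lval) phi) <->
  forall y : nat -> F, rsat O (fun=> True) (fun i => if (i < n)%N then y i else e (i - n)%N) phi.
Proof.
elim: n e => [|n IH] e /=.
  have eE : (fun i => e (i - 0)%N) = e by apply/funext => i; rewrite subn0.
  by rewrite eE; split=> // /(_ e).
split=> [h y|h x _].
  have /IH/(_ y) := h (y n) I; congr (rsat _ _ _ _); apply/funext => i.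
  rewrite ltnS; have [ni|ni|->] := ltngtP i n => //; last by rewrite subnn.
  by rewrite -(subnSK ni).
apply/IH => y; have := h (fun i => if i == n then x else y i); congr (rsat _ _ _ _); apply/funext => i.
rewrite ltnS; have [ni|ni|->] := ltngtP i n => //; last by rewrite subnn.
by rewrite -(subnSK ni).
Qed.

(** * From the given valuation to its ring *)

Section ValuationRingOf.
Variables (K : fieldType) (G : ordered_group) (v : valuation K G).

Lemma valuation_ring_total x : x \in valuation_ring v \/ x^-1 \in valuation_ring v.
Proof.
have [->|x0] := eqVneq x 0; first by left; rewrite inE eqxx.
rewrite !inE invr_eq0 (negPf x0) /=.
have e : v x^-1 + v x = 0 by rewrite -valuationM ?invr_eq0 // mulVf // valuation1.
have /orP[h|h] := leD_total 0 (v x); first by left.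
by right; rewrite -e -[leRHS]addr0; apply: leD2l.
Qed.

Lemma valuation_ring1 : 1 \in valuation_ring v.
Proof. by case: (valuation_ring_subring_closed v). Qed.

Lemma valuation_ringB x y : x \in valuation_ring v -> y \in valuation_ring v ->
  x - y \in valuation_ring v.
Proof. by case: (valuation_ring_subring_closed v) => _ h _; apply: h. Qed.

Lemma valuation_ringM x y : x \in valuation_ring v -> y \in valuation_ring v ->
  x * y \in valuation_ring v.
Proof. by case: (valuation_ring_subring_closed v) => _ _ h; apply: h. Qed.

Definition valuation_valring : valring K :=
  Valring (vring := fun x => x \in valuation_ring v) valuation_ring1 valuation_ringB valuation_ringM
    valuation_ring_total.

Local Notation O := valuation_valring.

Lemma vlt_valuation x : vlt O x 1 <-> (x == 0) || (0 < v x).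
Proof.
have [->|x0] /= := eqVneq x 0; first by split=> // _; apply/vlt0/oner_neq0.
have e : v x^-1 + v x = 0 by rewrite -valuationM ?invr_eq0 // mulVf // valuation1.
have h1x : vle O 1 x <-> 0 <= v x^-1.
  split=> [[t Ot e1]|h]; last by exists x^-1; rewrite ?mulVf //;
    rewrite -[O _]/(is_true (_ \in _)) inE invr_eq0 (negPf x0).
  have tE : t = x^-1 by rewrite -[RHS]mul1r e1 mulfK.
  by move: Ot; rewrite tE -[O _]/(is_true (_ \in _)) inE invr_eq0 (negPf x0).
rewrite /vlt h1x; have cmp := group_comparable 0 (v x).
have veN : 0 <= v x^-1 <-> v x <= 0.
  split=> h; first by have := leD2l (v x) h; rewrite addr0 addrC e.
  by have := leD2l (v x^-1) h; rewrite addr0 e.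
rewrite veN; split=> [/negP|h /(lt_le_trans h)]; last by rewrite ltxx.
by rewrite -comparable_ltNge // comparable_sym.
Qed.

Hypothesis Khenselian : henselian v.

Lemma valuation_henselian : henselian_in O (fun=> True).
Proof.
move=> g _ Og g0 g1.
pose f : {poly valuation_ring_of v} := \poly_(i < size g) ValuationRing (Og i).
have fE : map_poly val f = g.
  by apply/polyP => i; rewrite coef_map coef_poly; case: ltnP => gi //=; rewrite nth_default.
have f0 : residue f`_0 = 0.
  apply/eqP; rewrite residue_eq0 inE; have := g0; rewrite vlt_valuation -fE coef_map.
  by [].
have f1 : residue f`_1 != 0.
  rewrite residue_eq0 inE; apply/negP => h; have /vlt_valuation : (g`_1 == 0) || (0 < v g`_1).
    by rewrite -fE coef_map.
  by apply.
have [||b rb bres] := Khenselian (f := f) (a := 0).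
- by rewrite rootE horner_coef0 coef_map; apply/eqP.
- by rewrite deriv_map rootE horner_coef0 coef_map coef_deriv mulr1n; apply: f1.
exists (val b); split=> //; last first.
  by rewrite -fE rootE horner_map (eqP rb) rmorph0.
by apply/vlt_valuation; have /eqP := bres; rewrite residue_eq0 inE.
Qed.

Lemma mixed_characteristic_p : mixed_characteristic v -> (forall n, n.+1%:R != 0 :> K) /\
  exists2 p, prime p & vlt O p%:R 1.
Proof.
move=> [char0 [p pch]]; split=> [n|]; first by move/pcharf0P: char0 => ->.
exists p; first exact: pcharf_prime pch.
apply/vlt_valuation; have := pcharf0 pch.
rewrite -(rmorph_nat (@residue K G v)) => /eqP; rewrite residue_eq0 inE.
by rewrite rmorph_nat.
Qed.

End ValuationRingOf.

Theorem theorem5p3 (K : fieldType) (G : ordered_group) (v : valuation K G)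
    (Kmixed : mixed_characteristic v)
    (Khenselian : henselian v)
    (Knontrivial : nontrivial_valuation v) :
  finitely_undecidable (Th (valued_field_structure v)) /\
  (@definable Lring (field_structure K) [set x | x \in valuation_ring v] ->
   finitely_undecidable (Th (field_structure K))).
Proof.
have [char0 [p p_prime p1]] := mixed_characteristic_p Kmixed.
have coreK := core char0 p_prime p1 (valuation_henselian Khenselian).
split=> [S ST finS _|[theta [e0 defO]] S ST finS _].
  have [psi hpsi] := finite_conjunction finS.
  have [|k [Ok [z [l [q [kpsi hz]]]]]] := coreK psi.
    apply/(@sat_fstruct K (fun _ => [set x | x \in valuation_ring v]))/hpsi => phi /ST[_]; apply.
  pose M := @fstruct Lval k (fun=> Ok).
  have MS phi : S phi -> models M phi.
    move=> Sphi; apply: (@sentence_models _ M phi (fun=> 0 : k)); first by case: (ST _ Sphi).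
    by move/sat_fstruct/hpsi: kpsi; apply.
  apply: (@undecidable_arithmetic Lval (fun M _ x => spred tt x) l q _ 1 S M (fun=> z)) => //.
    by move=> s i; exists (Pred tt (Var i)).
  exact: marith_field.
have [psi hpsi] := finite_conjunction finS.
have [B0 hB0] := formula_bound_ex theta; pose B := B0.
have hB : formula_bound B.+1 theta by apply: formula_bound_le hB0.
pose chi : formula Lval := All (And (Imp (Pred tt (Var 0)) (to_val theta)) (Imp (to_val theta)
  (Pred tt (Var 0)))).
have chiP (F : fieldType) (Ok : F -> Prop) e : rsat Ok (fun=> True) e chi <->
    forall x, Ok x <-> @sat Lring (fstruct (fun=> set0)) (env_cons x e) theta.
  split=> [h x|h x _].
    rewrite -(sat_to_val Ok); have h0 := h x I; rewrite /= in h0.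
    by split=> [Ox|t]; apply: contrapT => nt; apply: h0 => k1 k2; apply: nt; [apply: k1|apply: k2].
  have [h1 h2] := h x; have [t1 t2] := sat_to_val Ok (fun=> set0) (env_cons x e) theta.
  by move=> nh; apply: (nh (fun o => t2 (h1 o)) (fun t => h2 (t1 t))).
(* For some values of the B parameters [theta] defines the valuation ring, the existential
   quantifiers being a negated universal closure. The new model then has a definable ring again,
   with parameters of its own. *)
pose Psi := And (to_val psi) (Imp (iter B (@All Lval) (Imp chi Falsum)) Falsum).
have PsiP (F : fieldType) (Ok : F -> Prop) : rsat Ok (fun=> True) (fun=> 0) Psi <->
    @sat Lring (fstruct (fun=> set0)) (fun=> 0 : F) psi /\ exists y : nat -> F, forall x,
      Ok x <-> @sat Lring (fstruct (fun=> set0)) (env_cons x (fun i =>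
        if (i < B)%N then y i else 0)) theta.
  rewrite -(sat_to_val Ok); split=> [h|[h1 [y hy]] h].
    apply: contrapT => nh; apply: h => h1 h2; apply: nh; split=> //.
    apply: contrapT => ny; apply: h2; apply/rsat_closure => y hy; apply: ny; exists y.
    by apply/chiP.
  apply: (h h1) => /rsat_closure/(_ y); apply; exact/chiP.
have thetaB (F : fieldType) (x : F) (y y' : nat -> F) : (forall i, (i < B)%N -> y i = y' i) ->
    @sat Lring (fstruct (fun=> set0)) (env_cons x y) theta <->
    @sat Lring (fstruct (fun=> set0)) (env_cons x y') theta.
  by move=> yy; apply: (sat_bound hB) => -[|i] //=; apply: yy.
have [|k [Ok [z [l [q [/PsiP[kpsi [y hy]] hz]]]]]] := coreK Psi.
  apply/PsiP; split; first by apply/hpsi => phi /ST[_]; apply.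
  exists e0 => x; apply: iff_trans (defO x) _; apply: thetaB => i iB.
  by rewrite iB.
pose M := @fstruct Lring k (fun=> set0).
have MS phi : S phi -> models M phi.
  move=> Sphi; apply: (@sentence_models _ M phi (fun=> 0 : k)); first by case: (ST _ Sphi).
  by move/hpsi: kpsi; apply.
pose Op (M : structure Lring) (p : nat -> M) x := sat (env_cons x (fun i => p i.+1)) theta.
(* Index 0 carries z, the indices 1 to B the parameters of [theta], and z fills up the rest, as
   [clip] requires. *)
pose par (i : nat) : k := if i is j.+1 then (if (j < B)%N then y j else z) else z.
apply: (@undecidable_arithmetic Lring Op l q _ B.+1 S M par) => //.
- move=> s i; have : udef (fun (M : structure Lring) e => sat e theta) by exists theta.
  by move=> /(udef_ren (env_cons i (fun j => s j.+1))); apply: eq_udef => M' e; rewrite -env_cons_map.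
- move=> [|j]; rewrite /clip //; case: ifP => // jB.
  by rewrite /par; move: jB; rewrite ltnS => ->.
apply: marith_field; rewrite (_ : @Op M par = Ok) //; apply/funext => x; apply/propext.
rewrite hy; apply: thetaB => i iB; by rewrite iB /par iB.
Qed.
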